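(* Let $p\ge2$ and $x_0\in\mathcal C_0$. There exist admissible constants $c,C_{7.6}>0$ such that, whenever $h<c$, $\delta^2<h$, $M^{-2/d}<h$ and $\rho\ge1$, for every $k\in\{0,\dots,N-1\}$, almost surely on $\{t_k<\tau_\infty\}$, $$\mathbb E\big[|(\bar v-v)(t_{k+1},\Pi_{k+1}(X_{t_k}+\mathcal T^0(t_k,X_{t_k})))|\mid\mathcal F_{t_k}\big]\le C_{7.6}\,\mathcal E(\mathrm{gradient},p)+C_{7.6}\,\mathbb E\big[|(\bar v-v)(t_{k+1},X_{t_{k+1}})|^2\mid\mathcal F_{t_k}\big]^{1/2},$$ where $\mathcal T^0(t_k,X_{t_k})=\sigma(X_{t_k},\bar u(t_{k+1},X_{t_k}))g(\Delta B^k)$.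
   Context: Standing setting. Fix $d\in\mathbb N^*$, $T>0$ and functions $b:\mathbb R^d\times\mathbb R\times\mathbb R^d\to\mathbb R^d$, $f:\mathbb R^d\times\mathbb R\times\mathbb R^d\to\mathbb R$, $\sigma:\mathbb R^d\times\mathbb R\to\mathbb R^{d\times d}$, $H:\mathbb R^d\to\mathbb R$ satisfying Assumption (A): $b,f,\sigma,H$ are uniformly Lipschitz continuous in all variables; $b,f,\sigma$ are bounded in the space variable $x$ and have at most linear growth in the other variables, i.e. $|b(x,y,z)|+|f(x,y,z)|+|\sigma(x,y)|\le\Lambda(1+|y|+|z|)$; $a=\sigma\sigma^*$ is uniformly elliptic; and $H$ is bounded in $C^{2+\alpha}(\mathbb R^d)$ for some $\alpha\in(0,1)$. Let $u$ be the unique function in $C([0,T]\times\mathbb R^d)\cap C^{1,2}([0,T)\times\mathbb R^d)$ with $u,\nabla_xu$ bounded solving $\partial_tu+\langle b(x,u,\nabla_xu\,\sigma(x,u)),\nabla_xu\rangle+\tfrac12\mathrm{tr}(a(x,u)\nabla^2_{x,x}u)+f(x,u,\nabla_xu\,\sigma(x,u))=0$ on $[0,T)\times\mathbb R^d$, $u(T,\cdot)=H$ (it is known that $u,\nabla_xu,\nabla^2_{x,x}u,\partial_tu$ are bounded on $[0,T]\times\mathbb R^d$ and $\nabla_xu$ is $\tfrac12$-Hölder in $t$ uniformly in $x$). Here $\nabla_xu$ is a row vector and $v(t,x):=\nabla_xu(t,x)\sigma(x,u(t,x))$. Let $(\Omega,\mathcal F,\mathbb P)$ carry a $d$-dimensional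 Brownian motion $B$ with augmented natural filtration $(\mathcal F_t)$. Discretization: $N\in\mathbb N^*$, $h=T/N$, $t_k=kh$, $\Delta B^k=B_{t_{k+1}}-B_{t_k}$. Quantization: $M\in\mathbb N^*$, a grid $\Lambda(M)=\{y_1,\dots,y_M\}\subset\mathbb R^d$ with nearest-neighbour projection $G_{\Lambda(M)}$, and $g(\Delta B^k):=h^{1/2}G_{\Lambda(M)}(h^{-1/2}\Delta B^k)$; it is assumed that for every $q\ge1$ there is $C_{\rm Quantiz}(q,d)$ with $\mathbb E[|g(\Delta B^k)-\Delta B^k|^q]^{1/q}\le C_{\rm Quantiz}(q,d)h^{1/2}M^{-1/d}$. Spatial grids: $\delta>0$, $\mathcal C_\infty=\delta\mathbb Z^d$, $\Pi_\infty(x)$ the point with coordinates $\delta\lfloor\delta^{-1}x_j+1/2\rfloor$; $R>0$, $\rho\ge1$, $r_0=R$, $r_i=R+\rho$ for $1\le i\le N$; $\Delta_i=\{x\in\mathbb R^d:-\delta\lfloor r_i/\delta\rfloor-\delta/2\le x_j<\delta\lfloor r_i/\delta\rfloor+\delta/2,\ j=1,\dots,d\}$, $\mathcal C_i=\mathcal C_\infty\cap\Delta_i$; $\mathcal Q(r,y)=\big((y_j\vee(-\delta\lfloor r/\delta\rfloor))\wedge\delta\lfloor r/\delta\rfloor\big)_{1\le j\le d}$; $\Pi_i(x)=\mathcal Q(r_i,\Pi_\infty(x))$ (so $\Pi_i(x)=\Pi_\infty(x)$ for $x\in\Delta_i$). Algorithm: for $x\in\mathcal C_N$, $\bar u(T,x)=H(x)$,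 $\bar v(T,x)=\nabla_xH(x)\sigma(x,H(x))$; for $k=N-1,\dots,0$ and $x\in\mathcal C_k$: $\mathcal T^0(t_k,x)=\sigma(x,\bar u(t_{k+1},x))g(\Delta B^k)$; $\hat v(t_k,x)=\mathbb E[\bar v(t_{k+1},\Pi_{k+1}(x+\mathcal T^0(t_k,x)))]$; $\mathcal T(t_k,x)=b(x,\bar u(t_{k+1},x),\hat v(t_k,x))h+\sigma(x,\bar u(t_{k+1},x))g(\Delta B^k)$; $\bar v(t_k,x)=h^{-1}\mathbb E[\bar u(t_{k+1},\Pi_{k+1}(x+\mathcal T(t_k,x)))g(\Delta B^k)]$; $\bar u(t_k,x)=\mathbb E[\bar u(t_{k+1},\Pi_{k+1}(x+\mathcal T(t_k,x)))]+f(x,\bar u(t_{k+1},x),\bar v(t_k,x))h$. Discrete processes: for $x_0\in\mathcal C_0$, $X_0=x_0$ and $X_{t_{k+1}}=\Pi_{k+1}(X_{t_k}+\mathcal T(t_k,X_{t_k}))$, where in $\mathcal T(t_k,X_{t_k})$ the random variable $g(\Delta B^k)$ is the quantized actual increment; $\tau_\infty=\inf\{t_k,1\le k\le N: X_{t_{k-1}}+\mathcal T(t_{k-1},X_{t_{k-1}})\notin\Delta_k\}$, $\inf\emptyset=+\infty$. $\mathcal E(\mathrm{gradient},p)=h^{p/2+d/4-1/2}M^{-p/d}\delta^{-p-d/2}$. A constant is called admissible if it depends only on $p$, $T$, $d$, the constants in Assumption (A) and the constants $C_{\rm Quantiz}(\cdot,d)$ (not on $h,\delta,M,R,\rho$,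 the starting point or the time index). *)

(* Defs.v *)
From HB Require Import structures.
From mathcomp Require Import all_boot all_order all_algebra.
From mathcomp Require Import all_classical all_reals all_analysis.

Set Implicit Arguments.
Unset Strict Implicit.
Unset Printing Implicit Defensive.

Import Order.TTheory GRing.Theory Num.Def Num.Theory.
Import numFieldNormedType.Exports.

Local Open Scope classical_set_scope.
Local Open Scope ring_scope.

Section Analysis_on_Rd.
Variables (R : realType) (d : nat).

Definition enorm m n (A : 'M[R]_(m, n)) : R :=
  Num.sqrt (\sum_(i < m) \sum_(j < n) A i j ^+ 2).

Definition ev (i : 'I_d) : 'rV[R]_d := delta_mx 0 i.

Definition grad (F : 'rV[R]_d -> R) (x : 'rV[R]_d) : 'rV[R]_d :=
  \row_i derive F x (ev i).
Definition hess (F : 'rV[R]_d -> R) (x : 'rV[R]_d) : 'M[R]_d :=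
  \matrix_(i, j) derive (fun y => derive F y (ev i)) x (ev j).
Definition dtime (u : R -> 'rV[R]_d -> R) (t : R) (x : 'rV[R]_d) : R :=
  derive (fun s : R => u s x) t 1.

Definition mv (A : 'M[R]_d) (g : 'rV[R]_d) : 'rV[R]_d := (A *m g^T)^T.
Definition inner (a c : 'rV[R]_d) : R := (a *m c^T) 0 0.

Definition C2alpha_bounded (K alpha : R) (H : 'rV[R]_d -> R) : Prop :=
  (forall x i, derivable H x (ev i)) /\
  (forall x i j, derivable (fun y => derive H y (ev i)) x (ev j)) /\
  (forall x, `|H x| <= K /\ enorm (grad H x) <= K /\ enorm (hess H x) <= K) /\
  (forall x x', enorm (hess H x - hess H x') <= K * enorm (x - x') `^ alpha).

Definition AssumptionA (L Lam lam K alpha : R)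
  (b : 'rV[R]_d -> R -> 'rV[R]_d -> 'rV[R]_d)
  (f : 'rV[R]_d -> R -> 'rV[R]_d -> R)
  (sigma : 'rV[R]_d -> R -> 'M[R]_d) (H : 'rV[R]_d -> R) : Prop :=
  (forall x y z x' y' z', enorm (b x y z - b x' y' z')
      <= L * (enorm (x - x') + `|y - y'| + enorm (z - z'))) /\
  (forall x y z x' y' z', `|f x y z - f x' y' z'|
      <= L * (enorm (x - x') + `|y - y'| + enorm (z - z'))) /\
  (forall x y x' y', enorm (sigma x y - sigma x' y')
      <= L * (enorm (x - x') + `|y - y'|)) /\
  (forall x x', `|H x - H x'| <= L * enorm (x - x')) /\
  (forall x y z, enorm (b x y z) + `|f x y z| + enorm (sigma x y)
      <= Lam * (1 + `|y| + enorm z)) /\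
  (forall x y (xi : 'rV[R]_d),
      lam * enorm xi ^+ 2 <= inner (xi *m (sigma x y *m (sigma x y)^T)) xi) /\
  C2alpha_bounded K alpha H.

Definition is_solution (T : R)
  (b : 'rV[R]_d -> R -> 'rV[R]_d -> 'rV[R]_d)
  (f : 'rV[R]_d -> R -> 'rV[R]_d -> R)
  (sigma : 'rV[R]_d -> R -> 'M[R]_d) (H : 'rV[R]_d -> R)
  (u : R -> 'rV[R]_d -> R) : Prop :=
  {within [set z : R * 'rV[R]_d | 0 <= z.1 <= T],
     continuous (fun z : R * 'rV[R]_d => u z.1 z.2)} /\
  (forall t x, 0 <= t < T ->
     (forall i, derivable (u t) x (ev i)) /\
     (forall i j, derivable (fun y => derive (u t) y (ev i)) x (ev j))) /\
  (forall t x, 0 < t < T -> derivable (fun s : R => u s x) t 1) /\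
  {within [set z : R * 'rV[R]_d | 0 <= z.1 < T],
     continuous (fun z : R * 'rV[R]_d => grad (u z.1) z.2)} /\
  {within [set z : R * 'rV[R]_d | 0 <= z.1 < T],
     continuous (fun z : R * 'rV[R]_d => hess (u z.1) z.2)} /\
  {in [set z : R * 'rV[R]_d | 0 < z.1 < T],
     continuous (fun z : R * 'rV[R]_d => dtime u z.1 z.2)} /\
  (exists Cb : R, forall t x, 0 <= t <= T -> `|u t x| <= Cb) /\
  (exists Cb : R, forall t x, 0 <= t < T -> enorm (grad (u t) x) <= Cb) /\
  (forall t x, 0 < t < T ->
     let z := grad (u t) x *m sigma x (u t x) in
     let a := sigma x (u t x) *m (sigma x (u t x))^T in
     dtime u t x + inner (b x (u t x) z) (grad (u t) x)
       + 2^-1 * \tr (a *m hess (u t) x) + f x (u t x) z = 0) /\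
  (forall x, u T x = H x).

Definition vfun (sigma : 'rV[R]_d -> R -> 'M[R]_d) (u : R -> 'rV[R]_d -> R)
  (t : R) (x : 'rV[R]_d) : 'rV[R]_d := grad (u t) x *m sigma x (u t x).

Definition flr (y : R) : R := (Num.floor y)%:~R.
Definition Pi_inf (delta : R) (x : 'rV[R]_d) : 'rV[R]_d :=
  \row_j (delta * flr (x 0 j / delta + 2^-1)).
Definition rad (Rr rho : R) (i : nat) : R := if i == 0%N then Rr else Rr + rho.
Definition Qclamp (delta r : R) (y : 'rV[R]_d) : 'rV[R]_d :=
  \row_j Num.min (Num.max (y 0 j) (- (delta * flr (r / delta))))
                 (delta * flr (r / delta)).
Definition Pi_i (delta Rr rho : R) (i : nat) (x : 'rV[R]_d) : 'rV[R]_d :=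
  Qclamp delta (rad Rr rho i) (Pi_inf delta x).
Definition Delta_i (delta Rr rho : R) (i : nat) : set 'rV[R]_d :=
  [set x : 'rV[R]_d | forall j, - (delta * flr (rad Rr rho i / delta)) - delta / 2 <= x 0 j
                     < delta * flr (rad Rr rho i / delta) + delta / 2].
Definition Cgrid (delta Rr rho : R) (i : nat) : set 'rV[R]_d :=
  [set x : 'rV[R]_d | (exists z : 'I_d -> int, forall j, x 0 j = delta * (z j)%:~R)
           /\ Delta_i delta Rr rho i x].

Definition nearest (M : nat) (ygrid : 'I_M -> 'rV[R]_d) (z : 'rV[R]_d)
  : 'rV[R]_d :=
  match [pick i : 'I_M | [forall j : 'I_M,
            enorm (z - ygrid i) <= enorm (z - ygrid j)]] with
  | Some i => ygrid i
  | None => 0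
  end.

End Analysis_on_Rd.

Section Probability.
Variables (R : realType) (d : nat).
Variables (d0 : measure_display) (Omega : measurableType d0)
          (P : probability Omega R).

Definition natural_gen (B : R -> Omega -> 'rV[R]_d) (t : R)
  : set (set Omega) :=
  <<s [set E | exists s (j : 'I_d) (A : set R), 0 <= s <= t /\ measurable A
                 /\ E = (fun w => B s w 0 j) @^-1` A] >>.

Definition augmented_filtration (B : R -> Omega -> 'rV[R]_d) (t : R)
  : set (set Omega) :=
  <<s [set E | exists s (j : 'I_d) (A : set R), 0 <= s <= t /\ measurable A
                 /\ E = (fun w => B s w 0 j) @^-1` A]
      `|` [set E | measurable E /\ P E = 0%E] >>.

Definition is_brownian (B : R -> Omega -> 'rV[R]_d) : Prop :=
  (forall t (j : 'I_d), 0 <= t -> measurable_fun setT (fun w => B t w 0 j)) /\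
  {ae P, forall w, B 0 w = 0} /\
  {ae P, forall w, {within [set t : R | 0 <= t], continuous (fun t => B t w)}} /\
  (forall s t, 0 <= s < t -> forall E, natural_gen B s E ->
     forall A : 'I_d -> set R, (forall j, measurable (A j)) ->
     P (E `&` [set w | forall j, A j (B t w 0 j - B s w 0 j)])
       = (P E * \prod_(j < d) normal_prob 0 (Num.sqrt (t - s)) (A j))%E).

Definition is_cond_exp (G : set (set Omega)) (X Y : Omega -> R) : Prop :=
  (forall A : set R, measurable A -> G (Y @^-1` A)) /\
  P.-integrable setT (EFin \o Y) /\
  (forall A, G A -> (\int[P]_(w in A) (Y w)%:E = \int[P]_(w in A) (X w)%:E)%E).

Definition Ereal (X : Omega -> R) : R := fine (\int[P]_w (X w)%:E)%E.
Definition Evec (X : Omega -> 'rV[R]_d) : 'rV[R]_d :=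
  \row_j Ereal (fun w => X w 0 j).

(** The numerical scheme, for given coefficients, time step h, number of
    steps N, quantized increments g k = g(Delta B^k) and projections Pi i. *)
Variables (b : 'rV[R]_d -> R -> 'rV[R]_d -> 'rV[R]_d)
          (f : 'rV[R]_d -> R -> 'rV[R]_d -> R)
          (sigma : 'rV[R]_d -> R -> 'M[R]_d) (H : 'rV[R]_d -> R)
          (N : nat) (h : R) (g : nat -> Omega -> 'rV[R]_d)
          (Pi : nat -> 'rV[R]_d -> 'rV[R]_d).

(* ub, vb : the approximations at time t_{k+1} *)
Definition T0f (ub : 'rV[R]_d -> R) (k : nat) (x : 'rV[R]_d) (w : Omega)
  : 'rV[R]_d := mv (sigma x (ub x)) (g k w).
Definition vhatf (ub : 'rV[R]_d -> R) (vb : 'rV[R]_d -> 'rV[R]_d) (k : nat)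
  (x : 'rV[R]_d) : 'rV[R]_d :=
  Evec (fun w => vb (Pi k.+1 (x + T0f ub k x w))).
Definition Tf (ub : 'rV[R]_d -> R) (vb : 'rV[R]_d -> 'rV[R]_d) (k : nat)
  (x : 'rV[R]_d) (w : Omega) : 'rV[R]_d :=
  h *: b x (ub x) (vhatf ub vb k x) + mv (sigma x (ub x)) (g k w).

(** scheme_aux j = (ubar(t_{N-j},.), vbar(t_{N-j},.)) *)
Fixpoint scheme_aux (j : nat) : ('rV[R]_d -> R) * ('rV[R]_d -> 'rV[R]_d) :=
  match j with
  | 0%N => (H, fun x => grad H x *m sigma x (H x))
  | j'.+1 =>
    let k := (N - j'.+1)%N in
    let ub := (scheme_aux j').1 in
    let vb := (scheme_aux j').2 in
    let vbar := fun x => h^-1 *: Evec (fun w => ub (Pi k.+1 (x + Tf ub vb k x w)) *: g k w) in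
    (fun x => Ereal (fun w => ub (Pi k.+1 (x + Tf ub vb k x w)))
              + f x (ub x) (vbar x) * h,
     vbar)
  end.

Definition ubar (k : nat) : 'rV[R]_d -> R := (scheme_aux (N - k)).1.
Definition vbar (k : nat) : 'rV[R]_d -> 'rV[R]_d := (scheme_aux (N - k)).2.

Fixpoint Xproc (x0 : 'rV[R]_d) (k : nat) (w : Omega) : 'rV[R]_d :=
  match k with
  | 0%N => x0
  | k'.+1 => Pi k'.+1 (Xproc x0 k' w
                       + Tf (ubar k'.+1) (vbar k'.+1) k' (Xproc x0 k' w) w)
  end.

(** stopping time tau_infty (with inf of the empty set = +oo) *)
Definition tau_inf (Dom : nat -> set 'rV[R]_d) (x0 : 'rV[R]_d) (w : Omega)
  : \bar R :=
  ereal_inf [set ((k%:R * h)%:E) | k in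
    [set k : nat | (1 <= k <= N)%N /\
       ~ Dom k (Xproc x0 k.-1 w
                + Tf (ubar k) (vbar k) k.-1 (Xproc x0 k.-1 w) w)]].

End Probability.

(* Main.v *)
(** Proof. Both conditional expectations are finite sums over the values of g(dB^k),
    because this increment is independent of F_{t_k} and X_{t_k} takes finitely
    many values. The claim thus becomes an inequality at a fixed starting point
    x, between the means of F(Pi(x + sigma g)) and of F(Pi(x + b h + sigma
    g))^2, where F = |(vb - v)(t_{k+1}, .)|.

    The difference between the two is a drift of size O(h^(1/2)), which a
    Cameron-Martin shift of the Gaussian increment removes at the price of a
    Cauchy-Schwarz inequality and a bounded factor. The shift acts on dB and not
    on g(dB); the two give the same projected point when x + sigma g(dB) is at
    distance at least of order delta from the boundary of its cell and the
    quantization error is small compared to delta. The first condition is met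
    after one of 3^d translations by thirds of a cell, whose cost is again a
    bounded Cameron-Martin factor since delta^2 < h. The second fails with a
    probability which, by Markov's inequality with exponent 2p, contributes the
    error term, provided that F = O(h^(-1/2)) with an admissible constant.

    For vb this bound follows from an L^2 estimate of the scheme: the discrete
    martingale component is controlled by the variance of the next value of ub.
    For v one needs a bound of grad u by the constants of Assumption (A) only
    (the bound in the definition of a solution may depend on u itself). It is
    obtained from the maximum principle alone. The functions |u| and |u - H|/(T
    - t) are bounded by barriers. The oscillation of u becomes small at an
    admissible scale: as a(x, u) depends on the solution only through u
    itself, it is nearly constant where u is close to its upper bound, so a
    Krylov-Safonov type growth lemma can be proved there with an explicit
    barrier, an average of subsolutions of heat-kernel type over lattice points.
    Once the oscillation is small, doubling of variables gives first a Hoelder,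
    then a Lipschitz bound. *)

Require Import Defs.
From HB Require Import structures.
From mathcomp Require Import all_boot all_order all_algebra.
From mathcomp Require Import all_classical all_reals all_analysis.
From mathcomp Require Import measurable_realfun.
From mathcomp Require Import ring lra.
Set Implicit Arguments.
Unset Strict Implicit.
Unset Printing Implicit Defensive.
Import Order.TTheory GRing.Theory Num.Def Num.Theory.
Import numFieldNormedType.Exports.
Local Open Scope classical_set_scope.
Local Open Scope ring_scope.

(** Three obstacles shape the analytic half. All constants must be fixed before the solution is
    given, so a qualitative bound on [u] may only serve to choose a penalty and never appears in an
    estimate. The lower-order terms are quadratic in grad u, because [b] grows with grad u and is
    multiplied by it; an exponential of [u] absorbs them in the growth lemma, and smallness of the
    oscillation absorbs them under doubling of variables. Finally no modulus of continuity of a(x,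
    u) is known at first: either [u] is far below its upper bound on half of a lattice, or far above
    its lower bound on half of it, and this alternative replaces the measure-theoretic part of
    Krylov-Safonov.

    As [u] is classical, second derivatives are tested only along lines: tr(a hess u) is the sum of
    the second derivatives along the columns of sigma, a form that allows the noise to be reflected
    at one of two points.

    The exponent 2p comes from Cauchy-Schwarz, which takes the square root of the exceptional
    probability; the factor h^(d/4) delta^(-d/2) of the error term is at least one. *)

Ltac clra := clear; intros; lra.

(** * Euclidean norm and inner product of row vectors and matrices *)

Section Euclid.
Variable R : realType.

Lemma CauchySchwarz_sum (I : finType) (a b : I -> R) :
  (\sum_i a i * b i) ^+ 2 <= (\sum_i a i ^+ 2) * (\sum_i b i ^+ 2).
Proof.
set A := \sum_i a i ^+ 2; set B := \sum_i b i ^+ 2; set D := \sum_i _.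
have B0 : 0 <= B by apply: sumr_ge0 => i _; exact: sqr_ge0.
have : 0 <= \sum_i (B * a i - D * b i) ^+ 2.
  by apply: sumr_ge0 => i _; exact: sqr_ge0.
have -> : \sum_i (B * a i - D * b i) ^+ 2 = B * (B * A - D ^+ 2).
  transitivity (\sum_i (B ^+ 2 * a i ^+ 2 - 2 * B * D * (a i * b i)
      + D ^+ 2 * b i ^+ 2)); first by apply: eq_bigr => i _; ring.
  by rewrite big_split sumrB /= -!mulr_sumr -/A -/B -/D; ring.
have [B0'|Bn] := eqVneq B 0; last first.
  have Bp : 0 < B by rewrite lt_neqAle eq_sym Bn.
  by rewrite pmulr_rge0 // subr_ge0 mulrC.
move=> _; have bz i : b i = 0.
  apply/eqP; rewrite -sqrf_eq0; apply/eqP.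
  by apply: (psumr_eq0P (P := xpredT) _ B0') => // j _; exact: sqr_ge0.
have -> : D = 0 by rewrite /D big1 // => i _; rewrite bz mulr0.
by rewrite expr0n /= B0' mulr0.
Qed.

Lemma enorm_ge0 m n (A : 'M[R]_(m, n)) : 0 <= enorm A.
Proof. exact: sqrtr_ge0. Qed.
Hint Resolve enorm_ge0 : core.

Lemma enorm_sqr m n (A : 'M[R]_(m, n)) :
  enorm A ^+ 2 = \sum_(i < m) \sum_(j < n) A i j ^+ 2.
Proof.
rewrite sqr_sqrtr //; apply: sumr_ge0 => i _; apply: sumr_ge0 => j _.
exact: sqr_ge0.
Qed.

Lemma enorm_sqr_pair m n (A : 'M[R]_(m, n)) :
  enorm A ^+ 2 = \sum_(p : 'I_m * 'I_n) A p.1 p.2 ^+ 2.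
Proof. by rewrite enorm_sqr pair_big. Qed.

Lemma enorm_le_sqr m n (A : 'M[R]_(m, n)) (c : R) :
  0 <= c -> enorm A ^+ 2 <= c ^+ 2 -> enorm A <= c.
Proof. by move=> c0; rewrite ler_sqr // nnegrE. Qed.

Lemma coord_le_enorm m n (A : 'M[R]_(m, n)) i j : `|A i j| <= enorm A.
Proof.
rewrite -(ler_sqr (x := `|A i j|)) ?nnegrE // real_normK ?num_real //.
rewrite enorm_sqr_pair (bigD1 (i, j)) //= lerDl.
by apply: sumr_ge0 => p _; exact: sqr_ge0.
Qed.

Lemma enormZ m n k (A : 'M[R]_(m, n)) : enorm (k *: A) = `|k| * enorm A.
Proof.
apply/eqP; rewrite -(eqrXn2 (n := 2)) ?mulr_ge0 // exprMn enorm_sqr_pair.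
rewrite real_normK ?num_real // enorm_sqr_pair mulr_sumr; apply/eqP.
by apply: eq_bigr => p _; rewrite mxE exprMn.
Qed.

Lemma enormN m n (A : 'M[R]_(m, n)) : enorm (- A) = enorm A.
Proof. by rewrite -scaleN1r enormZ normrN1 mul1r. Qed.

Lemma enormB_sym m n (A B : 'M[R]_(m, n)) : enorm (A - B) = enorm (B - A).
Proof. by rewrite -enormN opprB. Qed.

Lemma enorm0 m n : enorm (0 : 'M[R]_(m, n)) = 0.
Proof. by rewrite -(scale0r 0) enormZ normr0 mul0r. Qed.

Lemma enorm_eq0 m n (A : 'M[R]_(m, n)) : (enorm A == 0) = (A == 0).
Proof.
apply/eqP/eqP => [A0|->]; last exact: enorm0.
apply/matrixP => i j; rewrite mxE; apply/eqP; rewrite -normr_le0 -A0.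
exact: coord_le_enorm.
Qed.

Lemma enorm_gt0 m n (A : 'M[R]_(m, n)) : (0 < enorm A) = (A != 0).
Proof. by rewrite lt_def enorm_ge0 andbT enorm_eq0. Qed.

Lemma enormD m n (A B : 'M[R]_(m, n)) : enorm (A + B) <= enorm A + enorm B.
Proof.
apply: enorm_le_sqr; first exact: addr_ge0.
have -> : enorm (A + B) ^+ 2 = enorm A ^+ 2 + enorm B ^+ 2
    + 2 * \sum_(p : 'I_m * 'I_n) A p.1 p.2 * B p.1 p.2.
  rewrite !enorm_sqr_pair mulr_sumr -!big_split /=.
  by apply: eq_bigr => p _; rewrite mxE; ring.
have := CauchySchwarz_sum (fun p : ('I_m * 'I_n)%type => A p.1 p.2) (fun p => B p.1 p.2).
rewrite -!enorm_sqr_pair -exprMn.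
set D := \sum_p _ => HD.
have : D <= enorm A * enorm B.
  apply: le_trans (ler_norm _) _.
  by rewrite -(ler_sqr (x := `|D|)) ?nnegrE ?mulr_ge0 // real_normK ?num_real.
by nra.
Qed.

Lemma enormB m n (A B : 'M[R]_(m, n)) : enorm (A - B) <= enorm A + enorm B.
Proof. by rewrite -(enormN B) enormD. Qed.

Lemma enorm_dist m n (A B : 'M[R]_(m, n)) : `|enorm A - enorm B| <= enorm (A - B).
Proof.
have h X Y : enorm X - enorm Y <= enorm (X - Y :> 'M[R]_(m, n)).
  by rewrite lerBlDr -{1}(subrK Y X) enormD.
by rewrite ler_norml h andbT lerNl opprB enormB_sym h.
Qed.

Lemma enorm_tr m n (A : 'M[R]_(m, n)) : enorm A^T = enorm A.
Proof.
rewrite /enorm exchange_big /=; congr Num.sqrt.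
by apply: eq_bigr => i _; apply: eq_bigr => j _; rewrite mxE.
Qed.

Lemma enorm_mulmx m n q (A : 'M[R]_(m, n)) (B : 'M[R]_(n, q)) :
  enorm (A *m B) <= enorm A * enorm B.
Proof.
apply: enorm_le_sqr; first exact: mulr_ge0.
rewrite exprMn enorm_sqr.
apply: (@le_trans _ _ (\sum_(i < m) \sum_(j < q)
   (\sum_k A i k ^+ 2) * (\sum_k B k j ^+ 2))).
  apply: ler_sum => i _; apply: ler_sum => j _; rewrite mxE.
  exact: CauchySchwarz_sum.
have -> : enorm B ^+ 2 = \sum_(j < q) \sum_k B k j ^+ 2.
  by rewrite enorm_sqr exchange_big.
by rewrite enorm_sqr mulr_suml; apply: ler_sum => i _; rewrite mulr_sumr.
Qed.

Lemma enorm_sum (I : Type) (s : seq I) (Q : pred I) m n (F : I -> 'M[R]_(m, n)) :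
  enorm (\sum_(i <- s | Q i) F i) <= \sum_(i <- s | Q i) enorm (F i).
Proof.
elim/big_ind2 : _ => [|a A b B Aa Bb|//]; first by rewrite enorm0.
exact: le_trans (enormD _ _) (lerD Aa Bb).
Qed.

Section Vectors.
Variable d : nat.
Implicit Types x y z : 'rV[R]_d.

Lemma innerE x y : inner x y = \sum_i x 0 i * y 0 i.
Proof. by rewrite /inner mxE; apply: eq_bigr => i _; rewrite mxE. Qed.

Lemma innerC x y : inner x y = inner y x.
Proof. by rewrite !innerE; apply: eq_bigr => i _; rewrite mulrC. Qed.

Lemma innerDl x y z : inner (x + y) z = inner x z + inner y z.
Proof. by rewrite /inner mulmxDl mxE. Qed.

Lemma innerZl k x y : inner (k *: x) y = k * inner x y.
Proof. by rewrite /inner -scalemxAl mxE. Qed.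

Lemma innerNl x y : inner (- x) y = - inner x y.
Proof. by rewrite -scaleN1r innerZl mulN1r. Qed.

Lemma innerBl x y z : inner (x - y) z = inner x z - inner y z.
Proof. by rewrite innerDl innerNl. Qed.

Lemma innerDr x y z : inner z (x + y) = inner z x + inner z y.
Proof. by rewrite !(innerC z) innerDl. Qed.

Lemma innerZr k x y : inner x (k *: y) = k * inner x y.
Proof. by rewrite !(innerC x) innerZl. Qed.

Lemma innerNr x y : inner x (- y) = - inner x y.
Proof. by rewrite !(innerC x) innerNl. Qed.

Lemma inner0l x : inner 0 x = 0.
Proof. by rewrite -(scale0r 0) innerZl mul0r. Qed.

Lemma inner0r x : inner x 0 = 0.
Proof. by rewrite innerC inner0l. Qed.

Lemma inner_xx x : inner x x = enorm x ^+ 2.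
Proof.
by rewrite innerE enorm_sqr big_ord1; apply: eq_bigr => i _; rewrite expr2.
Qed.

Lemma inner_mul x y (A : 'M[R]_d) : inner (x *m A) y = inner x (y *m A^T).
Proof. by rewrite /inner trmx_mul trmxK mulmxA. Qed.

Lemma CauchySchwarz x y : `|inner x y| <= enorm x * enorm y.
Proof.
rewrite -(ler_sqr (x := `|_|)) ?nnegrE ?mulr_ge0 // real_normK ?num_real //.
rewrite exprMn innerE !enorm_sqr !big_ord1.
exact: (CauchySchwarz_sum (fun i => x 0 i) (fun i => y 0 i)).
Qed.

Lemma enormD_sqr x y : enorm (x + y) ^+ 2 = enorm x ^+ 2 + 2 * inner x y + enorm y ^+ 2.
Proof. by rewrite -!inner_xx innerDl !innerDr (innerC y x); ring. Qed.

Lemma enorm_le_coord x (c : R) : 0 <= c -> (forall j, `|x 0 j| <= c) -> enorm x <= d%:R * c.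
Proof.
move=> c0 xc; apply: enorm_le_sqr; first exact: mulr_ge0.
rewrite enorm_sqr big_ord1.
apply: (@le_trans _ _ (\sum_(j < d) c ^+ 2)).
  apply: ler_sum => j _; rewrite -(real_normK (num_real (x 0 j))).
  by rewrite ler_sqr ?nnegrE.
rewrite sumr_const card_ord -[c ^+ 2 *+ _]mulr_natl exprMn; apply: ler_wpM2r; rewrite ?sqr_ge0 //.
rewrite -natrX ler_nat; by case: (d) => // k; rewrite leq_pmulr.
Qed.

Lemma enorm_row_sum (A : 'M[R]_d) : enorm A ^+ 2 = \sum_k enorm (row k A) ^+ 2.
Proof.
rewrite enorm_sqr; apply: eq_bigr => i _; rewrite enorm_sqr big_ord1.
by apply: eq_bigr => j _; rewrite mxE.
Qed.

Lemma enorm_mul_row_sum x (A : 'M[R]_d) :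
  enorm (x *m A^T) ^+ 2 = \sum_k inner x (row k A) ^+ 2.
Proof.
rewrite enorm_sqr big_ord1; apply: eq_bigr => j _; congr (_ ^+ 2).
by rewrite /inner !mxE; apply: eq_bigr => i _; rewrite !mxE.
Qed.

Lemma mxnorm_le_enorm x : `|x| <= enorm x.
Proof.
rewrite [leLHS]/normr /= mx_normrE; apply/bigmax_leP; split=> // -[i j] _ /=.
exact: coord_le_enorm.
Qed.

Lemma enorm_le_mxnorm x : enorm x <= d%:R * `|x|.
Proof.
apply: enorm_le_coord => // j.
rewrite [leRHS]/normr /= mx_normrE.
exact: (le_bigmax_cond _ (fun i : ('I_1 * 'I_d)%type => `|x i.1 i.2|) (j := (0, j))).
Qed.

Lemma continuous_enorm : continuous (fun x : 'rV[R]_d => enorm x).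
Proof.
move=> x; apply/(@cvgrPdist_lt _ _ _ (nbhs x)) => e e0.
have d1 : 0 < d%:R + 1 :> R by rewrite ltr_wpDl.
near=> y.
apply: le_lt_trans (enorm_dist _ _) _.
apply: le_lt_trans (enorm_le_mxnorm _) _.
apply: (@le_lt_trans _ _ ((d%:R + 1) * `|x - y|)).
  by rewrite ler_wpM2r // lerDl.
rewrite -ltr_pdivlMl // mulrC.
by near: y; apply: (@cvgr_dist_lt _ _ _ _ _ id) => //; rewrite divr_gt0.
Unshelve. all: by end_near. Qed.

End Vectors.
End Euclid.
#[export] Hint Extern 0 (is_true (_ <= enorm _)) => solve [exact: enorm_ge0] : core.

(** * Derivatives along lines *)

Section LineCalculus.
Variable R : realType.

Lemma near0P (x : R) (Q : R -> Prop) :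
  (exists2 e : R, 0 < e & forall z, `|z - x| < e -> Q z) <-> \forall z \near x, Q z.
Proof.
split=> [[e e0 He]|].
  apply/nbhs_ballP; exists e => // z; rewrite /ball /= => xz; apply: He.
  by rewrite distrC.
move=> /nbhs_ballP[e /= e0 He]; exists e => // z xz; apply: He.
by rewrite /ball /= distrC.
Qed.

(** Little-o form of the derivative, obtained from the slope function of Caratheodory. It reduces
    translations, reflections and sums along lines to inequalities. *)
Lemma derP (f : R -> R) (x a : R) :
  is_derive x 1 f a <-> forall e : R, 0 < e -> exists2 r : R, 0 < r &
     forall h : R, `|h| < r -> `|f (x + h) - f x - a * h| <= e * `|h|.
Proof.
split.
  move=> /is_derive1_caratheodory[g [fg cg ga]] e e0.
  have /near0P[r r0 Hr] : \forall z \near x, `|g x - g z| < e.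
    exact: (@cvgr_dist_lt _ _ _ _ _ g (g x) cg).
  exists r => // h hr; rewrite fg addrAC subrr add0r -mulrBl normrM.
  rewrite ler_wpM2r // -ga distrC ltW // Hr //.
  by rewrite addrAC subrr add0r.
move=> H; apply/is_derive1_caratheodory.
exists (fun z => if z == x then a else (f z - f x) / (z - x)); split.
- move=> z; case: eqP => [->|/eqP zx]; first by rewrite !subrr mulr0.
  by rewrite divfK // subr_eq0.
- apply/(@cvgrPdist_le _ _ _ (nbhs x)) => e e0.
  have [r r0 Hr] := H e e0.
  apply/near0P; exists r => // z zr; rewrite eqxx.
  case: eqP => [_|/eqP zx]; first by rewrite subrr normr0 ltW.
  have zx0 : 0 < `|z - x| by rewrite normr_gt0 subr_eq0.
  rewrite -(ler_pM2r zx0) -normrM mulrBl divfK ?subr_eq0 // distrC.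
  have := Hr (z - x) zr.
  by rewrite (addrC x) subrK.
- by rewrite eqxx.
Qed.

Lemma is_derive_ext (f g : R -> R) (x a : R) :
  f =1 g -> is_derive x 1 f a -> is_derive x 1 g a.
Proof. by move=> /funext ->. Qed.

Lemma is_derive_affine (a b x : R) : is_derive x 1 (fun s => a + b * s) b.
Proof.
apply/derP => e e0; exists 1 => // h _.
rewrite [X in `|X|](_ : _ = 0); last by ring.
by rewrite normr0 mulr_ge0 // ltW.
Qed.

Lemma is_derive_continuous (f : R -> R) (x a : R) :
  is_derive x 1 f a -> {for x, continuous f}.
Proof.
by move=> H; apply: differentiable_continuous; apply/derivable1_diffP; exact: ex_derive.
Qed.

Lemma mvt_gt0 (f f' : R -> R) (h : R) : 0 < h ->
  (forall s : R, 0 <= s <= h -> is_derive s 1 f (f' s)) ->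
  exists2 c : R, 0 < c < h & f h - f 0 = f' c * h.
Proof.
move=> h0 H; have [||c] := @MVT R f f' 0 h h0.
- by move=> x; rewrite in_itv /= => /andP[x0 xh]; apply: H; rewrite !ltW.
- by apply: derivable_within_continuous => x; rewrite in_itv /= => /H /(@ex_derive _ _ _ _ _ _ _).
- by rewrite in_itv /= subr0 => ch ->; exists c.
Qed.

Lemma is_derive_opp (f : R -> R) (x a : R) :
  is_derive (- x) 1 f a -> is_derive x 1 (fun z => f (- z)) (- a).
Proof.
move=> /derP H; apply/derP => e /H[r r0 Hr]; exists r => // h hr.
have := Hr (- h); rewrite normrN => /(_ hr).
by rewrite opprD mulrN mulNr.
Qed.

Lemma mvt_abs (f f' : R -> R) (h : R) :
  (forall s : R, is_derive s 1 f (f' s)) ->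
  exists2 c : R, `|c| <= `|h| & f h - f 0 = f' c * h.
Proof.
move=> H; have [->|] := eqVneq h 0.
  by exists 0 => //; rewrite mulr0 subrr.
rewrite neq_lt => /orP[h0|h0]; last first.
  have [c /andP[c0 ch] ->] := @mvt_gt0 f f' h h0 (fun s _ => H s).
  by exists c => //; rewrite !gtr0_norm // ltW.
have [||c /andP[c0 ch] E] := @mvt_gt0 (fun s => f (- s)) (fun s => - f' (- s)) (- h).
- by rewrite oppr_gt0.
- by move=> s _; apply: is_derive_opp; exact: H.
- exists (- c); first by rewrite normrN gtr0_norm // ltr0_norm // ltW.
  by move: E; rewrite opprK oppr0 => ->; rewrite mulrNN.
Qed.

(** A second-order jet at 0, with [f'] required only in a neighbourhood of 0. This is what the
    maximum principle consumes, and it is stable under sums and composition. *)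
Definition D2at (f : R -> R) (a e : R) := exists f' : R -> R,
  [/\ exists2 r : R, 0 < r & forall s : R, `|s| < r -> is_derive s 1 f (f' s),
   f' 0 = a & is_derive (0 : R) 1 f' e].

Lemma D2at_ext f g a e : f =1 g -> D2at f a e -> D2at g a e.
Proof. by move=> /funext ->. Qed.

Lemma D2at_D1 f a e : D2at f a e -> is_derive (0 : R) 1 f a.
Proof. by case=> f' [[r r0 Hr] <- _]; apply: Hr; rewrite normr0. Qed.

Lemma D2atD f g a b e c :
  D2at f a e -> D2at g b c -> D2at (fun s => f s + g s) (a + b) (e + c).
Proof.
move=> [f' [[r r0 Hr] fa He]] [g' [[q q0 Hq] gb Hc]].
exists (fun s => f' s + g' s); split; last first.
- exact: is_deriveD.
- by rewrite fa gb.
exists (Num.min r q) => [|s]; first by rewrite lt_min r0.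
by rewrite lt_min => /andP[/Hr ? /Hq ?]; exact: is_deriveD.
Qed.

Lemma D2atZ k f a e : D2at f a e -> D2at (fun s => k * f s) (k * a) (k * e).
Proof.
move=> [f' [[r r0 Hr] fa He]].
exists (fun s => k * f' s); split; last first.
- exact: (@is_deriveZ _ _ _ f' k).
- by rewrite fa.
by exists r => // s /Hr H; exact: (@is_deriveZ _ _ _ f k).
Qed.

Lemma D2atN f a e : D2at f a e -> D2at (fun s => - f s) (- a) (- e).
Proof.
move=> /(D2atZ (-1)); rewrite !mulN1r; apply: D2at_ext => s.
by rewrite mulN1r.
Qed.

Lemma D2atB f g a b e c :
  D2at f a e -> D2at g b c -> D2at (fun s => f s - g s) (a - b) (e - c).
Proof. by move=> H /D2atN; exact: D2atD. Qed.

Lemma D2at_cst k : D2at (fun=> k) 0 0.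
Proof.
by exists (fun=> 0); split=> //; [exists 1 => // s _ |]; exact: is_derive_cst.
Qed.

Lemma D2at_id : D2at id 1 0.
Proof.
exists (fun=> 1); split=> //; [exists 1 => // s _ |].
  exact: is_derive_id.
exact: is_derive_cst.
Qed.

Lemma D2at_comp (g g1 : R -> R) (g2 : R) f a e :
  D2at f a e ->
  (exists2 r : R, 0 < r & forall y, `|y - f 0| < r -> is_derive y 1 g (g1 y)) ->
  is_derive (f 0) 1 g1 g2 ->
  D2at (fun s => g (f s)) (g1 (f 0) * a) (g1 (f 0) * e + g2 * a ^+ 2).
Proof.
move=> [f' [[r r0 Hr] fa He]] [q q0 Hq] H2.
have H0 : is_derive (0 : R) 1 f (f' 0) by apply: Hr; rewrite normr0.
exists (fun s => g1 (f s) * f' s); split; last first.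
- have := @is_deriveM _ _ (g1 \o f) f' 0 1 _ _ (is_derive1_comp H2 H0) He.
  move=> H3; apply: (is_derive_eq H3); rewrite /= fa /GRing.scale /=.
  by ring.
- by rewrite fa.
have cf := is_derive_continuous H0.
have /near0P[t t0 Ht] : \forall z \near 0, `|f 0 - f z| < q.
  exact: (@cvgr_dist_lt _ _ _ _ _ f (f 0) cf).
exists (Num.min r t) => [|s]; first by rewrite lt_min r0.
rewrite lt_min => /andP[/Hr H1 st].
apply: (@is_derive1_comp _ g f) => //.
by apply: Hq; rewrite distrC; apply: Ht; rewrite subr0.
Qed.

Lemma D2at_sqr f a e : D2at f a e -> D2at (fun s => f s ^+ 2) (2 * f 0 * a) (2 * f 0 * e + 2 * a ^+ 2).
Proof.
move=> H; apply: (D2at_comp (g := fun y => y ^+ 2) (g1 := fun y => 2 * y)) => //.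
  exists 1 => // y _; apply: is_derive_eq; rewrite /GRing.scale /=.
  by ring.
by apply: is_derive_eq; rewrite /GRing.scale /= mulr1.
Qed.

Lemma D2at_exp f a e : D2at f a e ->
  D2at (fun s => expR (f s)) (expR (f 0) * a) (expR (f 0) * (e + a ^+ 2)).
Proof.
move=> H; rewrite mulrDr.
apply: (D2at_comp (g := expR) (g1 := expR)) => //.
by exists 1 => // y _; exact: is_derive_expR.
Qed.

Lemma D2at_pow (c : R) f a e : 0 < f 0 -> D2at f a e ->
  D2at (fun s => f s `^ c) (c * f 0 `^ (c - 1) * a)
     (c * f 0 `^ (c - 1) * e + c * (c - 1) * f 0 `^ (c - 2) * a ^+ 2).
Proof.
move=> f0 H.
apply: (D2at_comp (g := fun y => y `^ c) (g1 := fun y => c * y `^ (c - 1))) => //.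
  exists (f 0) => // y yf; apply: is_derive1_powR.
  by move: yf; rewrite ltr_norml; lra.
have := @is_deriveZ _ _ _ (fun y => y `^ (c - 1)) c _ _ _ (is_derive1_powR (c - 1) f0).
move=> H3; apply: (is_derive_eq H3); rewrite /GRing.scale /= mulrA; congr (_ * _ `^ _); lra.
Qed.

Lemma der_max_r (f : R -> R) (x a r : R) : is_derive x 1 f a -> 0 < r ->
  (forall h, 0 <= h < r -> f (x + h) <= f x) -> a <= 0.
Proof.
move=> /derP H r0 Hm; rewrite leNgt; apply/negP => a0.
have [|q q0 Hq] := H (a / 2); first lra.
pose h := Num.min r q / 2.
have : 0 < Num.min r q by rewrite lt_min r0.
have mr : Num.min r q <= r by rewrite ge_min lexx.
have mq : Num.min r q <= q by rewrite ge_min lexx orbT.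
move=> m0; have h0 : 0 < h by rewrite /h; lra.
have hh : `|h| = h by rewrite gtr0_norm // /h; lra.
have := Hm h; have := Hq h; rewrite ler_norml hh.
have hq : h < q by rewrite /h; lra.
have hr : h < r by rewrite /h; lra.
move=> /(_ hq) /andP[H1 _]; rewrite hr ltW //= => /(_ isT).
by nra.
Qed.

Lemma der_max_l (f : R -> R) (x a r : R) : is_derive x 1 f a -> 0 < r ->
  (forall h, 0 <= h < r -> f (x - h) <= f x) -> 0 <= a.
Proof.
move=> H r0 Hm.
suff : - a <= 0 by rewrite oppr_le0.
apply: (@der_max_r (fun z => f (- z)) (- x) _ r) => // [|h hr].
  by apply: is_derive_opp; rewrite opprK.
by rewrite opprD !opprK; exact: Hm.
Qed.

(** If [e > 0], then [f' s] is at least [e / 2 * s] for small positive [s], and the mean value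
    theorem lifts [f] above [f 0]. *)
Lemma D2at_max f a e r : D2at f a e -> 0 < r ->
  (forall s, `|s| < r -> f s <= f 0) -> a = 0 /\ e <= 0.
Proof.
move=> H r0 Hm; have H1 := D2at_D1 H.
have a0 : a = 0.
  apply/eqP; rewrite eq_le; apply/andP; split.
    apply: (der_max_r H1 r0) => h /andP[h0 hr]; rewrite add0r Hm //.
    by rewrite ger0_norm.
  apply: (der_max_l H1 r0) => h /andP[h0 hr]; rewrite add0r Hm //.
  by rewrite normrN ger0_norm.
split=> //; rewrite leNgt; apply/negP => e0.
move: H => [f' [[q q0 Hq] fa /derP He]].
have [|t t0 Ht] := He (e / 2); first lra.
pose m := Num.min r (Num.min q t).
have m0 : 0 < m by rewrite !lt_min r0 q0.
have mr : m <= r by rewrite ge_min lexx.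
have mq : m <= q by rewrite !ge_min lexx orbT.
have mt : m <= t by rewrite !ge_min lexx !orbT.
have [||c /andP[c0 cm] E] := @mvt_gt0 f f' (m / 2); first lra.
  move=> s /andP[s0 sm]; apply: Hq; rewrite ger0_norm //; lra.
have := Ht c; rewrite ler_norml gtr0_norm // add0r fa a0 subr0.
have ct : c < t by lra.
move=> /(_ ct) /andP[H2 _].
have := Hm (m / 2); rewrite gtr0_norm; last lra.
have mr2 : m / 2 < r by lra.
move=> /(_ mr2) Hle.
have f'c : 0 < f' c by have := mulr_gt0 e0 c0; lra.
by have := mulr_gt0 f'c m0; lra.
Qed.

Section Space.
Variable d : nat.
Implicit Types x y xi : 'rV[R]_d.

Lemma cont_eps (G : 'rV[R]_d -> R) x : {for x, continuous G} ->
  forall e : R, 0 < e -> exists2 r : R, 0 < r & forall y, enorm (y - x) < r -> `|G y - G x| < e.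
Proof.
move=> cG e e0.
have : \forall y \near x, `|G x - G y| < e by exact: (@cvgr_dist_lt _ _ _ _ _ G (G x) cG).
move=> /nbhs_ballP[r /= r0 Hr]; exists r => // y yr; rewrite distrC; apply: Hr.
rewrite -ball_normE /=; apply: le_lt_trans (mxnorm_le_enorm _) _.
by rewrite enormB_sym.
Qed.

Lemma line_partial (F : 'rV[R]_d -> R) x xi : derivable F x xi ->
  is_derive (0 : R) 1 (fun s => F (x + s *: xi)) (derive F x xi).
Proof.
move=> /derivableP[H1 _].
have E0 : (fun s : R => F (x + s *: xi)) = (fun s : R => F (s *: xi + x)).
  by apply: funext => s; rewrite addrC.
have H2 : derivable (fun s : R => F (x + s *: xi)) 0 1.
  by rewrite E0; move: H1; rewrite derivable1P.
apply: DeriveDef => //; rewrite /derive.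
have -> // : (fun h : R => h^-1 *: (((fun s : R => F (x + s *: xi)) \o shift 0) (h *: 1)
   - F (x + 0 *: xi))) = (fun h => h^-1 *: ((F \o shift x) (h *: xi) - F x)).
apply: funext => h /=; congr (_ *: (F _ - F _)); last by rewrite scale0r addr0.
by rewrite addr0 addrC; congr (_ *: _ + _); exact: mulr1.
Qed.

Lemma line_shift (F : 'rV[R]_d -> R) x xi s a :
  is_derive (0 : R) 1 (fun r => F (x + s *: xi + r *: xi)) a ->
  is_derive s 1 (fun r => F (x + r *: xi)) a.
Proof.
move=> /derP H; apply/derP => e /H[r r0 Hr]; exists r => // h /Hr.
by rewrite add0r scale0r addr0 -[x + _ + _]addrA -scalerDl.
Qed.

(** After the move along [xi], the move along [eta] is evaluated by the mean value theorem at a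
    point close to [x], where [B] is nearly [B x]. Iterated over coordinates, this passes from
    continuous partial derivatives to derivatives in all directions. *)
Lemma line_add (F A B : 'rV[R]_d -> R) (xi eta x : 'rV[R]_d) :
  (forall y, is_derive (0 : R) 1 (fun r => F (y + r *: xi)) (A y)) ->
  (forall y, is_derive (0 : R) 1 (fun r => F (y + r *: eta)) (B y)) ->
  {for x, continuous B} ->
  is_derive (0 : R) 1 (fun r => F (x + r *: (xi + eta))) (A x + B x).
Proof.
move=> HA HB cB; apply/derP => e e0.
have e2 : 0 < e / 2 by lra.
have [r r0 Hr] := (derP _ _ _).1 (HA x) _ e2.
have [q q0 Hq] := cont_eps cB e2.
pose c := enorm xi + enorm eta + 1.
have c0 : 0 < c by have := enorm_ge0 xi; have := enorm_ge0 eta; rewrite /c; lra.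
exists (Num.min r (q / c)) => [|h]; first by rewrite lt_min r0 divr_gt0.
rewrite lt_min => /andP[hr hq].
have [|t th E] := @mvt_abs (fun s => F (x + h *: xi + s *: eta))
  (fun s => B (x + h *: xi + s *: eta)) h.
  by move=> s; apply: line_shift; exact: HB.
move: E; rewrite scale0r addr0 -[x + _ + _]addrA -scalerDr => E.
have := Hr h hr; rewrite !add0r !scale0r !addr0 => H1.
have : `|B (x + h *: xi + t *: eta) - B x| < e / 2.
  apply: Hq; rewrite addrAC (addrAC x) subrr add0r.
  apply: le_lt_trans (enormD _ _) _; rewrite !enormZ.
  apply: (@le_lt_trans _ _ (`|h| * c)); last by rewrite -ltr_pdivlMr.
  rewrite /c !mulrDr mulr1 -addrA lerD // ler_wpDr //.
  by rewrite ler_wpM2r.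
move=> H2.
have -> : F (x + h *: (xi + eta)) - F x - (A x + B x) * h =
   (F (x + h *: xi) - F x - A x * h) + (B (x + h *: xi + t *: eta) - B x) * h.
  by rewrite (mulrBl h) -addrA -E; ring.
apply: le_trans (ler_normD _ _) _.
rewrite [leRHS](_ : _ = e / 2 * `|h| + e / 2 * `|h|); last by field.
by rewrite lerD // normrM ler_wpM2r // ltW.
Qed.

Lemma line_scale (F : 'rV[R]_d -> R) x xi k a :
  is_derive (0 : R) 1 (fun r => F (x + r *: xi)) a ->
  is_derive (0 : R) 1 (fun r => F (x + r *: (k *: xi))) (k * a).
Proof.
move=> H; rewrite mulrC.
have -> : (fun r => F (x + r *: (k *: xi))) = (fun r => F (x + r *: xi)) \o (fun r => r * k).
  by apply: funext => r /=; rewrite scalerA.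
apply: is_derive1_comp; first by rewrite mul0r.
by apply: is_derive_eq; rewrite /GRing.scale /=; ring.
Qed.

Lemma C1_line (F : 'rV[R]_d -> R) :
  (forall x i, derivable F x (ev R i)) ->
  (forall i, continuous (fun y => derive F y (ev R i))) ->
  forall x xi, is_derive (0 : R) 1 (fun s => F (x + s *: xi)) (inner (grad F x) xi).
Proof.
move=> dF cp x xi.
have H (s : seq 'I_d) y : is_derive (0 : R) 1 (fun r => F (y + r *: (\sum_(i <- s) xi 0 i *: ev R i)))
    (\sum_(i <- s) xi 0 i * derive F y (ev R i)).
  elim: s y => [|i s IH] y.
    rewrite !big_nil; apply: is_derive_ext (is_derive_cst (F y) _ _) => r.
    by rewrite scaler0 addr0.
  rewrite !big_cons (addrC (xi 0 i *: _)) (addrC (xi 0 i * _)).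
  apply: (line_add (A := fun z => \sum_(j <- s) xi 0 j * derive F z (ev R j))
             (B := fun z => xi 0 i * derive F z (ev R i))) => //.
    by move=> z; apply: line_scale; apply: line_partial.
  by apply: continuousM; [exact: cst_continuous|exact: cp].
have := H (index_enum _) x; rewrite /index_enum.
have <- : xi = \sum_i xi 0 i *: ev R i by rewrite {1}(row_sum_delta xi).
move=> H3; apply: (is_derive_eq H3); rewrite innerE; apply: eq_bigr => i _.
by rewrite mxE mulrC.
Qed.

Lemma C2_line (F : 'rV[R]_d -> R) :
  (forall x i, derivable F x (ev R i)) -> continuous (grad F) ->
  (forall x i j, derivable (fun y => derive F y (ev R i)) x (ev R j)) ->
  continuous (hess F) ->
  forall x xi, D2at (fun s => F (x + s *: xi)) (inner (grad F x) xi)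
                    (inner (xi *m hess F x) xi).
Proof.
move=> dF cF ddF ch x xi.
pose G i := fun y => derive F y (ev R i).
have cG i : continuous (G i).
  move=> y; have -> : G i = (fun A : 'rV[R]_d => A 0 i) \o grad F.
    by apply: funext => z /=; rewrite mxE.
  by apply: continuous_comp; [exact: cF | exact: coord_continuous].
have cH i j : continuous (fun y => derive (G i) y (ev R j)).
  move=> y; have -> : (fun z => derive (G i) z (ev R j)) = (fun A : 'M[R]_d => A i j) \o hess F.
    by apply: funext => z /=; rewrite mxE.
  by apply: continuous_comp; [exact: ch | exact: coord_continuous].
exists (fun s => inner (grad F (x + s *: xi)) xi); split.
- by exists 1 => // s _; apply: line_shift; exact: C1_line.
- by rewrite scale0r addr0.
have HG i : is_derive (0 : R) 1 (fun s => G i (x + s *: xi)) (inner (row i (hess F x)) xi).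
  have <- : grad (G i) x = row i (hess F x) by apply/rowP => j; rewrite !mxE.
  exact: (@C1_line (G i) (fun y j => ddF y i j) (cH i)).
have -> : (fun s => inner (grad F (x + s *: xi)) xi) =
    \sum_(i < d) (fun s => xi 0 i *: G i (x + s *: xi)).
  apply: funext => s; rewrite fct_sumE innerE; apply: eq_bigr => i _.
  by rewrite mxE mulrC.
have := @is_derive_sum R R R d (fun i s => xi 0 i *: G i (x + s *: xi)) 0 1
  (fun i => xi 0 i *: inner (row i (hess F x)) xi)
  (fun i => @is_deriveZ R R R (fun s => G i (x + s *: xi)) (xi 0 i) 0 1 _ (HG i)).
move=> H3; apply: (is_derive_eq H3).
rewrite [in RHS]/inner -mulmxA mxE; apply: eq_bigr => i _.
by rewrite /inner [X in _ *: X]mxE [X in _ = _ * X]mxE; congr (_ * _); apply: eq_bigr => j _; rewrite !mxE.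
Qed.

Lemma D2at_enorm_sqr x xi :
  D2at (fun s => enorm (x + s *: xi) ^+ 2) (2 * inner x xi) (2 * enorm xi ^+ 2).
Proof.
apply: (@D2at_ext (fun s => enorm x ^+ 2 + (2 * inner x xi) * s + enorm xi ^+ 2 * s ^+ 2)).
  move=> s; rewrite enormD_sqr innerZr enormZ exprMn real_normK ?num_real //.
  by ring.
have := D2atD (D2atD (D2at_cst (enorm x ^+ 2)) (D2atZ (2 * inner x xi) D2at_id))
  (D2atZ (enorm xi ^+ 2) (D2at_sqr D2at_id)).
by congr D2at; ring.
Qed.

End Space.
End LineCalculus.

(** * Continuity of composite functions on topological spaces *)

Section Continuity.
Variables (R : realType) (T : topologicalType).

Lemma continuous_pair (U V : topologicalType) (f : T -> U) (g : T -> V) :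
  continuous f -> continuous g -> continuous (fun x => (f x, g x)).
Proof. by move=> cf cg x; apply: cvg_pair; [exact: cf | exact: cg]. Qed.

Lemma continuous_fst (U V : topologicalType) : continuous (@fst U V).
Proof. by move=> x; exact: cvg_fst. Qed.

Lemma continuous_snd (U V : topologicalType) : continuous (@snd U V).
Proof. by move=> x; exact: cvg_snd. Qed.

Lemma continuous_cst (U : topologicalType) (k : U) : continuous (fun _ : T => k).
Proof. by move=> x; exact: cvg_cst. Qed.

Lemma continuous_comp2 (U V : topologicalType) (g : U -> V) (f : T -> U) :
  continuous f -> continuous g -> continuous (fun x => g (f x)).
Proof. by move=> cf cg x; apply: continuous_comp; [exact: cf | exact: cg]. Qed.

Lemma continuous_addr (V : normedModType R) (f g : T -> V) :
  continuous f -> continuous g -> continuous (fun x => f x + g x).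
Proof. by move=> cf cg x; apply: cvgD; [exact: cf | exact: cg]. Qed.

Lemma continuous_oppr (V : normedModType R) (f : T -> V) :
  continuous f -> continuous (fun x => - f x).
Proof. by move=> cf x; apply: cvgN; exact: cf. Qed.

Lemma continuous_mulr (f g : T -> R) :
  continuous f -> continuous g -> continuous (fun x => f x * g x).
Proof. by move=> cf cg x; apply: cvgM; [exact: cf | exact: cg]. Qed.

Lemma continuous_exprn (f : T -> R) n :
  continuous f -> continuous (fun x => f x ^+ n).
Proof.
move=> cf; elim: n => [|n IH]; first exact: continuous_cst.
rewrite (_ : (fun x => f x ^+ n.+1) = (fun x => f x * f x ^+ n)).
  exact: continuous_mulr.
by apply: funext => x; rewrite exprS.
Qed.

Lemma continuous_scale (V : normedModType R) (f : T -> R) (g : T -> V) :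
  continuous f -> continuous g -> continuous (fun x => f x *: g x).
Proof. by move=> cf cg x; apply: cvgZ; [exact: cf | exact: cg]. Qed.

End Continuity.

(** * Maxima on an unbounded space by penalisation *)

Section Max.
Variables (R : realType) (d : nat).
Local Notation E := 'rV[R]_d.

Lemma compact_ball (rho : R) : compact [set x : E | enorm x <= rho].
Proof.
apply: bounded_closed_compact.
  exists rho; split; first exact: num_real.
  move=> M rM x /= xr; apply: le_trans (mxnorm_le_enorm x) _.
  exact: le_trans xr (ltW rM).
have := @preimage_closed E R (fun x => enorm x) [set y | y <= rho].
apply; last exact: closed_le.
by move=> x _; exact: continuous_enorm.
Qed.

(** The penalty restores compactness in [x]: for [enorm x > rho >= 1] it exceeds [B - m0], so the
    value there is below the one at the origin. The variable [z] ranges over a fixed ball; it is the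
    difference of the two points when variables are doubled, and is frozen by [r = 0] otherwise. *)
Lemma coercive_max (g : R -> E -> E -> R) (t1 T r B eps : R) :
  continuous (fun q : R * E * E => g q.1.1 q.1.2 q.2) ->
  t1 <= T -> 0 <= r -> 0 < eps ->
  (forall t x z, t1 <= t <= T -> enorm z <= r -> g t x z <= B) ->
  exists t x z, [/\ t1 <= t <= T, enorm z <= r &
    forall t' x' z', t1 <= t' <= T -> enorm z' <= r ->
      g t' x' z' - eps * enorm x' ^+ 2 <= g t x z - eps * enorm x ^+ 2].
Proof.
move=> cg tT r0 e0 gB.
pose m0 := g t1 0 0; pose rho := 1 + `|B - m0| / eps.
have rho1 : 1 <= rho by rewrite lerDl divr_ge0 // ltW.
pose K := (`[t1, T] `*` [set x : E | enorm x <= rho]) `*` [set z : E | enorm z <= r].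
pose G := fun q : R * E * E => g q.1.1 q.1.2 q.2 - eps * enorm q.1.2 ^+ 2.
have cK : compact K.
  apply: compact_setX; last exact: compact_ball.
  by apply: compact_setX; [exact: segment_compact|exact: compact_ball].
have K0 : K (t1, 0, 0).
  rewrite /K /=; split; last by rewrite /= enorm0.
  split; first by rewrite /= in_itv /= lexx.
  by rewrite /= enorm0; lra.
have cG : continuous G.
  apply: continuous_addr => //; apply: continuous_oppr.
  apply: continuous_mulr; first exact: continuous_cst.
  apply: continuous_exprn; apply: (continuous_comp2 (g := fun x : E => enorm x)).
    apply: (continuous_comp2 (g := @snd R E)); first exact: continuous_fst.
    exact: continuous_snd.
  exact: continuous_enorm.
have [|[[t x] z]] := @compact_EVT_max _ R G K _ cK (continuous_subspaceT cG).
  by exists (t1, 0, 0).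
rewrite inE /K /= => -[[tt xx] zz] HM.
have HM' : forall t' x' z', t1 <= t' <= T -> enorm x' <= rho -> enorm z' <= r ->
   g t' x' z' - eps * enorm x' ^+ 2 <= g t x z - eps * enorm x ^+ 2.
  move=> t' x' z' t't x'x z'z; apply: (HM (t', x', z')).
  by rewrite inE /K /=; split=> //; split=> //=; rewrite in_itv /=.
have tt' : t1 <= t <= T by move: tt; rewrite in_itv.
exists t, x, z; split => // t' x' z' t't z'r; have [|xr] := leP (enorm x') rho; first by move=> x'r; apply: HM'.
apply: le_trans (_ : g t1 0 0 - eps * enorm (0 : E) ^+ 2 <= _); last first.
  by apply: HM'; rewrite ?lexx ?enorm0 //; lra.
rewrite enorm0 expr0n mulr0 subr0 -/m0.
have H1 : g t' x' z' <= B by exact: gB.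
suff : B - m0 <= eps * enorm x' ^+ 2 by lra.
apply: le_trans (ler_norm _) _.
rewrite mulrC -ler_pdivrMr //.
have : `|B - m0| / eps <= rho by rewrite /rho; lra.
move=> H2; apply: (le_trans H2).
by apply: le_trans (ltW xr) _; rewrite expr2; nra.
Qed.

End Max.

(** * The second-order term and pointwise jets of the solution *)

Section Jets.
Variables (R : realType) (d : nat).
Local Notation E := 'rV[R]_d.

(** For [S] the transpose of sigma this is tr(a H). Read by rows it is a sum of second derivatives
    along lines, and it is invariant when [S] is multiplied on the left by an orthogonal matrix. *)
Definition qsum (S H : 'M[R]_d) : R := \tr (S *m H *m S^T).

Lemma qsumE S H : qsum S H = \sum_k inner (row k S *m H) (row k S).
Proof.
rewrite /qsum /mxtrace; apply: eq_bigr => k _.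
by rewrite /inner -row_mul mxE [in RHS]mxE; apply: eq_bigr => j _; rewrite !mxE.
Qed.

Lemma qsum_rot (O S H : 'M[R]_d) : O^T *m O = 1%:M -> qsum (O *m S) H = qsum S H.
Proof.
by move=> OO; rewrite /qsum trmx_mul !mulmxA mxtrace_mulC !mulmxA OO mul1mx.
Qed.

Lemma qsumN S H : qsum S (- H) = - qsum S H.
Proof. by rewrite /qsum mulmxN mulNmx raddfN. Qed.

Lemma qsum_le S H c : (forall xi : E, inner (xi *m H) xi <= c * enorm xi ^+ 2) ->
  qsum S H <= c * enorm S ^+ 2.
Proof.
move=> HH; rewrite qsumE enorm_row_sum mulr_sumr.
by apply: ler_sum => k _; exact: HH.
Qed.

Definition jet (u : R -> E -> R) (t : R) (x : E) (dt : R) (p : E) (H : 'M[R]_d) :=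
  is_derive t 1 (fun s => u s x) dt /\
  forall xi, D2at (fun s => u t (x + s *: xi)) (inner p xi) (inner (xi *m H) xi).

Lemma jetN u t x dt p H : jet u t x dt p H ->
  jet (fun s y => - u s y) t x (- dt) (- p) (- H).
Proof.
move=> [h1 h2]; split; first exact: is_deriveN.
by move=> xi; rewrite innerNl mulmxN innerNl; apply: D2atN.
Qed.

Lemma inner_inj (p q : E) : (forall xi, inner p xi = inner q xi) -> p = q.
Proof.
move=> H; apply/eqP; rewrite -subr_eq0 -enorm_eq0 -sqrf_eq0 -inner_xx.
by rewrite innerBl H subrr.
Qed.

End Jets.

(** * A priori bounds by the maximum principle *)

Section Apriori.
Variables (R : realType) (d : nat).
Local Notation E := 'rV[R]_d.

Lemma small3 (a1 b1 a2 b2 a3 b3 : R) : 0 < b1 -> 0 < b2 -> 0 < b3 ->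
  exists2 e : R, 0 < e <= 1 & [/\ e * a1 <= b1, e * a2 <= b2 & e * a3 <= b3].
Proof.
move=> B1 B2 B3.
have H a b : 0 < b -> exists2 c : R, 0 < c & forall e, 0 < e -> e <= c -> e * a <= b.
  move=> b0; exists (b / (`|a| + 1)); first by rewrite divr_gt0 // ltr_wpDl.
  move=> e e0 ec; apply: le_trans (_ : e * (`|a| + 1) <= _).
    by rewrite ler_pM2l //; have := ler_norm a; lra.
  by rewrite -ler_pdivlMr // ltr_wpDl.
have [c1 c10 H1] := H a1 _ B1; have [c2 c20 H2] := H a2 _ B2; have [c3 c30 H3] := H a3 _ B3.
pose m := Num.min 1 (Num.min c1 (Num.min c2 c3)).
have m0 : 0 < m by rewrite !lt_min c10 c20 c30 ltr01.
exists m; first by rewrite m0 ge_min lexx.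
by split; [apply: H1 | apply: H2 | apply: H3] => //; rewrite !ge_min lexx ?orbT.
Qed.

Lemma touch (phi : E -> R) x theta (P Q : E -> R) :
  (forall xi, D2at (fun s => phi (x + s *: xi)) (P xi) (Q xi)) ->
  (forall y, phi y - theta * enorm y ^+ 2 <= phi x - theta * enorm x ^+ 2) ->
  forall xi, P xi = 2 * theta * inner x xi /\ Q xi <= 2 * theta * enorm xi ^+ 2.
Proof.
move=> HD Hm xi.
have := D2at_max (D2atB (HD xi) (D2atZ theta (D2at_enorm_sqr x xi))) (@ltr01 R).
rewrite scale0r addr0 => /(_ (fun s _ => Hm (x + s *: xi))) [H1 H2].
by split; lra.
Qed.

(** The equation is kept only as a two-sided bound [F] on the lower-order terms. The class is thus
    stable under changing the sign of [u], and each one-sided barrier argument gives both bounds. *)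
Definition pde (T : R) (u : R -> E -> R) (S : R -> E -> 'M[R]_d) (F : R -> R -> R -> R) :=
  forall (t : R) x, 0 < t < T -> exists dt p H, jet u t x dt p H /\
    `|dt + 2^-1 * qsum (S t x) H| <= F `|u t x| (enorm p) (enorm (S t x)).

Lemma pdeN T (u : R -> E -> R) S F : pde T u S F -> pde T (fun t x => - u t x) S F.
Proof.
move=> H t x /(H _ x)[dt [p [h [J B]]]]; exists (- dt), (- p), (- h).
split; first exact: jetN.
by rewrite qsumN mulrN -opprD !normrN enormN.
Qed.

(** The contradiction at the maximum in [sup_bound]: [v] is the value, [q] the gradient, [s] the
    norm of sigma, [th] the penalty. As [v >= 1], the zero-order growth [Lam * (1 + v)] is at most
    [2 * Lam * v], and the rate [2 * Lam + 1] leaves a margin [v] for the rest. *)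
Lemma sup_bound_num (Lam v q s th : R) : 0 <= Lam -> 1 <= v -> 0 <= q -> 0 <= s ->
  s <= Lam * (1 + v) -> 0 <= th -> th * (4 * Lam ^+ 2 * v) <= 4^-1 ->
  q * (8 * (Lam + 1) * (2 * Lam + 1)) <= 1 ->
  (2 * Lam + 1) * v <= th * s ^+ 2 + Lam * (1 + v + q * s) * (1 + q) -> False.
Proof.
move=> L0 v1 q0 s0 sL th0 thv b2 key.
have v0 : 0 <= v by lra.
have Lv : 0 <= Lam * v by exact: mulr_ge0.
have LL : 0 <= Lam * Lam by exact: mulr_ge0.
have Lq : 0 <= Lam * q by exact: mulr_ge0.
have s2 : s <= 2 * Lam * v.
  have : Lam * (1 + v) <= Lam * (2 * v) by rewrite ler_wpM2l //; lra.
  by move: sL; clra.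
have k1 : th * s ^+ 2 <= v / 4.
  have h1 : s ^+ 2 <= (2 * Lam * v) ^+ 2.
    by rewrite ler_sqr ?nnegrE //; move: Lv; clra.
  have h2 : th * s ^+ 2 <= th * (2 * Lam * v) ^+ 2 by rewrite ler_wpM2l.
  have h4 : th * (4 * Lam ^+ 2 * v) * v <= 4^-1 * v by rewrite ler_wpM2r.
  by move: h2 h4; clra.
have q1 : q <= 1.
  have : q * 8 <= q * (8 * (Lam + 1) * (2 * Lam + 1)).
    by rewrite ler_wpM2l //; move: L0 LL; clra.
  by move: b2 q0; clra.
have a0 : q * s <= q * (2 * Lam * v) by rewrite ler_wpM2l.
have a1 : 1 + v + q * s <= 2 * v + q * (2 * Lam * v) by move: a0 v1; clra.
have a2 : Lam * (1 + v + q * s) * (1 + q) <= Lam * (2 * v + q * (2 * Lam * v)) * (1 + q).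
  by rewrite ler_wpM2r ?ler_wpM2l //; move: q0; clra.
have a3 : Lam * (2 * v + q * (2 * Lam * v)) * (1 + q) =
     2 * Lam * v + v * (2 * Lam * (q + Lam * q + Lam * q * q)) by ring.
have b1 : 2 * Lam * (q + Lam * q + Lam * q * q) <= 2 * Lam * (q * (1 + 2 * Lam)).
  rewrite ler_wpM2l //; first by move: L0; clra.
  have : Lam * q * q <= Lam * q * 1 by rewrite ler_wpM2l.
  by clra.
have b3 : 0 <= Lam * q * Lam by rewrite !mulr_ge0.
have b4 : 2 * Lam * (q + Lam * q + Lam * q * q) <= 2^-1 by move: b1 b2 b3 q0 Lq; clra.
have b5 : v * (2 * Lam * (q + Lam * q + Lam * q * q)) <= v * 2^-1 by rewrite ler_wpM2l.
by move: key k1 a2 a3 b5 v1; clra.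
Qed.

(** At a penalised maximum of [expR (ga * (t - T)) * u], the gradient is a small multiple of [x], so
    the products with the gradient are negligible and the exponential rate beats the linear growth.
    [Cb] enters only the choice of the penalty. *)
Lemma sup_bound (T K Lam Cb : R) (u : R -> E -> R) (S : R -> E -> 'M[R]_d) :
  0 < T -> 0 <= K -> 0 <= Lam ->
  continuous (fun z : R * E => u z.1 z.2) ->
  (forall (t : R) x, 0 < t <= T -> `|u t x| <= Cb) ->
  (forall x, u T x <= K) ->
  (forall (t : R) x, 0 < t < T -> enorm (S t x) <= Lam * (1 + `|u t x|)) ->
  pde T u S (fun a q s => Lam * (1 + a + q * s) * (1 + q)) ->
  forall (t : R) x, 0 < t <= T -> u t x <= (K + 1) * expR ((2 * Lam + 1) * T).
Proof.
move=> T0 K0 L0 cu ub uT SL HP t0 x0 /andP[t00 t0T].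
pose ga := 2 * Lam + 1; have ga0 : 0 < ga by rewrite /ga; lra.
have Cb0 : 0 <= Cb by apply: le_trans (ub T 0 _); rewrite ?lexx ?T0.
rewrite leNgt; apply/negP => Hcontra.
pose g := fun t x (z : E) => expR (ga * (t - T)) * u t x.
have ex1 t : t <= T -> expR (ga * (t - T)) <= 1.
  by move=> tT; rewrite -[leRHS]expR0 ler_expR pmulr_rle0 // subr_le0.
have Hg0 : K + 1 < g t0 x0 0.
  rewrite /g -(ltr_pM2l (expR_gt0 (ga * T))) mulrA -expRD.
  rewrite -mulrDr (addrC T) subrK.
  apply: (@lt_trans _ _ (u t0 x0)); first by rewrite mulrC.
  have u0 : 0 < u t0 x0.
    by apply: le_lt_trans Hcontra; rewrite mulr_ge0 ?expR_ge0 //; lra.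
  by rewrite ltr_pMl // expR_gt1 mulr_gt0.
pose EE := expR (ga * T); have EE1 : 1 <= EE.
  by rewrite /EE -[leLHS]expR0 ler_expR mulr_ge0 // ltW.
pose pi0 := (8 * (Lam + 1) * (2 * Lam + 1))^-1.
have pi00 : 0 < pi0 by rewrite invr_gt0 !mulr_gt0 //; lra.
(* The three conditions keep the penalised maximum above [K + 1], force the gradient there below
   [pi0], and make the second derivative of the penalty harmless. *)
have [| | |eps /andP[e0 e1] [E1 E2 E3]] := @small3
   (enorm x0 ^+ 2) ((g t0 x0 0 - K - 1) / 2)
   (4 * EE ^+ 2 * Cb) (pi0 ^+ 2) (4 * EE * Lam ^+ 2 * Cb) 4^-1.
- lra.
- by rewrite exprn_gt0.
- lra.
have cg : continuous (fun q : R * E * E => g q.1.1 q.1.2 q.2).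
  have c1 : continuous (fun q : R * E * E => q.1.1).
    by apply: (continuous_comp2 (g := fst)); exact: continuous_fst.
  apply: continuous_mulr.
    apply: (continuous_comp2 (g := expR)); last exact: continuous_expR.
    apply: continuous_mulr; first exact: continuous_cst.
    apply: continuous_addr => //; exact: continuous_cst.
  apply: (continuous_comp2 (g := fun z : R * E => u z.1 z.2)) => //.
  exact: continuous_fst.
have gB : forall t x (z : E), t0 <= t <= T -> enorm z <= 0 -> g t x z <= Cb.
  move=> t x z /andP[t0t tT] _; rewrite /g.
  have Hu : u t x <= Cb by apply: le_trans (ler_norm _) (ub _ _ _); rewrite tT andbT (lt_le_trans t00).
  have := ex1 t tT; have := expR_gt0 (ga * (t - T)).
  by nra.
have [t [x [z [/andP[t0t tT] _ HM]]]] := coercive_max cg t0T (lexx 0) e0 gB.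
have z0 : enorm (0 : E) <= 0 by rewrite enorm0.
have Hbig : K + 1 < g t x 0 - eps * enorm x ^+ 2.
  apply: lt_le_trans (HM t0 x0 0 _ z0); last by rewrite lexx.
  lra.
have Kx : eps * enorm x ^+ 2 <= Cb.
  have : g t x 0 <= Cb by apply: gB; rewrite ?t0t ?enorm0.
  lra.
have ex0 : 0 <= eps * enorm x ^+ 2 by rewrite mulr_ge0 ?sqr_ge0 // ltW.
have t1T : t < T.
  rewrite lt_neqAle tT andbT; apply/eqP => tE.
  by move: Hbig; rewrite /g tE subrr mulr0 expR0 mul1r; have := uT x; lra.
have tpos : 0 < t by rewrite (lt_le_trans t00).
have tin : 0 < t < T by rewrite tpos.
have [dt [p [H [[Jt Jx] B]]]] := HP t x tin.
pose c := expR (ga * (t - T)).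
have c0 : 0 < c by exact: expR_gt0.
have c1 : c <= 1 by exact: ex1.
have u1 : K + 1 < u t x.
  have : K + 1 < c * u t x by move: Hbig; rewrite /g -/c; lra.
  by nra.
pose th := eps * expR (ga * (T - t)).
have cE : c * expR (ga * (T - t)) = 1.
  by rewrite /c -expRD -mulrDr addrA subrK subrr mulr0 expR0.
have thc : th * c = eps by rewrite /th -mulrA (mulrC _ c) cE mulr1.
have th0 : 0 < th by rewrite mulr_gt0 ?expR_gt0.
have thE : th <= eps * EE.
  by rewrite ler_pM2l // ler_expR ler_pM2l //; lra.
have Hy y : u t y - th * enorm y ^+ 2 <= u t x - th * enorm x ^+ 2.
  have tt : t0 <= t <= T by rewrite t0t.
  have := HM t y 0 tt z0; rewrite /g -/c -thc => HH.
  by rewrite -(ler_pM2l c0); move: HH; clra.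
have Htouch := touch (fun xi => Jx xi) Hy.
have pE : p = (2 * th) *: x.
  by apply: inner_inj => xi; rewrite innerZl; exact: (Htouch xi).1.
have qE : qsum (S t x) H <= 2 * th * enorm (S t x) ^+ 2.
  by apply: qsum_le => xi; exact: (Htouch xi).2.
have dtE : ga * u t x + dt <= 0.
  have D : is_derive t 1 (fun s => expR (ga * (s - T)) * u s x)
      (c * (ga * u t x + dt)).
    have D1 : is_derive t 1 (fun s : R => expR (ga * (s - T))) (c * ga).
      apply: (@is_derive1_comp R expR (fun s => ga * (s - T)) t c ga) => //.
      by apply: is_derive_eq; rewrite /GRing.scale /= subr0 mulr1.
    have := is_deriveM D1 Jt => D2; apply: (is_derive_eq D2).
    by rewrite /GRing.scale /= -/c; ring.
  have := der_max_r (r := T - t) D; rewrite subr_gt0 t1T => /(_ isT) DD.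
  rewrite -(pmulr_rle0 _ c0); apply: DD => h /andP[h0 hT].
  have tt : t0 <= t + h <= T by lra.
  by have := HM (t + h) x 0 tt z0; rewrite /g; lra.
have v1 : 1 <= u t x by move: u1 K0; clra.
have uu : `|u t x| = u t x by rewrite ger0_norm //; move: v1; clra.
have uCb : u t x <= Cb by rewrite -uu; apply: ub; rewrite tpos.
have q2 : enorm p <= pi0.
  rewrite -(ler_sqr (x := enorm p)) ?nnegrE ?(ltW pi00) //.
  apply: le_trans E2.
  rewrite pE enormZ exprMn real_normK ?num_real //.
  have -> : (2 * th) ^+ 2 * enorm x ^+ 2 = 4 * th * (th * enorm x ^+ 2) by ring.
  have -> : eps * (4 * EE ^+ 2 * Cb) = 4 * (eps * EE) * (EE * Cb) by ring.
  apply: ler_pM => //.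
  - by rewrite mulr_ge0 // ltW.
  - by rewrite mulr_ge0 ?sqr_ge0 // ltW.
  - by rewrite ler_pM2l.
  - have -> : th * enorm x ^+ 2 = expR (ga * (T - t)) * (eps * enorm x ^+ 2).
      by rewrite /th; ring.
    rewrite ler_pM ?expR_ge0 // ler_expR ler_pM2l //.
    by move: tpos; clra.
have D0 : 0 < 8 * (Lam + 1) * (2 * Lam + 1) by rewrite !mulr_gt0 //; move: L0; clra.
have SL' := SL t x tin; rewrite uu in SL'.
apply: (sup_bound_num L0 v1 (enorm_ge0 p) (enorm_ge0 (S t x)) SL' (ltW th0)).
- apply: le_trans E3.
  have -> : eps * (4 * EE * Lam ^+ 2 * Cb) = eps * EE * (4 * Lam ^+ 2 * Cb) by ring.
  apply: ler_pM => //; first exact: ltW.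
    by rewrite !mulr_ge0 ?sqr_ge0 //; move: v1; clra.
  by rewrite ler_wpM2l // mulr_ge0 ?sqr_ge0.
- by rewrite -ler_pdivlMr // mul1r.
move: B; rewrite uu ler_norml => /andP[B _].
by move: B dtE qE; rewrite /ga; clra.
Qed.

End Apriori.

(** * Doubling of variables *)

Section Doubling.
Variables (R : realType) (d : nat).
Local Notation E := 'rV[R]_d.

Lemma pde_mono (T : R) (u : R -> E -> R) (S : R -> E -> 'M[R]_d) (F G : R -> R -> R -> R) :
  (forall (t : R) x q, 0 < t < T -> 0 <= q ->
     F `|u t x| q (enorm (S t x)) <= G `|u t x| q (enorm (S t x))) ->
  pde T u S F -> pde T u S G.
Proof.
move=> FG H t x tT; have [dt [p [h [J B]]]] := H t x tT.
exists dt, p, h; split => //; apply: le_trans B _.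
exact: FG.
Qed.

(** At a penalised maximum of [u - H - C0 * (T - t)] the gradient is within one of grad H and the
    second derivatives are at most those of [H] plus 2 eps. The equation then bounds the time
    derivative below by [- (C0 - 1)], against [C0 + dt <= 0]. *)
Lemma terminal_le (T K M0 C1 C2 : R) (u : R -> E -> R) (S : R -> E -> 'M[R]_d)
    (H : E -> R) (gH : E -> E) (hH : E -> 'M[R]_d) :
  0 < T -> 0 <= K -> 0 <= C1 ->
  continuous (fun z : R * E => u z.1 z.2) -> continuous H ->
  (forall (t : R) x, 0 < t <= T -> `|u t x| <= M0) ->
  (forall x, `|H x| <= K) ->
  (forall x, u T x = H x) ->
  (forall x xi, D2at (fun s => H (x + s *: xi)) (inner (gH x) xi) (inner (xi *m hH x) xi)) ->
  (forall x, enorm (gH x) <= K) -> (forall x, enorm (hH x) <= K) ->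
  (forall (t : R) x, 0 < t < T -> enorm (S t x) <= C2) ->
  pde T u S (fun _ q _ => C1 * (1 + q ^+ 2)) ->
  forall (t : R) x, 0 < t <= T ->
    u t x - H x <= (2^-1 * (K + 2) * C2 ^+ 2 + C1 * (1 + (K + 1) ^+ 2) + 1) * (T - t).
Proof.
move=> T0 K0 C10 cu cH ub HK uT HD gK hK SC HP t0 x0 /andP[t00 t0T].
set C0 := (X in X * _).
rewrite leNgt; apply/negP => Hcontra.
pose g := fun t x (z : E) => u t x - H x - C0 * (T - t).
have C20 : 0 <= C2 ^+ 2 by exact: sqr_ge0.
have C00 : 0 <= C0.
  have h1 : 0 <= (K + 2) * C2 ^+ 2 by rewrite mulr_ge0 // addr_ge0.
  have h2 : 0 <= C1 * (1 + (K + 1) ^+ 2) by rewrite mulr_ge0 // addr_ge0 // sqr_ge0.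
  by move: h1 h2; rewrite /C0; clra.
have M00 : 0 <= M0 by apply: le_trans (ub T 0 _); rewrite ?lexx ?T0.
have [| | |eps /andP[e0 e1] [E1 E2 _]] := @small3 R
   (enorm x0 ^+ 2) ((g t0 x0 0) / 2) (4 * (M0 + K)) 1 1 1 => //.
  by rewrite /g; move: Hcontra; clra.
have cg : continuous (fun q : R * E * E => g q.1.1 q.1.2 q.2).
  have c1 : continuous (fun q : R * E * E => q.1.1).
    by apply: (continuous_comp2 (g := fst)); exact: continuous_fst.
  have c2 : continuous (fun q : R * E * E => q.1.2).
    by apply: (continuous_comp2 (g := snd)); [exact: continuous_fst|exact: continuous_snd].
  apply: continuous_addr; last first.
    apply: continuous_oppr; apply: continuous_mulr; first exact: continuous_cst.
    by apply: continuous_addr; [exact: continuous_cst|exact: continuous_oppr].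
  apply: continuous_addr; last by apply: continuous_oppr; exact: (continuous_comp2 (g := H)).
  apply: (continuous_comp2 (g := fun z : R * E => u z.1 z.2)) => //.
  exact: continuous_fst.
have gB : forall (t : R) x (z : E), t0 <= t <= T -> enorm z <= 0 -> g t x z <= M0 + K.
  move=> t x z /andP[t0t tT] _; rewrite /g.
  have Hu : u t x <= M0 by apply: le_trans (ler_norm _) (ub _ _ _); rewrite tT andbT (lt_le_trans t00).
  have Hh : - H x <= K by apply: le_trans (HK x); rewrite -normrN ler_norm.
  have : 0 <= C0 * (T - t) by rewrite mulr_ge0 // subr_ge0.
  by move: Hu Hh; clra.
have [t [x [z [/andP[t0t tT] _ HM]]]] := coercive_max cg t0T (lexx 0) e0 gB.
have z0 : enorm (0 : E) <= 0 by rewrite enorm0.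
have Hbig : 0 < g t x 0 - eps * enorm x ^+ 2.
  apply: lt_le_trans (HM t0 x0 0 _ z0); last by rewrite lexx.
  by move: E1 Hcontra; rewrite /g; clra.
have Kx : eps * enorm x ^+ 2 <= M0 + K.
  have : g t x 0 <= M0 + K by apply: gB; rewrite ?t0t ?enorm0.
  by move: Hbig; clra.
have ex0 : 0 <= eps * enorm x ^+ 2 by rewrite mulr_ge0 ?sqr_ge0 // ltW.
have t1T : t < T.
  rewrite lt_neqAle tT andbT; apply/eqP => tE.
  by move: Hbig ex0; rewrite /g tE subrr mulr0 uT; clra.
have tpos : 0 < t by rewrite (lt_le_trans t00).
have tin : 0 < t < T by rewrite tpos.
have [dt [p [h [[Jt Jx] B]]]] := HP t x tin.
have Hy y : (u t y - H y) - eps * enorm y ^+ 2 <= (u t x - H x) - eps * enorm x ^+ 2.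
  have tt : t0 <= t <= T by rewrite t0t.
  by have := HM t y 0 tt z0; rewrite /g; clra.
have Htouch := touch (phi := fun y => u t y - H y) (fun xi => D2atB (Jx xi) (HD x xi)) Hy.
have pE : p = gH x + (2 * eps) *: x.
  apply: inner_inj => xi; rewrite innerDl innerZl -(Htouch xi).1.
  by rewrite addrC subrK.
have qE : qsum (S t x) h <= (K + 2 * eps) * enorm (S t x) ^+ 2.
  apply: qsum_le => xi; have := (Htouch xi).2.
  have : inner (xi *m hH x) xi <= K * enorm xi ^+ 2.
    apply: le_trans (ler_norm _) _; apply: le_trans (CauchySchwarz _ _) _.
    rewrite expr2 mulrA ler_wpM2r // mulrC.
    by apply: le_trans (enorm_mulmx _ _) _; rewrite ler_wpM2l.
  by clra.
have dtE : C0 + dt <= 0.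
  have D : is_derive t 1 (fun s : R => u s x - C0 * (T - s)) (C0 + dt).
    have D1 : is_derive t 1 (fun s : R => C0 * (T - s)) (- C0).
      apply: is_derive_ext (is_derive_affine (C0 * T) (- C0) t) => s.
      by ring.
    by have D2 := is_deriveB Jt D1; apply: (is_derive_eq D2); rewrite opprK addrC.
  have := der_max_r (r := T - t) D; rewrite subr_gt0 t1T => /(_ isT); apply.
  move=> s /andP[s0 sT].
  have tt : t0 <= t + s <= T by move: t0t sT s0; clear; intros; apply/andP; split; lra.
  by have := HM (t + s) x 0 tt z0; rewrite /g; clra.
have px : enorm p <= K + 1.
  rewrite pE; apply: le_trans (enormD _ _) _; apply: lerD; first exact: gK.
  apply: enorm_le_sqr => //.
  rewrite enormZ exprMn real_normK ?num_real // expr1n.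
  have -> : (2 * eps) ^+ 2 * enorm x ^+ 2 = 4 * eps * (eps * enorm x ^+ 2) by ring.
  have -> : 4 * eps * (eps * enorm x ^+ 2) = eps * (4 * (eps * enorm x ^+ 2)) by ring.
  by apply: le_trans E2; rewrite ler_wpM2l ?(ltW e0) // ler_wpM2l.
move: B; rewrite ler_norml => /andP[B _].
have S2 : enorm (S t x) ^+ 2 <= C2 ^+ 2.
  by rewrite ler_sqr ?nnegrE //; [exact: SC|apply: le_trans (SC t x tin)].
have q2 : qsum (S t x) h <= (K + 2) * C2 ^+ 2.
  apply: le_trans qE _; apply: ler_pM; rewrite ?sqr_ge0 //.
    by move: K0 e0; clra.
  by move: e1; clra.
have p2 : C1 * (1 + enorm p ^+ 2) <= C1 * (1 + (K + 1) ^+ 2).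
  rewrite ler_wpM2l // lerD2l ler_sqr ?nnegrE //.
  by move: K0; clra.
by move: dtE B q2 p2; rewrite /C0; clra.
Qed.

(** Coupling by reflection. [O] is the Householder reflection along the unit vector [n] that [Sy]
    maps to [c *: e]; it changes [Sx - Sy] by the rank-one matrix [(2 * c) *: (n^T *m e)]. The parts
    orthogonal to [e] stay those of [Sx - Sy], while the part along [e] has norm at least
    [2 * c - sl >= sl], by ellipticity. *)
Lemma reflection (Sx Sy : 'M[R]_d) (e : E) (sl : R) :
  0 < sl -> enorm e = 1 -> (forall xi : E, sl * enorm xi <= enorm (xi *m Sy^T)) ->
  enorm (Sx - Sy) <= sl ->
  exists O : 'M[R]_d, [/\ O^T *m O = 1%:M,
    sl ^+ 2 <= \sum_k inner e (row k (Sx - O *m Sy)) ^+ 2 &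
    \sum_k (enorm (row k (Sx - O *m Sy)) ^+ 2 - inner e (row k (Sx - O *m Sy)) ^+ 2)
      <= enorm (Sx - Sy) ^+ 2].
Proof.
move=> sl0 e1 ell dS.
have ut : Sy^T \in unitmx.
  rewrite -row_free_unit; apply: inj_row_free => v v0.
  apply/eqP; rewrite -enorm_eq0 eq_le enorm_ge0 andbT -(pmulr_rle0 _ sl0).
  by apply: le_trans (ell v) _; rewrite v0 enorm0.
have us : Sy \in unitmx by rewrite -unitmx_tr.
pose w := e *m invmx Sy.
have wS : w *m Sy = e by rewrite /w mulmxKV.
have w0 : 0 < enorm w.
  rewrite enorm_gt0; apply/eqP => w0.
  by move: e1; rewrite -wS w0 mul0mx enorm0 => /eqP; rewrite eq_sym oner_eq0.
pose xi := w *m invmx Sy^T.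
have xiS : xi *m Sy^T = w by rewrite /xi mulmxKV.
have slw : sl * enorm w <= 1.
  rewrite -(ler_pM2r w0) mul1r -mulrA -expr2 -inner_xx.
  apply: le_trans (_ : sl * enorm xi <= _); last by have := ell xi; rewrite xiS.
  rewrite ler_pM2l // -[X in inner _ X]xiS -inner_mul wS; apply: le_trans (ler_norm _) _.
  by apply: le_trans (CauchySchwarz _ _) _; rewrite e1 mul1r.
pose c := (enorm w)^-1.
have cs : sl <= c by rewrite /c -[leRHS]mul1r ler_pdivlMr.
have c0 : 0 < c by rewrite invr_gt0.
have [n nS nn] : exists2 n : E, n *m Sy = c *: e & enorm n = 1.
  exists (c *: w); first by rewrite -scalemxAl wS.
  by rewrite enormZ gtr0_norm // mulVf // gt_eqF.
have nnT : n *m n^T = 1%:M.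
  by apply/matrixP => i j; rewrite !ord1 [LHS](inner_xx n) nn expr1n mxE.
pose O : 'M[R]_d := 1%:M - 2 *: (n^T *m n).
have OT : O^T = O.
  by apply/matrixP => i j; rewrite !mxE !big_ord1 !mxE eq_sym (mulrC (n 0 j)).
have AA : (n^T *m n) *m (n^T *m n) = n^T *m n.
  by rewrite mulmxA -(mulmxA n^T n n^T) nnT mulmx1.
have OO : O^T *m O = 1%:M.
  rewrite OT /O mulmxBl mul1mx mulmxBr mulmx1 -scalemxAl -scalemxAr AA.
  by apply/matrixP => i j; rewrite !mxE; ring.
have DE : Sx - O *m Sy = (Sx - Sy) + (2 * c) *: (n^T *m e).
  rewrite /O mulmxBl mul1mx -scalemxAl -mulmxA nS -scalemxAr scalerA opprB.
  by rewrite addrA addrAC.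
have rowD k : row k (Sx - O *m Sy) = row k (Sx - Sy) + (2 * c * n 0 k) *: e.
  rewrite DE; apply/rowP => j; rewrite !mxE big_ord1 !mxE; ring.
exists O; split => //.
- rewrite -enorm_mul_row_sum ler_sqr ?nnegrE //; last exact: ltW.
  have -> : e *m (Sx - O *m Sy)^T = (2 * c) *: n + e *m (Sx - Sy)^T.
    rewrite DE linearD linearZ /= mulmxDr -scalemxAr trmx_mul trmxK mulmxA.
    have -> : e *m e^T = 1%:M.
      by apply/matrixP => i j; rewrite !ord1 [LHS](inner_xx e) e1 expr1n mxE.
    by rewrite mul1mx addrC.
  have h1 : enorm ((2 * c) *: n) = 2 * c by rewrite enormZ nn mulr1 gtr0_norm // mulr_gt0.
  have h2 : enorm (e *m (Sx - Sy)^T) <= sl.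
    by apply: le_trans (enorm_mulmx _ _) _; rewrite e1 mul1r enorm_tr.
  have := enormB ((2 * c) *: n + e *m (Sx - Sy)^T) (e *m (Sx - Sy)^T).
  rewrite addrK h1; move: h2 cs; clra.
- rewrite (enorm_row_sum (Sx - Sy)); apply: ler_sum => k _.
  rewrite rowD enormD_sqr innerDr !innerZr inner_xx enormZ e1.
  rewrite (innerC _ e) mulr1 real_normK ?num_real //.
  have := sqr_ge0 (inner e (row k (Sx - Sy))).
  by clra.
Qed.

End Doubling.

Section DoublingLemma.
Variables (R : realType) (d : nat).
Local Notation E := 'rV[R]_d.

(** Derivatives of a radial function psi(|z|) away from 0: [A1 r] is psi'(r)/r, the weight of
    tangential directions, and [A2 r] is psi''(r), the weight of the radial one. *)
Definition profile (Psi : E -> R) (A1 A2 : R -> R) :=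
  forall z : E, z != 0 -> forall xi : E,
    D2at (fun s => Psi (z + s *: xi)) (A1 (enorm z) * inner z xi)
      (A1 (enorm z) * (enorm xi ^+ 2 - inner ((enorm z)^-1 *: z) xi ^+ 2)
       + A2 (enorm z) * inner ((enorm z)^-1 *: z) xi ^+ 2).

(* Ishii-Lions: at a maximum of [u(x) - u(x - z) - Psi z], the second-order
   condition is tested along the rows of [S x] and of a reflection of [S (x - z)];
   the reflection is what produces the good term [sl ^+ 2 * A2]. *)
Lemma doubling (T t1 r1 M0 C1 C2 L sl : R) (u : R -> E -> R) (S : R -> E -> 'M[R]_d)
    (Psi : E -> R) (A1 A2 w : R -> R) :
  0 < t1 <= T -> 0 <= r1 -> 0 <= C1 -> 0 <= L -> 0 < sl ->
  continuous (fun z : R * E => u z.1 z.2) -> continuous Psi ->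
  (forall (t : R) x, t1 <= t <= T -> `|u t x| <= M0) ->
  (forall (t : R) x, t1 <= t < T -> enorm (S t x) <= C2) ->
  (forall (t : R) x y, t1 <= t < T ->
     enorm (S t x - S t y) <= L * (enorm (x - y) + `|u t x - u t y|)) ->
  (forall (t : R) x (xi : E), t1 <= t < T -> sl * enorm xi <= enorm (xi *m (S t x)^T)) ->
  pde T u S (fun _ q _ => C1 * (1 + q ^+ 2)) ->
  profile Psi A1 A2 -> (forall z, enorm z <= r1 -> 0 <= Psi z) ->
  (forall (t : R) x z, t1 <= t <= T -> enorm z <= r1 ->
     `|u t x - u t (x - z)| <= w (enorm z)) ->
  (forall x z, enorm z <= r1 -> u T x - u T (x - z) <= Psi z) ->
  (forall z, enorm z = r1 -> w r1 <= Psi z) ->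
  (forall r : R, 0 < r < r1 -> [/\ 0 <= A1 r, A2 r <= 0, L * (r + w r) <= sl &
     A1 r * (L * (r + w r)) ^+ 2 + sl ^+ 2 * A2 r
       + 2 * C1 * (4 + 3 * (A1 r * r) ^+ 2) + 2 < 0]) ->
  forall (t : R) x z, t1 <= t <= T -> enorm z <= r1 -> u t x - u t (x - z) <= Psi z.
Proof.
move=> /andP[t10 t1T] r10 C10 L0 sl0 cu cP ub SC SL ell HP prof P0 Hw uT Hr1 Hc.
move=> t0 x0 z0 /andP[t0t t0T] z0r; rewrite leNgt; apply/negP => Hcontra.
pose g := fun t x z => u t x - u t (x - z) - Psi z.
have M00 : 0 <= M0 by apply: le_trans (ub T 0 _); rewrite ?lexx ?t1T.
have [| | |eps /andP[e0 e1] [E1 E2 E3]] := @small3 R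
   (enorm x0 ^+ 2) ((g t0 x0 z0) / 2) (8 * M0) 1 (C2 ^+ 2) 1 => //.
  by rewrite /g; move: Hcontra; clra.
have cg : continuous (fun q : R * E * E => g q.1.1 q.1.2 q.2).
  have c1 : continuous (fun q : R * E * E => q.1.1).
    by apply: (continuous_comp2 (g := fst)); exact: continuous_fst.
  have c2 : continuous (fun q : R * E * E => q.1.2).
    by apply: (continuous_comp2 (g := snd)); [exact: continuous_fst|exact: continuous_snd].
  have c3 : continuous (fun q : R * E * E => q.2) by exact: continuous_snd.
  apply: continuous_addr; last first.
    by apply: continuous_oppr; exact: (continuous_comp2 (g := Psi)).
  apply: continuous_addr.
    apply: (continuous_comp2 (g := fun z : R * E => u z.1 z.2)) => //.
    exact: continuous_fst.
  apply: continuous_oppr.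
  apply: (continuous_comp2 (f := fun q : R * E * E => (q.1.1, q.1.2 - q.2))
            (g := fun z : R * E => u z.1 z.2)) => //.
  by apply: continuous_pair => //; apply: continuous_addr => //; exact: continuous_oppr.
have gB : forall (t : R) x (z : E), t1 <= t <= T -> enorm z <= r1 -> g t x z <= 2 * M0.
  move=> t x z tt zr; rewrite /g.
  have h1 : u t x <= M0 by apply: le_trans (ler_norm _) (ub _ _ tt).
  have h2 : - u t (x - z) <= M0 by apply: le_trans (ub t (x - z) tt); rewrite -normrN ler_norm.
  by move: (P0 z zr) h1 h2; clra.
have [t [x [z [/andP[t0t' tT] zr HM]]]] := coercive_max cg t1T r10 e0 gB.
have Hbig : 0 < g t x z - eps * enorm x ^+ 2.
  apply: lt_le_trans (HM t0 x0 z0 _ z0r); last by rewrite t0t.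
  by move: E1 Hcontra; rewrite /g; clra.
have ttT : t1 <= t <= T by rewrite t0t'.
have Kx : eps * enorm x ^+ 2 <= 2 * M0.
  by move: Hbig (gB t x z ttT zr); clra.
have ex0 : 0 <= eps * enorm x ^+ 2 by rewrite mulr_ge0 ?sqr_ge0 // ltW.
have tltT : t < T.
  rewrite lt_neqAle tT andbT; apply/eqP => tE.
  by move: Hbig ex0 (uT x z zr); rewrite /g tE; clra.
have zn0 : z != 0.
  apply/eqP => zE; move: Hbig ex0 (P0 z zr); rewrite /g zE subr0; clra.
have zpos : 0 < enorm z by rewrite enorm_gt0.
have zlt : enorm z < r1.
  rewrite lt_neqAle zr andbT; apply/eqP => zE.
  have := Hr1 z zE; have := Hw t x z ttT zr; rewrite ler_norml zE => /andP[_].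
  by move: Hbig ex0; rewrite /g; clra.
have tpos : 0 < t by rewrite (lt_le_trans t10).
have tin : 0 < t < T by rewrite tpos.
have tin1 : t1 <= t < T by rewrite t0t'.
have [dx [px [hx [[Jtx Jx] Bx]]]] := HP t x tin.
have [dy [py [hy [[Jty Jy] By]]]] := HP t (x - z) tin.
set r := enorm z in zpos zlt zr *.
pose e := r^-1 *: z.
have e1' : enorm e = 1 by rewrite enormZ gtr0_norm ?invr_gt0 // mulVf // gt_eqF.
have [A10 A20 Lw Hneg] : [/\ 0 <= A1 r, A2 r <= 0, L * (r + w r) <= sl &
     A1 r * (L * (r + w r)) ^+ 2 + sl ^+ 2 * A2 r
       + 2 * C1 * (4 + 3 * (A1 r * r) ^+ 2) + 2 < 0] by apply: Hc; rewrite zpos.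
have dS : enorm (S t x - S t (x - z)) <= L * (r + w r).
  apply: le_trans (SL t x (x - z) tin1) _; rewrite ler_wpM2l //.
  have -> : x - (x - z) = z by rewrite opprB addrC subrK.
  by rewrite lerD2l; exact: Hw.
(* The two points move independently: [x] by [s *: xi] and [x - z] by [s *: zeta], hence [z] by
   [s *: (xi - zeta)]. *)
have HD (xi zeta : E) : inner px xi - inner py zeta - A1 r * inner z (xi - zeta)
      - eps * (2 * inner x xi) = 0 /\
    inner (xi *m hx) xi - inner (zeta *m hy) zeta
     - (A1 r * (enorm (xi - zeta) ^+ 2 - inner e (xi - zeta) ^+ 2)
       + A2 r * inner e (xi - zeta) ^+ 2) - eps * (2 * enorm xi ^+ 2) <= 0.
  have D := D2atB (D2atB (D2atB (Jx xi) (Jy zeta)) (prof z zn0 (xi - zeta)))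
     (D2atZ eps (D2at_enorm_sqr x xi)).
  pose q := (r1 - r) / (enorm (xi - zeta) + 1).
  have n0 : 0 < enorm (xi - zeta) + 1 by rewrite ltr_wpDl.
  have q0 : 0 < q by rewrite divr_gt0 // subr_gt0.
  apply: (D2at_max D q0) => s sq; rewrite !scale0r !addr0.
  have zs : enorm (z + s *: (xi - zeta)) <= r1.
    apply: le_trans (enormD _ _) _; rewrite -lerBrDl enormZ.
    apply: le_trans (_ : `|s| * (enorm (xi - zeta) + 1) <= _).
      by rewrite ler_wpM2l // lerDl.
    by rewrite -ler_pdivlMr // ltW.
  have := HM t (x + s *: xi) (z + s *: (xi - zeta)) ttT zs; rewrite /g.
  have -> : x + s *: xi - (z + s *: (xi - zeta)) = x - z + s *: zeta.
    by apply/rowP => j; rewrite !mxE; ring.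
  by clra.
have pyE : py = A1 r *: z.
  apply: inner_inj => xi; have [H1 _] := HD 0 (- xi).
  move: H1; rewrite (_ : 0 - - xi = xi) ?sub0r ?opprK // !inner0r innerNr innerZl; clra.
have pxE : px = A1 r *: z + (2 * eps) *: x.
  apply: inner_inj => xi; have [H1 _] := HD xi 0.
  by move: H1; rewrite inner0r !subr0 innerDl !innerZl; clra.
have [Rf [OO O1 O2]] := reflection sl0 e1' (fun xi => ell t (x - z) xi tin1) (le_trans dS Lw).
have Q : qsum (S t x) hx - qsum (S t (x - z)) hy <=
    A1 r * (L * (r + w r)) ^+ 2 + A2 r * sl ^+ 2 + 2 * eps * enorm (S t x) ^+ 2.
  rewrite -(qsum_rot (S t (x - z)) hy OO) !qsumE enorm_row_sum -sumrB.
  set D := S t x - Rf *m S t (x - z) in O1 O2.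
  have rD k : row k (S t x) - row k (Rf *m S t (x - z)) = row k D by rewrite linearB.
  apply: (@le_trans _ _ (\sum_k (A1 r * (enorm (row k D) ^+ 2 - inner e (row k D) ^+ 2)
       + A2 r * inner e (row k D) ^+ 2 + 2 * eps * enorm (row k (S t x)) ^+ 2))).
    apply: ler_sum => k _.
    have [_] := HD (row k (S t x)) (row k (Rf *m S t (x - z))).
    by rewrite rD; clra.
  rewrite !big_split /= -!mulr_sumr lerD2r; apply: lerD.
    rewrite ler_wpM2l //; apply: le_trans O2 _.
    have dS0 := enorm_ge0 (S t x - S t (x - z)).
    by rewrite ler_sqr ?nnegrE //; exact: le_trans dS.
  by rewrite ler_wnM2l.
have dtE : dx - dy <= 0.
  have D : is_derive t 1 (fun s => u s x - u s (x - z)) (dx - dy) by exact: is_deriveB.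
  have := der_max_r (r := T - t) D; rewrite subr_gt0 tltT => /(_ isT); apply.
  move=> s /andP[s0 sT].
  have tt : t1 <= t + s <= T by move: t0t' sT s0; clear; intros; apply/andP; split; lra.
  by have := HM (t + s) x z tt zr; rewrite /g /=; clra.
have xe : enorm ((2 * eps) *: x) <= 1.
  apply: enorm_le_sqr => //.
  rewrite enormZ exprMn real_normK ?num_real // expr1n.
  have -> : (2 * eps) ^+ 2 * enorm x ^+ 2 = eps * (4 * (eps * enorm x ^+ 2)) by ring.
  apply: le_trans E2; rewrite ler_wpM2l ?(ltW e0) //.
  by move: Kx; clra.
have py2 : enorm py = A1 r * r by rewrite pyE enormZ ger0_norm.
have px2 : enorm px <= A1 r * r + 1.
  rewrite pxE; apply: le_trans (enormD _ _) _; apply: lerD => //.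
  by rewrite enormZ ger0_norm.
have px3 : enorm px ^+ 2 <= 2 * (A1 r * r) ^+ 2 + 2.
  apply: (@le_trans _ _ ((A1 r * r + 1) ^+ 2)).
    rewrite ler_sqr ?nnegrE //.
    by apply: addr_ge0 => //; apply: mulr_ge0 => //; exact: ltW.
  by have := sqr_ge0 (A1 r * r - 1); clra.
have S2 : eps * enorm (S t x) ^+ 2 <= 1.
  apply: le_trans E3; rewrite ler_wpM2l ?(ltW e0) // ler_sqr ?nnegrE //; first exact: SC.
  by apply: le_trans (SC t x tin1).
move: Bx By; rewrite !ler_norml py2 => /andP[Bx _] /andP[_ By].
have p4 : C1 * (1 + enorm px ^+ 2) <= C1 * (3 + 2 * (A1 r * r) ^+ 2).
  by rewrite ler_wpM2l //; move: px3; clra.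
by move: Hneg Bx By p4 S2 Q dtE; clra.
Qed.

End DoublingLemma.

(** * From small oscillation to a Hoelder bound, then to a Lipschitz bound *)

Section LipschitzOfSmallOscillation.
Variables (R : realType) (d : nat).
Local Notation E := 'rV[R]_d.

(** The profiles are |z|^(3/4) and |z| - k |z|^(3/2). In terms of the fourth root all exponents are
    integers, and the derivative computations become rational identities. *)
Definition root4 (r : R) := Num.sqrt (Num.sqrt r).

Lemma root4_ge0 r : 0 <= root4 r. Proof. exact: sqrtr_ge0. Qed.

Lemma root4K r : 0 <= r -> root4 r ^+ 4 = r.
Proof.
by move=> r0; rewrite (exprM _ 2 2) !sqr_sqrtr // sqrtr_ge0.
Qed.

Lemma exp4_root4 (a : R) : 0 <= a -> root4 (a ^+ 4) = a.
Proof.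
by move=> a0; rewrite /root4 (exprM a 2 2) sqrtr_sqr (ger0_norm (sqr_ge0 _)) sqrtr_sqr ger0_norm.
Qed.

Lemma root4_gt0 r : 0 < r -> 0 < root4 r.
Proof. by move=> r0; rewrite !sqrtr_gt0. Qed.

Lemma ler_root4 (r s : R) : 0 <= s -> r <= s -> root4 r <= root4 s.
Proof. by move=> s0 rs; rewrite !ler_sqrt // sqrtr_ge0. Qed.

Lemma continuous_root4 n (c : R) : continuous (fun z : E => c * root4 (enorm z) ^+ n).
Proof.
apply: continuous_mulr; first exact: continuous_cst.
apply: continuous_exprn.
apply: (continuous_comp2 (g := fun r => Num.sqrt (Num.sqrt r))).
  exact: continuous_enorm.
by apply: (continuous_comp2 (g := Num.sqrt)); exact: sqrt_continuous.
Qed.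

Lemma profile_root4 n (c : R) : (0 < n)%N ->
  profile (fun z : E => c * root4 (enorm z) ^+ n)
    (fun r => c * (n%:R / 4) * (root4 r ^+ n / root4 r ^+ 8))
    (fun r => c * (n%:R / 4) * (n%:R / 4 - 1) * (root4 r ^+ n / root4 r ^+ 8)).
Proof.
move=> n0 z zn0 xi.
have zpos : 0 < enorm z by rewrite enorm_gt0.
set w := root4 (enorm z); have w0 : 0 < w by exact: root4_gt0.
have w4 : w ^+ 4 = enorm z by rewrite root4K // ltW.
have w8 : w ^+ 8 = enorm z ^+ 2 by rewrite -w4 -exprM.
have wn0 : w != 0 by rewrite gt_eqF.
pose e : R := n%:R / 8.
have pw (b : R) m : 0 <= b -> (b ^+ 8) `^ (m%:R / 8) = b ^+ m.
  by move=> b0; rewrite -(powR_mulrn 8) // -powRrM mulrC divfK ?powR_mulrn.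
have pB (m : R) : 0 <= m -> (w ^+ 8) `^ (e - m) = w ^+ n / ((w ^+ 8) `^ m).
  move=> m0; rewrite powRB ?pw ?(ltW w0) //.
  by rewrite implybE expf_eq0 (negbTE wn0) andbF orbT.
have D := D2atZ c (@D2at_pow R e _ _ _ _ (D2at_enorm_sqr z xi)).
rewrite scale0r addr0 -w8 in D.
have {D} := D (exprn_gt0 _ w0).
rewrite !pB // powRr1 ?exprn_ge0 ?(ltW w0) // (_ : 2 = 2%:R :> R) // powR_mulrn ?exprn_ge0 ?(ltW w0) //.
rewrite innerZl -w4 => D.
have -> : (fun s => c * root4 (enorm (z + s *: xi)) ^+ n) =
  (fun s => c * (enorm (z + s *: xi) ^+ 2) `^ e).
  apply: funext => s; congr (_ * _); rewrite -[enorm _](@root4K (enorm _)) ?enorm_ge0 //.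
  by rewrite -exprM pw ?root4_ge0 // exp4_root4 // root4_ge0.
move: D; rewrite -/w; congr D2at; rewrite /e.
  by field.
by field.
Qed.

Lemma profileD (P1 P2 : E -> R) (A1 A2 B1 B2 : R -> R) :
  profile P1 A1 A2 -> profile P2 B1 B2 ->
  profile (fun z => P1 z + P2 z) (fun r => A1 r + B1 r) (fun r => A2 r + B2 r).
Proof.
move=> H1 H2 z zn xi; have := D2atD (H1 z zn xi) (H2 z zn xi).
by congr D2at; ring.
Qed.

Record quasilinear (T t1 M0 C1 C2 L sl LH : R) (u : R -> E -> R)
    (S : R -> E -> 'M[R]_d) : Prop := Quasilinear {
  ql_time : 0 < t1 <= T;
  ql_cont : continuous (fun z : R * E => u z.1 z.2);
  ql_bound : forall (t : R) x, t1 <= t <= T -> `|u t x| <= M0;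
  ql_sigma : forall (t : R) x, t1 <= t < T -> enorm (S t x) <= C2;
  ql_sigma_lip : forall (t : R) x y, t1 <= t < T ->
     enorm (S t x - S t y) <= L * (enorm (x - y) + `|u t x - u t y|);
  ql_elliptic : forall (t : R) x (xi : E), t1 <= t < T ->
     sl * enorm xi <= enorm (xi *m (S t x)^T);
  ql_pde : pde T u S (fun _ q _ => C1 * (1 + q ^+ 2));
  ql_terminal : forall x z, u T x - u T (x - z) <= LH * enorm z }.

(** With [Y] of order r^(-5/4), the concavity of the profile gives the good term
    [3 / 16 * sl ^+ 2 * Y]. The bad terms are all of order [eta * Y]: the quadratic gradient term
    because [K * w ^+ 3 <= eta], the constants because [1 <= Y * eta], the variation of sigma
    because it is at most [2 * L * eta]. Small oscillation alone suffices. *)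
Lemma holder_bound (T t1 M0 C1 C2 L sl LH : R) (u : R -> E -> R) (S : R -> E -> 'M[R]_d)
    (eta w1 : R) :
  0 <= C1 -> 0 <= L -> 0 < sl -> 0 <= LH ->
  quasilinear T t1 M0 C1 C2 L sl LH u S ->
  0 < eta -> 0 < w1 -> w1 ^+ 4 <= eta ->
  (forall (t : R) x z, t1 <= t <= T -> enorm z <= w1 ^+ 4 ->
     `|u t x - u t (x - z)| <= eta) ->
  2 * L * eta <= sl -> LH * w1 ^+ 4 <= eta ->
  3 * L ^+ 2 * eta ^+ 2 + (12 * C1 + 2) * eta < 3 / 16 * sl ^+ 2 ->
  forall (t : R) x z, t1 <= t <= T -> enorm z <= w1 ^+ 4 ->
    u t x - u t (x - z) <= eta / w1 ^+ 3 * root4 (enorm z) ^+ 3.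
Proof.
move=> C10 L0 sl0 LH0 Q e0 w10 w1e osc Le LHe small.
have [tT cu ub SC SL ell HP uT] := Q.
set K := eta / w1 ^+ 3.
have w3 : 0 < w1 ^+ 3 by rewrite exprn_gt0.
have K0 : 0 < K by rewrite divr_gt0.
have rw (z : E) : enorm z <= w1 ^+ 4 -> root4 (enorm z) <= w1.
  move=> zr; rewrite -[leRHS]exp4_root4 ?(ltW w10) //.
  by apply: ler_root4 => //; rewrite exprn_ge0 // ltW.
apply: (doubling (Psi := fun z => K * root4 (enorm z) ^+ 3) (w := fun=> eta)
   tT _ C10 L0 sl0 cu _ ub SC SL ell HP (profile_root4 K _)) => //.
- by rewrite exprn_ge0 // ltW.
- exact: continuous_root4.
- by move=> z _; rewrite mulr_ge0 ?(ltW K0) // exprn_ge0 // root4_ge0.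
- move=> x z zr; apply: le_trans (uT x z) _.
  have wz := rw z zr; set w := root4 (enorm z) in wz *.
  have w0 : 0 <= w by exact: root4_ge0.
  have -> : enorm z = w * w ^+ 3 by rewrite -exprS root4K.
  rewrite mulrA ler_wpM2r ?exprn_ge0 //.
  apply: (@le_trans _ _ (LH * w1)); first by rewrite ler_wpM2l.
  by rewrite ler_pdivlMr // -mulrA -exprS.
- move=> z zr; rewrite zr exp4_root4 ?(ltW w10) // divfK //.
  by rewrite gt_eqF.
move=> r /andP[r0 r1]; have w0 := root4_gt0 r0.
set w := root4 r in w0 *.
have rE : r = w ^+ 4 by rewrite root4K // ltW.
have ww1 : w <= w1.
  rewrite -[leRHS]exp4_root4 ?(ltW w10) //.
  by apply: ler_root4; [rewrite exprn_ge0 // ltW | exact: ltW].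
have wn0 : w != 0 by rewrite gt_eqF.
have XE : w ^+ 3 / w ^+ 8 = (w ^+ 5)^-1.
  by rewrite (exprD w 3 5) invfM mulrA divff ?mul1r // expf_neq0.
rewrite XE.
pose Y := K / w ^+ 5; have Y0 : 0 < Y by rewrite divr_gt0 // exprn_gt0.
have -> : K * (3 / 4) * (w ^+ 5)^-1 = 3 / 4 * Y by rewrite /Y; ring.
have -> : K * (3 / 4) * (3 / 4 - 1) * (w ^+ 5)^-1 = - (3 / 16 * Y) by rewrite /Y; field; exact: wn0.
have re : r <= eta by apply: le_trans (ltW r1) _.
have Kw : K * w ^+ 3 <= eta.
  rewrite /K mulrAC ler_pdivrMr // ler_pM2l //.
  by rewrite lerXn2r // nnegrE ltW.
have H1 : (3 / 4 * Y * r) ^+ 2 <= 9 / 16 * (Y * eta).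
  have -> : (3 / 4 * Y * r) ^+ 2 = 9 / 16 * (Y * (K * w ^+ 3)).
    by rewrite rE /Y; field; exact: wn0.
  by rewrite ler_pM2l // ler_pM2l.
have H2 : 1 <= Y * eta.
  have -> : Y * eta = eta ^+ 2 / (w1 ^+ 3 * w ^+ 5).
    by rewrite /Y /K; field; rewrite wn0 gt_eqF.
  rewrite ler_pdivlMr ?mul1r; last by rewrite mulr_gt0 // exprn_gt0.
  apply: (@le_trans _ _ (w1 ^+ 3 * w1 ^+ 5)).
    rewrite ler_pM2l //.
    by rewrite lerXn2r // nnegrE ltW.
  rewrite -exprD (exprM w1 4 2) ler_sqr // nnegrE; last exact: ltW.
  by rewrite exprn_ge0 // ltW.
have H3 : (L * (r + eta)) ^+ 2 <= 4 * L ^+ 2 * eta ^+ 2.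
  have -> : 4 * L ^+ 2 * eta ^+ 2 = (L * (2 * eta)) ^+ 2 by ring.
  rewrite ler_sqr ?nnegrE; last 2 first.
  - by rewrite mulr_ge0 //; move: e0 r0; clra.
  - by rewrite mulr_ge0 //; move: e0; clra.
  by rewrite ler_wpM2l //; move: re; clra.
split.
- by rewrite mulr_ge0 // ltW.
- by rewrite oppr_le0 mulr_ge0 // ltW.
- have : L * (r + eta) <= L * (2 * eta) by rewrite ler_wpM2l //; move: re; clra.
  by move: Le; clra.
have H4 : 3 / 4 * Y * (L * (r + eta)) ^+ 2 <= 3 / 4 * Y * (4 * L ^+ 2 * eta ^+ 2).
  by rewrite ler_wpM2l // mulr_ge0 // ltW.
have H5 : 2 * C1 * (4 + 3 * (3 / 4 * Y * r) ^+ 2) + 2 <= (12 * C1 + 2) * (Y * eta).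
  have h5 : 2 * C1 * (4 + 3 * (3 / 4 * Y * r) ^+ 2) <= 2 * C1 * (4 * (Y * eta) + 3 * (9 / 16 * (Y * eta))).
    by rewrite ler_wpM2l ?mulr_ge0 //; move: H1 H2; clra.
  have h6 : 0 <= C1 * (Y * eta) by rewrite mulr_ge0 // mulr_ge0 // ltW.
  by move: h5 h6 H2; clra.
have H6 : Y * (3 * L ^+ 2 * eta ^+ 2 + (12 * C1 + 2) * eta) < Y * (3 / 16 * sl ^+ 2) by rewrite ltr_pM2l.
by move: H4 H5 H6; clra.
Qed.

(** The exponent 3/4 exceeds 1/2, so the tangential term, of order r^(-1) times the square of
    r^(3/4), stays bounded as r tends to 0. The correction in r^(3/2) provides a good term of order
    [K / w1 ^+ 2]; since [K * w1] is bounded, it also dominates the gradient term of order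
    [K ^+ 2]. *)
Lemma lipschitz_bound (T t1 M0 C1 C2 L sl LH : R) (u : R -> E -> R) (S : R -> E -> 'M[R]_d)
    (C0 w1 : R) :
  0 <= C1 -> 0 <= L -> 0 < sl -> 0 <= LH ->
  quasilinear T t1 M0 C1 C2 L sl LH u S ->
  0 <= C0 -> 0 < w1 <= 1 ->
  (forall (t : R) x z, t1 <= t <= T -> enorm z <= w1 ^+ 4 ->
     `|u t x - u t (x - z)| <= C0 * root4 (enorm z) ^+ 3) ->
  L * (1 + C0) * w1 <= sl ->
  (L ^+ 2 * (1 + C0) ^+ 2 + 8 * C1 + 2 + 6 * C1 * (2 * C0 + 2 * LH + 1)) * w1
     < 3 / 8 * sl ^+ 2 ->
  forall (t : R) x z, t1 <= t <= T -> enorm z <= w1 ^+ 4 ->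
    u t x - u t (x - z) <= (2 * C0 / w1 + 2 * LH + 1) * enorm z.
Proof.
move=> C10 L0 sl0 LH0 Q C00 /andP[w10 w11] osc Le small.
have [tT cu ub SC SL ell HP uT] := Q.
set K := 2 * C0 / w1 + 2 * LH + 1.
have K1 : 1 <= K.
  have : 0 <= 2 * C0 / w1 by rewrite divr_ge0 ?mulr_ge0 // ltW.
  by move: LH0; rewrite /K; clra.
have K0 : 0 < K by move: K1; clra.
have wn10 : w1 != 0 by rewrite gt_eqF.
(* Chosen so that the correction takes away at most half of the linear part on the ball of radius
   [w1 ^+ 4]. *)
pose kap := K / (2 * w1 ^+ 2).
have rw (r : R) : r <= w1 ^+ 4 -> root4 r <= w1.
  move=> zr; rewrite -[leRHS]exp4_root4 ?(ltW w10) //.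
  by apply: ler_root4 => //; rewrite exprn_ge0 // ltW.
pose Psi := fun z : E => K * root4 (enorm z) ^+ 4 + (- kap) * root4 (enorm z) ^+ 6.
have PsiE z : enorm z <= w1 ^+ 4 -> K / 2 * enorm z <= Psi z <= K * enorm z.
  move=> /rw wz; rewrite /Psi; set w := root4 _ in wz *.
  have w0 : 0 <= w by exact: root4_ge0.
  have -> : enorm z = w ^+ 4 by rewrite root4K.
  have k0 : 0 <= kap by rewrite divr_ge0 // ?mulr_ge0 ?sqr_ge0 // ltW.
  have H : kap * w ^+ 6 <= K / 2 * w ^+ 4.
    rewrite (exprD w 2 4) mulrA ler_wpM2r ?exprn_ge0 //.
    have -> : K / 2 = kap * w1 ^+ 2 by rewrite /kap; field.
    by rewrite ler_wpM2l // lerXn2r // nnegrE ltW.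
  have H0 : 0 <= kap * w ^+ 6 by rewrite mulr_ge0 ?exprn_ge0.
  by apply/andP; split; move: H H0; clra.
move=> t x z tt zr; apply: (@le_trans _ _ (Psi z)); last by case/andP: (PsiE z zr).
move: t x z tt zr.
apply: (doubling (w := fun r => C0 * root4 r ^+ 3)
   tT _ C10 L0 sl0 cu _ ub SC SL ell HP
   (profileD (profile_root4 K (n := 4) _) (profile_root4 (- kap) (n := 6) _))) => //.
- by rewrite exprn_ge0 // ltW.
- by apply: continuous_addr; exact: continuous_root4.
- move=> z zr; case/andP: (PsiE z zr) => + _; apply: le_trans.
  by rewrite mulr_ge0 // divr_ge0 // ltW.
- move=> x z zr; apply: le_trans (uT x z) _.
  case/andP: (PsiE z zr) => + _; apply: le_trans.
  rewrite ler_wpM2r //.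
  have : 0 <= 2 * C0 / w1 by rewrite divr_ge0 ?mulr_ge0 // ltW.
  by rewrite /K; clra.
- move=> z zE; have : enorm z <= w1 ^+ 4 by rewrite zE.
  move=> /PsiE /andP[+ _]; apply: le_trans.
  rewrite zE exp4_root4 ?(ltW w10) // (exprS w1 3) mulrA ler_wpM2r ?exprn_ge0 ?(ltW w10) //.
  rewrite /K.
  have -> : (2 * C0 / w1 + 2 * LH + 1) / 2 * w1 = C0 + (2 * LH + 1) / 2 * w1 by field.
  rewrite lerDl mulr_ge0 ?(ltW w10) //; move: LH0; clra.
move=> r /andP[r0 r1]; have w0 := root4_gt0 r0.
have ww1 := rw r (ltW r1).
set w := root4 r in w0 ww1 *.
have rE : r = w ^+ 4 by rewrite root4K // ltW.
have wn0 : w != 0 by rewrite gt_eqF.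
set A1 := (X in [/\ 0 <= X, _, _ & _]); set A2 := (X in [/\ _, X <= 0, _ & _]).
have wr2 : 0 <= (w / w1) ^+ 2 <= 1.
  by rewrite sqr_ge0 exprn_ile1 // ?divr_ge0 ?(ltW w0) ?(ltW w10) // ler_pdivrMr // mul1r.
have A1E : A1 * w ^+ 4 = K * (1 - 3 / 4 * (w / w1) ^+ 2).
  by rewrite /A1 /kap; field; rewrite wn0 wn10.
have A2E : A2 = - (3 / 8 * K / (w1 ^+ 2 * w ^+ 2)).
  by rewrite /A2 /kap; field; rewrite wn0 wn10.
have w40 : 0 < w ^+ 4 by rewrite exprn_gt0.
have A1r : 0 <= A1 * w ^+ 4 <= K.
  rewrite A1E; apply/andP; split.
    by rewrite mulr_ge0 ?(ltW K0) //; move: wr2; clear => /andP[? ?]; lra.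
  by rewrite ger_pMr //; move: wr2; clear => /andP[? ?]; lra.
have A10 : 0 <= A1 by case/andP: A1r => + _; rewrite pmulr_lge0.
have ww : w ^+ 3 * (w + C0) = w ^+ 4 + C0 * w ^+ 3 by ring.
have w_1 : w <= 1 by exact: le_trans ww1 w11.
split => //.
- by rewrite A2E oppr_le0 divr_ge0 ?mulr_ge0 ?sqr_ge0 // ltW.
- apply: le_trans Le; rewrite -mulrA ler_wpM2l // rE -ww.
  rewrite mulrC ler_pM //.
  + by rewrite addr_ge0 // ltW.
  + by rewrite exprn_ge0 // ltW.
  + by rewrite lerD2r.
  + apply: le_trans ww1; rewrite -[leRHS]expr1; apply: ler_wiXn2l => //; exact: ltW.
have h1 : A1 * (L * (r + C0 * w ^+ 3)) ^+ 2 <= K * (L ^+ 2 * (1 + C0) ^+ 2).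
  have -> : A1 * (L * (r + C0 * w ^+ 3)) ^+ 2 = A1 * w ^+ 4 * (L ^+ 2 * (w ^+ 2 * (w + C0) ^+ 2)).
    by rewrite rE; ring.
  apply: ler_pM; first by case/andP: A1r.
  + by rewrite mulr_ge0 ?sqr_ge0 // mulr_ge0 ?sqr_ge0.
  + by case/andP: A1r.
  rewrite ler_wpM2l ?sqr_ge0 // -[leRHS]mul1r.
  apply: ler_pM; rewrite ?sqr_ge0 //; first by rewrite exprn_ile1 // ltW.
  rewrite ler_sqr ?nnegrE ?lerD2r ?addr_ge0 //; exact: ltW.
have h2 : (A1 * r) ^+ 2 <= K ^+ 2.
  by rewrite rE; case/andP: A1r => a b; rewrite ler_sqr ?nnegrE // ltW.
have h3 : sl ^+ 2 * A2 <= - (3 / 8 * sl ^+ 2 * K / w1 ^+ 2).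
  rewrite A2E mulrN lerN2.
  have -> : sl ^+ 2 * (3 / 8 * K / (w1 ^+ 2 * w ^+ 2)) = 3 / 8 * sl ^+ 2 * K * (w1 ^+ 2 * w ^+ 2)^-1 by ring.
  rewrite ler_wpM2l //.
    by rewrite !mulr_ge0 ?sqr_ge0 // ltW.
  rewrite lef_pV2 ?posrE ?mulr_gt0 ?exprn_gt0 //.
  by rewrite ger_pMr ?exprn_gt0 // exprn_ile1 // ltW.
have h4 : K * w1 <= 2 * C0 + 2 * LH + 1.
  have -> : K * w1 = 2 * C0 + (2 * LH + 1) * w1 by rewrite /K; field.
  have : (2 * LH + 1) * w1 <= (2 * LH + 1) * 1 by rewrite ler_wpM2l //; move: LH0; clra.
  by clra.
pose B := L ^+ 2 * (1 + C0) ^+ 2.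
have B0 : 0 <= B by rewrite mulr_ge0 ?sqr_ge0.
have main : (K * B - 3 / 8 * sl ^+ 2 * K / w1 ^+ 2 + 2 * C1 * (4 + 3 * K ^+ 2) + 2) < 0.
  have w12 : 0 < w1 ^+ 2 by rewrite exprn_gt0.
  have w1w1 : w1 ^+ 2 <= w1 by rewrite expr2 ger_pMr.
  rewrite -(pmulr_llt0 _ w12).
  have -> : (K * B - 3 / 8 * sl ^+ 2 * K / w1 ^+ 2 + 2 * C1 * (4 + 3 * K ^+ 2) + 2) * w1 ^+ 2
    = K * B * w1 ^+ 2 - K * (3 / 8 * sl ^+ 2) + (8 * C1 + 2) * w1 ^+ 2
      + 6 * C1 * K * w1 * (K * w1) by field.
  have C80 : 0 <= 8 * C1 + 2 by move: C10; clra.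
  have g0 : K * B * w1 ^+ 2 <= K * B * w1 by rewrite ler_wpM2l // mulr_ge0 // ltW.
  have g1 : (8 * C1 + 2) * w1 ^+ 2 <= K * ((8 * C1 + 2) * w1).
    apply: (@le_trans _ _ ((8 * C1 + 2) * w1)); first by rewrite ler_wpM2l.
    by rewrite ler_peMl // mulr_ge0 ?(ltW w10).
  have g2 : 6 * C1 * K * w1 * (K * w1) <= 6 * C1 * K * w1 * (2 * C0 + 2 * LH + 1).
    by rewrite ler_wpM2l // !mulr_ge0 // ltW.
  have g3 : K * ((B + 8 * C1 + 2 + 6 * C1 * (2 * C0 + 2 * LH + 1)) * w1) < K * (3 / 8 * sl ^+ 2).
    by rewrite ltr_pM2l.
  by move: g0 g1 g2 g3; clra.
have h5 : 2 * C1 * (4 + 3 * (A1 * r) ^+ 2) <= 2 * C1 * (4 + 3 * K ^+ 2).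
  by rewrite ler_wpM2l ?mulr_ge0 //; move: h2; clra.
suff : A1 * (L * (r + C0 * w ^+ 3)) ^+ 2 + sl ^+ 2 * A2
    + 2 * C1 * (4 + 3 * (A1 * r) ^+ 2) + 2 < 0 by [].
by move: h1 h3 h5 main; rewrite /B; clra.
Qed.

Lemma jet_lipschitz (u : R -> E -> R) (t : R) x dt p H (K rho : R) : 0 < rho -> 0 <= K ->
  (forall y z, enorm z <= rho -> u t y - u t (y - z) <= K * enorm z) ->
  jet u t x dt p H -> enorm p <= K.
Proof.
move=> rho0 K0 HK [_ J].
have D : is_derive (0 : R) 1 (fun s => u t (x + s *: p) - (K * enorm p) * s)
    (inner p p - K * enorm p).
  apply: is_deriveB; first exact: D2at_D1 (J p).
  by apply: is_derive_ext (is_derive_affine 0 (K * enorm p) 0) => s; rewrite add0r.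
have n0 : 0 < enorm p + 1 by rewrite ltr_wpDl.
have : inner p p - K * enorm p <= 0.
  apply: (der_max_r (r := rho / (enorm p + 1)) D); first by rewrite divr_gt0.
  move=> h /andP[h0 hr]; rewrite add0r scale0r addr0 mulr0 subr0.
  have : enorm (h *: p) <= rho.
    rewrite enormZ ger0_norm //.
    apply: (@le_trans _ _ (h * (enorm p + 1))); first by rewrite ler_wpM2l // lerDl.
    by rewrite -ler_pdivlMr // ltW.
  move=> /(HK (x + h *: p)); rewrite addrK enormZ ger0_norm //; clra.
rewrite inner_xx; have [->|p0] := eqVneq p 0.
  by rewrite enorm0.
have pp : 0 < enorm p by rewrite enorm_gt0.
by rewrite subr_le0 expr2 ler_pM2r.
Qed.

(** The order of quantifiers matters: [eta] depends on the structure constants alone, because the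
    scale [r0] at which the oscillation falls below [eta] is produced afterwards, for this [eta];
    [K] is then fixed before any solution is given. *)
Lemma gradient_of_small_osc (C1 L sl LH : R) :
  0 <= C1 -> 0 <= L -> 0 < sl -> 0 <= LH ->
  exists2 eta : R, 0 < eta & forall r0 : R, 0 < r0 -> exists2 K : R, 0 <= K &
  forall (T t1 M0 C2 : R) (u : R -> E -> R) (S : R -> E -> 'M[R]_d),
  quasilinear T t1 M0 C1 C2 L sl LH u S ->
  (forall (t : R) x z, t1 <= t <= T -> enorm z <= r0 -> `|u t x - u t (x - z)| <= eta) ->
  forall (t : R) x dt p H, t1 <= t <= T -> jet u t x dt p H -> enorm p <= K.
Proof.
move=> C10 L0 sl0 LH0.
have [| | |eta /andP[e0 e1] [E1 E2 _]] := @small3 R (2 * L) sl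
   (3 * L ^+ 2 + 12 * C1 + 2) (8^-1 * sl ^+ 2) 1 1 => //.
  by rewrite mulr_gt0 // exprn_gt0.
have small : 3 * L ^+ 2 * eta ^+ 2 + (12 * C1 + 2) * eta < 3 / 16 * sl ^+ 2.
  have h1 : L ^+ 2 * eta ^+ 2 <= L ^+ 2 * eta.
    by rewrite ler_wpM2l ?sqr_ge0 // expr2 ger_pMr.
  have h2 : 0 < sl ^+ 2 by rewrite exprn_gt0.
  by move: h1 h2 E2; clra.
exists eta => // r0 r00.
have [| | |w1 /andP[w10 w11] [F1 F2 F3]] := @small3 R 1 eta LH eta 1 r0 => //.
rewrite mulr1 in F1; rewrite mulr1 in F3.
have w14 : w1 ^+ 4 <= w1 by rewrite -[leRHS]expr1; apply: ler_wiXn2l => //; exact: ltW.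
pose C0 := eta / w1 ^+ 3.
have C00 : 0 <= C0 by rewrite divr_ge0 ?exprn_ge0 // ltW.
(* A second, smaller scale: the Hoelder constant [C0] is known only once [w1] is fixed. *)
have [| | |w2 /andP[w20 w21] [G1 G2 G3]] := @small3 R 1 w1 (L * (1 + C0)) sl
  (L ^+ 2 * (1 + C0) ^+ 2 + 8 * C1 + 2 + 6 * C1 * (2 * C0 + 2 * LH + 1)) (4^-1 * sl ^+ 2) => //.
  by rewrite mulr_gt0 // exprn_gt0.
rewrite mulr1 in G1.
exists (2 * C0 / w2 + 2 * LH + 1).
  have : 0 <= 2 * C0 / w2 by apply: divr_ge0; [exact: mulr_ge0|exact: ltW].
  by move: LH0; clra.
move=> T t1 M0 C2 u S Q osc t x dt p H tt.
apply: (@jet_lipschitz _ _ _ _ _ _ _ (w2 ^+ 4)); first by rewrite exprn_gt0.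
  have : 0 <= 2 * C0 / w2 by apply: divr_ge0; [exact: mulr_ge0|exact: ltW].
  by move: LH0; clra.
move=> y z; move: t y z tt {x dt p H}.
have hol (t : R) x z : t1 <= t <= T -> enorm z <= w1 ^+ 4 ->
    u t x - u t (x - z) <= C0 * root4 (enorm z) ^+ 3.
  apply: (holder_bound C10 L0 sl0 LH0 Q e0 w10) => //.
  - exact: le_trans w14 F1.
  - move=> s y v st vr; apply: osc => //.
    exact: le_trans vr (le_trans w14 F3).
  - by move: E1; clra.
  - apply: le_trans F2; rewrite mulrC ler_wpM2r //.
have w24 : w2 ^+ 4 <= w1 ^+ 4 by rewrite lerXn2r // nnegrE ltW.
move=> t y z tt zr; apply: (lipschitz_bound C10 L0 sl0 LH0 Q C00) => //.
- by rewrite w20.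
- move=> s x v st vr; rewrite ler_norml; apply/andP; split; last first.
    by apply: hol => //; exact: le_trans w24.
  have := hol s (x - v) (- v) st; rewrite enormN opprK subrK => /(_ (le_trans vr w24)).
  by clra.
- by move: G2; clra.
- have h2 : 0 < sl ^+ 2 by rewrite exprn_gt0.
  by move: G3 h2; clra.
Qed.

End LipschitzOfSmallOscillation.

(** * The growth lemma *)

Section Kernel.
Variables (R : realType) (d : nat).
Local Notation E := 'rV[R]_d.

(* The heat kernel, flattened in [t] and in [x] just enough to be a subsolution for
   every constant-coefficient operator within [keps] of the Laplacian. *)
Definition km : R := (d%:R + 1) / 2.
Definition keps : R := (8 * (d%:R + 1))^-1.
Definition kth : R := (2 * (1 - 2 * keps))^-1.

Lemma keps_gt0 : 0 < keps.
Proof. by rewrite invr_gt0 mulr_gt0 // ltr_wpDl. Qed.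

Lemma keps_mul : keps * (d%:R + 1) = 8^-1.
Proof.
have d1 : d%:R + 1 != 0 :> R by rewrite gt_eqF // ltr_wpDl.
by rewrite /keps; field; rewrite d1.
Qed.

Lemma keps_le : keps <= 8^-1.
Proof.
have := keps_mul; have := keps_gt0; have : 0 <= d%:R :> R by [].
by clear; intros; nra.
Qed.

Lemma kth_mul : 2 * kth * (1 - 2 * keps) = 1.
Proof.
have := keps_le => H; have n0 : 1 - 2 * keps != 0 by rewrite gt_eqF //; lra.
by rewrite /kth; field.
Qed.

Lemma kth_bounds : 2^-1 <= kth <= 1.
Proof.
have := kth_mul; have := keps_le; have := keps_gt0.
by clear; intros; apply/andP; split; nra.
Qed.

Lemma km_gt0 : 0 < km.
Proof. by rewrite divr_gt0 // ltr_wpDl. Qed.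

Definition gker (t : R) (x : E) : R := expR (- km * ln t - kth * enorm x ^+ 2 / t).
Definition ker (t : R) (x : E) : R := if 0 < t then gker t x else 0.

Lemma ker_ge0 (t : R) (x : E) : 0 <= ker t x.
Proof. by rewrite /ker; case: ifP => // _; exact: expR_ge0. Qed.

Lemma gker_dtime (t : R) (x : E) : 0 < t -> is_derive t 1 (fun s => gker s x)
  (gker t x * (- km / t + kth * enorm x ^+ 2 / t ^+ 2)).
Proof.
move=> t0; apply: (@is_derive1_comp R expR).
have D1 := @is_deriveZ R R R (@ln R) (- km) t 1 _ (is_derive1_ln t0).
have D2 := @is_deriveV R (fun s => s) t 1 1 (lt0r_neq0 t0) (is_derive_id _ _).
have D3 := @is_deriveZ R R R (fun s : R => s^-1) (kth * enorm x ^+ 2) t 1 _ D2.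
have := is_deriveB D1 D3 => D; apply: (is_derive_eq D).
by rewrite /GRing.scale /= mulr1 mulrN opprK.
Qed.

Lemma gker_dspace (t : R) (x xi : E) : 0 < t -> D2at (fun s => gker t (x + s *: xi))
  (gker t x * (- (2 * kth * inner x xi / t)))
  (gker t x * (- (2 * kth * enorm xi ^+ 2 / t) + (2 * kth * inner x xi / t) ^+ 2)).
Proof.
move=> t0.
have D := D2at_exp (D2atB (D2at_cst (- km * ln t)) (D2atZ (kth / t) (D2at_enorm_sqr x xi))).
have -> : (fun s => gker t (x + s *: xi)) =
   (fun s => expR (- km * ln t - kth / t * enorm (x + s *: xi) ^+ 2)).
  by apply: funext => s; rewrite /gker mulrAC.
move: D; rewrite scale0r addr0 (mulrAC kth) -/(gker t x).
by congr D2at; ring.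
Qed.

(** What the margins in [km] and [kth] pay for: a perturbation of size [keps] raises the trace of
    [S *m S^T] by at most 1/3 and lowers the quadratic form by at most the factor [1 - 2 * keps]. *)
Lemma near_id_bounds (S : 'M[R]_d) (x : E) : enorm (S - 1%:M) <= keps ->
  enorm S ^+ 2 <= d%:R + 1 / 3 /\ enorm x ^+ 2 <= 2 * kth * enorm (x *m S^T) ^+ 2.
Proof.
move=> HS; have e0 := keps_gt0; have e8 := keps_le; have em := keps_mul.
pose a : R := enorm (1%:M : 'M[R]_d).
have a2 : a ^+ 2 = d%:R.
  rewrite enorm_sqr; transitivity (\sum_(i < d) (1 : R)); last first.
    by rewrite sumr_const card_ord.
  apply: eq_bigr => i _; rewrite (bigD1 i) //= big1 ?addr0 ?mxE ?eqxx ?expr1n // => j ji.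
  by rewrite mxE eq_sym (negbTE ji) expr0n.
split.
  have h : enorm S <= a + keps.
    rewrite -(subrK 1%:M S) addrC; apply: le_trans (enormD _ _) _.
    by rewrite lerD2l.
  have h1 : enorm S ^+ 2 <= (a + keps) ^+ 2.
    rewrite ler_sqr ?nnegrE // addr_ge0 ?(ltW e0) //; exact: enorm_ge0.
  have h2 : keps * (2 * a) <= keps * (a ^+ 2 + 1).
    by rewrite ler_pM2l //; have := sqr_ge0 (a - 1); clra.
  have h3 : keps ^+ 2 <= 8^-1 * 8^-1 by rewrite expr2 ler_pM // ltW.
  by rewrite a2 in h2; move: h1 h2 h3 em a2; clra.
have h : (1 - keps) * enorm x <= enorm (x *m S^T).
  have -> : x *m S^T = x + x *m (S - 1%:M)^T.
    by rewrite linearB /= trmx1 mulmxBr mulmx1 addrC subrK.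
  have := enormB (x + x *m (S - 1%:M)^T) (x *m (S - 1%:M)^T).
  rewrite addrK => h1.
  have h2 : enorm (x *m (S - 1%:M)^T) <= enorm x * keps.
    by apply: le_trans (enorm_mulmx _ _) _; rewrite enorm_tr ler_wpM2l.
  by move: h1 h2; clra.
have h2 : ((1 - keps) * enorm x) ^+ 2 <= enorm (x *m S^T) ^+ 2.
  by rewrite ler_sqr ?nnegrE // mulr_ge0 //; move: e8; clra.
have k0 : 0 <= 2 * kth by have /andP[] := kth_bounds; clra.
apply: le_trans (ler_wpM2l k0 h2).
have -> : 2 * kth * ((1 - keps) * enorm x) ^+ 2 =
   (2 * kth * (1 - 2 * keps)) * enorm x ^+ 2 + 2 * kth * keps ^+ 2 * enorm x ^+ 2 by ring.
by rewrite kth_mul mul1r lerDl mulr_ge0 ?sqr_ge0 // mulr_ge0 ?sqr_ge0.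
Qed.

(** After division by the kernel, the terms in 1/t and in |x|^2/t^2 compare separately, one through
    each half of [near_id_bounds]. *)
Lemma gker_subsol (t : R) (x : E) (S : 'M[R]_d) : 0 < t -> enorm (S - 1%:M) <= keps ->
  gker t x * (- km / t + kth * enorm x ^+ 2 / t ^+ 2) <=
  2^-1 * \sum_k (gker t x * (- (2 * kth * enorm (row k S) ^+ 2 / t)
      + (2 * kth * inner x (row k S) / t) ^+ 2)).
Proof.
move=> t0 HS; rewrite -mulr_sumr [leRHS]mulrCA ler_pM2l ?expR_gt0 //.
have [h1 h2] := near_id_bounds x HS.
have -> : \sum_k (- (2 * kth * enorm (row k S) ^+ 2 / t)
      + (2 * kth * inner x (row k S) / t) ^+ 2) =
   - (2 * kth / t * enorm S ^+ 2) + 4 * kth ^+ 2 / t ^+ 2 * enorm (x *m S^T) ^+ 2.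
  rewrite enorm_row_sum enorm_mul_row_sum !mulr_sumr -sumrN -big_split /=.
  by apply: eq_bigr => k _; field; rewrite gt_eqF.
have t1 : 0 < t^-1 by rewrite invr_gt0.
have [k1 k2] := andP kth_bounds.
have k0 : 0 <= kth by move: k1; clra.
have g1 : kth * enorm S ^+ 2 <= km.
  have em := keps_mul; have km' := kth_mul.
  apply: le_trans (_ : kth * (d%:R + 1 / 3) <= _); first by rewrite ler_wpM2l.
  have hk : kth = 2^-1 + 2 * kth * keps by move: km'; clra.
  have hd : 2 * kth * keps * (d%:R + 1) = kth / 4 by rewrite -mulrA em; field.
  have h3 : 2 * kth * keps * (d%:R + 1 / 3) <= 2 * kth * keps * (d%:R + 1).
    rewrite ler_wpM2l ?mulr_ge0 ?(ltW keps_gt0) //; clra.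
  rewrite /km {1}hk mulrDl.
  by move: h3; rewrite hd; move: k2; clra.
have g2 : t^-1 * (kth * enorm S ^+ 2) <= t^-1 * km by rewrite ler_pM2l.
have g3 : (kth / t ^+ 2) * enorm x ^+ 2 <= (kth / t ^+ 2) * (2 * kth * enorm (x *m S^T) ^+ 2).
  by rewrite ler_wpM2l // divr_ge0 // sqr_ge0.
have -> : 2^-1 * (- (2 * kth / t * enorm S ^+ 2)
     + 4 * kth ^+ 2 / t ^+ 2 * enorm (x *m S^T) ^+ 2) =
   - (t^-1 * (kth * enorm S ^+ 2)) + (kth / t ^+ 2) * (2 * kth * enorm (x *m S^T) ^+ 2).
  by field; rewrite gt_eqF.
by move: g2 g3; clra.
Qed.

Lemma ln_le_sub1 (x : R) : 0 < x -> ln x <= x - 1.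
Proof.
move=> x0; have := @le_ln1Dx R (x - 1).
by rewrite (addrC 1) subrK; apply; lra.
Qed.

Lemma ln_le_lin (a c v : R) : 0 < a -> 0 < c -> 0 < v -> a * ln v <= c * v + a ^+ 2 / c.
Proof.
move=> a0 c0 v0.
have ac : 0 < c / a by rewrite divr_gt0.
have h : ln (v * (c / a)) <= v * (c / a) - 1 by apply: ln_le_sub1; rewrite mulr_gt0.
rewrite lnM ?posrE // in h.
have h2 : - ln (c / a) <= a / c.
  have := @ln_le_sub1 (a / c) (divr_gt0 a0 c0).
  rewrite -(invf_div c a) lnV ?posrE //; lra.
have h3 : a * ln v <= a * (v * (c / a) + a / c).
  by rewrite ler_pM2l //; move: h h2; clra.
apply: le_trans h3 _.
have -> : a * (v * (c / a) + a / c) = c * v + a ^+ 2 / c by field; rewrite !gt_eqF.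
by [].
Qed.

(** At parabolic distance at least [i2] from the singularity, the kernel is controlled by a wider
    Gaussian of age [t + i2]. This removes the singularity from the lattice sums, with [i2] one
    lattice time step; the power of [t] lost is paid by part of the Gaussian exponent. *)
Lemma gker_regularize (i2 t : R) (x : E) : 0 < i2 -> 0 < t ->
  (i2 <= t \/ i2 <= enorm x ^+ 2) ->
  gker t x <= expR (8 * km ^+ 2 + km) *
     expR (- km * ln (t + i2) - 4^-1 * enorm x ^+ 2 / (t + i2)).
Proof.
move=> i0 t0 H; rewrite -expRD ler_expR.
have m0 := km_gt0; have /andP[k1 k2] := kth_bounds.
set q := enorm x ^+ 2 in H *; have q0 : 0 <= q by exact: sqr_ge0.
set s := t + i2; have s0 : 0 < s by rewrite addr_gt0.
have ts : t <= s by rewrite lerDl ltW.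
pose v := s / t; have v0 : 0 < v by rewrite divr_gt0.
have lnv : ln s = ln t + ln v by rewrite -lnM ?posrE // /v mulrC divfK // gt_eqF.
have st : s^-1 <= t^-1 by rewrite lef_pV2 // posrE.
have q1 : 4^-1 * q / s <= 4^-1 * q / t by rewrite ler_wpM2l // mulr_ge0.
have q2 : 2^-1 * q / t <= kth * q / t.
  by rewrite ler_pM2r ?invr_gt0 // ler_wpM2r.
have qt : 0 <= q / t by rewrite divr_ge0 // ltW.
suff h : km * ln v <= 4^-1 * (q / t) + (8 * km ^+ 2 + km).
  by rewrite lnv; move: h q1 q2; clra.
have [it|it] := leP i2 t.
  have v2 : v <= 2 by rewrite /v ler_pdivrMr // /s; move: it; clra.
  have h1 : ln v <= 1 by apply: le_trans (ln_le_sub1 v0) _; move: v2; clra.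
  have h2 : km * ln v <= km * 1 by rewrite ler_pM2l.
  have h3 : 0 <= km ^+ 2 by exact: sqr_ge0.
  by move: h2 h3 qt; clra.
have iq : i2 <= q by case: H => // ti; move: it ti; clear; lra.
have vq : 8^-1 * v <= 4^-1 * (q / t).
  rewrite /v (mulrA 8^-1) (mulrA 4^-1) ler_pM2r ?invr_gt0 //.
  by rewrite /s; move: it iq; clra.
have i8 : (0 : R) < 8^-1 by rewrite invr_gt0.
have := ln_le_lin m0 i8 v0; rewrite invrK; move: vq m0; clra.
Qed.

Lemma ker_continuous (q : R * E) : q.1 != 0 \/ q.2 != 0 ->
  {for q, continuous (fun z : R * E => ker z.1 z.2)}.
Proof.
case: q => t x /= H.
have c1 : (z.1 @[z --> (t, x)] --> t)%classic by exact: cvg_fst.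
have c2 : (z.2 @[z --> (t, x)] --> x)%classic by exact: cvg_snd.
have cx : (enorm z.2 @[z --> (t, x)] --> enorm x)%classic.
  by apply: (cvg_comp (fun z : R * E => z.2) (fun y : E => enorm y) c2); exact: continuous_enorm.
have [t0|t0|t0] := ltgtP t 0.
- have h : \forall z \near (t, x), (0 : R) = ker z.1 z.2.
    have N : \forall z \near (t, x), z.1 < 0 by exact: (cvgr_lt _ c1).
    by near=> z; rewrite /ker ltNge ltW //=; near: z.
  apply: cvg_trans (near_eq_cvg h) _; rewrite /ker ltNge ltW //=.
  exact: cvg_cst.
- have h : \forall z \near (t, x), gker z.1 z.2 = ker z.1 z.2.
    have N : \forall z \near (t, x), 0 < z.1 by exact: (cvgr_gt _ c1).
    by near=> z; rewrite /ker; have -> : 0 < z.1 by near: z.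
  apply: cvg_trans (near_eq_cvg h) _; rewrite /ker t0.
  apply: (cvg_comp (fun z : R * E => - km * ln z.1 - kth * enorm z.2 ^+ 2 / z.1) expR); last exact: continuous_expR.
  apply: cvgB.
    apply: cvgM; first exact: cvg_cst.
    by apply: (cvg_comp (fun z : R * E => z.1) (@ln R) c1); exact: continuous_ln.
  apply: cvgM; last by apply: cvgV => //; rewrite gt_eqF.
  apply: cvgM; first exact: cvg_cst.
  by rewrite expr2; under eq_fun do rewrite expr2; exact: cvgM.
have x0 : 0 < enorm x.
  by rewrite enorm_gt0; case: H => //; rewrite t0 eqxx.
apply/(@cvgrPdist_le _ _ _ (nbhs _)) => e e0.
have k00 : ker t x = 0 by rewrite /ker t0 ltxx.
pose q0 := (enorm x / 2) ^+ 2.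
have q00 : 0 < q0 by rewrite exprn_gt0 // divr_gt0.
have /andP[k1 _] := kth_bounds.
have kq : 0 < kth * q0 by rewrite mulr_gt0 //; move: k1; clra.
(* With |x| bounded below, [(km + 1) * ln (1 / t)] is at most the Gaussian exponent plus a constant,
   so the kernel is at most [C * t] as [t] tends to 0. *)
pose C := expR ((km + 1) ^+ 2 / (kth * q0)).
have C0 : 0 < C by exact: expR_gt0.
have eC : 0 < e / C by rewrite divr_gt0.
have N1 : \forall z \near (t, x), z.1 < e / C by apply: (cvgr_lt _ c1); rewrite t0.
have N2 : \forall z \near (t, x), enorm x / 2 < enorm z.2.
  by apply: (cvgr_gt _ cx); move: x0; clra.
near=> z; rewrite /= k00 sub0r normrN ger0_norm ?ker_ge0 // /ker.
case: ifPn => [z0|_]; last exact: ltW.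
apply: (@le_trans _ _ (z.1 * C)); last first.
  by rewrite -ler_pdivlMr // ltW //; near: z.
rewrite -{2}(@lnK _ z.1) ?posrE // /C -expRD ler_expR.
have zq : q0 <= enorm z.2 ^+ 2.
  have x20 : 0 <= enorm x / 2 by rewrite divr_ge0 // ltW.
  rewrite /q0 ler_sqr ?nnegrE ?enorm_ge0 //.
  by rewrite ltW //; near: z.
have zv : 0 < (z.1)^-1 by rewrite invr_gt0.
have m1 : 0 < km + 1 by have := km_gt0; clra.
have := ln_le_lin m1 kq zv; rewrite lnV ?posrE //.
have : kth * q0 / z.1 <= kth * enorm z.2 ^+ 2 / z.1.
  rewrite ler_pM2r // ler_wpM2l //; move: k1; clra.
by clra.
Unshelve. all: by end_near. Qed.

End Kernel.

(** * Lattice averages of the kernel, and their upper and lower bounds *)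

Section KernelSum.
Variable R : realType.

Lemma expR_le_inv (y : R) : expR (- (y ^+ 2 / 4)) <= 8 / ((1 + `|y|) * (2 + `|y|)).
Proof.
have a0 : 0 <= `|y| by [].
have A0 : 0 < (1 + `|y|) * (2 + `|y|) by apply: mulr_gt0; lra.
rewrite expRN ler_pdivlMr // mulrC ler_pdivrMr ?expR_gt0 //.
have := expR_ge1Dx (y ^+ 2 / 4).
have y2 : y ^+ 2 = `|y| ^+ 2 by rewrite real_normK ?num_real.
by have := sqr_ge0 (`|y| - 3 / 2); rewrite y2; clra.
Qed.

(** A discrete substitute for integrating the Gaussian: y/(1 + |y|) is bounded by one, and its
    increment over a step [del] dominates [del] times the Gaussian, so that Gaussian sums
    telescope. *)
Lemma telescope_term (y del : R) : 0 < del <= 1 ->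
  expR (- (y ^+ 2 / 4)) <= 8 / del * ((y + del) / (1 + `|y + del|) - y / (1 + `|y|)).
Proof.
move=> /andP[d0 d1].
have a0 : 0 <= `|y| by [].
have b0 : 0 <= `|y + del| by [].
have A0 : 0 < 1 + `|y| by lra.
have B0 : 0 < 1 + `|y + del| by lra.
have ab : `|y + del| <= `|y| + 1.
  by apply: le_trans (ler_normD _ _) _; rewrite lerD2l ger0_norm // ltW.
have -> : (y + del) / (1 + `|y + del|) - y / (1 + `|y|) =
   (del + ((y + del) * `|y| - y * `|y + del|)) / ((1 + `|y|) * (1 + `|y + del|)).
  by field; rewrite !gt_eqF.
have num : 0 <= (y + del) * `|y| - y * `|y + del|.
  have [y0|y0] := leP 0 y.
    rewrite (ger0_norm y0) (ger0_norm (addr_ge0 y0 (ltW d0))).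
    by rewrite [X in _ <= X](_ : _ = 0) //; ring.
  rewrite (ltr0_norm y0).
  have -> : (y + del) * - y - y * `|y + del| = (- y) * (y + del + `|y + del|) by ring.
  rewrite mulr_ge0 ?oppr_ge0 ?(ltW y0) //.
  by have := ler_norm (- (y + del)); rewrite normrN; clra.
apply: le_trans (expR_le_inv y) _.
have e1 : (2 + `|y|)^-1 <= (1 + `|y + del|)^-1.
  by rewrite lef_pV2 ?posrE //; move: a0 ab; clra.
have -> : 8 / ((1 + `|y|) * (2 + `|y|)) = 8 / (1 + `|y|) * (2 + `|y|)^-1.
  by rewrite invfM mulrA.
apply: (@le_trans _ _ (8 / (1 + `|y|) * (1 + `|y + del|)^-1)).
  by rewrite ler_wpM2l // divr_ge0 // ltW.
have -> : 8 / del * ((del + ((y + del) * `|y| - y * `|y + del|)) / ((1 + `|y|) * (1 + `|y + del|)))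
  = 8 / (1 + `|y|) * (1 + `|y + del|)^-1 +
    8 / del * ((y + del) * `|y| - y * `|y + del|) / ((1 + `|y|) * (1 + `|y + del|)).
  by field; rewrite !gt_eqF.
by rewrite lerDl divr_ge0 ?mulr_ge0 ?divr_ge0 ?invr_ge0 // ltW.
Qed.

Lemma gauss_sum (a del : R) n : 0 < del <= 1 ->
  \sum_(k < n) expR (- ((a + k%:R * del) ^+ 2 / 4)) <= 16 / del.
Proof.
move=> dd; have /andP[d0 d1] := dd.
pose f k : R := (a + k%:R * del) / (1 + `|a + k%:R * del|).
apply: (@le_trans _ _ (\sum_(0 <= k < n) (8 / del * (f k.+1 - f k)))).
  rewrite big_mkord; apply: ler_sum => k _.
  have := telescope_term (a + k%:R * del) dd.
  have -> // : a + k%:R * del + del = a + k.+1%:R * del by rewrite -natr1; ring.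
rewrite -mulr_sumr telescope_sumr //.
have -> : 16 / del = 8 / del * 2 by ring.
rewrite ler_wpM2l ?divr_ge0 ?(ltW d0) //.
have f1 k : `|f k| <= 1.
  rewrite /f normrM normfV (ger0_norm (addr_ge0 ler01 (normr_ge0 _))).
  by rewrite ler_pdivrMr ?mul1r ?lerDr // ltr_pwDl.
have := f1 n; have := f1 0%N; rewrite !ler_norml => /andP[h1 h2] /andP[h3 h4].
by move: h1 h4; clra.
Qed.

Variable d : nat.
Local Notation E := 'rV[R]_d.

(** Lattice of the unit parabolic cylinder: times spaced by n^(-2) and points spaced by 1/n, in
    accordance with parabolic scaling. *)
Definition ltime (n : nat) (i : 'I_(n ^ 2)) : R := i%:R / n%:R ^+ 2.
Definition lpoint (n : nat) (z : {ffun 'I_d -> 'I_n}) : E := \row_j ((z j)%:R / n%:R).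

Lemma lpoint_le n (z : {ffun 'I_d -> 'I_n}) : (0 < n)%N -> enorm (lpoint z) <= d%:R.
Proof.
move=> n0; rewrite -[leRHS]mulr1; apply: enorm_le_coord => // j.
rewrite mxE ger0_norm ?divr_ge0 // ler_pdivrMr ?ltr0n // mul1r ler_nat.
exact: ltnW.
Qed.

Lemma ltime_bounds n (i : 'I_(n ^ 2)) : 0 <= ltime i <= 1.
Proof.
rewrite divr_ge0 ?exprn_ge0 //=; case: n i => [|n] i; first by case: i.
by rewrite ler_pdivrMr ?exprn_gt0 ?ltr0n // mul1r -natrX ler_nat ltnW.
Qed.

(** A Riemann sum for the heat potential of a set of sources [J], normalised by the total number
    [n ^ (d + 2)] of lattice points. *)
Definition Psi (B : 'M[R]_d) (n : nat) (J : pred ('I_(n ^ 2) * {ffun 'I_d -> 'I_n})) (s : R) (x : E) : R :=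
  (n%:R ^+ (d + 2))^-1 * \sum_(p | J p) ker (s - ltime p.1) (x - lpoint p.2 *m B).

(** The Gaussian factorises over coordinates, and each factor is a one-dimensional sum with spacing
    1/(n sqrt(sg)), which is at most one by the lower bound on [sg]. *)
Lemma space_sum_id n (x : E) (sg : R) : (0 < n)%N -> n%:R ^- 2 <= sg ->
  \sum_(z : {ffun 'I_d -> 'I_n}) expR (- (4^-1 * enorm (x - lpoint z) ^+ 2 / sg))
   <= (16 * n%:R * Num.sqrt sg) ^+ d.
Proof.
move=> n0 nsg; have n1 : 0 < n%:R :> R by rewrite ltr0n.
have s0 : 0 < sg by apply: lt_le_trans nsg; rewrite invr_gt0 exprn_gt0.
set r := Num.sqrt sg; have r0 : 0 < r by rewrite sqrtr_gt0.
have r2 : sg = r ^+ 2 by rewrite sqr_sqrtr // ltW.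
have nr : 1 <= n%:R * r.
  rewrite -(ler_sqr (x := 1)) ?nnegrE ?mulr_ge0 ?(ltW r0) // expr1n exprMn -r2.
  by rewrite -ler_pdivrMl ?exprn_gt0 // mulr1.
pose F (j : 'I_d) (k : 'I_n) : R := expR (- ((- (x 0 j / r) + k%:R * (n%:R * r)^-1) ^+ 2 / 4)).
have -> : \sum_(z : {ffun 'I_d -> 'I_n}) expR (- (4^-1 * enorm (x - lpoint z) ^+ 2 / sg))
    = \sum_(z : {ffun 'I_d -> 'I_n}) \prod_j F j (z j).
  apply: eq_bigr => z _; rewrite /F -expR_sum; congr expR.
  rewrite enorm_sqr big_ord1 sumrN; congr (- _).
  rewrite mulr_sumr mulr_suml; apply: eq_bigr => j _.
  by rewrite !mxE r2; field; rewrite !gt_eqF.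
rewrite -(bigA_distr_bigA F).
have -> : (16 * n%:R * r) ^+ d = \prod_(j < d) (16 * n%:R * r).
  by rewrite prodr_const card_ord.
apply: ler_prod => j _; apply/andP; split.
  by apply: sumr_ge0 => k _; exact: expR_ge0.
have := @gauss_sum (- (x 0 j / r)) (n%:R * r)^-1 n.
rewrite invrK mulrA; apply.
by rewrite invr_gt0 mulr_gt0 //= invf_le1 // mulr_gt0.
Qed.

(** [B] will be the inverse of the transposed sigma at a frozen point. Carrying it in the lattice
    keeps the lattice fixed in the original variables, so the same sources can be counted for [u]
    and for its opposite, whose frozen matrices differ. *)
Definition spread (B : 'M[R]_d) (b b' : R) :=
  [/\ B \in unitmx, 0 < b <= 1, 0 <= b' &
   forall xi : E, b * enorm xi <= enorm (xi *m B) <= b' * enorm xi].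

Lemma space_sum (B : 'M[R]_d) (b b' : R) n (x : E) (sg : R) :
  spread B b b' -> (0 < n)%N -> n%:R ^- 2 <= sg ->
  \sum_(z : {ffun 'I_d -> 'I_n}) expR (- (4^-1 * enorm (x - lpoint z *m B) ^+ 2 / sg))
   <= (16 * n%:R / b * Num.sqrt sg) ^+ d.
Proof.
move=> [uB /andP[b0 b1] _ HB] n0 nsg; have n1 : 0 < n%:R :> R by rewrite ltr0n.
have s0 : 0 < sg by apply: lt_le_trans nsg; rewrite invr_gt0 exprn_gt0.
have b20 : 0 < b ^+ 2 by rewrite exprn_gt0.
have bs : sg <= sg / b ^+ 2.
  by rewrite ler_peMr ?(ltW s0) // invf_ge1 // exprn_ile1 // ltW.
apply: (@le_trans _ _ (\sum_(z : {ffun 'I_d -> 'I_n})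
   expR (- (4^-1 * enorm (x *m invmx B - lpoint z) ^+ 2 / (sg / b ^+ 2))))).
  apply: ler_sum => z _; rewrite ler_expR lerN2.
  have -> : x - lpoint z *m B = (x *m invmx B - lpoint z) *m B by rewrite mulmxBl mulmxKV.
  set y := x *m invmx B - lpoint z.
  have -> : 4^-1 * enorm y ^+ 2 / (sg / b ^+ 2) = 4^-1 * (b * enorm y) ^+ 2 / sg.
    by field; rewrite !gt_eqF.
  rewrite ler_pM2r ?invr_gt0 // ler_pM2l ?invr_gt0 // ler_sqr ?nnegrE //.
    by have /andP[] := HB y.
  by rewrite mulr_ge0 // ltW.
apply: le_trans (space_sum_id _ n0 (le_trans nsg bs)) _.
have -> : Num.sqrt (sg / b ^+ 2) = Num.sqrt sg / b.
  by rewrite sqrtrM ?(ltW s0) // sqrtrV ?(ltW b20) // sqrtr_sqr gtr0_norm.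
by have -> : 16 * n%:R * (Num.sqrt sg / b) = 16 * n%:R / b * Num.sqrt sg by ring.
Qed.

Definition CPsi (b : R) : R := expR (8 * km R d ^+ 2 + km R d) * (16 / b) ^+ d * 4.

Lemma CPsi_gt0 b : 0 < b -> 0 < CPsi b.
Proof. by move=> b0; rewrite mulr_gt0 // mulr_gt0 ?expR_gt0 // exprn_gt0 // divr_gt0. Qed.

(** After regularisation, the sources of age [bb i = r ^+ 2] contribute r^(-d-1) (n r)^d, up to a
    constant, that is n^d / r. The sum over times telescopes because n^(-2) / r is at most twice the
    decrement of the square root of [bb]; the total is of order n^(d+2). *)
Lemma Psi_le (B : 'M[R]_d) (b b' : R) n (J : pred ('I_(n ^ 2) * {ffun 'I_d -> 'I_n})) (s : R) (x : E) :
  spread B b b' -> (0 < n)%N -> 0 <= s <= 3 ->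
  (forall p, J p -> ltime p.1 < s ->
     n%:R ^- 2 <= s - ltime p.1 \/ n%:R ^- 2 <= enorm (x - lpoint p.2 *m B) ^+ 2) ->
  Psi B J s x <= CPsi b.
Proof.
move=> SB n0 /andP[s0 s3] HJ; have [_ /andP[b0 b1] _ _] := SB; have n1 : 0 < n%:R :> R by rewrite ltr0n.
have i0 : 0 < n%:R ^- 2 :> R by rewrite invr_gt0 exprn_gt0.
pose c1 : R := expR (8 * km R d ^+ 2 + km R d).
have c10 : 0 < c1 by exact: expR_gt0.
have A0 : 0 <= 16 * n%:R / b by rewrite divr_ge0 ?mulr_ge0 // ltW.
have cA0 : 0 <= c1 * (16 * n%:R / b) ^+ d by rewrite mulr_ge0 ?exprn_ge0 // ltW.
(* Age of the sources of index [k], increased by one time step of the lattice. *)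
pose bb (k : nat) : R := s - k%:R / n%:R ^+ 2 + n%:R ^- 2.
pose G (i : 'I_(n ^ 2)) (z : {ffun 'I_d -> 'I_n}) : R := if ltime i < s then
   c1 * (expR (- km R d * ln (bb i)) * expR (- (4^-1 * enorm (x - lpoint z *m B) ^+ 2 / bb i))) else 0.
have G0 i z : 0 <= G i z.
  by rewrite /G; case: ifP => // _; rewrite !mulr_ge0 ?expR_ge0 // ltW.
have h1 : \sum_(p | J p) ker (s - ltime p.1) (x - lpoint p.2 *m B) <= \sum_i \sum_z G i z.
  rewrite pair_big /= [leRHS](bigID J) /= ler_wpDr ?sumr_ge0 //.
  apply: ler_sum => p Jp; rewrite /ker subr_gt0 /G.
  case: ifPn => // ts; rewrite -expRD -/(bb p.1).
  have tsp : 0 < s - ltime p.1 by rewrite subr_gt0.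
  exact: gker_regularize i0 tsp (HJ p Jp ts).
have h2 i : \sum_z G i z <= c1 * (16 * n%:R / b) ^+ d * (2 * n%:R ^+ 2 * (Num.sqrt (bb i) - Num.sqrt (bb i.+1))).
  have bbS : bb i.+1 <= bb i.
    rewrite /bb lerD2r lerD2l lerN2 ler_pM2r ?invr_gt0 ?exprn_gt0 // ler_nat.
    exact: leqnSn.
  have sb : Num.sqrt (bb i.+1) <= Num.sqrt (bb i) by exact: ler_wsqrtr.
  have [ts|ts] := ltP (ltime i) s; last first.
    rewrite big1; last by move=> z _; rewrite /G ltNge ts.
    by apply: mulr_ge0 => //; rewrite !mulr_ge0 ?subr_ge0.
  have nb : n%:R ^- 2 <= bb i by rewrite /bb lerDr subr_ge0 ltW.
  have bi0 : 0 < bb i by apply: lt_le_trans nb.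
  set r := Num.sqrt (bb i) in sb *; have r0 : 0 < r by rewrite sqrtr_gt0.
  have r2 : bb i = r ^+ 2 by rewrite sqr_sqrtr // ltW.
  have -> : \sum_z G i z = c1 * expR (- km R d * ln (bb i)) *
     \sum_(z : {ffun 'I_d -> 'I_n}) expR (- (4^-1 * enorm (x - lpoint z *m B) ^+ 2 / bb i)).
    by rewrite mulr_sumr; apply: eq_bigr => z _; rewrite /G ts mulrA.
  have kE : expR (- km R d * ln (bb i)) = (r ^+ d.+1)^-1.
    rewrite r2 lnXn // -[RHS](@lnK _) ?posrE ?invr_gt0 ?exprn_gt0 //.
    rewrite lnV ?posrE ?exprn_gt0 // lnXn // /km -[d.+1]addn1 mulrnDr mulr1n mulr2n.
    by congr expR; rewrite -mulr_natl; field.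
  have bS : bb i.+1 = r ^+ 2 - n%:R ^- 2.
    rewrite -r2 /bb -natr1 mulrDl mul1r; ring.
  have key : r^-1 <= 2 * n%:R ^+ 2 * (r - Num.sqrt (bb i.+1)).
    set q := Num.sqrt (bb i.+1) in sb *.
    have q0 : 0 <= q by exact: sqrtr_ge0.
    have bS0 : 0 <= bb i.+1 by rewrite bS -r2 subr_ge0.
    have q2 : q ^+ 2 = r ^+ 2 - n%:R ^- 2 by rewrite sqr_sqrtr.
    have e1 : (r - q) * (r + q) = n%:R ^- 2 by rewrite -subr_sqr q2; ring.
    have rq : 0 < r + q by rewrite ltr_pwDl.
    have -> : 2 * n%:R ^+ 2 * (r - q) = 2 / (r + q).
      have -> : r - q = n%:R ^- 2 / (r + q) by rewrite -e1 mulfK // gt_eqF.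
      by field; rewrite !gt_eqF.
    rewrite -[leLHS]div1r ler_pdivrMr // mulrAC ler_pdivlMr // mul1r.
    by move: sb; clra.
  apply: (@le_trans _ _ (c1 * (r ^+ d.+1)^-1 * (16 * n%:R / b * r) ^+ d)).
    rewrite kE ler_wpM2l ?mulr_ge0 ?invr_ge0 ?exprn_ge0 ?(ltW c10) ?(ltW r0) //.
    exact: space_sum SB n0 nb.
  have -> : c1 * (r ^+ d.+1)^-1 * (16 * n%:R / b * r) ^+ d = c1 * (16 * n%:R / b) ^+ d * r^-1.
    rewrite [(16 * n%:R / b * r) ^+ d]exprMn [r ^+ d.+1]exprS; field.
    by rewrite expf_neq0 ?gt_eqF.
  by rewrite ler_wpM2l.
have h3 : \sum_(i < n ^ 2) (Num.sqrt (bb i) - Num.sqrt (bb i.+1)) <= 2.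
  have -> : \sum_(i < n ^ 2) (Num.sqrt (bb i) - Num.sqrt (bb i.+1)) =
      Num.sqrt (bb 0%N) - Num.sqrt (bb (n ^ 2)%N).
    rewrite -(big_mkord xpredT (fun i => Num.sqrt (bb i) - Num.sqrt (bb i.+1))).
    pose f k := - Num.sqrt (bb k).
    transitivity (\sum_(0 <= i < n ^ 2) (f i.+1 - f i)).
      by apply: eq_bigr => i _; rewrite /f opprK addrC.
    by rewrite telescope_sumr // /f opprK addrC.
  have : Num.sqrt (bb 0%N) <= Num.sqrt (2 ^+ 2).
    apply: ler_wsqrtr; rewrite /bb mul0r subr0.
    have : n%:R ^- 2 <= 1 :> R by rewrite invf_le1 ?exprn_gt0 // exprn_ege1 // ler1n.
    by move: s3; clra.
  rewrite sqrtr_sqr ger0_norm //; have := sqrtr_ge0 (bb (n ^ 2)%N); clra.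
rewrite /Psi ler_pdivrMl ?exprn_gt0 //.
apply: le_trans h1 _.
apply: (@le_trans _ _ (\sum_(i < n ^ 2)
   (c1 * (16 * n%:R / b) ^+ d * (2 * n%:R ^+ 2) * (Num.sqrt (bb i) - Num.sqrt (bb i.+1))))).
  by apply: ler_sum => i _; apply: le_trans (h2 i) _; rewrite !mulrA.
rewrite -mulr_sumr.
have -> : n%:R ^+ (d + 2) * CPsi b = c1 * (16 * n%:R / b) ^+ d * (2 * n%:R ^+ 2) * 2.
  have -> : 16 * n%:R / b = n%:R * (16 / b) by ring.
  by rewrite /CPsi -/c1 [(n%:R * (16 / b)) ^+ d]exprMn exprD; ring.
by rewrite ler_wpM2l // mulr_ge0 // mulr_ge0.
Qed.

Definition cPsi (b' : R) : R := expR (- km R d * ln 3 - kth R d * (b' * d%:R + 1) ^+ 2).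

Lemma cPsi_gt0 b' : 0 < cPsi b'. Proof. exact: expR_gt0. Qed.

(** From time 2 on every source is between one and three units old and at bounded distance, so each
    kernel is at least [cPsi], and half of the lattice carries a source. *)
Lemma Psi_ge (B : 'M[R]_d) (b b' : R) n (J : pred ('I_(n ^ 2) * {ffun 'I_d -> 'I_n})) (s : R) (x : E) :
  spread B b b' -> (0 < n)%N -> 2 <= s <= 3 -> enorm x <= 1 -> (n ^ (d + 2) <= 2 * #|J|)%N ->
  cPsi b' / 2 <= Psi B J s x.
Proof.
move=> [_ _ b'0 HB] n0 /andP[s2 s3] x1 cJ; have n1 : 0 < n%:R :> R by rewrite ltr0n.
have /andP[k1 k2] := kth_bounds R d.
have k0 : 0 <= kth R d by move: k1; clra.
have h (p : 'I_(n ^ 2) * {ffun 'I_d -> 'I_n}) : cPsi b' <= ker (s - ltime p.1) (x - lpoint p.2 *m B).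
  have /andP[t0 t1] := @ltime_bounds n p.1.
  have sp : 1 <= s - ltime p.1 by move: t1 s2; clra.
  have sp3 : s - ltime p.1 <= 3 by move: t0 s3; clra.
  have sp0 : 0 < s - ltime p.1 by move: sp; clra.
  rewrite /ker sp0 ler_expR lerB //.
    by rewrite !mulNr lerN2 ler_wpM2l ?(ltW (km_gt0 R d)) // ler_ln ?posrE.
  rewrite ler_pdivrMr //.
  have e1 : enorm (x - lpoint p.2 *m B) <= b' * d%:R + 1.
    apply: le_trans (enormB _ _) _; rewrite addrC lerD //.
    have /andP[_ h] := HB (lpoint p.2); apply: le_trans h _.
    by rewrite ler_wpM2l // lpoint_le.
  have e2 : enorm (x - lpoint p.2 *m B) ^+ 2 <= (b' * d%:R + 1) ^+ 2.
    by rewrite ler_sqr ?nnegrE // addr_ge0 // mulr_ge0.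
  apply: (@le_trans _ _ (kth R d * (b' * d%:R + 1) ^+ 2)); first by rewrite ler_wpM2l.
  by rewrite ler_peMr // mulr_ge0 // sqr_ge0.
rewrite /Psi -ler_pdivrMl ?invr_gt0 ?exprn_gt0 // invrK.
apply: (@le_trans _ _ (\sum_(p | J p) cPsi b')); last by apply: ler_sum => p _; exact: h.
rewrite sumr_const -[leRHS]mulr_natr mulrA ler_pdivrMr // mulrC -mulrA.
rewrite ler_wpM2l ?(ltW (cPsi_gt0 _)) // -natrX -natrM ler_nat mulnC.
exact: cJ.
Qed.

Lemma Psi_early (B : 'M[R]_d) n (J : pred ('I_(n ^ 2) * {ffun 'I_d -> 'I_n})) (x : E) : Psi B J 0 x = 0.
Proof.
rewrite /Psi big1 ?mulr0 // => p _; rewrite /ker sub0r oppr_gt0.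
by have /andP[t0 _] := @ltime_bounds n p.1; rewrite ltNge t0.
Qed.

End KernelSum.

(** * The barrier and the comparison on a superlevel set *)

Section Growth.
Variables (R : realType) (d : nat).
Local Notation E := 'rV[R]_d.

(** On the compact set of pairs whose values differ by at least [e], the distance attains a minimum,
    which is positive. *)
Lemma unif_cont (f : R * E -> R) (A : set (R * E)) (e : R) :
  continuous f -> compact A -> 0 < e ->
  exists2 del : R, 0 < del & forall a b, A a -> A b ->
    `|a.1 - b.1| < del -> enorm (a.2 - b.2) < del -> `|f a - f b| < e.
Proof.
move=> cf cA e0.
pose g := fun q : (R * E) * (R * E) => `|f q.1 - f q.2|.
have cg : continuous g.
  apply: (continuous_comp2 (g := fun y : R => `|y|)); last exact: norm_continuous.
  apply: continuous_addr.
    by apply: (continuous_comp2 (g := f)) => //; exact: continuous_fst.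
  apply: continuous_oppr; apply: (continuous_comp2 (g := f)) => //.
  exact: continuous_snd.
pose D := (A `*` A) `&` [set q | e <= g q].
have cD : compact D.
  apply: compact_closedI; first exact: compact_setX.
  have := @preimage_closed ((R * E) * (R * E))%type R g [set y | e <= y].
  by apply; [move=> q _; exact: cg | exact: closed_ge].
have [D0|D0] := pselect (D !=set0); last first.
  exists 1 => // a b Aa Ab _ _; rewrite ltNge; apply/negP => ge.
  by apply: D0; exists (a, b).
pose h := fun q : (R * E) * (R * E) => `|q.1.1 - q.2.1| + enorm (q.1.2 - q.2.2).
have ch : continuous h.
  have c11 : continuous (fun q : (R * E) * (R * E) => q.1.1).
    by apply: (continuous_comp2 (g := fst)); exact: continuous_fst.
  have c12 : continuous (fun q : (R * E) * (R * E) => q.1.2).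
    by apply: (continuous_comp2 (g := snd)); [exact: continuous_fst|exact: continuous_snd].
  have c21 : continuous (fun q : (R * E) * (R * E) => q.2.1).
    by apply: (continuous_comp2 (g := fst)); [exact: continuous_snd|exact: continuous_fst].
  have c22 : continuous (fun q : (R * E) * (R * E) => q.2.2).
    by apply: (continuous_comp2 (g := snd)); exact: continuous_snd.
  apply: continuous_addr.
    apply: (continuous_comp2 (g := fun y : R => `|y|)); last exact: norm_continuous.
    by apply: continuous_addr => //; exact: continuous_oppr.
  apply: (continuous_comp2 (g := fun y : E => enorm y)); last exact: continuous_enorm.
  by apply: continuous_addr => //; exact: continuous_oppr.
have [[a0 b0]] := compact_EVT_min D0 cD (continuous_subspaceT ch).
rewrite inE => -[[Aa0 Ab0] /= ge0] hmin.
pose m := h (a0, b0).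
have m0 : 0 < m.
  rewrite lt_neqAle; apply/andP; split; last by rewrite addr_ge0.
  apply/eqP => /esym/eqP; rewrite /m /h /= paddr_eq0 // normr_eq0 enorm_eq0 !subr_eq0.
  move=> /andP[/eqP e1 /eqP e2]; move: ge0; rewrite /g /=.
  have -> : a0 = b0 by case: a0 b0 e1 e2 {Aa0 Ab0 hmin m} => [? ?] [? ?] /= -> ->.
  by rewrite subrr normr0 leNgt e0.
exists (m / 2); first by rewrite divr_gt0.
move=> a b Aa Ab h1 h2; rewrite ltNge; apply/negP => ge.
have := hmin (a, b); rewrite inE => /(_ (conj (conj Aa Ab) ge)).
by move: h1 h2; rewrite /m /h /=; clra.
Qed.

Lemma fin_pos_min (I : finType) (Q : pred I) (f : I -> R) :
  (forall i, Q i -> 0 < f i) -> exists2 r : R, 0 < r & forall i, Q i -> r <= f i.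
Proof.
move=> f0; have S0 : 0 <= \sum_(i | Q i) (f i)^-1.
  by apply: sumr_ge0 => i /f0 fi; rewrite invr_ge0 ltW.
exists (1 + \sum_(i | Q i) (f i)^-1)^-1; first by rewrite invr_gt0 ltr_pwDl.
move=> i Qi; rewrite -[leRHS]invrK lef_pV2 ?posrE ?invr_gt0 ?f0 ?ltr_pwDl //.
rewrite (bigD1 i) //= addrCA lerDl addr_ge0 //.
by apply: sumr_ge0 => j /andP[/f0 fj _]; rewrite invr_ge0 ltW.
Qed.

Lemma cvg_sumr (T : topologicalType) (q : T) (I : Type) (s : seq I) (Q : pred I) (f : I -> T -> R) :
  (forall i, Q i -> {for q, continuous (f i)}) ->
  {for q, continuous (fun x => \sum_(i <- s | Q i) f i x)}.
Proof.
move=> cf; elim: s => [|i s IH].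
  rewrite (_ : (fun x => _) = (fun=> 0)); first exact: cst_continuous.
  by apply: funext => x; rewrite big_nil.
case Qi : (Q i).
  rewrite (_ : (fun x => _) = (fun x => f i x + \sum_(j <- s | Q j) f j x)).
    by apply: cvgD; [exact: cf|exact: IH].
  by apply: funext => x; rewrite big_cons Qi.
rewrite (_ : (fun x => _) = (fun x => \sum_(j <- s | Q j) f j x)) //.
by apply: funext => x; rewrite big_cons Qi.
Qed.

Lemma is_derive_bigsum (I : Type) (s : seq I) (Q : pred I) (f : I -> R -> R) (x : R) (a : I -> R) :
  (forall i, Q i -> is_derive x 1 (f i) (a i)) ->
  is_derive x 1 (fun y => \sum_(i <- s | Q i) f i y) (\sum_(i <- s | Q i) a i).
Proof.
move=> H; elim: s => [|i s IH].
  rewrite big_nil; apply: is_derive_ext (is_derive_cst (0 : R) x 1) => y.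
  by rewrite big_nil.
rewrite big_cons; case Qi : (Q i).
  apply: is_derive_ext (is_deriveD (H i Qi) IH) => y.
  by rewrite big_cons Qi.
by apply: is_derive_ext IH => y; rewrite big_cons Qi.
Qed.

Lemma D2at_bigsum (I : Type) (s : seq I) (Q : pred I) (f : I -> R -> R) (a e : I -> R) :
  (forall i, Q i -> D2at (f i) (a i) (e i)) ->
  D2at (fun y => \sum_(i <- s | Q i) f i y) (\sum_(i <- s | Q i) a i) (\sum_(i <- s | Q i) e i).
Proof.
move=> H; elim: s => [|i s IH].
  rewrite !big_nil; apply: D2at_ext (D2at_cst (0 : R)) => y.
  by rewrite big_nil.
rewrite !big_cons; case Qi : (Q i).
  by apply: D2at_ext (D2atD (H i Qi) IH) => y; rewrite big_cons Qi.
by apply: D2at_ext IH => y; rewrite big_cons Qi.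
Qed.

Lemma is_derive_shiftc (f : R -> R) (x c a : R) :
  is_derive (x - c) 1 f a -> is_derive x 1 (fun s => f (s - c)) a.
Proof.
move=> /derP H; apply/derP => e /H[r r0 Hr]; exists r => // h /Hr.
by rewrite [x + h - c]addrAC.
Qed.

(** Constants of the barrier [1 - et * gc2 * (Psi - gmu * (s + gk * |x|^2))]. [gc2] makes
    [gc2 * Psi] at most 1/2; [gmu] makes the paraboloid at most [cPsi / 4] on the target; [Rad]
    makes it exceed [CPsi] on the lateral boundary; [gk] makes its second-order term at most half of
    its time derivative; [gdel] is half of the surplus left in the differential inequality. *)
Definition gk : R := (2 * (d%:R + 1))^-1.
Definition gmu (b' : R) : R := cPsi d b' / (4 * (3 + gk)).
Definition gc2 (b : R) : R := (2 * CPsi d b)^-1.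
Definition Rad (b b' : R) : R := b' * d%:R + 1 + CPsi d b / (gmu b' * gk).
Definition gc3 (b b' : R) : R := Num.min 2^-1 (gc2 b * cPsi d b' / 4).
Definition gdel (b b' : R) : R := gc2 b * gmu b' / 4.

Lemma gk_gt0 : 0 < gk. Proof. by rewrite invr_gt0 mulr_gt0 // ltr_wpDl. Qed.

Lemma gmu_gt0 b' : 0 < gmu b'.
Proof. by rewrite divr_gt0 ?cPsi_gt0 // mulr_gt0 // addr_gt0 // gk_gt0. Qed.

Lemma gc2_gt0 b : 0 < b -> 0 < gc2 b.
Proof. by move=> b0; rewrite invr_gt0 mulr_gt0 // CPsi_gt0. Qed.

Lemma gdel_gt0 b b' : 0 < b -> 0 < gdel b b'.
Proof. by move=> b0; rewrite divr_gt0 // mulr_gt0 ?gc2_gt0 ?gmu_gt0. Qed.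

Lemma gc3_bounds b b' : 0 < b -> 0 < gc3 b b' <= 2^-1.
Proof.
move=> b0; rewrite /gc3 ge_min lexx andbT lt_min invr_gt0 ltr0n /=.
by rewrite divr_gt0 // mulr_gt0 ?gc2_gt0 ?cPsi_gt0.
Qed.

Lemma Rad_ge b b' : 0 < b -> 0 <= b' ->
  b' * d%:R + 1 <= Rad b b' /\ CPsi d b <= gmu b' * gk * Rad b b' ^+ 2.
Proof.
move=> b0 b'0; have mk : 0 < gmu b' * gk by rewrite mulr_gt0 ?gmu_gt0 ?gk_gt0.
have q0 : 0 <= CPsi d b / (gmu b' * gk).
  by rewrite divr_ge0 ?(ltW mk) // ltW // CPsi_gt0.
have d0 : 0 <= b' * d%:R by rewrite mulr_ge0.
split; first by rewrite /Rad; move: q0; clra.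
rewrite mulrC -ler_pdivrMr //.
apply: (@le_trans _ _ (Rad b b')); first by rewrite /Rad; move: d0; clra.
rewrite expr2 ler_peMr // /Rad; move: q0 d0; clra.
Qed.

(* The second-order operator is only assumed close to the Laplacian where [w] is
   within [et] of its upper bound; there the barrier built on [Psi] is a
   subsolution.  Its sources are the lattice points where [w] is low, so the
   singularities of [Psi] are outside the region of comparison. *)
Lemma growth (B : 'M[R]_d) (b b' : R) (w : R -> E -> R) (et : R) :
  spread B b b' ->
  0 < et < 1 ->
  continuous (fun z : R * E => w z.1 z.2) ->
  (forall (s : R) x, 0 <= s <= 3 -> enorm x <= (Rad b b') -> w s x <= 1) ->
  (forall (s : R) x, 0 < s <= 3 -> enorm x < (Rad b b') -> 1 - et < w s x ->
     exists dt p H S, [/\ jet w s x dt p H, enorm (S - 1%:M) <= keps R d &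
        dt <= 2^-1 * qsum S H + et * (gdel b b')]) ->
  exists n0 : nat, forall n, (n0 <= n)%N -> (0 < n)%N ->
  forall J : pred ('I_(n ^ 2) * {ffun 'I_d -> 'I_n}), (n ^ (d + 2) <= 2 * #|J|)%N ->
  (forall p, J p -> w (ltime R p.1) (lpoint R p.2 *m B) <= 1 - et) ->
  forall (s : R) x, 2 <= s <= 3 -> enorm x <= 1 -> w s x <= 1 - et * (gc3 b b').
Proof.
move=> SB /andP[et0 et1] cw w1 Hjet.
have [_ /andP[b0 b1] b'0 HB] := SB.
have [Rd RC] := Rad_ge b0 b'0; have Rad0 : 0 < (Rad b b') by apply: lt_le_trans Rd; rewrite ltr_wpDl // mulr_ge0.
have C0 := CPsi_gt0 d b0; have c0 := cPsi_gt0 d b'; have mu0 := gmu_gt0 b'.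
have k0 := gk_gt0; have c20 := gc2_gt0 b0; have /andP[c30 c31] := gc3_bounds b' b0.
have c2C : (gc2 b) * CPsi d b = 2^-1 by rewrite /gc2; field; rewrite gt_eqF.
pose Q : set (R * E) := `[0, 3]%classic `*` [set x : E | enorm x <= (Rad b b')].
have cQ : compact Q by apply: compact_setX; [exact: segment_compact|exact: compact_ball].
have et2 : 0 < et / 2 by rewrite divr_gt0.
have [del del0 Hdel] := unif_cont cw cQ et2.
(* A lattice finer than the modulus of continuity of [w]: a point with [w >= 1 - et / 2] is then at
   least one lattice step away from every source. The modulus influences [n0] only, not the
   resulting bound. *)
exists (Num.truncn (del^-1)).+1 => n n0n n0 J cJ wJ s0 x0 ss x1.
have n1 : 0 < n%:R :> R by rewrite ltr0n.
have ndel : n%:R^-1 < del.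
  rewrite -[ltRHS]invrK ltf_pV2 ?posrE ?invr_gt0 //.
  apply: lt_le_trans (_ : (Num.truncn (del^-1)).+1%:R <= _); last by rewrite ler_nat.
  by rewrite truncnS_gt.
have n2del : n%:R ^- 2 < del.
  apply: le_lt_trans ndel; rewrite lef_pV2 ?posrE ?exprn_gt0 //.
  by rewrite expr2 ler_peMr // ler1n.
have Qp (p : 'I_(n ^ 2) * {ffun 'I_d -> 'I_n}) : Q (ltime R p.1, lpoint R p.2 *m B).
  split; rewrite /= ?in_itv /=.
    by have /andP[t0 t1] := ltime_bounds R p.1; rewrite t0 /=; move: t1; clra.
  have /andP[_ h] := HB (lpoint R p.2); apply: le_trans h _; apply: le_trans Rd.
  apply: (@le_trans _ _ (b' * d%:R)); last by rewrite lerDl.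
  by rewrite ler_wpM2l // lpoint_le.
have far (s : R) x p : 0 <= s <= 3 -> enorm x <= (Rad b b') -> 1 - et / 2 <= w s x -> J p ->
    del <= `|s - ltime R p.1| \/ del <= enorm (x - lpoint R p.2 *m B).
  move=> s3 xR wsx Jp; apply/orP; rewrite !leNgt -negb_and; apply/negP => /andP[h1 h2].
  have Qx : Q (s, x) by split; rewrite /= ?in_itv.
  have := Hdel (s, x) (ltime R p.1, lpoint R p.2 *m B) Qx (Qp p) h1 h2.
  rewrite /= ltr_norml => /andP[_].
  by have := wJ p Jp; move: wsx; clra.
have PsiC (s : R) x : 0 <= s <= 3 -> enorm x <= (Rad b b') -> 1 - et / 2 <= w s x ->
    Psi B J s x <= CPsi d b.
  move=> s3 xR wsx; apply: (Psi_le SB) => // p Jp ts.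
  have [h|h] := far s x p s3 xR wsx Jp.
    left; rewrite ger0_norm ?subr_ge0 ?(ltW ts) // in h.
    exact: le_trans (ltW n2del) h.
  right; rewrite -exprVn ler_sqr ?nnegrE ?invr_ge0 //.
  exact: le_trans (ltW ndel) h.
have /andP[s02 s03] := ss.
have s00 : 0 <= s0 <= 3 by rewrite s03 andbT; move: s02; clra.
have x0R : enorm x0 <= (Rad b b') by apply: le_trans x1 (le_trans _ Rd); rewrite lerDr mulr_ge0.
(* Where [w] is already low, [gc3 <= 2^-1] gives the claim; the barrier serves the other case. *)
have [wlow|whigh] := leP (w s0 x0) (1 - et / 2).
  apply: le_trans wlow _; rewrite lerD2l lerN2 ler_pM2l //.
rewrite leNgt; apply/negP => Hcontra.
pose G := fun q : R * E => w q.1 q.2 - 1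
   + et * (gc2 b) * (Psi B J q.1 q.2 - (gmu b') * (q.1 + gk * enorm q.2 ^+ 2)).
have G0 : 0 < G (s0, x0).
  rewrite /G /=.
  have h1 : cPsi d b' / 2 <= Psi B J s0 x0 by exact: (Psi_ge SB).
  have h2 : (gmu b') * (s0 + gk * enorm x0 ^+ 2) <= cPsi d b' / 4.
    have e1 : enorm x0 ^+ 2 <= 1 by rewrite exprn_ile1.
    have -> : cPsi d b' / 4 = (gmu b') * (3 + gk).
      by rewrite /gmu; field; rewrite gt_eqF // addr_gt0.
    rewrite ler_pM2l // lerD // -[leRHS]mulr1 ler_pM2l //.
  have h3 : et * ((gc2 b) * (cPsi d b' / 4)) <= et * ((gc2 b) * (Psi B J s0 x0 - (gmu b') * (s0 + gk * enorm x0 ^+ 2))).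
    rewrite ler_pM2l // ler_pM2l //; move: h1 h2; clra.
  have h4 : et * (gc3 b b') <= et * ((gc2 b) * (cPsi d b' / 4)).
    by rewrite ler_pM2l // /gc3 mulrA ge_min lexx orbT.
  by move: h3 h4 Hcontra; clra.
(* Comparison takes place on this superlevel set. Its free boundary [w = 1 - et / 2] cannot carry a
   positive [G], since there [et * gc2 * Psi <= et / 2]. *)
pose K := Q `&` [set q | 1 - et / 2 <= w q.1 q.2].
have cK : compact K.
  apply: compact_closedI => //.
  have := @preimage_closed (R * E)%type R (fun q => w q.1 q.2) [set y | 1 - et / 2 <= y].
  by apply; [move=> q _; exact: cw | exact: closed_ge].
have cG : {within K, continuous G}.
  apply: continuous_in_subspaceT => q; rewrite inE => -[[/= q1 q2] q3].
  rewrite /= in_itv /= in q1.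
  apply: cvgD.
    by apply: cvgB; [exact: cw | exact: cvg_cst].
  apply: cvgM; first exact: cvg_cst.
  apply: cvgB.
    apply: cvgM; first exact: cvg_cst.
    apply: (cvg_sumr (f := fun p (z : R * E) => ker (z.1 - ltime R p.1) (z.2 - lpoint R p.2 *m B))) => p Jp.
    apply: (continuous_comp (f := fun z : R * E => (z.1 - ltime R p.1, z.2 - lpoint R p.2 *m B))
        (g := fun z : R * E => ker z.1 z.2)).
      apply: continuous_pair.
        by apply: continuous_addr; [exact: continuous_fst|exact: continuous_cst].
      by apply: continuous_addr; [exact: continuous_snd|exact: continuous_cst].
    apply: ker_continuous => /=.
    have [h|h] := far q.1 q.2 p q1 q2 q3 Jp.
      by left; rewrite -normr_gt0; exact: lt_le_trans h.
    by right; rewrite -enorm_gt0; exact: lt_le_trans h.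
  apply: cvgM; first exact: cvg_cst.
  apply: cvgD; first exact: cvg_fst.
  apply: cvgM; first exact: cvg_cst.
  apply: (continuous_exprn (f := fun z : R * E => enorm z.2)).
  by apply: (continuous_comp2 (g := fun y : E => enorm y)); [exact: continuous_snd|exact: continuous_enorm].
have K0 : K !=set0.
  exists (s0, x0); split; last by rewrite /=; exact: ltW.
  by split; rewrite /= ?in_itv.
have [[s x]] := compact_EVT_max K0 cK cG.
rewrite inE => -[[/= s3 xR] wsx] Gmax; rewrite /= in_itv /= in s3.
have Gpos : 0 < G (s, x).
  apply: lt_le_trans G0 _; apply: Gmax; rewrite inE; split; last by rewrite /=; exact: ltW.
  by split; rewrite /= ?in_itv.
have PC := PsiC s x s3 xR wsx.
have x2 : 0 <= gk * enorm x ^+ 2 by rewrite mulr_ge0 ?sqr_ge0 // ltW.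
have /andP[s30 s33] := s3.
have w1sx : w s x <= 1 by exact: w1.
have ec0 : 0 < et * (gc2 b) by rewrite mulr_gt0.
have ws : 1 - et / 2 < w s x.
  have h1 : et * (gc2 b) * Psi B J s x <= et * 2^-1.
    by rewrite -c2C mulrA ler_pM2l.
  have h2 : 0 <= et * (gc2 b) * ((gmu b') * (s + gk * enorm x ^+ 2)).
    by rewrite mulr_ge0 ?(ltW ec0) // mulr_ge0 ?(ltW mu0) // addr_ge0.
  by move: Gpos h1 h2; rewrite /G /=; clra.
have Ppos : 0 < Psi B J s x - (gmu b') * (s + gk * enorm x ^+ 2).
  rewrite -(pmulr_rgt0 _ ec0); move: Gpos w1sx; rewrite /G /=; clra.
have sp : 0 < s.
  rewrite lt_neqAle s30 andbT; apply/eqP => sE.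
  move: Ppos; rewrite -sE Psi_early add0r.
  have : 0 <= (gmu b') * (gk * enorm x ^+ 2) by rewrite mulr_ge0 // ltW.
  by clra.
have xlt : enorm x < (Rad b b').
  rewrite lt_neqAle xR andbT; apply/eqP => xE.
  have h : 0 <= (gmu b') * s by rewrite mulr_ge0 // ltW.
  by move: Ppos PC RC h; rewrite xE; clra.
have sp3 : 0 < s <= 3 by rewrite sp.
have wse : 1 - et < w s x by move: ws et0; clra.
have [dt [p [H [S [[Jt Jx] HS HE]]]]] := Hjet s x sp3 xlt wse.
pose act := [pred p | J p && (ltime R p.1 < s)].
pose c : R := (n%:R ^+ (d + 2))^-1.
have c00 : 0 < c by rewrite invr_gt0 exprn_gt0.
have [r r0 Hr] : exists2 r : R, 0 < r & forall p, act p -> r <= s - ltime R p.1.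
  by apply: fin_pos_min => q /andP[_ h]; rewrite subr_gt0.
(* The maximum is tested only backward in time. Over a short time the active sources are then the
   same, and a source starting exactly at time [s] contributes nothing. *)
have PsiA (h : R) y : 0 <= h < r -> Psi B J (s - h) y =
    c * \sum_(p | act p) gker (s - h - ltime R p.1) (y - lpoint R p.2 *m B).
  move=> /andP[h0 hr]; rewrite /Psi -/c; congr (_ * _).
  rewrite (bigID (fun p : 'I_(n ^ 2) * {ffun 'I_d -> 'I_n} => ltime R p.1 < s)) /=.
  rewrite [X in _ + X]big1 ?addr0; last first.
    move=> q /andP[_]; rewrite -leNgt => ht; rewrite /ker.
    by rewrite subr_gt0 ltNge (le_trans _ ht) // gerBl.
  apply: eq_bigr => q aq; rewrite /ker ifT // addrAC subr_gt0.
  exact: lt_le_trans hr (Hr q aq).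
pose gp (q : 'I_(n ^ 2) * {ffun 'I_d -> 'I_n}) := gker (s - ltime R q.1) (x - lpoint R q.2 *m B).
pose tp (q : 'I_(n ^ 2) * {ffun 'I_d -> 'I_n}) := s - ltime R q.1.
pose xp (q : 'I_(n ^ 2) * {ffun 'I_d -> 'I_n}) := x - lpoint R q.2 *m B.
have tp0 q : act q -> 0 < tp q by move=> /andP[_ h]; rewrite subr_gt0.
have Dtime : 0 <= dt + et * (gc2 b) * (c * (\sum_(q | act q)
     gp q * (- km R d / tp q + kth R d * enorm (xp q) ^+ 2 / tp q ^+ 2)) - (gmu b')).
  have D : is_derive s 1 (fun y => w y x + et * (gc2 b) * (c * (\sum_(q | act q)
      gker (y - ltime R q.1) (xp q)) - ((gmu b') * gk * enorm x ^+ 2 + (gmu b') * y)))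
     (dt + et * (gc2 b) * (c * (\sum_(q | act q)
     gp q * (- km R d / tp q + kth R d * enorm (xp q) ^+ 2 / tp q ^+ 2)) - (gmu b'))).
    set dK := (X in is_derive _ _ _ (dt + X)).
    have DK : is_derive s 1 (fun y => et * (gc2 b) * (c * (\sum_(q | act q)
        gker (y - ltime R q.1) (xp q)) - ((gmu b') * gk * enorm x ^+ 2 + (gmu b') * y))) dK;
      last exact: (@is_deriveD R R R _ _ s 1 dt dK Jt DK).
    rewrite /dK.
    apply: (is_deriveZ (f := fun y => c * (\sum_(q | act q)
      gker (y - ltime R q.1) (xp q)) - ((gmu b') * gk * enorm x ^+ 2 + (gmu b') * y))).
    apply: is_deriveB; last exact: is_derive_affine.
    apply: (is_deriveZ (f := fun y => \sum_(q | act q) gker (y - ltime R q.1) (xp q))).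
    apply: is_derive_bigsum => q aq; apply: (is_derive_shiftc (f := fun y => gker y (xp q))).
    by apply: gker_dtime; exact: tp0.
  have cwt : {for 0, continuous (fun h : R => w (s - h) x)}.
    have c1 : continuous (fun h : R => (s - h, x)).
      apply: continuous_pair; last exact: continuous_cst.
      apply: continuous_addr; first exact: continuous_cst.
      by apply: continuous_oppr => h; exact: cvg_id.
    exact: (continuous_comp2 (g := fun z : R * E => w z.1 z.2) c1 cw).
  have /near0P[q q0 Hq] : \forall h \near (0 : R), 1 - et / 2 < w (s - h) x.
    by apply: (cvgr_gt _ cwt); rewrite subr0.
  pose r' := Num.min r (Num.min q s).
  have r'0 : 0 < r' by rewrite !lt_min r0 q0.
  apply: (der_max_l D r'0) => h /andP[h0]; rewrite !lt_min => /and3P[hr hq hs].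
  have wh : 1 - et / 2 < w (s - h) x by apply: Hq; rewrite subr0 ger0_norm.
  have Kh : K (s - h, x).
    split; last by rewrite /=; exact: ltW.
    by split => //=; rewrite in_itv /=; apply/andP; split; move: h0 hs s33; clra.
  have := Gmax (s - h, x); rewrite inE => /(_ Kh); rewrite /G /=.
  have hh : 0 <= h < r by rewrite h0.
  have h00 : (0 : R) <= 0 < r by rewrite lexx.
  rewrite (PsiA h x hh); have := PsiA 0 x h00; rewrite subr0 => ->.
  by rewrite /xp; clra.
have Dspace xi : inner (xi *m H) xi + et * (gc2 b) * (c * (\sum_(q | act q)
     gp q * (- (2 * kth R d * enorm xi ^+ 2 / tp q) + (2 * kth R d * inner (xp q) xi / tp q) ^+ 2))
     - (gmu b') * gk * (2 * enorm xi ^+ 2)) <= 0.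
  have D := D2atD (Jx xi) (D2atZ (et * (gc2 b)) (D2atB (D2atZ c (D2at_bigsum
     (Q := act) (index_enum _) (fun q aq => gker_dspace (xp q) xi (tp0 q aq))))
     (D2atZ ((gmu b') * gk) (D2at_enorm_sqr x xi)))).
  have cwx : {for 0, continuous (fun h : R => w s (x + h *: xi))}.
    have c1 : continuous (fun h : R => (s, x + h *: xi)).
      apply: continuous_pair; first exact: continuous_cst.
      apply: continuous_addr; first exact: continuous_cst.
      by apply: continuous_scale => [h|]; [exact: cvg_id|exact: continuous_cst].
    exact: (continuous_comp2 (g := fun z : R * E => w z.1 z.2) c1 cw).
  have cnx : {for 0, continuous (fun h : R => enorm (x + h *: xi))}.
    have c1 : continuous (fun h : R => x + h *: xi).
      apply: continuous_addr; first exact: continuous_cst.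
      by apply: continuous_scale => [h|]; [exact: cvg_id|exact: continuous_cst].
    exact: (continuous_comp2 (g := fun z : E => enorm z) c1 (@continuous_enorm R d)).
  have /near0P[q q0 Hq] : \forall h \near (0 : R), 1 - et / 2 < w s (x + h *: xi).
    by apply: (cvgr_gt _ cwx); rewrite scale0r addr0.
  have /near0P[q' q'0 Hq'] : \forall h \near (0 : R), enorm (x + h *: xi) < (Rad b b').
    by apply: (cvgr_lt _ cnx); rewrite scale0r addr0.
  have r'0 : 0 < Num.min q q' by rewrite lt_min q0.
  have [] := D2at_max D r'0 => // h; rewrite lt_min => /andP[hq hq'].
  have Kh : K (s, x + h *: xi).
    split; last by rewrite /=; apply: ltW; apply: Hq; rewrite subr0.
    split; first by rewrite /= in_itv /= s30 s33.
    by apply: ltW; apply: Hq'; rewrite subr0.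
  have := Gmax (s, x + h *: xi); rewrite inE => /(_ Kh); rewrite /G /=.
  have h00 : (0 : R) <= 0 < r by rewrite lexx.
  have := PsiA 0 (x + h *: xi) h00; have := PsiA 0 x h00; rewrite subr0 => -> ->.
  have -> : \sum_(p0 | act p0) gker (s - ltime R p0.1) (x + h *: xi - lpoint R p0.2 *m B)
     = \sum_(p0 | act p0) gker (tp p0) (xp p0 + h *: xi).
    by apply: eq_bigr => u _; rewrite addrAC.
  have -> : \sum_(p0 | act p0) gker (tp p0) (xp p0 + 0 *: xi)
     = \sum_(p0 | act p0) gker (s - ltime R p0.1) (x - lpoint R p0.2 *m B).
    by apply: eq_bigr => u _; rewrite scale0r addr0.
  by rewrite scale0r addr0; clra.
have HQ : qsum S H + et * (gc2 b) * (c * (\sum_k \sum_(q | act q)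
     gp q * (- (2 * kth R d * enorm (row k S) ^+ 2 / tp q) + (2 * kth R d * inner (xp q) (row k S) / tp q) ^+ 2))
     - 2 * (gmu b') * gk * enorm S ^+ 2) <= 0.
  rewrite qsumE enorm_row_sum !mulr_sumr -sumrB mulr_sumr -big_split /=.
  apply: sumr_le0 => k _; apply: le_trans (Dspace (row k S)).
  by clra.
have sub : \sum_(q | act q) gp q * (- km R d / tp q + kth R d * enorm (xp q) ^+ 2 / tp q ^+ 2) <=
   2^-1 * \sum_k \sum_(q | act q)
     gp q * (- (2 * kth R d * enorm (row k S) ^+ 2 / tp q) + (2 * kth R d * inner (xp q) (row k S) / tp q) ^+ 2).
  rewrite exchange_big /= mulr_sumr; apply: ler_sum => q aq.
  exact: gker_subsol (tp0 q aq) HS.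
have [S1 _] := near_id_bounds x HS.
have kS : gk * enorm S ^+ 2 <= 2^-1.
  apply: (@le_trans _ _ (gk * (d%:R + 1))).
    by rewrite ler_pM2l //; move: S1; clra.
  by rewrite /gk; have d1 : d%:R + 1 != 0 :> R; [rewrite gt_eqF // ltr_wpDl | rewrite le_eqVlt; apply/orP; left; apply/eqP; field].
have sub' : et * (gc2 b) * (c * \sum_(q | act q) gp q * (- km R d / tp q + kth R d * enorm (xp q) ^+ 2 / tp q ^+ 2))
   <= et * (gc2 b) * (c * (2^-1 * \sum_k \sum_(q | act q)
     gp q * (- (2 * kth R d * enorm (row k S) ^+ 2 / tp q) + (2 * kth R d * inner (xp q) (row k S) / tp q) ^+ 2))).
  by rewrite ler_pM2l // ler_pM2l.
have kS' : et * (gc2 b) * (gmu b') * (gk * enorm S ^+ 2) <= et * (gc2 b) * (gmu b') * 2^-1.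
  by rewrite ler_wpM2l // mulr_ge0 ?(ltW ec0) // ltW.
have e0 : 0 < et * (gc2 b) * (gmu b') by rewrite mulr_gt0.
by move: Dtime HQ sub' kS' e0 HE; rewrite /gdel; clra.
Qed.

End Growth.

(** * Oscillation decay and the gradient bound *)

Section Oscillation.
Variables (R : realType) (d : nat).
Local Notation E := 'rV[R]_d.

(** Equality of left and right singular values, for the smallest one: with [xi = w *m invmx A], the
    square of |w| is the inner product of [w *m A^T] and [xi], and Cauchy-Schwarz applies. *)
Lemma elliptic_tr (A : 'M[R]_d) (sl : R) : 0 < sl ->
  (forall xi : E, sl * enorm xi <= enorm (xi *m A)) ->
  A \in unitmx /\ forall xi : E, sl * enorm xi <= enorm (xi *m A^T).
Proof.
move=> sl0 ell.
have uA : A \in unitmx.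
  rewrite -row_free_unit; apply: inj_row_free => v v0.
  apply/eqP; rewrite -enorm_eq0 eq_le enorm_ge0 andbT -(pmulr_rle0 _ sl0).
  by apply: le_trans (ell v) _; rewrite v0 enorm0.
split=> // w; pose xi := w *m invmx A.
have xiA : xi *m A = w by rewrite /xi mulmxKV.
have [->|w0] := eqVneq w 0; first by rewrite mul0mx enorm0 mulr0.
have wp : 0 < enorm w by rewrite enorm_gt0.
have h1 : enorm w ^+ 2 <= enorm (w *m A^T) * enorm xi.
  rewrite -inner_xx -{2}xiA innerC inner_mul innerC.
  by apply: le_trans (ler_norm _) _; exact: CauchySchwarz.
have h2 := ell xi; rewrite xiA in h2.
rewrite -(ler_pM2r wp) -mulrA -expr2.
apply: (@le_trans _ _ (enorm (w *m A^T) * (sl * enorm xi))).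
  by rewrite [leRHS]mulrCA ler_pM2l.
by rewrite ler_wpM2l.
Qed.

Lemma enorm_mul_inv (A M : 'M[R]_d) (sl : R) : 0 < sl -> A \in unitmx ->
  (forall xi : E, sl * enorm xi <= enorm (xi *m A)) ->
  sl * enorm (M *m invmx A) <= enorm M.
Proof.
move=> sl0 uA ell; rewrite -ler_sqr ?nnegrE ?mulr_ge0 ?(ltW sl0) // exprMn !enorm_row_sum mulr_sumr.
apply: ler_sum => k _; rewrite -exprMn ler_sqr ?nnegrE ?mulr_ge0 ?(ltW sl0) //.
by apply: le_trans (ell _) _; rewrite -row_mul mulmxKV.
Qed.

Lemma continuous_mulmxr (A : 'M[R]_d) : continuous (fun z : E => z *m A).
Proof.
move=> x; apply/(@cvgrPdist_lt _ _ _ (nbhs x)) => e e0.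
have c0 : 0 < d%:R * enorm A + 1 by rewrite ltr_wpDl // mulr_ge0.
near=> y; rewrite -mulmxBl.
apply: le_lt_trans (mxnorm_le_enorm _) _.
apply: le_lt_trans (enorm_mulmx _ _) _.
apply: (@le_lt_trans _ _ (d%:R * `|x - y| * enorm A)).
  by rewrite ler_wpM2r // enorm_le_mxnorm.
apply: (@le_lt_trans _ _ ((d%:R * enorm A + 1) * `|x - y|)).
  by rewrite mulrAC ler_wpM2r // lerDl.
rewrite -ltr_pdivlMl // mulrC.
by near: y; apply: (@cvgr_dist_lt _ _ _ _ _ id) => //; rewrite divr_gt0.
Unshelve. all: by end_near. Qed.

(** Unlike in [quasilinear], sigma is kept as a function of (x, u): it can then be frozen at the
    pair made of the centre and the upper bound of [u]. *)
Record qsol (T C1 C2 L sl M0 : R) (u : R -> E -> R) (sg : E -> R -> 'M[R]_d) : Prop := QSol {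
  qs_cont : continuous (fun z : R * E => u z.1 z.2);
  qs_bound : forall (t : R) x, 0 < t <= T -> `|u t x| <= M0;
  qs_sigma : forall x (y : R), `|y| <= M0 -> enorm (sg x y) <= C2;
  qs_lip : forall x (y : R) x' (y' : R),
    enorm (sg x y - sg x' y') <= L * (enorm (x - x') + `|y - y'|);
  qs_ell : forall x (y : R) (xi : E), sl * enorm xi <= enorm (xi *m sg x y);
  qs_pde : pde T u (fun t x => (sg x (u t x))^T) (fun _ q _ => C1 * (1 + q ^+ 2)) }.

Lemma qsolN T C1 C2 L sl M0 (u : R -> E -> R) sg : qsol T C1 C2 L sl M0 u sg ->
  qsol T C1 C2 L sl M0 (fun t x => - u t x) (fun x y => sg x (- y)).
Proof.
move=> [h1 h2 h3 h4 h5 h6]; split => //.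
- exact: continuous_oppr.
- by move=> t x tT; rewrite normrN; exact: h2.
- by move=> x y yM; apply: h3; rewrite normrN.
- by move=> x y x' y'; apply: le_trans (h4 _ _ _ _) _; rewrite -opprD normrN.
- have := pdeN h6; congr pde; apply/funext => t; apply/funext => x.
  by rewrite opprK.
Qed.

(** [Gam] is the rate in w = exp(Gam (u - M)), with [Gam / 2 * sl ^+ 2 >= C1]. The other two
    translate between [u] and [w]: [u <= M - eta] means [w <= 1 - drop], and [w <= 1 - drop * gc3]
    gives back [u <= M - gain]. *)
Definition Gam (C1 sl : R) : R := 2 * C1 / sl ^+ 2 + 1.
Definition drop (C1 sl eta : R) : R := 1 - expR (- (Gam C1 sl * eta)).
Definition gain (C1 C2 sl eta : R) : R :=
  drop C1 sl eta * gc3 d C2^-1 sl^-1 / Gam C1 sl.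
Definition wid (C2 sl : R) : R := Rad d C2^-1 sl^-1 * C2.

(** The first condition puts sigma within relative distance [keps] of its frozen value wherever [u]
    is within [eta] of [M]; the second puts the rescaled lower-order terms below the surplus [gdel]
    of the barrier. *)
Definition small_scale (C1 C2 L sl eta r : R) : Prop :=
  L * (r * wid C2 sl + eta) <= sl * keps R d /\
  Gam C1 sl * C1 * r ^+ 2 <= drop C1 sl eta * gdel d C2^-1 sl^-1.

Lemma Gam_gt0 (C1 sl : R) : 0 <= C1 -> 0 < sl -> 0 < Gam C1 sl.
Proof.
move=> c0 s0; rewrite /Gam; apply: ltr_wpDl; last exact: ltr01.
by apply: divr_ge0; [exact: mulr_ge0|exact: sqr_ge0].
Qed.

Lemma drop_bounds (C1 sl eta : R) : 0 <= C1 -> 0 < sl -> 0 < eta ->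
  0 < drop C1 sl eta < 1 /\ drop C1 sl eta <= Gam C1 sl * eta.
Proof.
move=> c0 s0 e0; have g0 := Gam_gt0 c0 s0.
have ge : 0 < Gam C1 sl * eta by rewrite mulr_gt0.
have h1 : expR (- (Gam C1 sl * eta)) < 1 by rewrite -[ltRHS]expR0 ltr_expR oppr_lt0.
have h2 := expR_gt0 (- (Gam C1 sl * eta)).
have h3 := expR_ge1Dx (- (Gam C1 sl * eta)).
by rewrite /drop; split; [apply/andP; split|]; move: h1 h2 h3; clra.
Qed.

Lemma gain_bounds (C1 C2 sl eta : R) : 0 <= C1 -> 0 < C2 -> 0 < sl -> 0 < eta ->
  0 < gain C1 C2 sl eta <= eta.
Proof.
move=> c0 c2 s0 e0; have g0 := Gam_gt0 c0 s0.
have [/andP[d0 d1] d2] := drop_bounds c0 s0 e0.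
have c2' : 0 < C2^-1 by rewrite invr_gt0.
have /andP[h1 h2] := gc3_bounds d sl^-1 c2'.
rewrite /gain divr_gt0 ?mulr_gt0 //= ler_pdivrMr //.
apply: (@le_trans _ _ (drop C1 sl eta * 1)).
  by rewrite ler_pM2l //; move: h2; clra.
by rewrite mulr1 mulrC.
Qed.

Lemma wid_gt0 (C2 sl : R) : 1 <= C2 -> 0 < sl -> 0 < wid C2 sl.
Proof.
move=> c21 sl0; have c20 : 0 < C2 by apply: lt_le_trans c21.
rewrite mulr_gt0 //.
have c2' : 0 < C2^-1 by rewrite invr_gt0.
have s' : 0 <= sl^-1 by rewrite invr_ge0 ltW.
have [h _] := Rad_ge d c2' s'; apply: lt_le_trans h; apply: ltr_wpDl; last exact: ltr01.
exact: mulr_ge0.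
Qed.

Lemma one_sided (T C1 C2 L sl M0 : R) (u : R -> E -> R) (sg : E -> R -> 'M[R]_d) (eta r M ts : R) (xs : E) :
  0 <= C1 -> 1 <= C2 -> 0 <= L -> 0 < sl -> 0 < eta -> 0 < r ->
  qsol T C1 C2 L sl M0 u sg ->
  small_scale C1 C2 L sl eta r ->
  `|M| <= M0 -> 0 < ts -> ts + 3 * r ^+ 2 <= T ->
  (forall (t : R) x, ts <= t <= ts + 3 * r ^+ 2 -> enorm (x - xs) <= r * wid C2 sl -> u t x <= M) ->
  exists n0 : nat, forall n, (n0 <= n)%N -> (0 < n)%N ->
  forall J : pred ('I_(n ^ 2) * {ffun 'I_d -> 'I_n}), (n ^ (d + 2) <= 2 * #|J|)%N ->
  (forall p, J p -> u (ts + r ^+ 2 * (3 - ltime R p.1)) (xs + r *: lpoint R p.2) <= M - eta) ->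
  forall (t : R) x, ts <= t <= ts + r ^+ 2 -> enorm (x - xs) <= r * sl ->
    u t x <= M - gain C1 C2 sl eta.
Proof.
move=> C10 C21 L0 sl0 e0 r0 Q [sc1 sc2] MM ts0 tsT uM.
have [cu ub sgb sgl ell HP] := Q.
have C20 : 0 < C2 by apply: lt_le_trans C21.
have G0 := Gam_gt0 C10 sl0.
have [/andP[d0 d1] _] := drop_bounds C10 sl0 e0.
set Ga := Gam C1 sl in G0 sc2 *; set et := drop C1 sl eta in d0 d1 sc2 *.
pose S0 := (sg xs M)^T.
have ell0 (xi : E) : sl * enorm xi <= enorm (xi *m S0^T) by rewrite trmxK; exact: ell.
have [uS _] := elliptic_tr sl0 ell0.
have uS0 : S0 \in unitmx by rewrite -unitmx_tr.
have [_ ell1] := elliptic_tr sl0 (fun xi => ell xs M xi).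
have S0C : enorm S0 <= C2 by rewrite enorm_tr; exact: sgb.
pose B := invmx S0.
have SB : spread B C2^-1 sl^-1.
  split; first by rewrite unitmx_inv.
  - by rewrite invr_gt0 C20 invf_le1.
  - by rewrite invr_ge0 ltW.
  move=> xi; have xB : xi *m B *m S0 = xi by rewrite mulmxKV.
  apply/andP; split.
    rewrite mulrC ler_pdivrMr // -{1}xB.
    by apply: le_trans (enorm_mulmx _ _) _; rewrite ler_wpM2l.
  rewrite mulrC ler_pdivlMr // mulrC -{2}xB.
  exact: ell1.
have r20 : 0 < r ^+ 2 by rewrite exprn_gt0.
(* Time is reversed, as the data are terminal: the sources, at [s] in [0, 1], are the latest times,
   and the target [2, 3] is the interval from [ts] to [ts + r ^+ 2]. *)
pose tt (s : R) := ts + r ^+ 2 * (3 - s).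
pose yy (z : E) := xs + r *: (z *m S0).
pose w (s : R) (z : E) := expR (Ga * (u (tt s) (yy z) - M)).
have ttb (s : R) : 0 <= s <= 3 -> ts <= tt s <= ts + 3 * r ^+ 2.
  move=> /andP[s0 s3]; rewrite /tt lerDl mulr_ge0 ?(ltW r20) ?subr_ge0 //= lerD2l mulrC.
  by rewrite ler_wpM2r ?(ltW r20) // lerBlDr lerDl.
have yyb z (rho : R) : enorm z <= rho -> enorm (yy z - xs) <= r * (rho * C2).
  move=> zr; rewrite /yy addrAC subrr add0r enormZ gtr0_norm // ler_pM2l //.
  apply: le_trans (enorm_mulmx _ _) _; apply: ler_pM => //.
have cw : continuous (fun z : R * E => w z.1 z.2).
  apply: (continuous_comp2 (g := expR)); last exact: continuous_expR.
  apply: continuous_mulr; first exact: continuous_cst.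
  apply: continuous_addr; last exact: continuous_cst.
  apply: (continuous_comp2 (f := fun z : R * E => (tt z.1, yy z.2)) (g := fun z : R * E => u z.1 z.2)) => //.
  apply: continuous_pair.
    apply: continuous_addr; first exact: continuous_cst.
    apply: continuous_mulr; first exact: continuous_cst.
    apply: continuous_addr; first exact: continuous_cst.
    by apply: continuous_oppr; exact: continuous_fst.
  apply: continuous_addr; first exact: continuous_cst.
  apply: continuous_scale; first exact: continuous_cst.
  apply: (continuous_comp2 (g := fun z : E => z *m S0)); first exact: continuous_snd.
  exact: continuous_mulmxr.
have w1 (s : R) z : 0 <= s <= 3 -> enorm z <= Rad d C2^-1 sl^-1 -> w s z <= 1.
  move=> s3 zR; rewrite /w -[leRHS]expR0 ler_expR pmulr_rle0 // subr_le0.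
  by apply: uM; [exact: ttb|exact: yyb].
have [|n0 Hn] := growth SB (introT andP (conj d0 d1)) cw w1.
  move=> s z /andP[s0 s3] zR wz.
  have s03 : 0 <= s <= 3 by rewrite (ltW s0).
  have /andP[t1 t2] := ttb s s03.
  have tin : 0 < tt s < T.
    rewrite (lt_le_trans ts0) //=; apply: lt_le_trans tsT.
    rewrite /tt ltrD2l mulrC ltr_pM2r //; move: s0; clra.
  have [dt [p [H [[Jt Jx] BB]]]] := HP (tt s) (yy z) tin.
  set y := yy z in Jt Jx BB; set U := u (tt s) y in BB.
  set S := (sg y U)^T in BB.
  pose W := w s z.
  have W0 : 0 < W by exact: expR_gt0.
  have W1 : W <= 1 by apply: w1 => //; exact: ltW.
  have UM : U <= M by apply: uM; [rewrite t1|apply: yyb; exact: ltW].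
  have Ulow : M - eta < U.
    move: wz; rewrite /et /drop subKr /w ltr_expR -mulrN ltr_pM2l //.
    by rewrite -/y -/U; clra.
  exists (- (W * (Ga * r ^+ 2) * dt)), ((W * (Ga * r)) *: (p *m S0^T)),
    (W *: ((Ga * r ^+ 2) *: (S0 *m H *m S0^T) + (Ga * r) ^+ 2 *: ((S0 *m p^T) *m (p *m S0^T)))),
    (S *m invmx S0).
  split.
  - split.
      have D0 : is_derive (tt s) 1 (fun t => expR (Ga * (u t y - M))) (W * (Ga * dt)).
        apply: (@is_derive1_comp R expR (fun t => Ga * (u t y - M))).
        have := is_deriveZ (f := fun t => u t y - M) Ga (is_deriveB Jt (is_derive_cst M (tt s) 1)).
        by move=> D; apply: (is_derive_eq D); rewrite /GRing.scale /= subr0.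
      have D1 : is_derive s 1 tt (- r ^+ 2).
        apply: is_derive_ext (is_derive_affine (ts + r ^+ 2 * 3) (- r ^+ 2) s) => q.
        by rewrite /tt; ring.
      have := is_derive1_comp D0 D1 => D; apply: (is_derive_eq D).
      by ring.
    move=> xi.
    have D := D2at_exp (D2atB (D2atZ Ga (Jx (r *: (xi *m S0)))) (D2at_cst (Ga * M))).
    have -> : (fun q => w s (z + q *: xi)) =
        (fun q => expR (Ga * u (tt s) (y + q *: (r *: (xi *m S0))) - Ga * M)).
      apply/funext => q.
      have yE : yy (z + q *: xi) = y + q *: (r *: (xi *m S0)).
        by rewrite /y /yy mulmxDl scalerDr addrA -scalemxAl !scalerA mulrC.
      by rewrite /w yE mulrBr.
    move: D; rewrite scale0r addr0 -/U.
    have -> : expR (Ga * U - Ga * M) = W by rewrite -mulrBr.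
    have e1 : inner (W * (Ga * r) *: (p *m S0^T)) xi = W * (Ga * inner p (r *: (xi *m S0)) - 0).
      rewrite innerZl inner_mul trmxK innerZr; ring.
    have e2 : inner (xi *m (S0 *m H *m S0^T)) xi = inner (xi *m S0 *m H) (xi *m S0).
      by rewrite !mulmxA inner_mul trmxK.
    have e3 : inner (xi *m ((S0 *m p^T) *m (p *m S0^T))) xi = inner p (xi *m S0) ^+ 2.
      rewrite !mulmxA inner_mul trmxK.
      have -> : xi *m S0 *m p^T *m p = inner (xi *m S0) p *: p.
        by rewrite -[RHS]mul_scalar_mx /inner -mx11_scalar.
      by rewrite innerZl (innerC _ p) expr2.
    have e4 : inner (xi *m (W *: ((Ga * r ^+ 2) *: (S0 *m H *m S0^T) + (Ga * r) ^+ 2 *: ((S0 *m p^T) *m (p *m S0^T))))) xi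
      = W * (Ga * inner (r *: (xi *m S0) *m H) (r *: (xi *m S0)) - 0 + (Ga * inner p (r *: (xi *m S0)) - 0) ^+ 2).
      rewrite -scalemxAr innerZl mulmxDr innerDl -!scalemxAr !innerZl e2 e3.
      by rewrite -scalemxAl !innerZr innerZl; ring.
    by rewrite e1 e4.
  - rewrite -(ler_pM2l sl0); apply: le_trans sc1.
    have -> : S *m invmx S0 - 1%:M = (S - S0) *m invmx S0 by rewrite mulmxBl mulmxV.
    apply: le_trans (enorm_mul_inv _ sl0 uS0 ell1) _.
    rewrite /S /S0 -linearB /= enorm_tr; apply: le_trans (sgl _ _ _ _) _.
    rewrite ler_wpM2l // lerD //.
      by rewrite /wid; apply: yyb; exact: ltW.
    by rewrite ler_norml; apply/andP; split; move: UM Ulow e0; clra.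
  - have qE : qsum (S *m invmx S0) (W *: ((Ga * r ^+ 2) *: (S0 *m H *m S0^T) + (Ga * r) ^+ 2 *: ((S0 *m p^T) *m (p *m S0^T))))
       = W * (Ga * r ^+ 2 * qsum S H + (Ga * r) ^+ 2 * enorm (p *m S^T) ^+ 2).
      have kS : S *m invmx S0 *m S0 = S by rewrite mulmxKV.
      have kST : S0^T *m (S *m invmx S0)^T = S^T by rewrite -trmx_mul kS.
      rewrite /qsum -scalemxAr -scalemxAl mxtraceZ mulmxDr mulmxDl mxtraceD.
      rewrite -!scalemxAr -!scalemxAl !mxtraceZ; congr (_ * (_ * _ + _ * _)).
        by rewrite !mulmxA kS -!mulmxA kST.
      rewrite !mulmxA kS -!mulmxA kST mulmxA.
      have -> : S *m p^T *m (p *m S^T) = (p *m S^T)^T *m (p *m S^T) by rewrite trmx_mul trmxK.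
      by rewrite mxtrace_mulC trace_mx11 -inner_xx /inner.
    rewrite qE.
    have pS : sl ^+ 2 * enorm p ^+ 2 <= enorm (p *m S^T) ^+ 2.
      rewrite -exprMn ler_sqr ?nnegrE ?mulr_ge0 ?(ltW sl0) //.
      by rewrite /S trmxK; exact: ell.
    move: BB; rewrite ler_norml => /andP[BB _].
    (* By ellipticity and the choice of [Gam], the square produced by the exponential dominates
       [C1 * enorm p ^+ 2]. *)
    have key : - dt - 2^-1 * qsum S H - 2^-1 * Ga * enorm (p *m S^T) ^+ 2 <= C1.
      have g1 : Ga * (sl ^+ 2 * enorm p ^+ 2) <= Ga * enorm (p *m S^T) ^+ 2 by rewrite ler_pM2l.
      have g2 : Ga * (sl ^+ 2 * enorm p ^+ 2) = 2 * C1 * enorm p ^+ 2 + sl ^+ 2 * enorm p ^+ 2.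
        by rewrite /Ga /Gam; field; rewrite gt_eqF.
      have g3 : 0 <= sl ^+ 2 * enorm p ^+ 2 by rewrite mulr_ge0 ?sqr_ge0.
      by move: BB g1 g2 g3; clra.
    have WG : 0 <= W * (Ga * r ^+ 2) by rewrite !mulr_ge0 // ltW.
    have h1 := ler_wpM2l WG key.
    have h2 : W * (Ga * r ^+ 2) * C1 <= 1 * (Ga * r ^+ 2) * C1.
      by rewrite ler_wpM2r // ler_wpM2r // mulr_ge0 // ltW.
    by move: h1 h2 sc2; clra.
exists n0 => n n0n n1 J cJ HJ t x /andP[tt1 tt2] xx.
pose s := 3 - (t - ts) / r ^+ 2.
have st : tt s = t by rewrite /tt /s subKr mulrC divfK ?gt_eqF // addrC subrK.
pose z := r^-1 *: ((x - xs) *m B).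
have zx : yy z = x.
  rewrite /yy /z -scalemxAl mulmxKV // scalerA divff ?gt_eqF // scale1r addrC subrK //.
have zz : enorm z <= 1.
  rewrite -(ler_pM2l sl0) mulr1; apply: le_trans (ell1 _) _.
  rewrite -/S0 /z -scalemxAl; have -> : (x - xs) *m B *m S0 = x - xs by rewrite mulmxKV.
  by rewrite enormZ gtr0_norm ?invr_gt0 // ler_pdivrMl.
have ss : 2 <= s <= 3.
  have h1 : 0 <= (t - ts) / r ^+ 2 by rewrite divr_ge0 ?subr_ge0 // ltW.
  have h2 : (t - ts) / r ^+ 2 <= 1 by rewrite ler_pdivrMr // mul1r lerBlDl.
  by rewrite /s; apply/andP; split; move: h1 h2; clra.
have := Hn n n0n n1 J cJ _ s z ss zz.
rewrite /w st zx => H1.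
have {}H1 : expR (Ga * (u t x - M)) <= 1 - et * gc3 d C2^-1 sl^-1.
  apply: H1 => p Jp.
  have -> : yy (lpoint R p.2 *m B) = xs + r *: lpoint R p.2 by rewrite /yy mulmxKV.
  have -> : 1 - et = expR (- (Ga * eta)) by rewrite /et /drop subKr.
  rewrite ler_expR -mulrN ler_pM2l //.
  by have := HJ p Jp; rewrite /tt; clra.
have c2' : 0 < C2^-1 by rewrite invr_gt0.
have /andP[h1 h2] := gc3_bounds d sl^-1 c2'.
have h3 := expR_ge1Dx (Ga * (u t x - M)).
have h4 : Ga * (u t x - M) <= - (et * gc3 d C2^-1 sl^-1) by move: h3 H1; clra.
have : u t x - M <= - gain C1 C2 sl eta.
  rewrite /gain -/et -/Ga -mulNr ler_pdivlMr // mulrC; exact: h4.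
by clra.
Qed.

(** As [2 * eta <= M - m], every lattice point not in [J] satisfies [u >= m + eta]. Either [J] or
    its complement holds half of the lattice, and [one_sided] applies to [u] or to its opposite,
    with a common [n]. *)
Lemma osc_step (T C1 C2 L sl M0 : R) (u : R -> E -> R) (sg : E -> R -> 'M[R]_d)
    (eta r m M ts : R) (xs : E) :
  0 <= C1 -> 1 <= C2 -> 0 <= L -> 0 < sl -> 0 < eta -> 0 < r ->
  qsol T C1 C2 L sl M0 u sg ->
  small_scale C1 C2 L sl eta r ->
  `|m| <= M0 -> `|M| <= M0 -> 2 * eta <= M - m -> 0 < ts -> ts + 3 * r ^+ 2 <= T ->
  (forall (t : R) x, ts <= t <= ts + 3 * r ^+ 2 -> enorm (x - xs) <= r * wid C2 sl ->
     m <= u t x <= M) ->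
  (forall (t : R) x, ts <= t <= ts + r ^+ 2 -> enorm (x - xs) <= r * sl ->
     u t x <= M - gain C1 C2 sl eta) \/
  (forall (t : R) x, ts <= t <= ts + r ^+ 2 -> enorm (x - xs) <= r * sl ->
     m + gain C1 C2 sl eta <= u t x).
Proof.
move=> C10 C21 L0 sl0 e0 r0 Q sc mM MM gap ts0 tsT umM.
have [|n1 H1] := one_sided C10 C21 L0 sl0 e0 r0 Q sc MM ts0 tsT (xs := xs).
  by move=> t x tt xx; have /andP[] := umM t x tt xx.
have [||n2 H2] := one_sided C10 C21 L0 sl0 e0 r0 (qsolN Q) sc (M := - m) _ ts0 tsT (xs := xs).
- by rewrite normrN.
- by move=> t x tt xx; have /andP[h _] := umM t x tt xx; rewrite lerN2.
pose n := (maxn n1 n2).+1.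
have n1n : (n1 <= n)%N by rewrite leqW // leq_maxl.
have n2n : (n2 <= n)%N by rewrite leqW // leq_maxr.
pose J : pred ('I_(n ^ 2) * {ffun 'I_d -> 'I_n}) :=
  [pred p | u (ts + r ^+ 2 * (3 - ltime R p.1)) (xs + r *: lpoint R p.2) <= M - eta].
have cJ : (#|J| + #|predC J| = n ^ (d + 2))%N.
  by rewrite cardC card_prod card_ffun !card_ord -expnD addnC.
have [h|h] := leqP (n ^ (d + 2)) (2 * #|J|).
  by left => t x; exact: (H1 n n1n _ J h).
right => t x tt xx.
suff : - u t x <= - m - gain C1 C2 sl eta by clra.
apply: (H2 n n2n _ (predC J)) => //.
  by rewrite -cJ mul2n -addnn leq_add2r; move: h; rewrite -cJ mul2n -addnn ltn_add2l => /ltnW.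
move=> p; rewrite /= -ltNge; move: gap; clra.
Qed.

(** Ratio of successive radii: the wide cylinder of the next step must lie in the narrow one of
    radius [r * sl] and duration [r ^+ 2]. *)
Definition kap (C2 sl : R) : R := Num.min 2^-1 (sl / wid C2 sl).

Lemma kap_bounds (C2 sl : R) : 1 <= C2 -> 0 < sl -> 0 < kap C2 sl <= 2^-1.
Proof.
move=> c2 s0; have w0 := wid_gt0 c2 s0.
by rewrite /kap ge_min lexx andbT lt_min invr_gt0 ltr0n /= divr_gt0.
Qed.

Lemma small_scale_le (C1 C2 L sl eta r r' : R) :
  0 <= C1 -> 1 <= C2 -> 0 <= L -> 0 < sl -> 0 <= r' <= r ->
  small_scale C1 C2 L sl eta r -> small_scale C1 C2 L sl eta r'.
Proof.
move=> c1 c2 l0 s0 /andP[r0 rr] [h1 h2]; have w0 := wid_gt0 c2 s0; split.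
  by apply: le_trans h1; rewrite ler_wpM2l // lerD2r ler_wpM2r // ltW.
apply: le_trans h2; rewrite ler_wpM2l ?mulr_ge0 ?(ltW (Gam_gt0 c1 s0)) //.
by rewrite ler_sqr ?nnegrE //; exact: le_trans rr.
Qed.

(** Each step removes the fixed amount [gain] from the gap until it falls below [2 * eta]. As [eta]
    is fixed, the decay is arithmetic and the number of steps is known in advance; all cylinders
    start at the same time [ts]. *)
Lemma osc_iter (T C1 C2 L sl M0 : R) (u : R -> E -> R) (sg : E -> R -> 'M[R]_d)
    (eta ts : R) (xs : E) :
  0 <= C1 -> 1 <= C2 -> 0 <= L -> 0 < sl -> 0 < eta ->
  qsol T C1 C2 L sl M0 u sg -> 0 < ts ->
  forall k (r m M : R), 0 < r -> small_scale C1 C2 L sl eta r ->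
  ts + 3 * r ^+ 2 <= T -> - M0 <= m -> M <= M0 -> M - m <= 2 * eta + k%:R * gain C1 C2 sl eta ->
  (forall (t : R) x, ts <= t <= ts + 3 * r ^+ 2 -> enorm (x - xs) <= r * wid C2 sl ->
     m <= u t x <= M) ->
  exists m' M', M' - m' <= 2 * eta /\
   forall x, enorm (x - xs) <= kap C2 sl ^+ k * r * wid C2 sl -> m' <= u ts x <= M'.
Proof.
move=> C10 C21 L0 sl0 e0 Q ts0; have w0 := wid_gt0 C21 sl0.
have C20 : 0 < C2 by apply: lt_le_trans C21.
have /andP[k0 k2] := kap_bounds C21 sl0.
have /andP[g0 ge] := gain_bounds C10 C20 sl0 e0.
have tsin (r : R) : ts <= ts <= ts + 3 * r ^+ 2.
  by rewrite lexx lerDl mulr_ge0 ?sqr_ge0.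
elim=> [|k IH] r m M r0 sc tsT m0 M0' gap umM.
  exists m, M; split; first by move: gap; rewrite mul0r addr0.
  by move=> x; rewrite expr0 mul1r => xx; exact: umM.
have [small|big] := leP (M - m) (2 * eta).
  exists m, M; split => // x xx; apply: umM => //.
  apply: le_trans xx _; rewrite ler_pM2r // ger_pMl // exprn_ile1 ?(ltW k0) //.
  by apply: le_trans k2 _; rewrite invf_le1 // ler1n.
have mM : `|m| <= M0 by rewrite ler_norml m0 /=; move: big M0' e0; clra.
have MM : `|M| <= M0 by rewrite ler_norml M0' andbT; move: big m0 e0; clra.
pose r' := kap C2 sl * r.
have r'0 : 0 < r' by rewrite mulr_gt0.
have r'r : r' <= r.
  by rewrite ger_pMl //; apply: le_trans k2 _; rewrite invf_le1 // ler1n.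
have r'3 : 3 * r' ^+ 2 <= r ^+ 2.
  rewrite exprMn mulrA ger_pMl ?exprn_gt0 //.
  have : kap C2 sl ^+ 2 <= 2^-1 ^+ 2 by rewrite ler_sqr ?nnegrE // ltW.
  by clra.
have r'w : r' * wid C2 sl <= r * sl.
  rewrite mulrAC mulrC ler_pM2l // -ler_pdivlMr // /kap ge_min lexx orbT //.
have sc' : small_scale C1 C2 L sl eta r' by apply: (small_scale_le C10 C21 L0 sl0 _ sc); rewrite (ltW r'0).
have tsT' : ts + 3 * r' ^+ 2 <= T.
  by move: tsT r'3 (sqr_ge0 r); clra.
have krE : kap C2 sl ^+ k.+1 * r = kap C2 sl ^+ k * r' by rewrite exprS /r'; ring.
have gapS : M - m - gain C1 C2 sl eta <= 2 * eta + k%:R * gain C1 C2 sl eta.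
  by move: gap; rewrite -natr1; clra.
rewrite krE.
have sub (t : R) : ts <= t <= ts + 3 * r' ^+ 2 -> ts <= t <= ts + r ^+ 2 /\ ts <= t <= ts + 3 * r ^+ 2.
  move=> /andP[a b]; rewrite a /=; split; move: b r'3 (sqr_ge0 r); clra.
have subx x : enorm (x - xs) <= r' * wid C2 sl -> enorm (x - xs) <= r * sl /\ enorm (x - xs) <= r * wid C2 sl.
  move=> h; split; first exact: le_trans r'w.
  by apply: le_trans h _; rewrite ler_pM2r.
have [up|dn] := osc_step C10 C21 L0 sl0 e0 r0 Q sc mM MM (ltW big) ts0 tsT umM.
  apply: (IH r' m (M - gain C1 C2 sl eta)) => //.
  - by move: M0' g0; clra.
  - by move: gapS; clra.
  move=> t x /sub[t1 t2] /subx[x1 x2]; have /andP[-> _] := umM t x t2 x2.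
  by rewrite up.
apply: (IH r' (m + gain C1 C2 sl eta) M) => //.
- by move: m0 g0; clra.
- by move: gapS; clra.
move=> t x /sub[t1 t2] /subx[x1 x2]; have /andP[_ ->] := umM t x t2 x2.
by rewrite dn.
Qed.

(** The iteration needs the time [3 * r1 ^+ 2] after [t]. When [T] is closer, the oscillation is
    controlled by the linear estimate near [T] and the Lipschitz terminal value. *)
Lemma small_osc (C1 C2 L sl M0 C0 LH eta : R) :
  0 <= C1 -> 1 <= C2 -> 0 <= L -> 0 < sl -> 0 <= C0 -> 0 <= LH -> 0 < eta ->
  L * eta <= sl * keps R d / 2 ->
  exists2 r0 : R, 0 < r0 & forall (T : R) (u : R -> E -> R) (sg : E -> R -> 'M[R]_d),
  qsol T C1 C2 L sl M0 u sg ->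
  (forall (t : R) x, 0 < t <= T -> `|u t x - u T x| <= C0 * (T - t)) ->
  (forall x z, `|u T x - u T (x - z)| <= LH * enorm z) ->
  forall (t : R) x z, 0 < t <= T -> enorm z <= r0 -> `|u t x - u t (x - z)| <= 2 * eta.
Proof.
move=> C10 C21 L0 sl0 C00 LH0 e0 Le; have w0 := wid_gt0 C21 sl0.
have C20 : 0 < C2 by apply: lt_le_trans C21.
have c2' : 0 < C2^-1 by rewrite invr_gt0.
have /andP[k0 k2] := kap_bounds C21 sl0.
have /andP[g0 ge] := gain_bounds C10 C20 sl0 e0.
have [/andP[d0 d1] _] := drop_bounds C10 sl0 e0.
have gd := gdel_gt0 d sl^-1 c2'; have ke := keps_gt0 R d; have G0 := Gam_gt0 C10 sl0.
have [| | |r1 /andP[r10 r11] [E1 E2 E3]] := @small3 R (L * wid C2 sl) (sl * keps R d / 2)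
  (Gam C1 sl * C1) (drop C1 sl eta * gdel d C2^-1 sl^-1) (6 * C0) eta => //.
- by rewrite divr_gt0 // mulr_gt0.
- by rewrite mulr_gt0.
have r12 : r1 ^+ 2 <= r1 by rewrite expr2 ger_pMr.
have sc : small_scale C1 C2 L sl eta r1.
  split; first by move: E1 Le; clra.
  apply: le_trans E2; rewrite mulrC ler_wpM2r // mulr_ge0 // ltW //.
(* Enough steps to exhaust the initial gap [2 * M0]. *)
pose k := (Num.truncn (2 * M0 / gain C1 C2 sl eta)).+1.
have kM : 2 * M0 <= k%:R * gain C1 C2 sl eta.
  by rewrite -ler_pdivrMr // ltW // truncnS_gt.
have q0 : 0 < kap C2 sl ^+ k * r1 * wid C2 sl.
  by apply: mulr_gt0 => //; apply: mulr_gt0 => //; rewrite exprn_gt0.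
have [| | |r0 /andP[r00 r01] [F1 F2 _]] := @small3 R 1 (kap C2 sl ^+ k * r1 * wid C2 sl) LH eta 1 1 => //.
rewrite mulr1 in F1.
exists r0 => // T u sg Q uH HL t x z /andP[t0 tT] zr.
have [cu ub _ _ _ _] := Q.
have [h|h] := leP (t + 3 * r1 ^+ 2) T.
  have [||m' [M' [gap HM]]] := osc_iter (xs := x) C10 C21 L0 sl0 e0 Q t0 (k := k) (m := - M0) (M := M0) r10 sc h (lexx _) (lexx _).
  - by move: kM e0; clra.
  - move=> s y /andP[s1 s2] _; rewrite -ler_norml; apply: ub.
    by rewrite (lt_le_trans t0) //=; exact: le_trans h.
  have h1 : m' <= u t x <= M' by apply: HM; rewrite subrr enorm0 ltW.
  have h2 : m' <= u t (x - z) <= M'.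
    by apply: HM; rewrite addrAC subrr add0r enormN; exact: le_trans F1.
  have /andP[a1 a2] := h1; have /andP[b1 b2] := h2.
  by rewrite ler_norml; apply/andP; split; move: gap a1 a2 b1 b2; clra.
have t0T : 0 < t <= T by rewrite t0.
have h1 := uH t x t0T; have h2 := uH t (x - z) t0T; have h3 := HL x z.
have h4 : LH * enorm z <= eta.
  by apply: le_trans F2; rewrite mulrC ler_wpM2r.
have h5 : C0 * (T - t) <= C0 * (3 * r1).
  by rewrite ler_wpM2l //; move: h r12; clra.
rewrite !ler_norml in h1 h2 h3 *.
move: h1 h2 h3 h4 h5 E3; clear=> /andP[? ?] /andP[? ?] /andP[? ?] ? ? ?.
by apply/andP; split; lra.
Qed.

End Oscillation.

(** * The solution as an instance of the quantitative classes, and its gradient bound *)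

Section GradientBound.
Variables (R : realType) (d : nat).
Local Notation E := 'rV[R]_d.

Lemma within_continuous_comp (S U V : topologicalType) (A : set U) (f : U -> V) (g : S -> U) :
  {within A, continuous f} -> continuous g -> (forall x, A (g x)) ->
  continuous (fun x => f (g x)).
Proof.
move=> cf cg Ag x.
have h1 : f @ within A (nbhs (g x)) --> f (g x).
  by rewrite nbhs_subspace_in //; exact: cf.
have h2 : g @ nbhs x --> within A (nbhs (g x)).
  move=> Q /= HQ; have := cg x _ HQ; rewrite /nbhs /=.
  by apply: filterS => y; apply; exact: Ag.
exact: (cvg_comp _ _ h2 h1).
Qed.

Lemma lipschitz_of_partials (F : E -> R) (K : R) :
  (forall x i, derivable F x (ev R i)) -> (forall x i, `|derive F x (ev R i)| <= K) ->
  forall x y, `|F x - F y| <= K * \sum_i `|x 0 i - y 0 i|.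
Proof.
move=> dF bF x y.
pose z n : E := \row_(i < d) (if (i < n)%N then x 0 i else y 0 i).
have step n : (n <= d)%N -> `|F (z n) - F y| <= K * \sum_(i < d | (i < n)%N) `|x 0 i - y 0 i|.
  elim: n => [|n IH] nd.
    rewrite big_pred0 ?mulr0 //.
    suff -> : z 0%N = y by rewrite subrr normr0.
    by apply/rowP => i; rewrite mxE.
  pose i0 := Ordinal nd.
  have -> : z n.+1 = z n + (x 0 i0 - y 0 i0) *: ev R i0.
    apply/rowP => i; rewrite !mxE eqxx /= ltnS leq_eqVlt -val_eqE /=.
    have [->|ne] := eqVneq i i0; first by rewrite /= eqxx ltnn mulr1; ring.
    have -> : (i == n :> nat) = false by apply/negbTE; move: ne; rewrite -val_eqE.
    by rewrite mulr0 addr0.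
  rewrite (bigD1 i0) //=.
  have -> : \sum_(i < d | (i < n.+1)%N && (i != i0)) `|x 0 i - y 0 i| =
            \sum_(i < d | (i < n)%N) `|x 0 i - y 0 i|.
    by apply: eq_bigl => i; rewrite -val_eqE /= ltnS [in RHS]ltn_neqAle andbC.
  have hd (s : R) : is_derive s 1 (fun r => F (z n + r *: ev R i0)) (derive F (z n + s *: ev R i0) (ev R i0)).
    by apply: line_shift; apply: line_partial.
  have [c _ hc] := mvt_abs (x 0 i0 - y 0 i0) hd.
  rewrite scale0r addr0 in hc.
  have -> : F (z n + (x 0 i0 - y 0 i0) *: ev R i0) - F y =
    (F (z n + (x 0 i0 - y 0 i0) *: ev R i0) - F (z n)) + (F (z n) - F y) by ring.
  apply: le_trans (ler_normD _ _) _; rewrite hc [leRHS]mulrDr lerD ?IH //; last exact: ltnW.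
  by rewrite normrM ler_wpM2r.
have := step d (leqnn _).
have -> : z d = x by apply/rowP => i; rewrite mxE ltn_ord.
by under eq_bigl => i do rewrite ltn_ord.
Qed.

Lemma near_enorm (x : E) (r : R) : 0 < r -> \forall y \near x, enorm (x - y) < r.
Proof.
move=> r0; apply/nbhs_ballP; exists (r / (d%:R + 1)) => /=; first by rewrite divr_gt0 // ltr_wpDl.
move=> y; rewrite -ball_normE /= => h; apply: le_lt_trans (enorm_le_mxnorm _) _.
apply: (@le_lt_trans _ _ ((d%:R + 1) * `|x - y|)); first by rewrite ler_wpM2r // lerDl.
by rewrite mulrC -ltr_pdivlMr // ltr_wpDl.
Qed.

Lemma continuous_near (U : topologicalType) (f : U -> R) :
  (forall x (e : R), 0 < e -> \forall y \near x, `|f x - f y| < e) -> continuous f.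
Proof. by move=> h x; apply/cvg_ballP => e e0; exact: h. Qed.

Lemma continuous_of_partials (F : E -> R) (K : R) :
  (forall x i, derivable F x (ev R i)) -> (forall x i, `|derive F x (ev R i)| <= K) ->
  continuous F.
Proof.
move=> dF bF; apply: continuous_near => x e e0.
have C0 : 0 <= `|K| * d%:R by exact: mulr_ge0.
have r0 : 0 < e / (`|K| * d%:R + 1) by apply: divr_gt0 => //; apply: ltr_wpDl.
apply: filterS (near_enorm x r0) => y; rewrite ltr_pdivlMr ?ltr_wpDl // => hy.
apply: le_lt_trans hy; apply: le_trans (lipschitz_of_partials dF bF x y) _.
apply: (@le_trans _ _ (`|K| * \sum_(i < d) enorm (x - y))).
  apply: (@le_trans _ _ (`|K| * \sum_(i < d) `|x 0 i - y 0 i|)).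
    by rewrite ler_wpM2r ?ler_norm // sumr_ge0.
  rewrite ler_wpM2l //.
  by apply: ler_sum => i _; have := coord_le_enorm (x - y) 0 i; rewrite !mxE.
have -> : \sum_(i < d) enorm (x - y) = d%:R * enorm (x - y).
  by rewrite sumr_const card_ord mulr_natl.
have -> : enorm (x - y) * (`|K| * d%:R + 1) = `|K| * (d%:R * enorm (x - y)) + enorm (x - y) by ring.
by rewrite lerDl.
Qed.

Lemma continuous_mx (U : topologicalType) m n (f : U -> 'M[R]_(m, n)) :
  (forall i j, continuous (fun x => f x i j)) -> continuous f.
Proof.
move=> cf x; apply/cvg_ballP => e e0.
have : \forall y \near x, forall i, forall j, ball (f x i j) e (f y i j).
  apply: filter_forall => i; apply: filter_forall => j.
  by have /cvg_ballP := cf i j x; apply.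
by apply: filterS => y; rewrite /ball /= /mx_ball.
Qed.

(** Bounded partial derivatives make [H] and its gradient continuous coordinate by coordinate; the
    Hoelder condition makes the second derivatives continuous. [C2_line] then gives the jets in all
    directions. *)
Lemma C2alpha_D2at (K alpha : R) (H : E -> R) : 0 < alpha -> C2alpha_bounded K alpha H ->
  continuous H /\
  forall x xi, D2at (fun s => H (x + s *: xi)) (inner (grad H x) xi) (inner (xi *m hess H x) xi).
Proof.
move=> a0 [dH [ddH [bH hH]]].
have g1 x i : `|derive H x (ev R i)| <= K.
  have [_ [h _]] := bH x; apply: le_trans h; apply: le_trans (coord_le_enorm _ 0 i).
  by rewrite mxE.
have g2 x i j : `|derive (fun y => derive H y (ev R i)) x (ev R j)| <= K.
  have [_ [_ h]] := bH x; apply: le_trans h; apply: le_trans (coord_le_enorm _ i j).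
  by rewrite mxE.
split; first exact: continuous_of_partials dH g1.
apply: C2_line => //.
  apply: continuous_mx => i j.
  have -> : (fun x => grad H x i j) = (fun x => derive H x (ev R j)) by apply: funext => x; rewrite mxE.
  exact: continuous_of_partials (fun x k => ddH x j k) (fun x k => g2 x j k).
apply: continuous_mx => i j; apply: continuous_near => x e e0.
have K1 : 0 < `|K| + 1 by rewrite ltr_wpDl.
pose r := (e / (`|K| + 1)) `^ alpha^-1.
have r0 : 0 < r by rewrite powR_gt0 //; exact: divr_gt0.
apply: filterS (near_enorm x r0) => y yr.
have subE (A B : 'M[R]_d) k l : A k l - B k l = (A - B) k l by rewrite !mxE.
rewrite subE.
apply: le_lt_trans (coord_le_enorm _ i j) _; apply: le_lt_trans (hH x y) _.
apply: (@le_lt_trans _ _ ((`|K| + 1) * enorm (x - y) `^ alpha)).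
  by rewrite ler_wpM2r ?powR_ge0 //; have := ler_norm K; lra.
rewrite -ltr_pdivlMl // mulrC.
have -> : e / (`|K| + 1) = r `^ alpha.
  by rewrite -powRrM mulVf ?gt_eqF // powRr1 // ltW // divr_gt0.
by rewrite gt0_ltr_powR ?nnegrE ?(ltW r0).
Qed.

(** Composing with [clamp] extends [u] constantly in time beyond [0, T]: it becomes continuous on
    the whole space and is unchanged on [0, T]. *)
Definition clamp (T t : R) : R := Num.min (Num.max t 0) T.

Lemma clamp_bounds (T t : R) : 0 < T -> 0 <= clamp T t <= T.
Proof.
move=> T0; rewrite /clamp ge_min lexx orbT andbT le_min (ltW T0) andbT.
by rewrite le_max lexx orbT.
Qed.

Lemma clamp_id (T t : R) : 0 <= t <= T -> clamp T t = t.
Proof. by move=> /andP[t0 tT]; rewrite /clamp (max_idPl t0) (min_idPl tT). Qed.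

Lemma continuous_clamp (T : R) : continuous (clamp T).
Proof.
move=> t; rewrite /clamp; apply: (@continuous_min R R (fun s => Num.max s 0) (fun=> T)).
  apply: (@continuous_max R R id (fun=> 0)); [exact: cvg_id|exact: cvg_cst].
exact: cvg_cst.
Qed.

Lemma solution_continuous (T : R) (b : E -> R -> E -> E) (f : E -> R -> E -> R)
  (sigma : E -> R -> 'M[R]_d) (H : E -> R) (u : R -> E -> R) : 0 < T -> is_solution T b f sigma H u ->
  continuous (fun z : R * E => u (clamp T z.1) z.2).
Proof.
move=> T0 [cu _]; apply: (within_continuous_comp (g := fun z : R * E => (clamp T z.1, z.2)) cu).
  apply: continuous_pair; last exact: continuous_snd.
  by apply: continuous_comp2; [exact: continuous_fst|exact: continuous_clamp].
by move=> z /=; exact: clamp_bounds.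
Qed.

Lemma solution_jet (T : R) (b : E -> R -> E -> E) (f : E -> R -> E -> R)
  (sigma : E -> R -> 'M[R]_d) (H : E -> R) (u : R -> E -> R) : 0 < T -> is_solution T b f sigma H u ->
  forall (t : R) x, 0 < t < T -> jet (fun s => u (clamp T s)) t x (dtime u t x) (grad (u t) x) (hess (u t) x).
Proof.
move=> T0 [_ [dx [dt [cg [ch _]]]]] t x /andP[t0 tT]; split.
  have /derivableP h : derivable (fun s : R => u s x) t 1 by apply: dt; rewrite t0.
  apply: near_eq_is_derive h.
  have h1 : \forall s \near t, 0 < s by exact: lt_nbhsr.
  have h2 : \forall s \near t, s < T by exact: lt_nbhsl.
  apply: filterS2 h1 h2 => s s0 sT; rewrite clamp_id //.
  by rewrite (ltW s0) (ltW sT).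
rewrite clamp_id ?(ltW t0) ?(ltW tT) //.
have tA : 0 <= t < T by rewrite (ltW t0).
apply: C2_line.
- by move=> y i; have [h _] := dx t y tA; exact: h.
- apply: (within_continuous_comp (g := fun y => (t, y)) cg) => //.
  by apply: continuous_pair; [exact: continuous_cst|move=> y; exact: cvg_id].
- by move=> y i j; have [_ h] := dx t y tA; exact: h.
- apply: (within_continuous_comp (g := fun y => (t, y)) ch) => //.
  by apply: continuous_pair; [exact: continuous_cst|move=> y; exact: cvg_id].
Qed.

(** The product of the two factors [1 + a + q * s] and [1 + q] bounds both [f] and the inner product
    of [b] with the gradient; the absolute value of [Lam] makes the bound monotone. *)
Lemma solution_pde (L Lam lam K alpha : R) (T : R) (b : E -> R -> E -> E) (f : E -> R -> E -> R)
  (sigma : E -> R -> 'M[R]_d) (H : E -> R) (u : R -> E -> R) : 0 < T -> AssumptionA L Lam lam K alpha b f sigma H ->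
  is_solution T b f sigma H u ->
  pde T (fun t => u (clamp T t)) (fun t x => (sigma x (u (clamp T t) x))^T)
    (fun a q s => `|Lam| * (1 + a + q * s) * (1 + q)).
Proof.
move=> T0 [_ [_ [_ [_ [growth_bfs _]]]]] sol t x tT; have J := solution_jet T0 sol x tT.
have [_ [_ [_ [_ [_ [_ [_ [_ [/(_ t x tT)eq _]]]]]]]]] := sol.
exists (dtime u t x), (grad (u t) x), (hess (u t) x); split => //.
have -> : clamp T t = t by case/andP: tT => t0 t1; rewrite clamp_id // (ltW t0) (ltW t1).
move: eq => /=.
set s := sigma x (u t x); set z := grad (u t) x *m s; set p := grad (u t) x.
have -> : \tr (s *m s^T *m hess (u t) x) = qsum s^T (hess (u t) x).
  by rewrite /qsum trmxK [RHS]mxtrace_mulC mulmxA.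
move=> eq.
have -> : dtime u t x + 2^-1 * qsum s^T (hess (u t) x) =
  - (inner (b x (u t x) z) p + f x (u t x) z) by move: eq; clra.
rewrite normrN enorm_tr; apply: le_trans (ler_normD _ _) _.
have gr := growth_bfs x (u t x) z.
have s0 := enorm_ge0 (sigma x (u t x)).
have b0 := enorm_ge0 (b x (u t x) z).
have p0 := enorm_ge0 p.
have zp : enorm z <= enorm p * enorm s by exact: enorm_mulmx.
have A0 : 0 <= 1 + `|u t x| + enorm z by rewrite !addr_ge0.
have g2 : enorm (b x (u t x) z) + `|f x (u t x) z| <= `|Lam| * (1 + `|u t x| + enorm p * enorm s).
  apply: (@le_trans _ _ (Lam * (1 + `|u t x| + enorm z))); first by move: gr s0; clra.
  apply: (@le_trans _ _ (`|Lam| * (1 + `|u t x| + enorm z))).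
    by rewrite ler_wpM2r // ler_norm.
  by rewrite ler_wpM2l // lerD2l.
apply: (@le_trans _ _ ((enorm (b x (u t x) z) + `|f x (u t x) z|) * (1 + enorm p))).
  rewrite mulrDl lerD //.
    by apply: le_trans (CauchySchwarz _ _) _; rewrite ler_wpM2l //; move: p0; clra.
  by rewrite ler_peMr //; move: p0; clra.
by rewrite ler_wpM2r //; move: p0; clra.
Qed.

(** Every constant is fixed before the coefficients and the solution are introduced. Absolute values
    of [K], [L] and [Lam] dispense with sign conditions on these parameters. *)
Lemma gradient_bound (T L Lam lam K alpha : R) : 0 < T -> 0 < lam -> 0 < alpha ->
  exists2 C : R, 0 <= C &
  forall (b : E -> R -> E -> E) (f : E -> R -> E -> R) (sigma : E -> R -> 'M[R]_d)
    (H : E -> R) (u : R -> E -> R),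
  AssumptionA L Lam lam K alpha b f sigma H -> is_solution T b f sigma H u ->
  forall (t : R) x, 0 < t <= T -> `|u t x| <= C /\ enorm (grad (u t) x) <= C.
Proof.
move=> T0 lam0 a0.
(* [M0] bounds [u] through [sup_bound]; [C2] bounds sigma for values up to [M0] and is at least one;
   [C1] turns the lower-order terms into [C1 * (1 + q ^+ 2)]; [C0] is the slope of the terminal
   barrier. *)
pose M0 := (`|K| + 1) * expR ((2 * `|Lam| + 1) * T).
have M00 : 0 <= M0 by rewrite mulr_ge0 ?expR_ge0 // addr_ge0.
pose C2 := 1 + `|Lam| * (1 + M0).
have C21 : 1 <= C2 by rewrite lerDl mulr_ge0 // addr_ge0.
pose C1 := 2 * `|Lam| * (1 + M0 + C2).
have C10 : 0 <= C1 by rewrite !mulr_ge0 //; move: M00 C21; clra.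
pose C0 := 2^-1 * (`|K| + 2) * C2 ^+ 2 + C1 * (1 + (`|K| + 1) ^+ 2) + 1.
have C00 : 0 <= C0.
  apply: addr_ge0 => //; apply: addr_ge0.
    by apply: mulr_ge0; [apply: mulr_ge0 => //; exact: addr_ge0|exact: sqr_ge0].
  by apply: mulr_ge0 => //; apply: addr_ge0 => //; exact: sqr_ge0.
pose sl := Num.sqrt lam.
have sl0 : 0 < sl by rewrite sqrtr_gt0.
have [eta e0 HG] := @gradient_of_small_osc R d C1 `|L| sl `|L| C10 (normr_ge0 _) sl0 (normr_ge0 _).
have ke : 0 < sl * keps R d / 2 by rewrite divr_gt0 // mulr_gt0 // keps_gt0.
(* [small_osc] controls the oscillation by [2 * e], which must not exceed the [eta] of
   [gradient_of_small_osc]. *)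
have [| | |e /andP[ep0 ep1] [E1 E2 _]] := @small3 R `|L| (sl * keps R d / 2) 2 eta 1 1 => //.
rewrite mulrC in E1.
have [r0 r00 HO] := @small_osc R d C1 C2 `|L| sl M0 C0 `|L| e C10 C21 (normr_ge0 _) sl0 C00 (normr_ge0 _) ep0 E1.
have [Kg Kg0 HK] := HG r0 r00.
exists (Num.max M0 (Num.max Kg `|K|)); first by rewrite le_max M00.
move=> b f sigma H u AA sol.
have [bL [fL [sL [HLip [gr [ell C2H]]]]]] := AA.
have [cH DH] := C2alpha_D2at a0 C2H.
have [_ [_ [bH _]]] := C2H.
pose ut (t : R) (x : E) := u (clamp T t) x.
have utE (t : R) : 0 <= t <= T -> ut t = u t.
  by move=> tT; apply: funext => x; rewrite /ut clamp_id.
have cu : continuous (fun z : R * E => ut z.1 z.2) by exact: solution_continuous T0 sol.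
have HP := solution_pde T0 AA sol; rewrite -/ut in HP.
have [_ [_ [_ [_ [_ [_ [[Cb ub] [_ [_ uT]]]]]]]]] := sol.
have utT x : ut T x = H x by rewrite utE ?lexx ?ltW // uT.
have HK1 x : `|H x| <= `|K| by have [h _] := bH x; apply: le_trans h (ler_norm _).
have gK1 x : enorm (grad H x) <= `|K| by have [_ [h _]] := bH x; apply: le_trans h (ler_norm _).
have hK1 x : enorm (hess H x) <= `|K| by have [_ [_ h]] := bH x; apply: le_trans h (ler_norm _).
have ub' (t : R) x : 0 < t <= T -> `|ut t x| <= Cb.
  by move=> /andP[t0 tT]; rewrite utE ?(ltW t0) //; apply: ub; rewrite (ltW t0).
have sgr x (y : R) : enorm (sigma x y) <= `|Lam| * (1 + `|y|).
  have := gr x y 0; rewrite enorm0 addr0 => h.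
  have h0 := enorm_ge0 (b x y 0); have h1 := normr_ge0 (f x y 0).
  apply: (@le_trans _ _ (Lam * (1 + `|y|))); first by move: h h0 h1; clra.
  by rewrite ler_wpM2r ?ler_norm // addr_ge0.
have ST (t : R) x : 0 < t < T -> enorm (sigma x (ut t x))^T <= `|Lam| * (1 + `|ut t x|).
  by move=> _; rewrite enorm_tr.
have up (t : R) x : 0 < t <= T -> ut t x <= M0.
  move=> tT; apply: (sup_bound T0 (normr_ge0 K) (normr_ge0 Lam) cu ub' _ ST HP) tT.
  by move=> y; rewrite utT; apply: le_trans (ler_norm _) _.
have um (t : R) x : 0 < t <= T -> - ut t x <= M0.
  move=> tT.
  apply: (@sup_bound R d T `|K| `|Lam| Cb (fun t x => - ut t x)
    (fun t x => (sigma x (ut t x))^T) T0 (normr_ge0 K) (normr_ge0 Lam) _ _ _ _ (pdeN HP)) tT.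
  - exact: continuous_oppr.
  - by move=> s y sT; rewrite normrN; exact: ub'.
  - by move=> y; rewrite utT; apply: le_trans (ler_norm _) _; rewrite normrN.
  - by move=> s y sT; rewrite normrN; exact: ST.
have uM (t : R) x : 0 < t <= T -> `|ut t x| <= M0.
  by move=> tT; rewrite ler_norml; have := up t x tT; have := um t x tT; clra.
have sC x (y : R) : `|y| <= M0 -> enorm (sigma x y) <= C2.
  move=> yM; apply: le_trans (sgr x y) _.
  have : `|Lam| * (1 + `|y|) <= `|Lam| * (1 + M0) by rewrite ler_wpM2l // lerD2l.
  by rewrite /C2; clra.
have SC (t : R) x : 0 < t < T -> enorm (sigma x (ut t x))^T <= C2.
  by move=> /andP[t0 tT]; rewrite enorm_tr; apply: sC; apply: uM; rewrite t0 ltW.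
have HP1 : pde T ut (fun t x => (sigma x (ut t x))^T) (fun _ q _ => C1 * (1 + q ^+ 2)).
  apply: pde_mono HP => t x q tT q0 /=.
  have h1 : `|ut t x| <= M0 by case/andP: tT => t0 tT; apply: uM; rewrite t0 ltW.
  have h2 := SC t x tT; have s0 := enorm_ge0 (sigma x (ut t x))^T.
  have h3 : q * enorm (sigma x (ut t x))^T <= q * C2 by rewrite ler_wpM2l.
  apply: (@le_trans _ _ (`|Lam| * ((1 + M0 + C2) * (1 + q)) * (1 + q))).
    rewrite ler_wpM2r //; first by move: q0; clra.
    rewrite ler_wpM2l //.
    have h4 : 0 <= q * M0 by exact: mulr_ge0.
    by move: h1 h3 h4 q0 C21; clra.
  have -> : `|Lam| * ((1 + M0 + C2) * (1 + q)) * (1 + q) =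
     `|Lam| * (1 + M0 + C2) * (1 + q) ^+ 2 by ring.
  have -> : C1 * (1 + q ^+ 2) = `|Lam| * (1 + M0 + C2) * (2 * (1 + q ^+ 2)) by rewrite /C1; ring.
  rewrite ler_wpM2l //; first by rewrite mulr_ge0 //; move: M00 C21; clra.
  by have := sqr_ge0 (1 - q); clra.
have tl (t : R) x : 0 < t <= T -> `|ut t x - ut T x| <= C0 * (T - t).
  move=> tT.
  have t1 := terminal_le T0 (normr_ge0 K) C10 cu cH uM HK1 utT DH gK1 hK1 SC HP1 x tT.
  have t2 := @terminal_le R d T `|K| M0 C1 C2 (fun t x => - ut t x)
    (fun t x => (sigma x (ut t x))^T) (fun x => - H x) (fun x => - grad H x)
    (fun x => - hess H x) T0 (normr_ge0 K) C10 (continuous_oppr cu) (continuous_oppr cH)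
     _ _ _ _ _ _ SC (pdeN HP1) t x tT.
  rewrite ler_norml utT -/C0 in t1 *; apply/andP; split => //.
  rewrite lerNl.
  have -> : - (ut t x - H x) = - ut t x - - H x by ring.
  apply: t2.
  - by move=> s y sT; rewrite normrN; exact: uM.
  - by move=> y; rewrite normrN.
  - by move=> y; rewrite utT.
  - by move=> y xi; rewrite innerNl mulmxN innerNl; apply: D2atN.
  - by move=> y; rewrite enormN.
  - by move=> y; rewrite enormN.
have HLz x z : `|ut T x - ut T (x - z)| <= `|L| * enorm z.
  rewrite !utT; apply: le_trans (HLip _ _) _; rewrite opprB addrCA subrr addr0.
  by rewrite ler_wpM2r // ler_norm.
have sLip x (y : R) x' (y' : R) :
    enorm (sigma x y - sigma x' y') <= `|L| * (enorm (x - x') + `|y - y'|).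
  by apply: le_trans (sL _ _ _ _) _; rewrite ler_wpM2r ?ler_norm // addr_ge0.
have sEll x (y : R) (xi : E) : sl * enorm xi <= enorm (xi *m sigma x y).
  rewrite -ler_sqr ?nnegrE ?mulr_ge0 ?(ltW sl0) // exprMn sqr_sqrtr ?(ltW lam0) //.
  apply: le_trans (ell x y xi) _.
  by rewrite mulmxA inner_mul trmxK inner_xx.
have Q : qsol T C1 C2 `|L| sl M0 ut sigma by split.
have osc := HO T ut sigma Q tl HLz.
move=> t x /andP[t0 tT].
have tI : 0 <= t <= T by rewrite (ltW t0).
have tT' : 0 < t <= T by rewrite t0.
split; first by rewrite le_max -(utE t tI) uM.
have [tT1|] := ltP t T; last first.
  move=> Tt; have -> : t = T by apply/eqP; rewrite eq_le tT.
  have -> : u T = H by apply: funext => y; rewrite uT.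
  by rewrite !le_max gK1 !orbT.
have J := solution_jet T0 sol x (t := t) _.
rewrite !le_max; apply/orP; right; apply/orP; left.
apply: (HK T t M0 C2 ut (fun t x => (sigma x (ut t x))^T) _ _ t x _ _ _ _ (J _)).
- split => //.
  + by move=> s y /andP[s0 s1]; apply: uM; rewrite s1 (lt_le_trans t0).
  + by move=> s y /andP[s0 s1]; apply: SC; rewrite s1 (lt_le_trans t0).
  + by move=> s y z _; rewrite -linearB enorm_tr.
  + by move=> s y xi _; rewrite trmxK.
  + by move=> y z; apply: le_trans (ler_norm _) _.
- move=> s y z /andP[s0 s1] zr; have h := osc s y z _ zr.
  by apply: le_trans (h _) _; rewrite ?s1 ?(lt_le_trans t0) //; move: E2; clra.
- by rewrite lexx.
- by rewrite t0.
Qed.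

End GradientBound.

(** * The Cameron-Martin shift *)

Section Density.
Context d1 d2 (X : measurableType d1) (Y : measurableType d2) (R : realType).
Variables (mu : {measure set X -> \bar R}) (nu : {measure set Y -> \bar R}).
Variables (phi : X -> Y) (W : X -> R).
Local Open Scope ereal_scope.

Import HBNNSimple.

Lemma ge0_integral_density (f : Y -> \bar R) :
  measurable_fun setT phi -> measurable_fun setT W -> (forall x, (0 <= W x)%R) ->
  (forall B, measurable B -> \int[mu]_(x in phi @^-1` B) (W x)%:E = nu B) ->
  measurable_fun [set: Y] f -> (forall y, 0 <= f y) ->
  \int[nu]_y f y = \int[mu]_x (f (phi x) * (W x)%:E).
Proof.
move=> mphi mW W0 HW mf f0.
have mWE : measurable_fun setT (EFin \o W) by exact/measurable_EFinP.
have msc (h : {nnsfun Y >-> R}) :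
    \int[nu]_y (h y)%:E = \int[mu]_x ((h (phi x))%:E * (W x)%:E).
  have mind r : measurable (phi @^-1` (h @^-1` [set r])).
    by rewrite -[X in measurable X]setTI; exact: mphi.
  have m1 r : measurable_fun setT (fun x => (r * \1_(h @^-1` [set r]) (phi x))%:E * (W x)%:E).
    apply: emeasurable_funM => //; apply/measurable_EFinP; apply: measurable_funM => //.
    exact: (measurable_indic (mind r)).
  have m2 r : measurable_fun setT (fun y => (r * \1_(h @^-1` [set r]) y)%:E).
    by apply/measurable_EFinP; apply: measurable_funM.
  transitivity (\sum_(r \in range h) \int[nu]_y (r * \1_(h @^-1` [set r]) y)%:E).
    rewrite -ge0_integral_fsum //; last by move=> r y _; exact: nnfun_muleindic_ge0.
    by apply: eq_integral => y _; rewrite [in LHS]fimfunE -fsumEFin.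
  transitivity (\sum_(r \in range h)
      \int[mu]_x ((r * \1_(h @^-1` [set r]) (phi x))%:E * (W x)%:E)); last first.
    rewrite -ge0_integral_fsum //; last first.
      by move=> r x _; apply: mule_ge0; [exact: nnfun_muleindic_ge0|rewrite lee_fin].
    apply: eq_integral => x _; rewrite [in RHS]fimfunE -fsumEFin //.
    by rewrite ge0_mule_fsuml // => r; exact: nnfun_muleindic_ge0.
  apply: eq_fsbigr => r /[!inE] -[y _ <-].
  rewrite integralZl_indic_nnsfun // integral_indic // setIT -HW //.
  under [in RHS]eq_integral do rewrite EFinM -muleA.
  rewrite ge0_integralZl //; last 3 first.
  - apply: emeasurable_funM => //; apply/measurable_EFinP.
    exact: (measurable_indic (mind (h y))).
  - by move=> x _; rewrite mule_ge0 // lee_fin.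
  - by rewrite lee_fin.
  congr (_ * _); rewrite integral_mkcond; apply: eq_integral => x _.
  rewrite patchE indicE; case: ifPn => /=.
    by rewrite inE /= => hx; rewrite mem_set // mul1e.
  by rewrite notin_setE /= => hx; rewrite memNset // mul0e.
pose h := nnsfun_approx measurableT mf.
have hcv y : (EFin \o h n) y @[n --> \oo] --> f y by exact: cvg_nnsfun_approx.
transitivity (limn (fun n => \int[nu]_y (h n y)%:E)).
  rewrite -monotone_convergence //.
  - by apply: eq_integral => y _; apply/esym/cvg_lim => //; exact: hcv.
  - by move=> n; apply/measurable_EFinP.
  - by move=> n y _; rewrite lee_fin.
  - by move=> y _ a b ab; rewrite lee_fin; exact/lefP/nd_nnsfun_approx.
under eq_fun do rewrite msc.
rewrite -monotone_convergence //.
- apply: eq_integral => x _; apply/cvg_lim => //.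
  by apply: cvgeZr => //; exact: hcv.
- move=> n; apply: emeasurable_funM => //; apply/measurable_EFinP.
  by apply: measurableT_comp.
- by move=> n x _; rewrite mule_ge0 ?lee_fin.
- by move=> x _ a b ab; rewrite lee_wpmul2r ?lee_fin //; exact/lefP/nd_nnsfun_approx.
Qed.

End Density.

Section NormalShift.
Variable R : realType.
Local Open Scope ereal_scope.
Let mR : measurableType _ := measurableTypeR R.
Local Notation mu := (@lebesgue_measure R).

Lemma measurable_shift (a : R) : measurable_fun [set: mR] (fun x : mR => (x + a)%R : mR).
Proof.
have h : measurable_fun [set: R] (fun x : R => (x + a)%R) by exact: measurable_funD.
exact: h.
Qed.

Lemma lebesgue_shift (a : R) (A : set mR) : measurable A ->
  pushforward mu (fun x : mR => (x + a)%R : mR) A = mu A.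
Proof.
move=> mA; apply/esym.
apply: (@lebesgue_measure_unique R
  (measure_function_pushforward__canonical__measure_function_Measure mu (measurable_shift a))) => //.
move=> B [[p q] _ <-] /=; rewrite /pushforward.
have -> : (fun x : mR => (x + a)%R : mR) @^-1` `]p, q]%classic = `](p - a)%R, (q - a)%R]%classic.
  by apply/seteqP; split => x /=; rewrite !in_itv /= ltrBlDr lerBrDr.
rewrite !lebesgue_measure_itv /= !lte_fin ltrD2r; case: ifP => // _.
by rewrite -!EFinB; congr EFin; ring.
Qed.

(** Density at [y] of the normal law with mean [a] and deviation [s] relative to the centred one. *)
Definition cmw (s a y : R) : R := expR (a * y / s ^+ 2 - a ^+ 2 / (s ^+ 2 *+ 2)).

Lemma cmw_gt0 s a y : (0 < cmw s a y)%R.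
Proof. exact: expR_gt0. Qed.

Lemma measurable_cmw s a : measurable_fun [set: R] (cmw s a).
Proof.
apply: measurableT_comp => //; apply: measurable_funD => //.
by apply: measurable_funM => //; apply: measurable_funM.
Qed.

Lemma normal_shift (s a : R) (A : set mR) : (0 < s)%R -> measurable A ->
  \int[normal_prob 0 s]_(y in A) (cmw s a y)%:E =
  normal_prob 0 s ((fun y : mR => (y + a)%R : mR) @^-1` A).
Proof.
move=> s0 mA.
have mf : measurable_fun [set: mR] (fun y : mR => normal_pdf 0 s (y - a)).
  apply: (measurableT_comp (f := normal_pdf 0 s)); first exact: measurable_normal_pdf.
  exact: measurable_shift.
transitivity (\int[mu]_(y in A) (normal_pdf 0 s (y - a))%:E).
  rewrite integral_mkcond.
  rewrite (@ge0_integral_density _ _ mR mR R mu (normal_prob 0 s) id (normal_pdf 0 s)) //.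
  - rewrite [RHS]integral_mkcond; apply: eq_integral => y _.
    rewrite !patchE; case: ifP => _; last by rewrite mul0e.
    rewrite -EFinM; congr EFin.
    rewrite !normal_pdfE ?gt_eqF // /cmw mulrCA -expRD; congr (_ * expR _)%R.
    rewrite !subr0; field; exact: lt0r_neq0.
  - exact: measurable_normal_pdf.
  - by move=> x; exact: normal_pdf_ge0.
  - apply/(measurable_restrictT _ _).1 => //; apply/measurable_EFinP.
    by apply: measurable_funTS; exact: measurable_cmw.
  - by move=> y; rewrite patchE; case: ifP => // _; rewrite lee_fin ltW // cmw_gt0.
transitivity (\int[pushforward mu (fun y : mR => (y + a)%R : mR)]_(y in A) (normal_pdf 0 s (y - a))%:E).
  apply: (@eq_measure_integral _ mR R A
    (measure_function_pushforward__canonical__measure_function_Measure mu (measurable_shift a)) mu).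
  by move=> B mB _; apply/esym; exact: lebesgue_shift.
rewrite (ge0_integral_pushforward (measurable_shift a)) //.
- by apply: eq_integral => y _ /=; rewrite addrK.
- by apply/measurable_EFinP; apply: measurable_funTS.
- by move=> y _; rewrite lee_fin normal_pdf_ge0.
Qed.

End NormalShift.

Section WeightedMeasure.
Context d (X : measurableType d) (R : realType).
Variables (mu : {measure set X -> \bar R}) (W : X -> R).
Hypotheses (mW : measurable_fun setT W) (W0 : forall x, 0 <= W x).
Local Open Scope ereal_scope.

Definition weighted of measurable_fun setT W & (forall x, 0 <= W x)%R :=
  fun A : set X => \int[mu]_(x in A) (W x)%:E.

Let w := weighted mW W0.

Let weighted0 : w set0 = 0.
Proof. exact: integral_set0. Qed.

Let weighted_ge0 A : 0 <= w A.
Proof. by apply: integral_ge0 => x _; rewrite lee_fin. Qed.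

Let weighted_sigma_additive : semi_sigma_additive w.
Proof.
move=> F mF tF mUF; rewrite /w /weighted ge0_integral_bigcup //.
- by apply: is_cvg_ereal_nneg_natsum_cond => n _ _; exact: weighted_ge0.
- by apply/measurable_EFinP; exact: measurable_funTS.
- by move=> x _; rewrite lee_fin.
Qed.

HB.instance Definition _ := isMeasure.Build _ _ _ w weighted0 weighted_ge0 weighted_sigma_additive.

End WeightedMeasure.

(** * Row vectors as a measurable space, and the shift in several dimensions *)

Section VectorSpaceBorel.
Variables (R : realType) (d : nat).
Local Notation E := 'rV[R]_d.

Definition rect (A : 'I_d -> set R) : set E := [set x | forall j, A j (x 0 j)].

Definition rects : set (set E) := [set rect A | A in [set A | forall j, measurable (A j)]].

(** The sigma-algebra generated by measurable rectangles, since [is_brownian] prescribes the law of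
    an increment on rectangles. They are stable under intersection, so they determine finite
    measures. *)
Definition rvector := g_sigma_algebraType rects.

Lemma rects_setI : setI_closed rects.
Proof.
move=> _ _ [A mA <-] [B mB <-]; exists (fun j => A j `&` B j).
  by move=> j; exact: measurableI.
apply/seteqP; split => x /=.
  by move=> h; split => j; have [] := h j.
by move=> [h1 h2] j; split.
Qed.

Lemma rects_setT : rects setT.
Proof. by exists (fun=> setT) => //; apply/seteqP; split => x. Qed.

Lemma rvector_measure_unique (m1 m2 : {measure set rvector -> \bar R}) :
  (forall A, (forall j, measurable (A j)) -> m1 (rect A) = m2 (rect A)) ->
  (m1 setT < +oo)%E -> forall V, measurable V -> m1 V = m2 V.
Proof.
move=> h12 hf V mV.
apply: (@measure_unique _ R rvector rects (fun=> setT)) => //.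
- exact: rects_setI.
- by move=> _; exact: rects_setT.
- by apply/seteqP; split => // x _; exists 0%N.
- by move=> _ [A mA <-]; exact: h12.
Qed.

Lemma measurable_rvector d1 (T : measurableType d1) (D : T -> rvector) :
  (forall j, measurable_fun [set: T] (fun w => (D w : E) 0 j)) -> measurable_fun [set: T] D.
Proof.
move=> mD; refine (@measurability _ _ T rvector setT D rects _ _) => //.
move=> _ [_ [A mA <-] <-].
have -> : [set: T] `&` D @^-1` rect A = \bigcap_(j in [set: 'I_d]) (fun w => (D w : E) 0 j) @^-1` A j.
  apply/seteqP; split => w /=; first by move=> [_ h] j _; exact: h.
  by move=> h; split => // j; exact: h.
apply: fin_bigcap_measurable => // j _.
by rewrite -[X in measurable X]setTI; exact: mD.
Qed.

Lemma measurable_rvector_coord (j : 'I_d) :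
  measurable_fun [set: rvector] (fun x : rvector => (x : E) 0 j).
Proof.
move=> _ A mA; rewrite setTI; apply: sub_sigma_algebra.
exists (fun i => if i == j then A else setT); first by move=> i; case: ifP.
apply/seteqP; split => x /=; first by move=> /(_ j); rewrite eqxx.
by move=> h i; case: ifPn => // /eqP ->.
Qed.

End VectorSpaceBorel.

Section CameronMartin.
Context d0 (Omega : measurableType d0) (R : realType) (d : nat).
Variable P : probability Omega R.
Variables (D : Omega -> 'rV[R]_d) (s : R).
Local Notation E := 'rV[R]_d.
Local Open Scope ereal_scope.
Let mR : measurableType _ := measurableTypeR R.

Definition gaussian_vector := [/\ (0 < s)%R,
  forall j, measurable_fun [set: Omega] (fun w => D w 0%R j) &
  forall A : 'I_d -> set R, (forall j, measurable (A j)) ->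
    P [set w | forall j, A j (D w 0%R j)] = \prod_(j < d) normal_prob 0 s (A j)].

(** The weight of the first [n] coordinates only, for an induction that shifts one coordinate at a
    time. *)
Definition cmwn (n : nat) (a : E) (w : Omega) : R :=
  \prod_(j < d | (j < n)%N) cmw s (a 0%R j) (D w 0%R j).

Definition cmW (a : E) (w : Omega) : R := \prod_(j < d) cmw s (a 0%R j) (D w 0%R j).

Hypothesis GD : gaussian_vector.

Lemma cmwn_ge0 n a w : (0 <= cmwn n a w)%R.
Proof. by apply: prodr_ge0 => j _; rewrite ltW // cmw_gt0. Qed.

Lemma measurable_cmw_coord a j : measurable_fun [set: Omega] (fun w => cmw s a (D w 0%R j)).
Proof.
have [_ mD _] := GD.
by apply: (measurableT_comp (f := cmw s a)) => //; exact: measurable_cmw.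
Qed.

Lemma measurable_cmwn n a : measurable_fun [set: Omega] (cmwn n a).
Proof.
have -> : cmwn n a = fun w =>
   (\prod_(j <- enum 'I_d) (if (j < n)%N then cmw s (a 0%R j) (D w 0%R j) else 1))%R.
  by apply: funext => w; rewrite /cmwn big_mkcond /= big_enum.
apply: (@measurable_prod _ _ _ _ _ _ (fun (j : 'I_d) w => if (j < n)%N then cmw s (a 0%R j) (D w 0%R j) else 1%R)) => j _.
by case: (j < n)%N; [exact: measurable_cmw_coord|exact: measurable_cst].
Qed.

Let pr (n : nat) (a : E) (A : 'I_d -> set R) (j : 'I_d) : R :=
  fine (normal_prob 0 s (if (j < n)%N then (fun y : mR => (y + a 0%R j)%R : mR) @^-1` (A j) else A j)).

Let prE (n : nat) (a : E) (A : 'I_d -> set R) (j : 'I_d) : measurable (A j) ->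
  normal_prob 0 s (if (j < n)%N then (fun y : mR => (y + a 0%R j)%R : mR) @^-1` (A j) else A j) =
  (pr n a A j)%:E.
Proof.
move=> mA; rewrite /pr fineK // fin_num_measure //; case: ifP => // _.
by rewrite -[X in measurable X]setTI; exact: measurable_shift.
Qed.

Lemma gaussian_rect_measurable (A : 'I_d -> set R) : (forall j, measurable (A j)) ->
  measurable [set w | forall j, A j (D w 0%R j)].
Proof.
have [_ mD _] := GD; move=> mA.
have := measurable_rvector mD; rewrite /measurable_fun => h.
rewrite -[X in measurable X]setTI; apply: (h measurableT (rect A)).
by apply: sub_sigma_algebra; exists A.
Qed.

(** Under the measure with density [cmwn n a] restricted to the rectangle [C] in the other
    coordinates, coordinate [i0] is still centred normal up to the mass [c]. Integrating its own
    weight against this law shifts it by [normal_shift]. *)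
Lemma cameron_martin_rect n (a : E) (A : 'I_d -> set R) : (n <= d)%N -> (forall j, measurable (A j)) ->
  \int[P]_(w in [set w | forall j, A j (D w 0%R j)]) (cmwn n a w)%:E = (\prod_j pr n a A j)%:E.
Proof.
have [s0 mD law] := GD.
elim: n A => [|n IH] A nd mA.
  under eq_integral do rewrite /cmwn big_pred0 //.
  rewrite integral_cst ?mul1e; last exact: gaussian_rect_measurable.
  apply: (etrans (law A mA)).
  by rewrite -prodEFin; apply: eq_bigr => j _; rewrite -prE.
pose i0 := Ordinal nd.
pose C := [set w | forall j, (if j == i0 then setT else A j) (D w 0%R j)].
have mC : measurable C.
  by apply: (@gaussian_rect_measurable (fun j => if j == i0 then setT else A j)) => j; case: ifP.
pose c := (\prod_(j | j != i0) pr n a A j)%R.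
have c0 : (0 <= c)%R.
  by apply: prodr_ge0 => j _; rewrite /pr fine_ge0.
have mW : measurable_fun [set: Omega] (fun w => cmwn n a w * \1_C w)%R.
  by apply: measurable_funM; [exact: measurable_cmwn|exact: measurable_indic].
have W0 w : (0 <= cmwn n a w * \1_C w)%R by rewrite mulr_ge0 ?cmwn_ge0 // indicE.
have mi : measurable_fun [set: Omega] (fun w => D w 0%R i0 : mR) by exact: (mD i0).
have HW (B : set mR) : measurable B ->
   \int[P]_(w in (fun w => D w 0%R i0 : mR) @^-1` B) (cmwn n a w * \1_C w)%:E =
   mscale (NngNum c0) (normal_prob 0 s) B.
  move=> mB.
  transitivity (\int[P]_(w in (fun w => D w 0%R i0 : mR) @^-1` B `&` C) (cmwn n a w)%:E).
    by rewrite integral_mkcondr epatch_indic; apply: eq_integral.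
  pose A' j := if j == i0 then (B : set R) else A j.
  have mA' j : measurable (A' j) by rewrite /A'; case: ifP.
  have -> : (fun w => D w 0%R i0 : mR) @^-1` B `&` C = [set w | forall j, A' j (D w 0%R j)].
    apply/seteqP; split => w /=.
      by move=> [h1 h2] j; rewrite /A'; have := h2 j; case: ifPn => // /eqP ->.
    move=> h; split; first by have := h i0; rewrite /A' eqxx.
    by move=> j; have := h j; rewrite /A'; case: ifP.
  rewrite IH ?(ltnW nd) // (bigD1 i0) //= EFinM /mscale /= muleC; congr (_ * _).
    congr EFin; apply: eq_bigr => j /negbTE jn; by rewrite /pr /A' jn.
  by rewrite -prE // ltnn /A' eqxx.
have mf : measurable_fun [set: mR]
    ((fun y : mR => (cmw s (a 0%R i0) y)%:E) \_ (A i0 : set mR)).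
  apply/(measurable_restrictT _ _).1; first exact: (mA i0).
  by apply/measurable_EFinP; apply: measurable_funTS; exact: measurable_cmw.
have f0 (y : mR) : 0 <= ((fun y : mR => (cmw s (a 0%R i0) y)%:E) \_ (A i0 : set mR)) y.
  by rewrite patchE; case: ifP => // _; rewrite lee_fin ltW // cmw_gt0.
have := ge0_integral_density mi mW W0 HW mf f0.
rewrite -integral_mkcond ge0_integral_mscale //; last 2 first.
- by apply/measurable_EFinP; apply: measurable_funTS; exact: measurable_cmw.
- by move=> y _; rewrite lee_fin ltW // cmw_gt0.
rewrite normal_shift //; last exact: (mA i0).
have -> : (\prod_j pr n.+1 a A j = c * pr n.+1 a A i0)%R.
  rewrite (bigD1 i0) //= mulrC; congr (_ * _)%R; apply: eq_bigr => j jn.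
  rewrite /pr ltnS leq_eqVlt; suff -> : (j == n :> nat) = false by [].
  by apply/negbTE; move: jn; rewrite -val_eqE.
rewrite EFinM -prE // /= ltnSn => ->.
rewrite [LHS]integral_mkcond; apply: eq_integral => w _.
have cE : cmwn n.+1 a w = (cmw s (a 0%R i0) (D w 0%R i0) * cmwn n a w)%R.
  rewrite /cmwn (bigD1 i0) ?ltnSn //=; congr (_ * _)%R; apply: eq_bigl => j.
  by rewrite -val_eqE /= ltnS [in RHS]ltn_neqAle andbC.
rewrite !patchE indicE; case: ifPn.
  rewrite inE /= => h; rewrite !mem_set //.
    by rewrite mulr1 -EFinM cE.
  by move=> j; case: ifP.
rewrite notin_setE /= => h; case: ifPn; last by rewrite mul0e.
rewrite inE /= => h1; rewrite memNset ?mulr0 ?mule0 // => h2; apply: h => j.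
by have := h2 j; case: ifPn => // /eqP ->.
exact: (mA i0).
Qed.

Lemma measurable_cmW a : measurable_fun [set: Omega] (cmW a).
Proof.
have -> : cmW a = cmwn d a by apply: funext => w; apply: eq_bigl => j; rewrite ltn_ord.
exact: measurable_cmwn.
Qed.

Lemma cmW_ge0 a w : (0 <= cmW a w)%R.
Proof. by apply: prodr_ge0 => j _; rewrite ltW // cmw_gt0. Qed.

Lemma cameron_martin (a : E) (f : rvector R d -> \bar R) :
  measurable_fun [set: rvector R d] f -> (forall x, 0 <= f x) ->
  \int[P]_w f (D w + a)%R = \int[P]_w (f (D w) * (cmW a w)%:E).
Proof.
have [s0 mD law] := GD; move=> mf f0.
have mDV : measurable_fun [set: Omega] (D : Omega -> rvector R d) by exact: measurable_rvector.
have mDa : measurable_fun [set: Omega] ((fun w => D w + a)%R : Omega -> rvector R d).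
  apply: measurable_rvector => j.
  by under eq_fun do rewrite mxE; apply: measurable_funD.
pose m1 := measure_function_pushforward__canonical__measure_function_Measure P mDa.
pose m2 := measure_function_pushforward__canonical__measure_function_Measure
  (weighted P (measurable_cmW a) (cmW_ge0 a)) mDV.
have h V : measurable V -> m2 V = m1 V.
  move=> mV; apply/esym; apply: rvector_measure_unique => //; last first.
    have -> : m1 setT = P setT by [].
    by rewrite probability_setT ltry.
  move=> A mA; apply/esym.
  have -> : m2 (rect A) = \int[P]_(w in [set w | forall j, A j (D w 0%R j)]) (cmwn d a w)%:E.
    apply: eq_integral => w _; congr EFin.
    by apply: eq_bigl => j; rewrite ltn_ord.
  rewrite cameron_martin_rect //.
  pose A' j := (fun y : mR => (y + a 0%R j)%R : mR) @^-1` (A j).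
  have mA' j : measurable (A' j : set mR).
    by rewrite -[X in measurable X]setTI; apply: measurable_shift => //; exact: (mA j).
  have -> : m1 (rect A) = P [set w | forall j, A' j (D w 0%R j)].
    congr (P _); apply/seteqP; split => w /= h j; have := h j; by rewrite mxE.
  rewrite (law A'); last exact: mA'.
  rewrite -prodEFin; apply: eq_bigr => j _; rewrite -prE //.
  by rewrite ltn_ord.
have := ge0_integral_density mDV (measurable_cmW a) (cmW_ge0 a) h mf f0.
move=> <-; rewrite (ge0_integral_pushforward mDa) //.
Qed.

End CameronMartin.

(** * Gaussian moments derived from the Cameron-Martin density *)

Section GaussianMoments.
Context d0 (Omega : measurableType d0) (R : realType) (d : nat).
Local Notation E := 'rV[R]_d.

Lemma enorm_sqr_row (a : E) : enorm a ^+ 2 = \sum_j a 0 j ^+ 2.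
Proof. by rewrite enorm_sqr big_ord1. Qed.

(** The square of the weight is the weight of the doubled shift up to a constant, so its integral is
    explicit. *)
Lemma cmW_sqr (D : Omega -> E) (s : R) (a : E) w : 0 < s ->
  cmW D s a w ^+ 2 = cmW D s (2 *: a) w * expR (enorm a ^+ 2 / s ^+ 2).
Proof.
move=> s0; rewrite enorm_sqr_row mulr_suml expR_sum /cmW -prodrXl -big_split /=.
apply: eq_bigr => j _; rewrite /cmw mxE -expRM_natl -expRD; congr expR.
by field; rewrite lt0r_neq0.
Qed.

Lemma integral_prob_cst (P : probability Omega R) (k : R) : (\int[P]_w k%:E = k%:E)%E.
Proof.
apply: (etrans (integral_cst P measurableT k%:E)).
apply: (etrans (congr1 (fun z => k%:E * z)%E (probability_setT P))).
by rewrite mule1.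
Qed.

Lemma integral_cmW (P : probability Omega R) (D : Omega -> E) (s : R) (GD : gaussian_vector P D s) a : (\int[P]_w (cmW D s a w)%:E = 1)%E.
Proof.
have := cameron_martin GD a (measurable_cst (1%E : \bar R)) (fun=> lee01).
move=> h; apply: (etrans _ (etrans (esym h) (integral_prob_cst P 1))).
by apply: eq_integral => w _; rewrite mul1e.
Qed.

Lemma integral_cmW_sqr (P : probability Omega R) (D : Omega -> E) (s : R) (GD : gaussian_vector P D s) (a : E) :
  (\int[P]_w (cmW D s a w ^+ 2)%:E = (expR (enorm a ^+ 2 / s ^+ 2))%:E)%E.
Proof.
have [s0 _ _] := GD.
under eq_integral do rewrite cmW_sqr // mulrC EFinM.
rewrite ge0_integralZl_EFin ?expR_ge0 //.
- by rewrite (integral_cmW GD) mule1.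
- by move=> w _; rewrite lee_fin cmW_ge0.
- by apply/measurable_EFinP; exact: measurable_cmW GD _.
Qed.

(** Cauchy-Schwarz between [psi (D w)] and the Cameron-Martin weight, whose L^2 norm is exp(|a|^2 /
    (2 s^2)). It is written as a pointwise Young inequality with the optimal ratio [k] of the two
    norms. *)
Lemma shift_L2 (P : probability Omega R) (D : Omega -> E) (s : R) (GD : gaussian_vector P D s) (a : E) (psi : rvector R d -> R) (q : R) :
  measurable_fun [set: rvector R d] psi -> (forall x, 0 <= psi x) -> 0 < q ->
  (\int[P]_w (psi (D w) ^+ 2)%:E <= (q ^+ 2)%:E ->
   \int[P]_w (psi (D w + a))%:E <= (q * expR (enorm a ^+ 2 / (2 * s ^+ 2)))%:E)%E.
Proof.
have [s0 mD _] := GD; move=> mpsi psi0 q0 Hq.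
have mDV : measurable_fun [set: Omega] (D : Omega -> rvector R d) by exact: measurable_rvector.
have mpE : measurable_fun [set: rvector R d] (fun x => (psi x)%:E) by exact/measurable_EFinP.
have mpD : measurable_fun [set: Omega] (fun w => psi (D w)) by exact: (measurableT_comp mpsi mDV).
have mW := measurable_cmW GD a.
rewrite (cameron_martin GD a mpE) //.
set e := expR _; have e0 : 0 < e by exact: expR_gt0.
have ee : expR (enorm a ^+ 2 / s ^+ 2) = e ^+ 2.
  by rewrite /e -expRM_natl; congr expR; field; rewrite lt0r_neq0.
pose k := e / q; have k0 : 0 < k by exact: divr_gt0.
apply: (@le_trans _ _ (\int[P]_w ((k / 2)%:E * (psi (D w) ^+ 2)%:E + (k^-1 / 2)%:E * (cmW D s a w ^+ 2)%:E))%E).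
  apply: ge0_le_integral => //.
  - by move=> w _; rewrite mule_ge0 // lee_fin //; exact: cmW_ge0.
  - by apply: emeasurable_funM; apply/measurable_EFinP.
  - by apply: emeasurable_funD; apply: emeasurable_funM => //; apply/measurable_EFinP; exact: measurable_funX.
  - move=> w _; rewrite -!EFinM -EFinD lee_fin.
    have h := sqr_ge0 (k * psi (D w) - cmW D s a w).
    have -> : k / 2 * psi (D w) ^+ 2 + k^-1 / 2 * cmW D s a w ^+ 2 =
      psi (D w) * cmW D s a w + (2 * k)^-1 * (k * psi (D w) - cmW D s a w) ^+ 2.
      by field; rewrite lt0r_neq0.
    by rewrite lerDl mulr_ge0 // invr_ge0 mulr_ge0 // ltW.
rewrite ge0_integralD //; last 4 first.
- by move=> w _; rewrite mule_ge0 // lee_fin ?sqr_ge0 // divr_ge0 // ltW.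
- by apply: emeasurable_funM => //; apply/measurable_EFinP; exact: measurable_funX.
- by move=> w _; rewrite mule_ge0 // lee_fin ?sqr_ge0 // divr_ge0 // invr_ge0 ltW.
- by apply: emeasurable_funM => //; apply/measurable_EFinP; exact: measurable_funX.
have k2 : 0 <= k / 2 by rewrite divr_ge0 // ltW.
have k3 : 0 <= k^-1 / 2 by rewrite divr_ge0 // invr_ge0 ltW.
rewrite !ge0_integralZl_EFin //; last 4 first.
- by move=> w _; rewrite lee_fin sqr_ge0.
- by apply/measurable_EFinP; exact: measurable_funX.
- by move=> w _; rewrite lee_fin sqr_ge0.
- by apply/measurable_EFinP; exact: measurable_funX.
rewrite (integral_cmW_sqr GD) ee.
apply: (@le_trans _ _ ((k / 2)%:E * (q ^+ 2)%:E + (k^-1 / 2)%:E * (e ^+ 2)%:E)%E).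
  by rewrite leeD2r // lee_wpmul2l // lee_fin.
rewrite -!EFinM -EFinD lee_fin /k le_eqVlt; apply/orP; left; apply/eqP.
by field; rewrite !lt0r_neq0.
Qed.

(** Up to the stated constant, the integrand is the Cameron-Martin weight of the shift by [t * s]
    along coordinate [j], which has total mass one. *)
Lemma integral_expR_coord (P : probability Omega R) (D : Omega -> E) (s : R) (GD : gaussian_vector P D s) (j : 'I_d) (t : R) :
  (\int[P]_w (expR (t * D w 0 j / s))%:E = (expR (t ^+ 2 / 2))%:E)%E.
Proof.
have [s0 mD _] := GD.
pose a : E := (t * s) *: ev R j.
have h w : expR (t * D w 0 j / s) = expR (t ^+ 2 / 2) * cmW D s a w.
  rewrite /cmW (bigD1 j) //= big1 => [|i ij]; last first.
    by rewrite /cmw /a !mxE (negbTE ij) andbF !(mulr0, mul0r) expr0n /= mul0r subrr expR0.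
  rewrite mulr1 /cmw -expRD; congr expR; rewrite /a !mxE !eqxx mulr1.
  by field; rewrite lt0r_neq0.
under eq_integral do rewrite h EFinM.
rewrite ge0_integralZl_EFin ?expR_ge0 //.
- by rewrite (integral_cmW GD) mule1.
- by move=> w _; rewrite lee_fin cmW_ge0.
- by apply/measurable_EFinP; exact: measurable_cmW GD _.
Qed.

(** The pointwise bound y^2 <= exp y + exp(-y) reduces the second moment to two exponential moments;
    the resulting constant is not sharp. *)
Lemma gaussian_sqr_integral (P : probability Omega R) (D : Omega -> E) (s : R) (GD : gaussian_vector P D s) (j : 'I_d) :
  (\int[P]_w (D w 0 j ^+ 2)%:E <= (2 * expR (2^-1) * s ^+ 2)%:E)%E.
Proof.
have [s0 mD _] := GD.
have mexp (t : R) : measurable_fun [set: Omega] (fun w => expR (t * D w 0 j / s)).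
  by apply: measurableT_comp => //; apply: measurable_funM => //; apply: measurable_funM.
have mexpE (t : R) : measurable_fun [set: Omega] (fun w => (expR (t * D w 0 j / s))%:E).
  exact/measurable_EFinP.
have gexpE (t : R) w : [set: Omega] w -> (0 <= (expR (t * D w 0 j / s))%:E)%E.
  by rewrite lee_fin expR_ge0.
apply: (@le_trans _ _ (\int[P]_w ((s ^+ 2)%:E * ((expR (1 * D w 0 j / s))%:E + (expR (-1 * D w 0 j / s))%:E)))%E).
  apply: ge0_le_integral => //.
  - by move=> w _; rewrite lee_fin sqr_ge0.
  - by apply/measurable_EFinP; exact: measurable_funX.
  - by apply: emeasurable_funM => //; apply: emeasurable_funD; exact/measurable_EFinP.
  - move=> w _; rewrite -EFinD -EFinM lee_fin mul1r mulN1r mulNr.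
    have [y ->] : exists y, D w 0 j = s * y by exists (s^-1 * D w 0 j); rewrite mulVKf ?lt0r_neq0.
    have -> : s * y / s = y by field; rewrite lt0r_neq0.
    rewrite exprMn ler_wpM2l ?sqr_ge0 //.
    have key (z : R) : 0 <= z -> z ^+ 2 <= expR z.
      move=> z0; have h1 := @expR_ge1Dx R (z / 2).
      have h2 : expR z = expR (z / 2) ^+ 2 by rewrite -expRM_natl; congr expR; field.
      have z20 : 0 <= 1 + z / 2 by move: z0; clra.
      have h3 := @expR_ge1Dx R (z / 4).
      have h4 : expR (z / 2) = expR (z / 4) ^+ 2 by rewrite -expRM_natl; congr expR; field.
      have z40 : 0 <= 1 + z / 4 by move: z0; clra.
      have h5 : (1 + z / 4) ^+ 2 <= expR (z / 4) ^+ 2 by rewrite ler_sqr ?nnegrE ?expR_ge0.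
      have h6 : z <= expR (z / 2) by rewrite h4; apply: le_trans h5; have := sqr_ge0 (1 - z / 4); clra.
      by rewrite h2 ler_sqr ?nnegrE ?expR_ge0.
    have [y0|y0] := leP 0 y.
      by apply: le_trans (key y y0) _; rewrite lerDl expR_ge0.
    have ny : 0 <= - y by rewrite oppr_ge0 ltW.
    by rewrite -sqrrN; apply: le_trans (key _ ny) _; rewrite lerDr expR_ge0.
rewrite ge0_integralZl_EFin ?sqr_ge0 //; last 2 first.
- by move=> w _; rewrite adde_ge0 // lee_fin expR_ge0.
- by apply: emeasurable_funD; exact/measurable_EFinP.
rewrite ge0_integralD //.
rewrite !(integral_expR_coord GD) -EFinD -EFinM lee_fin sqrrN expr1n mul1r.
by rewrite le_eqVlt; apply/orP; left; apply/eqP; ring.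
Qed.

Lemma gaussian_integrable (P : probability Omega R) (D : Omega -> E) (s : R) (GD : gaussian_vector P D s) (j : 'I_d) : P.-integrable setT (EFin \o (fun w => D w 0 j)).
Proof.
have [s0 mD _] := GD; apply/integrableP; split; first exact/measurable_EFinP.
apply: (@le_lt_trans _ _ (\int[P]_w (1 + (D w 0 j ^+ 2)%:E))%E).
  apply: ge0_le_integral => //.
  - by apply/measurable_EFinP; exact: measurableT_comp.
  - by apply: emeasurable_funD => //; apply/measurable_EFinP; exact: measurable_funX.
  - move=> w _ /=; rewrite -EFinD lee_fin ler_norml.
    by have := sqr_ge0 (1 - D w 0 j); have := sqr_ge0 (1 + D w 0 j); clra.
rewrite ge0_integralD //; last 2 first.
- by move=> w _; rewrite lee_fin sqr_ge0.
- by apply/measurable_EFinP; exact: measurable_funX.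
rewrite integral_cst // mul1e lte_add_pinfty //.
  by rewrite -ge0_fin_numE // fin_num_measure.
apply: (le_lt_trans (gaussian_sqr_integral GD j)); exact: ltry.
Qed.

(* Jensen's inequality 1 + t m / s <= E exp (t D_j / s) = exp (t^2 / 2), for small t of both signs. *)
Lemma gaussian_mean (P : probability Omega R) (D : Omega -> E) (s : R) (GD : gaussian_vector P D s) (j : 'I_d) : (\int[P]_w (D w 0 j)%:E = 0)%E.
Proof.
have [s0 mD _] := GD.
have iD := gaussian_integrable GD j.
have fm : (\int[P]_w (D w 0 j)%:E \is a fin_num)%E by exact: integrable_fin_num.
rewrite -(fineK fm); congr EFin; set m := fine _.
have key (t : R) : 1 + t / s * m <= expR (t ^+ 2 / 2).
  rewrite -lee_fin -(integral_expR_coord GD j) EFinD EFinM /m fineK // -integralZl //.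
  have -> : (1 = \int[P]_w (cst 1 w)%:E)%E by rewrite /= integral_prob_cst.
  have i1 : P.-integrable setT (EFin \o (cst 1 : Omega -> R)).
    exact: finite_measure_integrable_cst.
  have i2 : P.-integrable setT (EFin \o (fun w => t / s * D w 0 j)).
    exact: (integrableZl measurableT (t / s) iD).
  have := integralD_EFin measurableT i1 i2; rewrite /= => <-.
  apply: le_integral => //.
  - exact: integrableD.
  - apply/integrableP; split.
      apply/measurable_EFinP; apply: measurableT_comp => //.
      by apply: measurable_funM => //; apply: measurable_funM.
    under eq_integral do rewrite /= ger0_norm ?expR_ge0 //.
    by rewrite (integral_expR_coord GD) ltry.
  - move=> w _ /=; rewrite -EFinD lee_fin; apply: le_trans (expR_ge1Dx _).
    by rewrite lerD2l mulrAC.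
have le0 (t : R) : t != 0 -> t ^+ 2 <= 1 -> t / s * m <= t ^+ 2.
  move=> t0 t1; have h := key t.
  have h1 := @expR_ge1Dx R (- (t ^+ 2 / 2)); have h2 := expR_gt0 (t ^+ 2 / 2).
  rewrite expRN in h1.
  have h3 : (1 - t ^+ 2 / 2) * expR (t ^+ 2 / 2) <= 1.
    by rewrite -ler_pdivlMr // mul1r.
  have h4 : expR (t ^+ 2 / 2) * 2^-1 <= (1 - t ^+ 2 / 2) * expR (t ^+ 2 / 2).
    by rewrite mulrC ler_wpM2r ?(ltW h2) //; move: t1; clra.
  have h5 : (t ^+ 2 / 2) * expR (t ^+ 2 / 2) <= (t ^+ 2 / 2) * 2.
    rewrite ler_wpM2l //; first by rewrite divr_ge0 ?sqr_ge0.
    by move: h3 h4; clra.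
  by move: h h3 h5; clra.
have ab (t : R) : 0 < t -> t <= 1 -> `|m| <= s * t.
  move=> t0 t1; have t2 : t ^+ 2 <= 1 by rewrite expr_le1 // ltW.
  have h1 : t / s * m <= t ^+ 2 by apply: le0 => //; rewrite lt0r_neq0.
  have h2 : (- t) / s * m <= (- t) ^+ 2 by apply: le0; rewrite ?oppr_eq0 ?lt0r_neq0 // sqrrN.
  have ts : 0 < t / s by exact: divr_gt0.
  have e1 : t ^+ 2 = t / s * (s * t) by field; rewrite lt0r_neq0.
  rewrite ler_norml; apply/andP; split.
    by rewrite lerNl -(ler_pM2l ts) -e1; move: h2; rewrite sqrrN; clra.
  by rewrite -(ler_pM2l ts) -e1.
apply/eqP; rewrite -normr_le0; apply/ler_addgt0Pr => e e0; rewrite add0r.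
have [es|es] := leP e s.
  have -> : e = s * (e / s) by rewrite mulrC divfK ?lt0r_neq0.
  by apply: ab; [exact: divr_gt0|rewrite ler_pdivrMr // mul1r].
by apply: le_trans (ab 1 ltr01 (lexx _)) _; rewrite mulr1 ltW.
Qed.

End GaussianMoments.

(** * The quantized scheme *)

Lemma sqrD_le2 (R : realDomainType) (a b : R) : (a + b) ^+ 2 <= 2 * (a ^+ 2 + b ^+ 2).
Proof. by have := sqr_ge0 (a - b); lra. Qed.

Section FiniteIndex.
Context d0 (Omega : measurableType d0) (R : realType).
Variables (P : probability Omega R) (I : finType) (idx : Omega -> I).

Definition pmass (i : I) : R := fine (P (idx @^-1` [set i])).

Hypothesis mI : forall i, measurable (idx @^-1` [set i]).

Lemma measurable_fin d1 (T : measurableType d1) (G : I -> T) :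
  measurable_fun [set: Omega] (fun w => G (idx w)).
Proof.
move=> _ A mA; rewrite setTI.
have -> : (fun w => G (idx w)) @^-1` A = \bigcup_(i in [set i | A (G i)]) (idx @^-1` [set i]).
  by apply/seteqP; split => w /=; [exists (idx w)|move=> [i Ai ->]].
exact: fin_bigcup_measurable.
Qed.

Lemma integrable_fin (G : I -> R) : P.-integrable setT (fun w => (G (idx w))%:E).
Proof.
have fP : (P setT < +oo)%E by rewrite -ge0_fin_numE // fin_num_measure.
apply: (measurable_bounded_integrable measurableT fP).
  exact: (measurable_fin (G : I -> measurableTypeR R)).
exists (\sum_i `|G i|); split; first exact: num_real.
move=> y /ltW hy w _ /=; apply: le_trans hy.
by rewrite (bigD1 (idx w)) //= lerDl sumr_ge0.
Qed.

Lemma integral_fin (S : set Omega) (G : I -> R) : measurable S ->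
  (\int[P]_(w in S) (G (idx w))%:E = (\sum_i G i * fine (P (S `&` idx @^-1` [set i])))%:E)%E.
Proof.
move=> mS.
have ii i : P.-integrable S (fun w => ((G i)%:E * (\1_(idx @^-1` [set i]) w)%:E)%E).
  apply: integrableZl => //; apply: (integrableS measurableT) => //.
  have := integrable_fin (fun k => (k == i)%:R).
  by apply: eq_integrable => // w _; rewrite indicE; congr ((nat_of_bool _)%:R)%:E; apply/eqP/idP; rewrite inE.
transitivity (\int[P]_(w in S) (\sum_(i <- enum I) ((G i)%:E * (\1_(idx @^-1` [set i]) w)%:E))%E)%E.
  apply: eq_integral => w _; rewrite big_enum (bigD1 (idx w)) //= indicE mem_set // mule1.
  rewrite big1 ?adde0 // => i /eqP ni; rewrite indicE memNset ?mule0 // => /= h.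
  by apply: ni.
rewrite integral_sum // big_enum /= -sumEFin; apply: eq_bigr => i _.
have iS : P.-integrable S (fun w => (\1_(idx @^-1` [set i]) w)%:E).
  apply: (integrableS measurableT) => //.
  have := integrable_fin (fun k => (k == i)%:R).
  by apply: eq_integrable => // w _; rewrite indicE; congr ((nat_of_bool _)%:R)%:E; apply/eqP/idP; rewrite inE.
rewrite integralZl // integral_indic // EFinM setIC; congr (_ * _)%E.
by rewrite fineK // fin_num_measure //; exact: measurableI.
Qed.

Lemma integral_finT (G : I -> R) :
  (\int[P]_w (G (idx w))%:E = (\sum_i G i * pmass i)%:E)%E.
Proof. by rewrite integral_fin //; congr EFin; apply: eq_bigr => i _; rewrite setTI. Qed.

Lemma Ereal_fin (G : I -> R) : Ereal P (fun w => G (idx w)) = \sum_i G i * pmass i.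
Proof. by rewrite /Ereal integral_finT. Qed.

Lemma pmass_ge0 i : 0 <= pmass i.
Proof. by rewrite /pmass fine_ge0. Qed.

Lemma pmass_sum : \sum_i pmass i = 1.
Proof.
have := integral_finT (fun=> 1); rewrite integral_prob_cst => -[->].
by apply: eq_bigr => i _; rewrite mul1r.
Qed.

End FiniteIndex.

Section QuantizedIncrement.
Context d0 (Omega : measurableType d0) (R : realType) (d : nat).
Variables (P : probability Omega R).
Local Notation E := 'rV[R]_d.

Lemma measurable_enorm_comp d1 (T : measurableType d1) (X : T -> E) :
  (forall j, measurable_fun [set: T] (fun w => X w 0 j)) ->
  measurable_fun [set: T] (fun w => enorm (X w)).
Proof.
move=> mX.
have -> : (fun w => enorm (X w)) = Num.sqrt \o (fun w => \sum_(j <- enum 'I_d) X w 0 j ^+ 2).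
  by apply: funext => w /=; rewrite /enorm big_ord1 big_enum.
apply: (measurableT_comp (f := Num.sqrt : R -> R)).
  by apply: nondecreasing_measurable => // x y; exact: ler_wsqrtr.
apply: measurable_sum => j; exact: measurable_funX.
Qed.

Lemma moment_le (X : Omega -> R) (q e : R) : (forall w, 0 <= X w) -> 0 < q ->
  (\int[P]_w (X w `^ q)%:E < +oo)%E ->
  fine (\int[P]_w (X w `^ q)%:E)%E `^ q^-1 <= e ->
  (\int[P]_w (X w `^ q)%:E <= (e `^ q)%:E)%E.
Proof.
move=> X0 q0 hf he.
have i0 : (0 <= \int[P]_w (X w `^ q)%:E)%E.
  by apply: integral_ge0 => w _; rewrite lee_fin powR_ge0.
have fn : (\int[P]_w (X w `^ q)%:E)%E \is a fin_num by rewrite ge0_fin_numE.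
rewrite -(fineK fn) lee_fin; move: he; set m := fine _ => he.
have m0 : 0 <= m by exact: fine_ge0.
have -> : m = (m `^ q^-1) `^ q by rewrite -powRrM mulVf ?lt0r_neq0 // powRr1.
apply: ge0_ler_powR => //; rewrite ?nnegrE ?powR_ge0 ?(ltW q0) //.
by apply: le_trans he; exact: powR_ge0.
Qed.

Lemma markov_powR (X : Omega -> R) (q e r : R) : measurable_fun [set: Omega] X ->
  (forall w, 0 <= X w) -> 0 < q -> 0 < r ->
  (\int[P]_w (X w `^ q)%:E <= (e `^ q)%:E)%E -> 0 <= e ->
  (P [set w | (r < X w)%R] <= ((e / r) `^ q)%:E)%E.
Proof.
move=> mX X0 q0 r0 H e0.
have mS : measurable [set w | (r < X w)%R].
  have -> : [set w | (r < X w)%R] = X @^-1` `]r, +oo[.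
    by apply/seteqP; split => w /=; rewrite in_itv /= andbT.
  by rewrite -[X in measurable X]setTI; apply: mX.
have mXq : measurable_fun [set: Omega] (fun w => X w `^ q).
  by apply: (measurableT_comp (f := fun x : R => x `^ q)) => //; exact: measurable_powR.
have rq : 0 < r `^ q by exact: powR_gt0.
apply: (@le_trans _ _ (\int[P]_w ((r `^ q)^-1%:E * (X w `^ q)%:E))%E).
  have <- : (\int[P]_w (\1_[set w | (r < X w)%R] w)%:E = P [set w | (r < X w)%R])%E.
    by rewrite integral_indic // setIT.
  apply: ge0_le_integral => //.
  - by apply/measurable_EFinP.
  - by apply: emeasurable_funM => //; exact/measurable_EFinP.
  - move=> w _; rewrite -EFinM lee_fin indicE.
    have [|_] := boolP (w \in _); last by rewrite mulr_ge0 ?invr_ge0 ?powR_ge0.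
    rewrite inE /= => h; rewrite mulrC ler_pdivlMr // mul1r.
    by apply: ge0_ler_powR; rewrite ?nnegrE ?(ltW q0) ?(ltW r0) ?(ltW h).
rewrite ge0_integralZl_EFin //; last 3 first.
- by move=> w _; rewrite lee_fin powR_ge0.
- exact/measurable_EFinP.
- by rewrite invr_ge0 ltW.
apply: (@le_trans _ _ ((r `^ q)^-1%:E * (e `^ q)%:E)%E).
  by rewrite lee_wpmul2l // lee_fin invr_ge0 ltW.
rewrite -EFinM lee_fin mulrC powRM ?invr_ge0 ?(ltW r0) //.
by rewrite -[r^-1]powR_inv1 ?(ltW r0) // -!powRrM mulN1r powRN.
Qed.

Variables (I : finType) (idx : Omega -> I) (c : I -> E) (D : Omega -> E) (s : R).
Hypothesis mI : forall i, measurable (idx @^-1` [set i]).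
Hypothesis GD : gaussian_vector P D s.

Lemma measurable_quantization_error j :
  measurable_fun [set: Omega] (fun w => (c (idx w) - D w) 0 j).
Proof.
have [_ mD _] := GD.
under eq_fun do rewrite !mxE.
apply: measurable_funB => //.
exact: (measurable_fin mI (fun i => c i 0 j : measurableTypeR R)).
Qed.

(** The increment [D] is centred, so the mean of its quantization equals the mean of the
    quantization error. *)
Lemma quantization_mean (e : R) (j : 'I_d) :
  (\int[P]_w (enorm (c (idx w) - D w))%:E <= e%:E)%E ->
  `|\sum_i c i 0 j * pmass P idx i| <= e.
Proof.
have [_ mD _] := GD; move=> He.
have i1 := integrable_fin P mI (fun i => c i 0 j).
have i2 := gaussian_integrable GD j.
have iB : P.-integrable setT (EFin \o (fun w => c (idx w) 0 j - D w 0 j)).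
  exact: (integrableB measurableT i1 i2).
have -> : \sum_i c i 0 j * pmass P idx i = fine (\int[P]_w (c (idx w) 0 j - D w 0 j)%:E)%E.
  have := integralB_EFin measurableT i1 i2; rewrite /= => ->.
  by rewrite (gaussian_mean GD) sube0 (integral_finT P mI (fun i => c i 0 j)).
rewrite -lee_fin -abse_EFin fineK; last exact: integrable_fin_num.
apply: le_trans (le_abse_integral P measurableT _) _.
  exact: (measurable_int P).
apply: le_trans He; apply: ge0_le_integral => //.
- by apply: measurableT_comp => //; exact: (measurable_int P).
- by apply/measurable_EFinP; apply: measurable_enorm_comp => k; exact: measurable_quantization_error.
- move=> w _; rewrite /= lee_fin; have := coord_le_enorm (c (idx w) - D w) 0 j.
  by rewrite !mxE.
Qed.

Lemma quantization_sqr (e : R) :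
  (\int[P]_w (enorm (c (idx w) - D w) ^+ 2)%:E <= e%:E)%E ->
  \sum_i enorm (c i) ^+ 2 * pmass P idx i <= 2 * e + d%:R * (4 * expR (2^-1) * s ^+ 2).
Proof.
have [_ mD _] := GD; move=> He.
have mq : measurable_fun [set: Omega] (fun w => (enorm (c (idx w) - D w) ^+ 2)%:E).
  apply/measurable_EFinP; apply: measurable_funX; apply: measurable_enorm_comp => j.
  exact: measurable_quantization_error.
have mD2 j : measurable_fun [set: Omega] (fun w => (D w 0 j ^+ 2)%:E).
  by apply/measurable_EFinP; exact: measurable_funX.
have mS : measurable_fun [set: Omega] (fun w => (\sum_(j <- enum 'I_d) (D w 0 j ^+ 2)%:E)%E).
  exact: emeasurable_sum.
rewrite -lee_fin -(integral_finT P mI (fun i => enorm (c i) ^+ 2)).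
apply: (@le_trans _ _ (\int[P]_w (2%:E * ((enorm (c (idx w) - D w) ^+ 2)%:E +
    \sum_(j <- enum 'I_d) (D w 0 j ^+ 2)%:E)))%E).
  apply: ge0_le_integral => //.
  - by move=> w _; rewrite lee_fin sqr_ge0.
  - apply/measurable_EFinP.
    exact: (measurable_fin mI (fun i => enorm (c i) ^+ 2 : measurableTypeR R)).
  - by apply: emeasurable_funM => //; exact: emeasurable_funD.
  - move=> w _; rewrite sumEFin -EFinD -EFinM lee_fin big_enum -enorm_sqr_row.
    have h := enormD (c (idx w) - D w) (D w); rewrite subrK in h.
    have h0 := enorm_ge0 (c (idx w)).
    apply: (@le_trans _ _ ((enorm (c (idx w) - D w) + enorm (D w)) ^+ 2)).
      by rewrite ler_sqr ?nnegrE // addr_ge0.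
    exact: sqrD_le2.
have n1 w : [set: Omega] w -> (0 <= (enorm (c (idx w) - D w) ^+ 2)%:E)%E.
  by rewrite lee_fin sqr_ge0.
have n2 w : [set: Omega] w -> (0 <= \sum_(j <- enum 'I_d) (D w 0 j ^+ 2)%:E)%E.
  by move=> _; apply: sume_ge0 => j _; rewrite lee_fin sqr_ge0.
rewrite ge0_integralZl_EFin //; last 2 first.
- by move=> w _; rewrite adde_ge0 ?n1 ?n2.
- exact: emeasurable_funD.
rewrite ge0_integralD // ge0_integral_sum //; last first.
  by move=> j w _; rewrite lee_fin sqr_ge0.
apply: (@le_trans _ _ (2%:E * (e%:E + \sum_(j <- enum 'I_d) (2 * expR (2^-1) * s ^+ 2)%:E))%E).
  apply: lee_wpmul2l; first by rewrite lee_fin.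
  apply: leeD => //; apply: lee_sum => j _; exact: gaussian_sqr_integral.
rewrite sumEFin -EFinD -EFinM lee_fin big_enum sumr_const card_ord -mulr_natl.
by rewrite le_eqVlt; apply/orP; left; apply/eqP; ring.
Qed.

End QuantizedIncrement.

(** * Energy estimate for one step of the scheme *)

Section OneStep.
Variables (R : realType) (d : nat) (I : finType).
Local Notation E := 'rV[R]_d.

Lemma mean_sqr_le (p Y : I -> R) (S : R) : (forall i, 0 <= p i) -> \sum_i p i = 1 ->
  (forall i, `|Y i| <= S) ->
  \sum_i (Y i - \sum_k Y k * p k) ^+ 2 * p i <= S ^+ 2 - (\sum_k Y k * p k) ^+ 2.
Proof.
move=> p0 p1 YS; set m := \sum_k Y k * p k.
have -> : \sum_i (Y i - m) ^+ 2 * p i = \sum_i Y i ^+ 2 * p i - m ^+ 2.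
  transitivity (\sum_i (Y i ^+ 2 * p i + (- 2 * m) * (Y i * p i) + m ^+ 2 * p i)).
    by apply: eq_bigr => i _; ring.
  by rewrite !big_split /= -!mulr_sumr p1 -/m; ring.
rewrite lerD2r -[leRHS]mulr1 -p1 mulr_sumr; apply: ler_sum => i _.
rewrite ler_wpM2r // -[Y i ^+ 2]real_normK ?num_real //.
by rewrite ler_sqr ?nnegrE // (le_trans _ (YS i)).
Qed.

Lemma mean_abs_le (p Y : I -> R) (S : R) : (forall i, 0 <= p i) -> \sum_i p i = 1 ->
  (forall i, `|Y i| <= S) -> `|\sum_k Y k * p k| <= S.
Proof.
move=> p0 p1 YS; apply: le_trans (ler_norm_sum _ _ _) _.
rewrite -[leRHS]mulr1 -p1 mulr_sumr; apply: ler_sum => i _.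
by rewrite normrM (ger0_norm (p0 i)) ler_wpM2r.
Qed.

Lemma mean_enorm_le (p : I -> R) (Y : I -> E) (S : R) : (forall i, 0 <= p i) -> \sum_i p i = 1 ->
  (forall i, enorm (Y i) <= S) -> enorm (\row_j \sum_k Y k 0 j * p k) <= S.
Proof.
move=> p0 p1 YS.
have -> : \row_j \sum_k Y k 0 j * p k = \sum_k p k *: Y k.
  by apply/rowP => j; rewrite mxE summxE; apply: eq_bigr => k _; rewrite mxE mulrC.
apply: le_trans (enorm_sum _ _ _) _.
rewrite -[leRHS]mulr1 -p1 mulr_sumr; apply: ler_sum => i _.
by rewrite enormZ (ger0_norm (p0 i)) mulrC ler_wpM2r.
Qed.

(** [Y] is split into its mean [m] and a fluctuation. The mean multiplies the mean increment, which
    is of order [h]; the fluctuation is paired with the increment by Cauchy-Schwarz, which leaves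
    the variance of [Y], here bounded by [S ^+ 2 - m ^+ 2]. *)
Lemma z_component_bound (p Y : I -> R) (c : I -> E) (S C1 C2 h : R) :
  (forall i, 0 <= p i) -> \sum_i p i = 1 -> (forall i, `|Y i| <= S) -> 0 < h -> 0 <= C1 ->
  (forall j, `|\sum_i c i 0 j * p i| <= C1 * h) ->
  \sum_i enorm (c i) ^+ 2 * p i <= C2 * h ->
  enorm (h^-1 *: \row_j \sum_i (Y i * c i 0 j) * p i) ^+ 2 <=
    2 * C2 / h * (S ^+ 2 - (\sum_k Y k * p k) ^+ 2) + 2 * (d%:R * C1 * S) ^+ 2.
Proof.
move=> p0 p1 YS h0 C10 Hm Hs.
have V0 := mean_sqr_le p0 p1 YS; have M0 := mean_abs_le p0 p1 YS.
set m := \sum_k Y k * p k in V0 M0 *.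
pose A : E := \sum_i ((Y i - m) * p i) *: c i.
pose B : E := \row_j \sum_i c i 0 j * p i.
have -> : \row_j \sum_i (Y i * c i 0 j) * p i = A + m *: B.
  apply/rowP => j; rewrite !mxE /A summxE mulr_sumr -big_split /=.
  by apply: eq_bigr => i _; rewrite !mxE; ring.
have nB : enorm B <= d%:R * (C1 * h).
  by apply: enorm_le_coord => [|j]; [rewrite mulr_ge0 // ltW|rewrite mxE].
have nA : enorm A ^+ 2 <= (S ^+ 2 - m ^+ 2) * (C2 * h).
  have h1 : enorm A <= \sum_i (`|Y i - m| * Num.sqrt (p i)) * (Num.sqrt (p i) * enorm (c i)).
    apply: le_trans (enorm_sum _ _ _) _; apply: ler_sum => i _.
    rewrite enormZ normrM (ger0_norm (p0 i)).
    rewrite -{1}[p i]sqr_sqrtr // le_eqVlt; apply/orP; left; apply/eqP; ring.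
  have h2 := CauchySchwarz_sum (fun i => `|Y i - m| * Num.sqrt (p i)) (fun i => Num.sqrt (p i) * enorm (c i)).
  have s1 : \sum_i (`|Y i - m| * Num.sqrt (p i)) ^+ 2 = \sum_i (Y i - m) ^+ 2 * p i.
    by apply: eq_bigr => i _; rewrite exprMn sqr_sqrtr // real_normK ?num_real.
  have s2 : \sum_i (Num.sqrt (p i) * enorm (c i)) ^+ 2 = \sum_i enorm (c i) ^+ 2 * p i.
    by apply: eq_bigr => i _; rewrite exprMn sqr_sqrtr // mulrC.
  rewrite s1 s2 in h2.
  apply: (@le_trans _ _ ((\sum_i (`|Y i - m| * Num.sqrt (p i)) * (Num.sqrt (p i) * enorm (c i))) ^+ 2)).
    by rewrite ler_sqr ?nnegrE // (le_trans _ h1).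
  apply: le_trans h2 _; apply: ler_pM => //.
    by apply: sumr_ge0 => i _; rewrite mulr_ge0 ?sqr_ge0.
  by apply: sumr_ge0 => i _; rewrite mulr_ge0 ?sqr_ge0.
have S0 : 0 <= S by apply: le_trans M0.
have nAB : enorm (A + m *: B) ^+ 2 <= 2 * (enorm A ^+ 2 + (S * (d%:R * (C1 * h))) ^+ 2).
  apply: (@le_trans _ _ ((enorm A + S * (d%:R * (C1 * h))) ^+ 2)); last exact: sqrD_le2.
  rewrite ler_sqr ?nnegrE ?addr_ge0 ?mulr_ge0 ?(ltW h0) //.
  apply: le_trans (enormD _ _) _; rewrite lerD2l enormZ.
  by apply: ler_pM.
rewrite enormZ exprMn real_normK ?num_real //.
apply: (@le_trans _ _ (h^-1 ^+ 2 * (2 * ((S ^+ 2 - m ^+ 2) * (C2 * h) + (S * (d%:R * (C1 * h))) ^+ 2)))).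
  rewrite ler_wpM2l ?sqr_ge0 //; apply: le_trans nAB _.
  by rewrite ler_wpM2l // lerD2r.
rewrite le_eqVlt; apply/orP; left; apply/eqP; field; exact: lt0r_neq0.
Qed.

End OneStep.

Section StepArithmetic.
Variable R : realType.

Definition stab (Lam C1 C2 : R) : R :=
  (12 * Lam ^+ 2 * C2 + 1) + 6 * Lam ^+ 2 * (1 + 2 * C1 ^+ 2).

Lemma young_sqr (a b t : R) : 0 < t -> (a + b) ^+ 2 <= (1 + t) * a ^+ 2 + (1 + t^-1) * b ^+ 2.
Proof.
move=> t0.
have -> : (1 + t) * a ^+ 2 + (1 + t^-1) * b ^+ 2 =
  (a + b) ^+ 2 + t^-1 * (t * a - b) ^+ 2 by field; exact: lt0r_neq0.
by rewrite lerDl mulr_ge0 ?sqr_ge0 // invr_ge0 ltW.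
Qed.

(** Young's inequality with weight [kap * h] leaves a term in [V ^+ 2], whose singular part is a
    multiple of [S ^+ 2 - m ^+ 2]. The value of [kap] makes this multiple at most one, so the
    variance saved by averaging pays for it. *)
Lemma y_component_bound (Lam C1 C2 h S m V U : R) :
  0 <= Lam -> 0 <= C2 -> 0 < h -> h <= (12 * Lam ^+ 2 * C2 + 1)^-1 ->
  0 <= S -> `|m| <= S -> 0 <= V ->
  V ^+ 2 <= 2 * C2 / h * (S ^+ 2 - m ^+ 2) + 2 * (C1 * S) ^+ 2 ->
  `|U| <= `|m| + h * (Lam * (1 + S + V)) ->
  1 + U ^+ 2 <= (1 + stab Lam C1 C2 * h) * (1 + S ^+ 2).
Proof.
move=> L0 C20 h0 hk S0 mS V0 HV HU.
set kap := 12 * Lam ^+ 2 * C2 + 1 in hk.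
have LC : 0 <= Lam ^+ 2 * C2 by rewrite mulr_ge0 ?sqr_ge0.
have k1 : 1 <= kap by rewrite /kap; move: LC; clra.
have k0 : 0 < kap by apply: lt_le_trans k1.
have h1 : h <= 1 by apply: le_trans hk _; rewrite invf_le1.
have kh : 0 < kap * h by rewrite mulr_gt0.
have hh : h <= 1 / kap by rewrite mul1r.
have mm : m ^+ 2 <= S ^+ 2 by rewrite -[m ^+ 2]real_normK ?num_real // ler_sqr ?nnegrE.
pose b := h * (Lam * (1 + S + V)).
have b0 : 0 <= b by rewrite !mulr_ge0 ?(ltW h0) // !addr_ge0.
have U1 : U ^+ 2 <= (1 + kap * h) * m ^+ 2 + (1 + (kap * h)^-1) * b ^+ 2.
  rewrite -[U ^+ 2]real_normK ?num_real // -[m ^+ 2]real_normK ?num_real //.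
  apply: le_trans (young_sqr _ _ kh).
  by rewrite ler_sqr ?nnegrE ?addr_ge0.
have q3 : (1 + S + V) ^+ 2 <= 3 * (1 + S ^+ 2 + V ^+ 2).
  by have := sqr_ge0 (1 - S); have := sqr_ge0 (1 - V); have := sqr_ge0 (S - V); clra.
pose G := S ^+ 2 - m ^+ 2.
have G0 : 0 <= G by rewrite subr_ge0.
have b2 : (1 + (kap * h)^-1) * b ^+ 2 <= (h + kap^-1) * Lam ^+ 2 * 3 *
    (h * (1 + S ^+ 2) + (2 * C2 * G + h * (2 * (C1 * S) ^+ 2))).
  have -> : (1 + (kap * h)^-1) * b ^+ 2 = (h + kap^-1) * Lam ^+ 2 * (h * (1 + S + V) ^+ 2).
    by rewrite /b; field; rewrite !lt0r_neq0.
  have c0 : 0 <= (h + kap^-1) * Lam ^+ 2.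
    by rewrite mulr_ge0 ?sqr_ge0 // addr_ge0 ?(ltW h0) // invr_ge0 ltW.
  rewrite -[leRHS]mulrA; apply: ler_wpM2l => //.
  have e1 : h * V ^+ 2 <= 2 * C2 * G + h * (2 * (C1 * S) ^+ 2).
    have : h * V ^+ 2 <= h * (2 * C2 / h * G + 2 * (C1 * S) ^+ 2) by rewrite ler_wpM2l // ltW.
    suff -> : h * (2 * C2 / h * G + 2 * (C1 * S) ^+ 2) = 2 * C2 * G + h * (2 * (C1 * S) ^+ 2) by [].
    by field; exact: lt0r_neq0.
  have e2 : h * (1 + S + V) ^+ 2 <= h * (3 * (1 + S ^+ 2 + V ^+ 2)) by rewrite ler_wpM2l // ltW.
  by move: e1 e2; clra.
have hk2 : h + kap^-1 <= 2 / kap by rewrite mulrC; move: hk; clra.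
have c1 : (h + kap^-1) * Lam ^+ 2 * 3 * (2 * C2) <= 1.
  apply: (@le_trans _ _ (2 / kap * (Lam ^+ 2 * 3 * (2 * C2)))).
    have -> : (h + kap^-1) * Lam ^+ 2 * 3 * (2 * C2) = (h + kap^-1) * (Lam ^+ 2 * 3 * (2 * C2)) by ring.
    apply: ler_wpM2r => //; apply: mulr_ge0; last exact: mulr_ge0.
    by apply: mulr_ge0 => //; exact: sqr_ge0.
  rewrite mulrAC ler_pdivrMr // mul1r /kap; move: LC; clra.
have k2 : kap^-1 <= 1 by rewrite invf_le1.
have hk3 : h + kap^-1 <= 2 by move: h1 k2; clra.
have L2 := sqr_ge0 Lam; have S2 := sqr_ge0 S; have CS := sqr_ge0 (C1 * S); have C12 := sqr_ge0 C1.
have hk0 : 0 <= h + kap^-1 by rewrite addr_ge0 ?(ltW h0) // invr_ge0 ltW.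
have t1 : (h + kap^-1) * Lam ^+ 2 * 3 * (2 * C2 * G) <= G.
  by rewrite [leLHS]mulrA ler_piMl.
have t2 : (h + kap^-1) * Lam ^+ 2 * 3 * (h * (1 + S ^+ 2) + h * (2 * (C1 * S) ^+ 2)) <=
    6 * Lam ^+ 2 * (1 + 2 * C1 ^+ 2) * h * (1 + S ^+ 2).
  have u1 : 1 + S ^+ 2 + 2 * (C1 * S) ^+ 2 <= (1 + 2 * C1 ^+ 2) * (1 + S ^+ 2).
    by rewrite exprMn; move: C12; clra.
  apply: (@le_trans _ _ (2 * Lam ^+ 2 * 3 * (h * ((1 + 2 * C1 ^+ 2) * (1 + S ^+ 2))))).
    apply: ler_pM.
    - by rewrite !mulr_ge0.
    - by apply: addr_ge0; apply: mulr_ge0; rewrite ?(ltW h0) //; [exact: addr_ge0|exact: mulr_ge0].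
    - by apply: ler_wpM2r => //; exact: ler_wpM2r.
    - by rewrite -mulrDr ler_wpM2l // ltW.
  by rewrite le_eqVlt; apply/orP; left; apply/eqP; ring.
have t3 : kap * h * m ^+ 2 <= kap * h * (1 + S ^+ 2).
  by rewrite ler_wpM2l ?(ltW kh) //; move: mm; clra.
have -> : (1 + stab Lam C1 C2 * h) * (1 + S ^+ 2) = 1 + S ^+ 2 +
   (kap * h * (1 + S ^+ 2) + 6 * Lam ^+ 2 * (1 + 2 * C1 ^+ 2) * h * (1 + S ^+ 2)).
  by rewrite /stab /kap; ring.
have b3 : (h + kap^-1) * Lam ^+ 2 * 3 * (h * (1 + S ^+ 2) + (2 * C2 * G + h * (2 * (C1 * S) ^+ 2)))
  = (h + kap^-1) * Lam ^+ 2 * 3 * (2 * C2 * G) +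
    (h + kap^-1) * Lam ^+ 2 * 3 * (h * (1 + S ^+ 2) + h * (2 * (C1 * S) ^+ 2)) by ring.
rewrite b3 in b2; rewrite /G in t1 b2.
move: U1 b2 t1 t2 t3; clra.
Qed.

End StepArithmetic.

Section SchemeBound.
Context d0 (Omega : measurableType d0) (R : realType) (d : nat).
Local Notation E := 'rV[R]_d.

Definition finite_increment (P : probability Omega R) (g : Omega -> E) (C1 C2 h : R) : Prop :=
  exists (I : finType) (idx : Omega -> I) (c : I -> E),
  [/\ forall i, measurable (idx @^-1` [set i]), forall w, g w = c (idx w),
      forall j, `|\sum_i c i 0 j * pmass P idx i| <= C1 * h &
      \sum_i enorm (c i) ^+ 2 * pmass P idx i <= C2 * h].

Definition ybound (Lam K T C1 C2 : R) : R :=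
  Num.sqrt (expR (stab Lam (d%:R * C1) C2 * T) * (1 + K ^+ 2)).
Definition zbound (Lam K T C1 C2 : R) : R :=
  (2 * C2 + 2 * (d%:R * C1) ^+ 2 + 1) * (ybound Lam K T C1 C2 + 1) + K * (Lam * (1 + K)).

(** A discrete Gronwall argument on a bound for [1 + ub ^+ 2], with
    [(1 + A * h) ^+ N <= expR (A * T)]. At each level [vb] is estimated from the supremum of the
    next [ub]; the drift intervenes only through the points at which [ub] is evaluated. *)
Lemma scheme_bound (Lam K T C1 C2 h : R) (P : probability Omega R)
    (b : E -> R -> E -> E) (f : E -> R -> E -> R) (sigma : E -> R -> 'M[R]_d) (H : E -> R)
    (N : nat) (g : nat -> Omega -> E) (Pi : nat -> E -> E) :
  0 <= Lam -> 0 <= K -> 0 <= C1 -> 0 <= C2 ->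
  (forall x (y : R) z, enorm (b x y z) + `|f x y z| + enorm (sigma x y) <= Lam * (1 + `|y| + enorm z)) ->
  (forall x, `|H x| <= K /\ enorm (grad H x) <= K) ->
  0 < h -> h <= (12 * Lam ^+ 2 * C2 + 1)^-1 -> N%:R * h = T ->
  (forall k, (k < N)%N -> finite_increment P (g k) C1 C2 h) ->
  forall k x, (k <= N)%N ->
    `|ubar P b f sigma H N h g Pi k x| <= ybound Lam K T C1 C2 /\
    enorm (vbar P b f sigma H N h g Pi k x) <= zbound Lam K T C1 C2 / Num.sqrt h.
Proof.
move=> L0 K0 C10 C20 growth HK h0 hk NT inc.
set Sb := ybound _ _ _ _ _; set Zb := zbound _ _ _ _ _.
set A := stab Lam (d%:R * C1) C2.
have A0 : 0 <= A.
  by rewrite /A /stab !(addr_ge0, mulr_ge0, sqr_ge0) //.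
have dC : 0 <= d%:R * C1 by rewrite mulr_ge0.
have kap1 : 1 <= 12 * Lam ^+ 2 * C2 + 1 by rewrite lerDr !mulr_ge0 ?sqr_ge0.
have h1 : h <= 1 by apply: le_trans hk _; rewrite invf_le1 // (lt_le_trans _ kap1).
have Sb0 : 0 <= Sb by exact: sqrtr_ge0.
have sh0 : 0 < Num.sqrt h by rewrite sqrtr_gt0.
have sh1 : Num.sqrt h <= 1 by rewrite -sqrtr1 ler_wsqrtr.
have q1 : 1 <= 1 + A * h by rewrite lerDl mulr_ge0 // ltW.
have qb j : (j <= N)%N -> (1 + A * h) ^+ j * (1 + K ^+ 2) <= Sb ^+ 2.
  move=> jN; rewrite sqr_sqrtr; last by rewrite mulr_ge0 ?expR_ge0 // addr_ge0 ?sqr_ge0.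
  rewrite ler_wpM2r ?addr_ge0 ?sqr_ge0 //.
  apply: (@le_trans _ _ ((1 + A * h) ^+ N)); first by rewrite ler_weXn2l.
  rewrite -NT mulrCA expRM_natl lerXn2r ?nnegrE ?expR_ge0 ?(le_trans _ q1) //.
  exact: expR_ge1Dx.
have Zb0 : 0 <= Zb.
  by rewrite /Zb /zbound -/Sb !(addr_ge0, mulr_ge0, sqr_ge0) //.
have main j x : (j <= N)%N ->
    1 + (scheme_aux P b f sigma H N h g Pi j).1 x ^+ 2 <= (1 + A * h) ^+ j * (1 + K ^+ 2) /\
    enorm ((scheme_aux P b f sigma H N h g Pi j).2 x) <= Zb / Num.sqrt h.
  elim: j x => [|j IH] x jN.
    have [H1 H2] := HK x; rewrite /= expr0 mul1r; split.
      by rewrite lerD2l -[H x ^+ 2]real_normK ?num_real // ler_sqr ?nnegrE.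
    apply: (@le_trans _ _ Zb); last by rewrite ler_peMr // invf_ge1.
    apply: (@le_trans _ _ (K * (Lam * (1 + K)))); last first.
      by rewrite /Zb /zbound -/Sb lerDr !(addr_ge0, mulr_ge0, sqr_ge0) //.
    apply: le_trans (enorm_mulmx _ _) _; apply: ler_pM => //.
    have := growth x (H x) 0; rewrite enorm0 addr0 => gr.
    apply: (@le_trans _ _ (Lam * (1 + `|H x|))).
      by apply: le_trans gr; rewrite lerDr addr_ge0.
    by rewrite ler_wpM2l // lerD2l.
  have jN' := ltnW jN.
  have kN : (N - j.+1 < N)%N by rewrite -subn_gt0 subKn.
  have [I [idx [c [mI gE mean sq]]]] := inc _ kN.
  rewrite /=; set k := (N - j.+1)%N.
  set ub := (scheme_aux P b f sigma H N h g Pi j).1.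
  set vb := (scheme_aux P b f sigma H N h g Pi j).2.
  set Q := (1 + A * h) ^+ j * (1 + K ^+ 2).
  have Q1 : 1 <= Q.
    have -> : 1 = 1 * 1 :> R by rewrite mulr1.
    by apply: ler_pM => //; [exact: exprn_ege1|rewrite lerDl sqr_ge0].
  pose S := Num.sqrt (Q - 1).
  have S0 : 0 <= S by exact: sqrtr_ge0.
  have S2 : S ^+ 2 = Q - 1 by rewrite sqr_sqrtr // subr_ge0.
  have ubS y : `|ub y| <= S.
    rewrite -ler_sqr ?nnegrE // S2 real_normK ?num_real //.
    by have [h2 _] := IH y jN'; rewrite lerBrDl.
  have SSb : S <= Sb.
    rewrite -ler_sqr ?nnegrE // S2; apply: le_trans (qb _ jN').
    by rewrite lerBlDr lerDl.
  pose TT i := x + (h *: b x (ub x) (vhatf P sigma g Pi ub vb k x) + mv (sigma x (ub x)) (c i)).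
  pose Y i := ub (Pi k.+1 (TT i)).
  have YE w : ub (Pi k.+1 (x + Tf P b sigma h g Pi ub vb k x w)) = Y (idx w).
    by rewrite /Y /TT /Tf gE.
  have p0 := pmass_ge0 P idx; have p1 := pmass_sum P mI.
  have YS i : `|Y i| <= S by exact: ubS.
  have mE : Ereal P (fun w => ub (Pi k.+1 (x + Tf P b sigma h g Pi ub vb k x w))) = \sum_i Y i * pmass P idx i.
    by rewrite -(Ereal_fin P mI); congr Ereal; apply: funext => w; exact: YE.
  have vE : Evec P (fun w => ub (Pi k.+1 (x + Tf P b sigma h g Pi ub vb k x w)) *: g k w) =
      \row_l \sum_i (Y i * c i 0 l) * pmass P idx i.
    apply/rowP => l; rewrite !mxE -(Ereal_fin P mI (fun i => Y i * c i 0 l)).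
    by congr Ereal; apply: funext => w; rewrite YE gE !mxE.
  rewrite mE vE; set m := \sum_i Y i * _; set v := h^-1 *: _.
  have mS : `|m| <= S by exact: mean_abs_le.
  have vB := z_component_bound p0 p1 YS h0 C10 mean sq.
  rewrite -/m -/v in vB.
  split.
    rewrite [(1 + A * h) ^+ j.+1]exprS -[leRHS]mulrA -/Q.
    have -> : Q = 1 + S ^+ 2 by rewrite S2 addrC subrK.
    apply: (@y_component_bound R Lam (d%:R * C1) C2 h S m (enorm v)) => //.
    apply: le_trans (ler_normD _ _) _; rewrite lerD2l normrM (gtr0_norm h0) mulrC.
    rewrite ler_wpM2l ?(ltW h0) //.
    have gr := growth x (ub x) v.
    apply: (@le_trans _ _ (Lam * (1 + `|ub x| + enorm v))).
      by apply: le_trans gr; rewrite addrAC lerDr addr_ge0.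
    by rewrite ler_wpM2l // lerD2r lerD2l.
  rewrite -ler_sqr ?nnegrE ?divr_ge0 ?(ltW sh0) //.
  have -> : (Zb / Num.sqrt h) ^+ 2 = Zb ^+ 2 / h by rewrite exprMn exprVn sqr_sqrtr // ltW.
  apply: le_trans vB _; rewrite ler_pdivlMr // mulrDl.
  have -> : 2 * C2 / h * (S ^+ 2 - m ^+ 2) * h = 2 * C2 * (S ^+ 2 - m ^+ 2).
    by field; exact: lt0r_neq0.
  set a := 2 * C2 + 2 * (d%:R * C1) ^+ 2.
  have a0 : 0 <= a by rewrite /a !(addr_ge0, mulr_ge0, sqr_ge0).
  have m2 := sqr_ge0 m.
  apply: (@le_trans _ _ (a * S ^+ 2)).
    rewrite /a [leRHS]mulrDl; apply: lerD.
      by apply: ler_wpM2l; [exact: mulr_ge0|rewrite lerBlDr lerDl].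
    rewrite [(d%:R * C1 * S) ^+ 2]exprMn [2 * (_ * _)]mulrA; apply: ler_piMr => //.
    by apply: mulr_ge0; [apply: mulr_ge0 => //; exact: sqr_ge0|exact: sqr_ge0].
  apply: (@le_trans _ _ ((a + 1) ^+ 2 * (Sb + 1) ^+ 2)).
    apply: ler_pM => //; first exact: sqr_ge0.
      by have := sqr_ge0 a; move: a0; clra.
    by rewrite ler_sqr ?nnegrE ?addr_ge0 // (le_trans SSb) // lerDl.
  have aS : 0 <= (a + 1) * (Sb + 1) by apply: mulr_ge0; [exact: addr_ge0|exact: addr_ge0].
  rewrite -exprMn ler_sqr ?nnegrE //.
  by rewrite /Zb /zbound -/Sb -/a lerDl !(addr_ge0, mulr_ge0).
move=> k x kN; have jN : (N - k <= N)%N by exact: leq_subr.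
have [h2 h3] := main (N - k)%N x jN; split => //.
rewrite -ler_sqr ?nnegrE // real_normK ?num_real //.
apply: le_trans (qb _ jN); apply: le_trans h2.
by rewrite lerDr.
Qed.

End SchemeBound.

(** * Comparison of the shifted and unshifted expectations *)

Section Cells.
Variables (R : realType) (d : nat) (delta : R).
Local Notation E := 'rV[R]_d.

Definition cpos (t : R) : R := t / delta + 2^-1.

(** Points with a margin of [delta / 12] in their cell, the largest quantization error tolerated in
    [key_estimate]. *)
Definition deep : set E := [set z | forall j,
  12^-1 <= cpos (z 0 j) - flr (cpos (z 0 j)) < 11 / 12].

Lemma flr_itv (y : R) : flr y <= y < flr y + 1.
Proof. by have := floor_itv y; rewrite intrD. Qed.

Lemma flr_eq (y z : R) : flr z <= y < flr z + 1 -> flr y = flr z.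
Proof. by rewrite /flr => h; congr (_%:~R); apply: floor_def; rewrite intrD. Qed.

Lemma cpos_dist (s t r : R) : 0 < delta -> `|s - t| <= delta * r -> `|cpos s - cpos t| <= r.
Proof.
move=> d0 h; have -> : cpos s - cpos t = (s - t) / delta by rewrite /cpos; ring.
by rewrite normrM (gtr0_norm (_ : 0 < delta^-1)) ?invr_gt0 // ler_pdivrMr // mulrC.
Qed.

Lemma deep_near (y z : E) : 0 < delta -> deep z -> enorm (y - z) <= delta * 12^-1 ->
  Pi_inf delta y = Pi_inf delta z.
Proof.
move=> d0 dz yz; apply/rowP => j; rewrite !mxE; congr (_ * _).
have h : `|y 0 j - z 0 j| <= delta * 12^-1.
  by apply: le_trans yz; have := coord_le_enorm (y - z) 0 j; rewrite !mxE.
have := cpos_dist d0 h; have := dz j; rewrite ler_norml => /andP[h1 h2] /andP[h3 h4].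
rewrite -!/(cpos _).
by apply: flr_eq; apply/andP; split; move: h1 h2 h3 h4; clra.
Qed.

Definition third (e : {ffun 'I_d -> 'I_3}) : E := \row_j ((e j)%:R - 1).

(** The translation is read off the cell position of [y] and would bring [y] into the middle third
    of its cell. The nearby point [z] then lands between 1/4 and 3/4 of the same cell. *)
Lemma third_shift (y z : E) : 0 < delta -> enorm (y - z) <= delta * 12^-1 ->
  exists e, deep (z + (delta / 3) *: third e) /\
    Pi_inf delta (z + (delta / 3) *: third e) = Pi_inf delta y.
Proof.
move=> d0 yz.
pose r j := cpos (y 0 j) - flr (cpos (y 0 j)).
pose e : {ffun 'I_d -> 'I_3} := [ffun j => if r j < 3^-1 then @inord 2 2 else
  if r j < 2 / 3 then @inord 2 1 else @inord 2 0].
exists e.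
have key j : flr (cpos (y 0 j)) + 4^-1 <= cpos ((z + (delta / 3) *: third e) 0 j)
             < flr (cpos (y 0 j)) + 3 / 4.
  have -> : cpos ((z + (delta / 3) *: third e) 0 j) = cpos (z 0 j) + 3^-1 * ((e j)%:R - 1).
    by rewrite /cpos !mxE; field; exact: lt0r_neq0.
  have h : `|y 0 j - z 0 j| <= delta * 12^-1.
    by apply: le_trans yz; have := coord_le_enorm (y - z) 0 j; rewrite !mxE.
  have := cpos_dist d0 h; have := flr_itv (cpos (y 0 j)).
  rewrite ler_norml => /andP[f1 f2] /andP[h1 h2].
  rewrite /e ffunE /r; case: ltP => c1; last case: ltP => c2.
  - by rewrite inordK //; move: f1 f2 h1 h2 c1 => /= *; apply/andP; split; lra.
  - by rewrite inordK //; move: f1 f2 h1 h2 c1 c2 => /= *; apply/andP; split; lra.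
  - by rewrite inordK //; move: f1 f2 h1 h2 c1 c2 => /= *; apply/andP; split; lra.
have fE j : flr (cpos ((z + (delta / 3) *: third e) 0 j)) = flr (cpos (y 0 j)).
  apply: flr_eq; have /andP[k1 k2] := key j.
  by apply/andP; split; move: k1 k2; clra.
split; first by move=> j; rewrite fE; have /andP[k1 k2] := key j; apply/andP; split; move: k1 k2; clra.
by apply/rowP => j; rewrite [LHS]mxE [RHS]mxE; congr (_ * _); exact: fE.
Qed.

Lemma third_le (e : {ffun 'I_d -> 'I_3}) : enorm (third e) <= d%:R.
Proof.
rewrite -[leRHS]mulr1; apply: enorm_le_coord => // j; rewrite mxE ler_norml.
have := ltn_ord (e j); case: (nat_of_ord (e j)) => [|[|[|]]] //= _; apply/andP; split; lra.
Qed.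

Section Measurability.
Context d1 (T : measurableType d1) (X : T -> E).
Hypothesis mX : forall j, measurable_fun [set: T] (fun w => X w 0 j).

Lemma measurable_cpos j : measurable_fun [set: T] (fun w => cpos (X w 0 j)).
Proof. by apply: measurable_funD => //; apply: measurable_funM. Qed.

(** The projection takes countably many values, each on a measurable set, so an arbitrary [G] may be
    composed with it. *)
Lemma measurable_Pi_inf (G : E -> R) : measurable_fun [set: T] (fun w => G (Pi_inf delta (X w))).
Proof.
pose val (m : {ffun 'I_d -> int}) : E := \row_j (delta * (m j)%:~R).
pose idx w := [ffun j => Num.floor (cpos (X w 0 j))] : {ffun 'I_d -> int}.
have PE w : Pi_inf delta (X w) = val (idx w).
  by apply/rowP => j; rewrite !mxE ffunE.
have mi (m : {ffun 'I_d -> int}) : measurable (idx @^-1` [set m]).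
  have -> : idx @^-1` [set m] = \bigcap_(j in [set: 'I_d])
      (fun w => cpos (X w 0 j)) @^-1` `[(m j)%:~R, (m j + 1)%:~R[.
    apply/seteqP; split => w /=.
      by move=> <- j _ /=; rewrite in_itv /= ffunE; exact: floor_itv.
    move=> h; apply/ffunP => j; rewrite ffunE; apply: floor_def.
    by have := h j I; rewrite /= in_itv.
  apply: fin_bigcap_measurable => // j _.
  by rewrite -[X in measurable X]setTI; apply: measurable_cpos.
move=> _ A mA; rewrite setTI.
pose Fn (n : nat) : set T := if unpickle n is Some m then
  (if pselect (A (G (val m))) then idx @^-1` [set m] else set0) else set0.
have -> : (fun w => G (Pi_inf delta (X w))) @^-1` A = \bigcup_n Fn n.
  apply/seteqP; split => w /=.
    rewrite PE => h; exists (pickle (idx w)) => //; rewrite /Fn pickleK.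
    by case: pselect.
  move=> [n _]; rewrite /Fn; case: (unpickle n) => // m; case: pselect => [h|//] /= im.
  by rewrite PE im.
apply: bigcupT_measurable => n; rewrite /Fn; case: (unpickle n) => // m.
by case: pselect => h /=; [exact: mi|exact: measurable0].
Qed.

Lemma measurable_flr : measurable_fun [set: R] (@flr R).
Proof.
by apply: nondecreasing_measurable => // x y xy; rewrite /flr ler_int; exact: le_floor.
Qed.

Lemma measurable_deep : measurable [set w | deep (X w)].
Proof.
have -> : [set w | deep (X w)] = \bigcap_(j in [set: 'I_d])
   (fun w => cpos (X w 0 j) - flr (cpos (X w 0 j))) @^-1` `[12^-1, 11 / 12[.
  apply/seteqP; split => w /=; first by move=> h j _ /=; rewrite in_itv; exact: h.
  by move=> h j; have := h j I; rewrite /= in_itv.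
apply: fin_bigcap_measurable => // j _.
rewrite -[X in measurable X]setTI.
have mc := measurable_cpos j.
have mf : measurable_fun [set: T] (fun w => cpos (X w 0 j) - flr (cpos (X w 0 j))).
  by apply: measurable_funB => //; apply: (measurableT_comp measurable_flr).
exact: mf.
Qed.

End Measurability.
End Cells.

Section KeyEstimate.
Context d0 (Omega : measurableType d0) (R : realType) (d : nat).
Local Notation E := 'rV[R]_d.

(** Off the exceptional event, the value at the quantized point is at most a sum over the [3 ^ d]
    translations of [psiA (D w + be e)]. [shift_L2] removes each translation, and [psiA (D w)] is in
    turn at most the value at the quantized point with drift. *)
Lemma key_estimate (P : probability Omega R) (D : Omega -> E) (s : R)
    (I : finType) (idx : Omega -> I) (c : I -> E) (A : 'M[R]_d) (x a : E) (G : E -> R)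
    (sl Ca CF delta pb : R) :
  gaussian_vector P D s -> (forall i, measurable (idx @^-1` [set i])) ->
  0 < sl -> (forall xi : E, sl * enorm xi <= enorm (xi *m A)) ->
  0 < delta -> delta <= s -> 0 <= Ca -> enorm a <= Ca * s ->
  0 < CF -> 0 < pb -> (forall y, 0 <= G y <= CF) ->
  (P [set w | delta * 12^-1 < enorm ((c (idx w) - D w) *m A)]%R <= pb%:E)%E ->
  \sum_i G (Pi_inf delta (x + c i *m A)) * pmass P idx i <=
    CF * pb + (3 ^ d)%N%:R * (expR ((((d%:R / 3 + Ca) / sl) ^+ 2) / 2) *
      (Num.sqrt (\sum_i G (Pi_inf delta (x + a + c i *m A)) ^+ 2 * pmass P idx i) +
       CF * Num.sqrt pb)).
Proof.
move=> GD mI sl0 ell d0' ds Ca0 aC CF0 pb0 GF HB.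
have [s0 mD _] := GD.
have [uA _] := elliptic_tr sl0 ell.
move: HB; set B := mkset _ => HB.
(* A single shift of the Gaussian cancels the drift [a] and adds the translation within the cell;
   both are of order [s] because [delta <= s]. *)
pose be (e : {ffun 'I_d -> 'I_3}) : E := ((delta / 3) *: third R e - a) *m invmx A.
have beA e : be e *m A = (delta / 3) *: third R e - a by rewrite /be mulmxKV.
pose Cb := (d%:R / 3 + Ca) / sl.
have beS e : enorm (be e) <= Cb * s.
  have h1 := ell (be e); rewrite beA in h1.
  have h2 : enorm ((delta / 3) *: third R e - a) <= (d%:R / 3 + Ca) * s.
    apply: le_trans (enormB _ _) _; rewrite enormZ (gtr0_norm (_ : 0 < delta / 3)) ?divr_gt0 // mulrDl lerD //.
    have -> : d%:R / 3 * s = s / 3 * d%:R by ring.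
    apply: ler_pM => //; first by rewrite divr_ge0 // ltW.
      by rewrite ler_pM2r ?invr_gt0.
    exact: third_le.
  have -> : Cb * s = (d%:R / 3 + Ca) * s / sl by rewrite /Cb; ring.
  by rewrite ler_pdivlMr // mulrC; apply: le_trans h1 h2.
(* The indicator restricts to points whose projection survives the quantization error. *)
pose psi (z : E) : R := G (Pi_inf delta z) * \1_(deep delta (d := d)) z.
have psi0 z : 0 <= psi z by have /andP[h _] := GF (Pi_inf delta z); rewrite mulr_ge0 // indicE.
pose psiA (z : rvector R d) : R := psi (x + a + (z : E) *m A).
have mX j : measurable_fun [set: rvector R d] (fun z : rvector R d => (x + a + (z : E) *m A) 0 j).
  under eq_fun do rewrite mxE [X in _ + X]mxE -big_enum.
  apply: measurable_funD => //; apply: measurable_sum => k.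
  by apply: measurable_funM => //; exact: measurable_rvector_coord.
have mpsi : measurable_fun [set: rvector R d] psiA.
  apply: measurable_funM; first exact: (measurable_Pi_inf delta mX).
  have h := @measurable_indic _ (rvector R d) R setT _ (measurable_deep delta mX).
  exact: h.
have mDV : measurable_fun [set: Omega] (D : Omega -> rvector R d) by exact: measurable_rvector.
have mpD (e : E) : measurable_fun [set: Omega] (fun w => psiA (D w + e)).
  apply: (measurableT_comp mpsi); apply: measurable_rvector => j.
  by under eq_fun do rewrite mxE; apply: measurable_funD.
have mB : measurable B.
  have mN : measurable_fun [set: Omega] (fun w => enorm ((c (idx w) - D w) *m A)).
    apply: measurable_enorm_comp => j.
    under eq_fun do rewrite mxE -big_enum.
    apply: measurable_sum => k; apply: measurable_funM => //.
    exact: (measurable_quantization_error c mI GD).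
  have -> : B = (fun w => enorm ((c (idx w) - D w) *m A)) @^-1` `]delta * 12^-1, +oo[.
    by apply/seteqP; split => w /=; rewrite in_itv /= andbT.
  by rewrite -[X in measurable X]setTI; apply: mN.
have mI1 : measurable_fun [set: Omega] (\1_B : Omega -> R) by exact: measurable_indic.
have mI2 : measurable_fun [set: Omega] (fun w => (\1_B w : R)%:E) by exact/measurable_EFinP.
have nI w : [set: Omega] w -> (0 <= (\1_B w : R)%:E)%E by rewrite lee_fin indicE.
have iB : (\int[P]_w (\1_B w)%:E <= pb%:E)%E by rewrite integral_indic // setIT.
have nearB w : ~ B w -> forall y, enorm ((y + c (idx w) *m A) - (y + D w *m A)) <= delta * 12^-1.
  move=> nB y; rewrite opprD addrACA subrr add0r -mulmxBl leNgt.
  by apply/negP => h; apply: nB.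
pose G1 i := G (Pi_inf delta (x + c i *m A)).
pose G2 i := G (Pi_inf delta (x + a + c i *m A)) ^+ 2.
set phi2 := \sum_i G (Pi_inf delta (x + a + c i *m A)) ^+ 2 * pmass P idx i.
have phi20 : 0 <= phi2 by apply: sumr_ge0 => i _; rewrite mulr_ge0 ?sqr_ge0 ?pmass_ge0.
(* The second summand accounts for the exceptional event and makes [q] positive, as [shift_L2]
   requires. *)
pose q := Num.sqrt phi2 + CF * Num.sqrt pb.
have sq0 : 0 < CF * Num.sqrt pb by rewrite mulr_gt0 // sqrtr_gt0.
have q0 : 0 < q by rewrite /q ltr_wpDl ?sqrtr_ge0.
have Hq : (\int[P]_w (psiA (D w) ^+ 2)%:E <= (q ^+ 2)%:E)%E.
  apply: (@le_trans _ _ (\int[P]_w ((G2 (idx w))%:E + (CF ^+ 2)%:E * (\1_B w)%:E))%E).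
    apply: ge0_le_integral => //.
    - by move=> w _; rewrite lee_fin sqr_ge0.
    - apply/measurable_EFinP; apply: measurable_funX.
      by have := mpD 0; under eq_fun do rewrite addr0.
    - apply: emeasurable_funD; last by apply: emeasurable_funM => //; exact/measurable_EFinP.
      apply/measurable_EFinP; exact: (measurable_fin mI (G2 : I -> measurableTypeR R)).
    - move=> w _; rewrite -EFinM -EFinD lee_fin /psiA /psi exprMn !indicE.
      have /andP[g0 g1] := GF (Pi_inf delta (x + a + D w *m A)).
      have g2 : 0 <= G2 (idx w) by exact: sqr_ge0.
      have [Bw|nBw] := pselect (B w).
        rewrite [w \in B]mem_set // mulr1.
        apply: (@le_trans _ _ (CF ^+ 2)); last by rewrite lerDr.
        case: (_ \in _); rewrite ?expr1n ?mulr1 ?expr0n ?mulr0 ?sqr_ge0 //.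
        by rewrite ler_sqr ?nnegrE // ltW.
      rewrite [w \in B]memNset // mulr0 addr0.
      have [dz|ndz] := pselect (deep delta (x + a + D w *m A)); last first.
        by rewrite memNset // expr0n mulr0.
      rewrite mem_set // expr1n mulr1 /G2.
      by rewrite (deep_near d0' dz (nearB w nBw (x + a))).
  rewrite ge0_integralD //; last 4 first.
  - by move=> w _; rewrite lee_fin sqr_ge0.
  - apply/measurable_EFinP; exact: (measurable_fin mI (G2 : I -> measurableTypeR R)).
  - by move=> w _; rewrite mule_ge0 // lee_fin ?sqr_ge0 // indicE.
  - by apply: emeasurable_funM => //; exact/measurable_EFinP.
  rewrite (integral_finT P mI G2) ge0_integralZl_EFin ?sqr_ge0 //.
  apply: (@le_trans _ _ (phi2%:E + (CF ^+ 2)%:E * pb%:E)%E).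
    by apply: leeD => //; apply: lee_wpmul2l => //; rewrite lee_fin sqr_ge0.
  rewrite -EFinM -EFinD lee_fin /q sqrrD sqr_sqrtr // exprMn sqr_sqrtr ?(ltW pb0) //.
  by rewrite lerD2r lerDl mulrn_wge0 // mulr_ge0 ?sqrtr_ge0 // ltW.
have He e : (\int[P]_w (psiA (D w + be e))%:E <= (q * expR (Cb ^+ 2 / 2))%:E)%E.
  apply: le_trans (shift_L2 GD (be e) mpsi (fun z => psi0 _) q0 Hq) _.
  rewrite lee_fin ler_pM2l // ler_expR ler_pdivrMr ?mulr_gt0 ?exprn_gt0 //.
  have -> : Cb ^+ 2 / 2 * (2 * s ^+ 2) = (Cb * s) ^+ 2 by field.
  by rewrite ler_sqr ?nnegrE // (le_trans _ (beS e)).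
rewrite -lee_fin -(integral_finT P mI G1).
apply: (@le_trans _ _ (\int[P]_w (CF%:E * (\1_B w)%:E +
    \sum_(e <- enum {ffun 'I_d -> 'I_3}) (psiA (D w + be e))%:E))%E).
  apply: ge0_le_integral => //.
  - by move=> w _; rewrite lee_fin; have /andP[] := GF (Pi_inf delta (x + c (idx w) *m A)).
  - apply/measurable_EFinP; exact: (measurable_fin mI (G1 : I -> measurableTypeR R)).
  - apply: emeasurable_funD; first by apply: emeasurable_funM => //; exact/measurable_EFinP.
    by apply: emeasurable_sum => e; exact/measurable_EFinP.
  - move=> w _; rewrite sumEFin -EFinM -EFinD lee_fin big_enum indicE.
    have /andP[g0 g1] := GF (Pi_inf delta (x + c (idx w) *m A)).
    have [Bw|nBw] := pselect (B w).
      rewrite mem_set // mulr1; apply: le_trans g1 _; rewrite lerDl.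
      by apply: sumr_ge0 => e _; exact: psi0.
    rewrite memNset // mulr0 add0r.
    have [e [de Pe]] := third_shift d0' (nearB w nBw x).
    rewrite (bigD1 e) //= /psiA mulmxDl beA.
    have -> : x + a + (D w *m A + ((delta / 3) *: third R e - a)) = x + D w *m A + (delta / 3) *: third R e.
      move: (D w *m A) ((delta / 3) *: third R e) => u v.
      by apply/rowP => j; rewrite !mxE; ring.
    by rewrite {1}/psi indicE mem_set // mulr1 Pe lerDl sumr_ge0.
rewrite ge0_integralD //; last 4 first.
- by move=> w _; rewrite mule_ge0 // lee_fin ?(ltW CF0) // indicE.
- by apply: emeasurable_funM => //; exact/measurable_EFinP.
- by move=> w _; apply: sume_ge0 => e _; rewrite lee_fin; exact: psi0.
- by apply: emeasurable_sum => e; exact/measurable_EFinP.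
rewrite ge0_integralZl_EFin ?(ltW CF0) //.
rewrite ge0_integral_sum //; last 2 first.
- by move=> e; exact/measurable_EFinP.
- by move=> e w _; rewrite lee_fin; exact: psi0.
apply: (@le_trans _ _ (CF%:E * pb%:E + \sum_(e <- enum {ffun 'I_d -> 'I_3}) (q * expR (Cb ^+ 2 / 2))%:E)%E).
  apply: leeD; first by apply: lee_wpmul2l => //; rewrite lee_fin ltW.
  by apply: lee_sum => e _; exact: He.
rewrite sumEFin -EFinM -EFinD lee_fin lerD2l big_enum sumr_const card_ffun !card_ord.
by rewrite -[leLHS]mulr_natl (mulrC q).
Qed.

End KeyEstimate.

(** * Conditional expectations *)

Section ConditionalExpectation.
Context d0 (Omega : measurableType d0) (R : realType).
Variable P : probability Omega R.

(** On the part of [S0] where [Y] exceeds the constant, which belongs to [G], the integral of the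
    positive difference vanishes by independence, so that part is null; likewise where [Y] is
    smaller. *)
Lemma cond_exp_on (G : set (set Omega)) (Z Y : Omega -> R) (S0 : set Omega)
    (I : finType) (idx : Omega -> I) (F : I -> R) :
  (forall S, G S -> measurable S) -> (forall S S', G S -> G S' -> G (S `&` S')) ->
  is_cond_exp P G Z Y -> G S0 -> (forall i, measurable (idx @^-1` [set i])) ->
  (forall w, S0 w -> Z w = F (idx w)) ->
  (forall S i, G S -> P (S `&` idx @^-1` [set i]) = P S * P (idx @^-1` [set i]))%E ->
  {ae P, forall w, S0 w -> Y w = \sum_i F i * pmass P idx i}.
Proof.
move=> Gm GI [GY [iY EY]] GS0 mI ZF ind.
set phi := \sum_i _.
have intS S : G S -> S `<=` S0 ->
    (\int[P]_(w in S) ((Y w)%:E - phi%:E) = 0)%E.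
  move=> GS SS0; have mS := Gm S GS.
  have iYS : P.-integrable S (EFin \o Y) by exact: (integrableS measurableT).
  have iCS : P.-integrable S (EFin \o (cst phi)) by exact: finite_measure_integrable_cst.
  have ec : (\int[P]_(w in S) (cst phi w)%:E = phi%:E * P S)%E := integral_cst P mS phi%:E.
  rewrite (integralB_EFin mS iYS iCS) ec EY //.
  rewrite (eq_integral (fun w => (F (idx w))%:E)); last first.
    by move=> w; rewrite inE => Sw; rewrite ZF //; exact: SS0.
  rewrite (integral_fin P mI) //.
  have fS : P S \is a fin_num by exact: fin_num_measure.
  have -> : \sum_i F i * fine (P (S `&` idx @^-1` [set i])) = phi * fine (P S).
    rewrite /phi mulr_suml; apply: eq_bigr => i _; rewrite ind // fineM //; last first.
      exact: fin_num_measure.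
    by rewrite mulrA mulrAC.
  rewrite EFinM fineK //; apply: subee; exact: fin_numM.
have side (S : set Omega) : G S -> S `<=` S0 ->
    ((forall w, S w -> phi < Y w) \/ (forall w, S w -> Y w < phi)) -> {ae P, forall w, ~ S w}.
  move=> GS SS0 h; have mS := Gm S GS.
  have iYS : P.-integrable S (EFin \o Y) by exact: (integrableS measurableT).
  have iCS : P.-integrable S (EFin \o (cst phi)) by exact: finite_measure_integrable_cst.
  have mf : measurable_fun S (fun w => ((Y w)%:E - phi%:E)%E).
    by have := measurable_int P (integrableB mS iYS iCS).
  have z : (\int[P]_(w in S) `|(Y w)%:E - phi%:E| = 0)%E.
    case: h => h.
      rewrite -[RHS](intS S GS SS0); apply: eq_integral => w; rewrite inE => Sw.
      by rewrite -EFinB gee0_abs // lee_fin subr_ge0 ltW // h.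
    transitivity (\int[P]_(w in S) (- ((Y w)%:E - phi%:E)))%E.
      apply: eq_integral => w; rewrite inE => Sw.
      by rewrite -EFinB lee0_abs // lee_fin subr_le0 ltW // h.
    rewrite integralN ?intS ?oppe0 //.
    have := integrableB mS iYS iCS; exact: integrable_add_def.
  have := (ae_eq_integral_abs P mS mf).1 z.
  apply: filterS => w /= hw Sw; have := hw Sw; rewrite -EFinB => -[] /eqP.
  by rewrite subr_eq0 => /eqP e; case: h => h; have := h w Sw; rewrite e ltxx.
have GA (A : set R) : measurable A -> G (S0 `&` Y @^-1` A) by move=> mA; apply: GI => //; exact: GY.
have h1 : {ae P, forall w, ~ (S0 `&` Y @^-1` `]phi, +oo[) w}.
  apply: side; [exact: GA|by move=> w []|left=> w [_] /=].
  by rewrite in_itv /= andbT.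
have h2 : {ae P, forall w, ~ (S0 `&` Y @^-1` `]-oo, phi[) w}.
  by apply: side; [exact: GA|move=> w []|right=> w [_] /=; rewrite in_itv].
apply: filterS2 h1 h2 => w n1 n2 S0w.
apply/eqP; rewrite eq_le; apply/andP; split; rewrite leNgt; apply/negP => lt.
  by apply: n1; split => //=; rewrite in_itv /= andbT.
by apply: n2; split => //=; rewrite in_itv.
Qed.

End ConditionalExpectation.

Section NearestIndex.
Variables (R : realType) (d : nat).
Local Notation E := 'rV[R]_d.

(** The finite label behind [nearest], which turns expectations into finite sums; [None] corresponds
    to the default value 0. *)
Definition nearest_idx (M : nat) (ygrid : 'I_M -> E) (z : E) : option 'I_M :=
  [pick i : 'I_M | [forall j : 'I_M, enorm (z - ygrid i) <= enorm (z - ygrid j)]].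

Definition grid_point (M : nat) (ygrid : 'I_M -> E) (o : option 'I_M) : E :=
  if o is Some i then ygrid i else 0.

Lemma nearestE M (ygrid : 'I_M -> E) z : nearest ygrid z = grid_point ygrid (nearest_idx ygrid z).
Proof. by rewrite /nearest /grid_point /nearest_idx; case: pickP. Qed.

(** The label is a function of the finite table of comparisons between distances, so the way ties
    are broken is irrelevant to measurability. *)
Lemma measurable_nearest_idx d1 (T : measurableType d1) (X : T -> E) (M : nat)
    (ygrid : 'I_M -> E) (o : option 'I_M) :
  (forall j, measurable_fun [set: T] (fun w => X w 0 j)) ->
  measurable ((fun w => nearest_idx ygrid (X w)) @^-1` [set o]).
Proof.
move=> mX.
pose cmp w : {ffun 'I_M * 'I_M -> bool} :=
  [ffun ij => enorm (X w - ygrid ij.1) <= enorm (X w - ygrid ij.2)].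
have mN i : measurable_fun [set: T] (fun w => enorm (X w - ygrid i)).
  apply: measurable_enorm_comp => j; under eq_fun do rewrite !mxE.
  exact: measurable_funB.
have mc (r : {ffun 'I_M * 'I_M -> bool}) : measurable (cmp @^-1` [set r]).
  have -> : cmp @^-1` [set r] = \bigcap_(ij in [set: 'I_M * 'I_M])
      (fun w => enorm (X w - ygrid ij.1) <= enorm (X w - ygrid ij.2)) @^-1` [set r ij].
    apply/seteqP; split => w /=; first by move=> <- ij _ /=; rewrite ffunE.
    by move=> h; apply/ffunP => ij; rewrite ffunE; exact: h.
  apply: fin_bigcap_measurable => // ij _.
  by rewrite -[X in measurable X]setTI; apply: measurable_fun_ler.
pose choose (r : {ffun 'I_M * 'I_M -> bool}) : option 'I_M :=
  [pick i : 'I_M | [forall j : 'I_M, r (i, j)]].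
have := measurable_fin mc (fun r => choose r == o : bool) measurableT (Y := [set true]).
rewrite setTI => /(_ _) h.
have -> : (fun w => nearest_idx ygrid (X w)) @^-1` [set o] =
   (fun w => choose (cmp w) == o) @^-1` [set true].
  have e w : choose (cmp w) = nearest_idx ygrid (X w).
    apply: eq_pick => i; apply: eq_forallb => j; by rewrite ffunE.
  by apply/seteqP; split => w /=; rewrite e => /eqP.
exact: h.
Qed.

End NearestIndex.

(** * The augmented filtration and independence of increments *)

Section BrownianFiltration.
Context d0 (Omega : measurableType d0) (R : realType) (d : nat).
Local Notation E := 'rV[R]_d.

Definition natural_events (B : R -> Omega -> E) (t : R) : set (set Omega) :=
  [set S | exists s (j : 'I_d) (A : set R), 0 <= s <= t /\ measurable A
                 /\ S = (fun w => B s w 0 j) @^-1` A].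

Lemma natural_gen_mono (B : R -> Omega -> E) (t t' : R) : t <= t' ->
  natural_gen B t `<=` natural_gen B t'.
Proof.
move=> tt'; apply: smallest_sub; first exact: smallest_sigma_algebra.
move=> S [s [j [A [/andP[s0 st] [mA ->]]]]]; apply: sub_sigma_algebra.
by exists s, j, A; rewrite s0 (le_trans st).
Qed.

Lemma natural_measurable_coord (B : R -> Omega -> E) (s t : R) (j : 'I_d) : 0 <= s <= t ->
  measurable_fun [set: g_sigma_algebraType (natural_events B t)]
    (fun w : g_sigma_algebraType (natural_events B t) => B s w 0 j).
Proof.
move=> st _ A mA; rewrite setTI; apply: sub_sigma_algebra.
by exists s, j, A.
Qed.

Lemma natural_gen_increment (B : R -> Omega -> E) (s t k : R) (M : nat) (ygrid : 'I_M -> E) o :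
  0 <= s -> s <= t ->
  natural_gen B t ((fun w => nearest_idx ygrid (k *: (B t w - B s w))) @^-1` [set o]).
Proof.
move=> s0 st.
have t0 := le_trans s0 st.
apply: (@measurable_nearest_idx R d _ (g_sigma_algebraType (natural_events B t))
  (fun w => k *: (B t w - B s w))) => j.
under eq_fun do rewrite !mxE.
apply: measurable_funM => //; apply: measurable_funB; apply: natural_measurable_coord.
  by rewrite t0 lexx.
by rewrite s0.
Qed.

Variable P : probability Omega R.

Lemma natural_gen_measurable (B : R -> Omega -> E) (t : R) : is_brownian P B ->
  natural_gen B t `<=` measurable.
Proof.
move=> [mB _]; apply: smallest_sub; first exact: sigma_algebra_measurable.
move=> S [s [j [A [/andP[s0 _] [mA ->]]]]].
by rewrite -[X in measurable X]setTI; apply: mB.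
Qed.

Lemma augmented_measurable (B : R -> Omega -> E) (t : R) : is_brownian P B ->
  augmented_filtration P B t `<=` measurable.
Proof.
move=> BM; have [mB _] := BM; apply: smallest_sub; first exact: sigma_algebra_measurable.
move=> S [[s [j [A [/andP[s0 _] [mA ->]]]]]|[]//].
by rewrite -[X in measurable X]setTI; apply: mB.
Qed.

Lemma natural_sub_augmented (B : R -> Omega -> E) (t : R) :
  natural_gen B t `<=` augmented_filtration P B t.
Proof. by apply: sub_smallest2r; [exact: smallest_sigma_algebra|move=> S; left]. Qed.

Lemma augmented_setI (B : R -> Omega -> E) (t : R) S S' :
  augmented_filtration P B t S -> augmented_filtration P B t S' ->
  augmented_filtration P B t (S `&` S').
Proof.
exact: (@measurableI _ (g_sigma_algebraType (natural_events B t `|` [set E | measurable E /\ P E = 0%E])) S S').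
Qed.

(** The events that agree with a natural event off a null set form a sigma-algebra containing the
    generators of the augmented one. *)
Lemma augmented_natural (B : R -> Omega -> E) (t : R) S : is_brownian P B ->
  augmented_filtration P B t S -> exists S' N, [/\ natural_gen B t S', measurable N, P N = 0%E &
    forall w, ~ N w -> S w <-> S' w].
Proof.
move=> BM.
pose C := [set S : set Omega | exists S' N, [/\ natural_gen B t S', measurable N, P N = 0%E &
    forall w, ~ N w -> S w <-> S' w]].
suff : augmented_filtration P B t `<=` C by move=> h /h.
have [n0 nC nU] := smallest_sigma_algebra setT (natural_events B t).
apply: smallest_sub.
  split.
  - by exists set0, set0; split.
  - move=> A [S' [N [h1 h2 h3 h4]]]; exists (setT `\` S'), N; split => //; first exact: nC.
    by move=> w nw; have := h4 w nw => -[h5 h6]; split => -[_ h]; split => // ?; apply: h; [exact: h6|exact: h5].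
  - move=> A HA.
    have /choice [S' HS'] : forall n, exists S', exists N, [/\ natural_gen B t S', measurable N, P N = 0%E &
       forall w, ~ N w -> A n w <-> S' w] by move=> n; exact: HA.
    have /choice [N HN] := HS'.
    exists (\bigcup_k S' k), (\bigcup_k N k); split.
    + by apply: nU => n; have [] := HN n.
    + by apply: bigcupT_measurable => n; have [] := HN n.
    + apply/negligibleP; first by apply: bigcupT_measurable => n; have [] := HN n.
      by apply: negligible_bigcup => n; have [_ mN N0 _] := HN n; exact/negligibleP.
    + move=> w nw; have nwk k : ~ N k w by move=> h; apply: nw; exists k.
      by split => -[k _ h]; exists k => //; have [_ _ _ /(_ w (nwk k))[h1 h2]] := HN k; [exact: h1|exact: h2].
move=> A [nA|[mA A0]].
  by exists A, set0; split => //; exact: sub_sigma_algebra.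
by exists set0, A; split.
Qed.

Lemma brownian_gaussian (B : R -> Omega -> E) (s t : R) : is_brownian P B -> 0 <= s < t ->
  gaussian_vector P (fun w => B t w - B s w) (Num.sqrt (t - s)).
Proof.
move=> [mB [_ [_ ind]]] st; have /andP[s0 s_t] := st; have t0 := ltW (le_lt_trans s0 s_t).
split; first by rewrite sqrtr_gt0 subr_gt0.
  by move=> j; under eq_fun do rewrite !mxE; apply: measurable_funB; exact: mB.
move=> A mA.
have nT : natural_gen B s setT.
  exact: (@measurableT _ (g_sigma_algebraType (natural_events B s))).
have := ind s t st setT nT A mA; rewrite setTI probability_setT mul1e => <-.
by congr (P _); apply/seteqP; split => w /= h j; have := h j; rewrite !mxE.
Qed.

(** [S] is replaced by a natural event up to a null set. For that event both sides are finite
    measures in [V] which agree on rectangles by the definition of Brownian motion. *)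
Lemma brownian_independent (B : R -> Omega -> E) (s t : R) (S : set Omega) (V : set (rvector R d)) :
  is_brownian P B -> 0 <= s < t -> augmented_filtration P B s S -> measurable V ->
  let D := fun w => B t w - B s w in (P (S `&` D @^-1` V) = P S * P (D @^-1` V))%E.
Proof.
move=> BM st aS mV D.
have GD := brownian_gaussian BM st.
rewrite -/D in GD; have [_ mD law] := GD.
have mDV : measurable_fun [set: Omega] (D : Omega -> rvector R d).
  exact: measurable_rvector.
have mDV' (W : set (rvector R d)) : measurable W -> measurable (D @^-1` W).
  by move=> mW; rewrite -[X in measurable X]setTI; exact: mDV.
have [S' [N [nS' mN PN SS']]] := augmented_natural BM aS.
have mS := augmented_measurable BM aS; have mS' := natural_gen_measurable BM nS'.
have eqP A : measurable A -> P (S `&` A) = P (S' `&` A).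
  move=> mA.
  have le (S1 S2 : set Omega) : measurable S1 -> measurable S2 ->
      (forall w, ~ N w -> S1 w -> S2 w) -> (P (S1 `&` A) <= P (S2 `&` A))%E.
    move=> m1 m2 h; apply: (@le_trans _ _ (P ((S2 `&` A) `|` N))).
      apply: le_measure; rewrite ?inE; [exact: measurableI|apply: measurableU => //; exact: measurableI|].
      move=> w [w1 wA]; have [Nw|Nw] := pselect (N w); first by right.
      by left; split => //; exact: h.
    apply: le_trans (measureU2 _ _ _) _ => //; first exact: measurableI.
    by rewrite [X in (_ + X <= _)%E](_ : _ = 0%E) ?adde0 //; exact: PN.
  by apply/eqP; rewrite eq_le !le //; move=> w nw; have [] := SS' w nw.
have PS : P S = P S' by have := eqP setT measurableT; rewrite !setIT.
rewrite eqP; last exact: mDV'.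
rewrite PS.
pose m1 := measure_function_pushforward__canonical__measure_function_Measure (mrestr P mS') mDV.
have r0 : 0 <= fine (P S') by exact: fine_ge0.
pose m2 := mscale (NngNum r0)
  (measure_function_pushforward__canonical__measure_function_Measure P mDV).
have e1 : P (S' `&` D @^-1` V) = m1 V by rewrite setIC.
have fS' : P S' \is a fin_num by exact: fin_num_measure.
have e2 : (P S' * P (D @^-1` V) = m2 V)%E by rewrite -{1}(fineK fS').
rewrite e1 e2; apply: rvector_measure_unique => //.
  move=> A mA.
  have -> : m1 (rect A) = P (S' `&` [set w | forall j, A j (B t w 0 j - B s w 0 j)]).
    rewrite setIC; congr (P (_ `&` _)).
    by apply/seteqP; split => w /= h j; have := h j; rewrite !mxE.
  have [_ [_ [_ ind]]] := BM; rewrite (ind s t st S' nS' A mA).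
  rewrite -(law A mA) -[in LHS](fineK fS').
  by [].
have -> : m1 setT = P S' by rewrite /m1 /= /pushforward /mrestr preimage_setT setTI.
by rewrite -ge0_fin_numE.
Qed.

End BrownianFiltration.

(** * Comparison with the error term, and the proof of the estimate *)

Section Assembly.
Context d0 (Omega : measurableType d0) (R : realType) (d : nat).
Local Notation E := 'rV[R]_d.

Lemma mv_mulmx (A : 'M[R]_d) (x : E) : mv A x = x *m A^T.
Proof. by rewrite /mv trmx_mul trmxK. Qed.

(** The square root turns the exponent 2p into p; what remains of the error term is h^(d/4)
    delta^(-d/2), which is at least one because [delta ^+ 2 < h]. *)
Lemma egrad_compare (p h delta m B CF : R) : 0 < p -> 0 < h -> 0 < delta ->
  delta ^+ 2 < h -> 0 < m -> 0 <= B -> 0 <= CF ->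
  CF / Num.sqrt h * Num.sqrt ((B * (Num.sqrt h * m `^ (- d%:R^-1)) / delta) `^ (2 * p)) <=
  CF * B `^ p * (h `^ (p / 2 + d%:R / 4 - 2^-1) * m `^ (- (p / d%:R)) * delta `^ (- p - d%:R / 2)).
Proof.
move=> p0 h0 dl0 dh m0 B0 CF0.
set y := B * _ / delta.
have sh : Num.sqrt h = h `^ 2^-1 by rewrite powR12_sqrt // ltW.
have y0 : 0 <= y by rewrite /y !mulr_ge0 ?sqrtr_ge0 ?powR_ge0 ?invr_ge0 // ltW.
have -> : Num.sqrt (y `^ (2 * p)) = y `^ p.
  by rewrite mulrC powRrM powR_mulrn ?powR_ge0 // sqrtr_sqr ger0_norm // powR_ge0.
have -> : y `^ p = B `^ p * (h `^ (p / 2) * m `^ (- (p / d%:R)) * delta `^ (- p)).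
  rewrite /y powRM ?invr_ge0 ?(ltW dl0) //; last by rewrite !mulr_ge0 ?sqrtr_ge0 ?powR_ge0.
  rewrite powRM //; last by rewrite mulr_ge0 ?sqrtr_ge0 ?powR_ge0.
  rewrite powRM ?sqrtr_ge0 ?powR_ge0 // sh -!powRrM.
  rewrite -[delta^-1]powR_inv1 ?(ltW dl0) // -powRrM mulN1r.
  have -> : 2^-1 * p = p / 2 by rewrite mulrC.
  have -> : - d%:R^-1 * p = - (p / d%:R) by rewrite mulNr mulrC.
  by rewrite -!mulrA.
have one : 1 <= h `^ (d%:R / 4) * delta `^ (- (d%:R / 2)).
  rewrite powRN -[leLHS](@mulfV _ (delta `^ (d%:R / 2))) ?gt_eqF ?powR_gt0 //.
  rewrite ler_wpM2r ?invr_ge0 ?powR_ge0 //.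
  have -> : delta `^ (d%:R / 2) = (delta ^+ 2) `^ (d%:R / 4).
    by rewrite -powR_mulrn ?(ltW dl0) // -powRrM; congr (_ `^ _); field.
  by apply: ge0_ler_powR; rewrite ?nnegrE ?divr_ge0 ?sqr_ge0 ?(ltW h0) ?(ltW dh).
have e1 : h `^ (p / 2 + d%:R / 4 - 2^-1) = (Num.sqrt h)^-1 * h `^ (p / 2) * h `^ (d%:R / 4).
  have hn : h != 0 by rewrite gt_eqF.
  by rewrite sh -powRN -!powRD ?hn ?implybT //; congr (_ `^ _); ring.
have e2 : delta `^ (- p - d%:R / 2) = delta `^ (- p) * delta `^ (- (d%:R / 2)).
  by rewrite -powRD // (gt_eqF dl0) implybT.
rewrite e1 e2.
set u := CF * _ * _.
have -> : u = CF * B `^ p * ((Num.sqrt h)^-1 * h `^ (p / 2) * m `^ (- (p / d%:R)) * delta `^ (- p)).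
  by rewrite /u; ring.
rewrite ler_wpM2l ?mulr_ge0 ?powR_ge0 //.
have -> : (Num.sqrt h)^-1 * h `^ (p / 2) * h `^ (d%:R / 4) * m `^ (- (p / d%:R)) *
   (delta `^ (- p) * delta `^ (- (d%:R / 2))) =
   (Num.sqrt h)^-1 * h `^ (p / 2) * m `^ (- (p / d%:R)) * delta `^ (- p) *
   (h `^ (d%:R / 4) * delta `^ (- (d%:R / 2))) by ring.
by rewrite ler_peMr // !mulr_ge0 ?powR_ge0 ?invr_ge0 ?sqrtr_ge0.
Qed.

(** The chain is a function of the finite history of quantization labels, so its atoms are events of
    the natural filtration. *)
Lemma Xproc_index (P : probability Omega R) (B : R -> Omega -> E)
    (b : E -> R -> E -> E) (f : E -> R -> E -> R) (sigma : E -> R -> 'M[R]_d) (H : E -> R)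
    (N : nat) (h : R) (g : nat -> Omega -> E) (Pi : nat -> E -> E) (x0 : E)
    (I : finType) (idx : nat -> Omega -> I) (c : I -> E) (tk : nat -> R) :
  {homo tk : i j / (i <= j)%N >-> i <= j} ->
  (forall k w, g k w = c (idx k w)) ->
  (forall k i, natural_gen B (tk k.+1) (idx k @^-1` [set i])) ->
  forall k, exists (J : finType) (hist : Omega -> J) (Xi : J -> E),
    (forall j, natural_gen B (tk k) (hist @^-1` [set j])) /\
    forall w, Xproc P b f sigma H N h g Pi x0 k w = Xi (hist w).
Proof.
move=> tm gE gm; elim=> [|k [J [hist [Xi [HJ HX]]]]].
  exists unit, (fun=> tt), (fun=> x0); split => // -[].
  have -> : (fun=> tt) @^-1` [set tt] = [set: Omega] by apply/seteqP; split.
  exact: (@measurableT _ (g_sigma_algebraType (natural_events B (tk 0%N)))).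
set ub := ubar P b f sigma H N h g Pi k.+1; set vb := vbar P b f sigma H N h g Pi k.+1.
exists (J * I)%type, (fun w => (hist w, idx k w)),
  (fun ji => Pi k.+1 (Xi ji.1 + (h *: b (Xi ji.1) (ub (Xi ji.1))
     (vhatf P sigma g Pi ub vb k (Xi ji.1)) + mv (sigma (Xi ji.1) (ub (Xi ji.1))) (c ji.2)))).
split; last by move=> w /=; rewrite -/ub -/vb HX /Tf gE.
move=> [j i].
have -> : (fun w => (hist w, idx k w)) @^-1` [set (j, i)] = hist @^-1` [set j] `&` idx k @^-1` [set i].
  by apply/seteqP; split => w /=; [move=> [-> ->]|move=> [-> ->]].
apply: (@measurableI _ (g_sigma_algebraType (natural_events B (tk k.+1)))); last exact: gm.
by apply: natural_gen_mono (HJ j); exact: tm.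
Qed.

Lemma one_step_bound (P : probability Omega R) (D : Omega -> E) (h : R) (I : finType)
    (idx : Omega -> I) (c : I -> E) (S : 'M[R]_d) (x a : E) (F : E -> R) (Pi : E -> E)
    (Pr : E -> E) (sl Ca CF C2 delta p e m : R) :
  gaussian_vector P D (Num.sqrt h) -> (forall i, measurable (idx @^-1` [set i])) ->
  0 < sl -> (forall xi : E, sl * enorm xi <= enorm (xi *m S)) -> enorm S <= C2 -> 0 < C2 ->
  0 < h -> 0 < delta -> delta ^+ 2 < h -> 0 <= Ca -> enorm a <= Ca * Num.sqrt h ->
  0 < CF -> (forall y, 0 <= F y <= CF / Num.sqrt h) ->
  (forall y, Pi y = Pr (Pi_inf delta y)) -> 0 < p -> 0 < e -> 0 < m ->
  (\int[P]_w (enorm (c (idx w) - D w) `^ (2 * p))%:E <=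
     ((e * (Num.sqrt h * m `^ (- d%:R^-1))) `^ (2 * p))%:E)%E ->
  forall K : R, K = (3 ^ d)%N%:R * expR ((((d%:R / 3 + Ca) / sl) ^+ 2) / 2) ->
  \sum_i F (Pi (x + mv S (c i))) * pmass P idx i <=
    (1 + K) * (CF * (12 * C2 * e) `^ p) *
      (h `^ (p / 2 + d%:R / 4 - 2^-1) * m `^ (- (p / d%:R)) * delta `^ (- p - d%:R / 2)) +
    K * Num.sqrt (\sum_i F (Pi (x + (a + mv S (c i)))) ^+ 2 * pmass P idx i).
Proof.
move=> GD mI sl0 ell SC C20 h0 dl0 dh Ca0 aC CF0 FB PE p0 e0 m0 Hm K KE.
have sh0 : 0 < Num.sqrt h by rewrite sqrtr_gt0.
have [_ ellT] := elliptic_tr sl0 ell.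
pose z : R := Num.sqrt h * m `^ (- d%:R^-1).
have z0 : 0 < z by rewrite mulr_gt0 // powR_gt0.
pose pb : R := (12 * C2 * e * z / delta) `^ (2 * p).
have C2e : 0 < 12 * C2 * e by apply: mulr_gt0 => //; exact: mulr_gt0.
have pb0 : 0 < pb by apply: powR_gt0; apply: divr_gt0 => //; exact: mulr_gt0.
have CFh0 : 0 < CF / Num.sqrt h by exact: divr_gt0.
have ds : delta <= Num.sqrt h.
  by rewrite -ler_sqr ?nnegrE ?(ltW dl0) ?(ltW sh0) // sqr_sqrtr ltW.
have mE : measurable_fun [set: Omega] (fun w => enorm (c (idx w) - D w)).
  by apply: measurable_enorm_comp => j; exact: (measurable_quantization_error c mI GD).
have mEA : measurable_fun [set: Omega] (fun w => enorm ((c (idx w) - D w) *m S^T)).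
  apply: measurable_enorm_comp => j; under eq_fun do rewrite mxE -big_enum.
  apply: measurable_sum => k; apply: measurable_funM => //.
  exact: (measurable_quantization_error c mI GD).
have mset (X : Omega -> R) (r : R) : measurable_fun [set: Omega] X -> measurable [set w | r < X w].
  move=> mX; have -> : [set w | r < X w] = X @^-1` `]r, +oo[.
    by apply/seteqP; split => w /=; rewrite in_itv /= andbT.
  by rewrite -[X in measurable X]setTI; apply: mX.
pose r := delta / (12 * C2).
have r0 : 0 < r by rewrite divr_gt0 // mulr_gt0.
have HB : (P [set w | delta * 12^-1 < enorm ((c (idx w) - D w) *m S^T)]%R <= pb%:E)%E.
  apply: (@le_trans _ _ (P [set w | r < enorm (c (idx w) - D w)]%R)).
    apply: le_measure; rewrite ?inE; [exact: mset|exact: mset|].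
    move=> w /= hw; rewrite /r ltr_pdivrMr ?mulr_gt0 //.
    have h1 := enorm_mulmx (c (idx w) - D w) S^T; rewrite enorm_tr in h1.
    have h2 : enorm (c (idx w) - D w) * enorm S <= enorm (c (idx w) - D w) * C2 by rewrite ler_wpM2l.
    by move: hw h1 h2; clra.
  have q0 : 0 < 2 * p by rewrite mulr_gt0.
  have ez0 : 0 <= e * z by rewrite mulr_ge0 // ltW.
  have := markov_powR mE (fun w => enorm_ge0 _) q0 r0 Hm ez0.
  suff -> : e * (Num.sqrt h * m `^ (- d%:R^-1)) / r = 12 * C2 * e * z / delta by [].
  by rewrite /r /z; field; rewrite !lt0r_neq0.
have FPr y : 0 <= (F \o Pr) y <= CF / Num.sqrt h by exact: FB.
have := @key_estimate d0 Omega R d P D (Num.sqrt h) I idx c S^T x a (F \o Pr) sl Ca (CF / Num.sqrt h) delta pb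
  GD mI sl0 ellT dl0 ds Ca0 aC CFh0 pb0 FPr HB.
have e1 i : (F \o Pr) (Pi_inf delta (x + c i *m S^T)) = F (Pi (x + mv S (c i))).
  by rewrite PE mv_mulmx.
have e2 i : (F \o Pr) (Pi_inf delta (x + a + c i *m S^T)) = F (Pi (x + (a + mv S (c i)))).
  by rewrite PE mv_mulmx addrA.
under eq_bigr do rewrite e1.
under [X in _ <= _ + _ * (_ * (Num.sqrt X + _)) -> _]eq_bigr do rewrite e2.
set phi1 := \sum_i _; set phi2 := \sum_i _; rewrite mulrA -KE => key.
have K0 : 0 <= K by rewrite KE mulr_ge0 ?expR_ge0.
have cmp' := egrad_compare p0 h0 dl0 dh m0 (ltW C2e) (ltW CF0); rewrite -/z -/pb in cmp'.
set EG := (X in _ <= _ * X) in cmp' *.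
set Q := CF / Num.sqrt h * Num.sqrt pb in cmp'.
have Q0 : 0 <= Q by rewrite mulr_ge0 ?sqrtr_ge0 // ltW.
have main : phi1 <= (1 + K) * Q + K * Num.sqrt phi2.
  (* If [pb <= 1], then [pb] is at most its square root; otherwise the trivial bound
     [CF / Num.sqrt h] is already below the error term. *)
  have [pb1|pb1] := leP pb 1.
    have h1 : CF / Num.sqrt h * pb <= Q.
      rewrite /Q ler_pM2l // -{1}[pb]sqr_sqrtr ?(ltW pb0) // expr2 ger_pMr ?sqrtr_gt0 //.
      by rewrite -sqrtr1 ler_wsqrtr.
    by move: key h1; rewrite -/Q; clra.
  have h1 : phi1 <= CF / Num.sqrt h.
    rewrite -[leRHS]mulr1 -(pmass_sum P mI) mulr_sumr; apply: ler_sum => i _.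
    by rewrite ler_wpM2r ?pmass_ge0 //; have /andP[] := FB (Pi (x + mv S (c i))).
  have h2 : CF / Num.sqrt h <= Q.
    by rewrite /Q ler_peMr ?(ltW CFh0) // -sqrtr1 ler_wsqrtr // ltW.
  have h3 : 0 <= K * Q by exact: mulr_ge0.
  have h4 : 0 <= K * Num.sqrt phi2 by rewrite mulr_ge0 ?sqrtr_ge0.
  by move: h1 h2 h3 h4; clra.
apply: le_trans main _; rewrite lerD2r -mulrA ler_wpM2l ?addr_ge0 //.
Qed.

End Assembly.

Unset Implicit Arguments.

Theorem theorem7p6 (R : realType) (d : nat)
  (T p L Lam lam K alpha : R) (CQ : R -> R) :
  (0 < d)%N -> 0 < T -> 2 <= p -> 0 < lam -> 0 < alpha < 1 ->
  exists c C76 : R, 0 < c /\ 0 < C76 /\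
  forall (b : 'rV[R]_d -> R -> 'rV[R]_d -> 'rV[R]_d)
         (f : 'rV[R]_d -> R -> 'rV[R]_d -> R)
         (sigma : 'rV[R]_d -> R -> 'M[R]_d) (H : 'rV[R]_d -> R)
         (u : R -> 'rV[R]_d -> R),
  AssumptionA L Lam lam K alpha b f sigma H ->
  is_solution T b f sigma H u ->
  forall (d0 : measure_display) (Omega : measurableType d0)
         (P : probability Omega R) (B : R -> Omega -> 'rV[R]_d),
  is_brownian P B ->
  forall (N M : nat) (ygrid : 'I_M -> 'rV[R]_d) (delta Rr rho : R),
  (0 < N)%N -> (0 < M)%N -> 0 < delta -> 0 < Rr ->
  let h := T / N%:R in
  let tk := fun k : nat => k%:R * h in
  let dB := fun (k : nat) (w : Omega) => B (tk k.+1) w - B (tk k) w in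
  let g := fun (k : nat) (w : Omega) =>
    Num.sqrt h *: nearest ygrid ((Num.sqrt h)^-1 *: dB k w) in
  let Pi := Pi_i delta Rr rho in
  (* quantization error assumption *)
  (forall q : R, 1 <= q -> forall k : nat, (k < N)%N ->
     (\int[P]_w ((enorm (g k w - dB k w)) `^ q)%:E < +oo)%E /\
     (fine (\int[P]_w ((enorm (g k w - dB k w)) `^ q)%:E)%E) `^ q^-1
       <= CQ q * Num.sqrt h * M%:R `^ (- d%:R^-1)) ->
  h < c -> delta ^+ 2 < h -> M%:R `^ (- (2 / d%:R)) < h -> 1 <= rho ->
  forall x0 : 'rV[R]_d, Cgrid delta Rr rho 0 x0 ->
  let ub := ubar P b f sigma H N h g Pi in
  let vb := vbar P b f sigma H N h g Pi in
  let X := Xproc P b f sigma H N h g Pi x0 in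
  let tau := tau_inf P b f sigma H N h g Pi (Delta_i delta Rr rho) x0 in
  let v := vfun sigma u in
  let Egrad := h `^ (p / 2 + d%:R / 4 - 2^-1) * M%:R `^ (- (p / d%:R))
               * delta `^ (- p - d%:R / 2) in
  forall k : nat, (k < N)%N ->
  let Z1 := fun w : Omega =>
    let y := Pi k.+1 (X k w + T0f sigma g (ub k.+1) k (X k w) w) in
    enorm (vb k.+1 y - v (tk k.+1) y) in
  let Z2 := fun w : Omega =>
    enorm (vb k.+1 (X k.+1 w) - v (tk k.+1) (X k.+1 w)) ^+ 2 in
  forall Y1 Y2 : Omega -> R,
  is_cond_exp P (augmented_filtration P B (tk k)) Z1 Y1 ->
  is_cond_exp P (augmented_filtration P B (tk k)) Z2 Y2 ->
  {ae P, forall w, ((tk k)%:E < tau w)%E ->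
                   Y1 w <= C76 * Egrad + C76 * Num.sqrt (Y2 w)}.
Proof.
move=> dpos T0 p2 lam0 /andP[al0 al1].
have [Cg Cg0 HG] := @gradient_bound R d T L Lam lam K alpha T0 lam0 al0.
pose La : R := `|Lam|; pose Ka : R := `|K|; pose C1q : R := `|CQ 1|.
(* From [quantization_sqr]: the second moment of a quantized increment is at most [C2q * h]. *)
pose C2q : R := 2 * (CQ 2) ^+ 2 + d%:R * (4 * expR (2^-1 : R)).
have La0 : 0 <= La by exact: normr_ge0.
have Ka0 : 0 <= Ka by exact: normr_ge0.
have C1q0 : 0 <= C1q by exact: normr_ge0.
have C2q0 : 0 <= C2q by rewrite /C2q addr_ge0 // mulr_ge0 ?sqr_ge0 // mulr_ge0 ?expR_ge0.
pose Sb : R := ybound d La Ka T C1q C2q; pose Zb : R := zbound d La Ka T C1q C2q.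
have Sb0 : 0 <= Sb by exact: sqrtr_ge0.
have Zb0 : 0 <= Zb.
  rewrite /Zb /zbound -/Sb; apply: addr_ge0; last first.
    by apply: mulr_ge0 => //; apply: mulr_ge0 => //; exact: addr_ge0.
  apply: mulr_ge0; last exact: addr_ge0.
  apply: addr_ge0 => //; apply: addr_ge0; first exact: mulr_ge0.
  by apply: mulr_ge0 => //; exact: sqr_ge0.
pose C2s : R := La * (1 + Sb) + 1; pose Cv : R := Cg * (La * (1 + Cg)).
(* [CF] bounds the square root of [h] times the error of [vb], [Ca] bounds the drift relative to the
   deviation of the increment, and [e] is a positive quantization constant for the exponent 2p. *)
pose CF : R := Zb + Cv + 1; pose Ca : R := La * (1 + Sb + Zb); pose e : R := `|CQ (2 * p)| + 1.
have LS0 : 0 <= La * (1 + Sb) by apply: mulr_ge0 => //; exact: addr_ge0.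
have C2s0 : 0 < C2s by rewrite /C2s ltr_wpDl.
have Cv0 : 0 <= Cv by apply: mulr_ge0 => //; apply: mulr_ge0 => //; exact: addr_ge0.
have CF0 : 0 < CF by rewrite /CF ltr_wpDl // addr_ge0.
have Ca0 : 0 <= Ca by apply: mulr_ge0 => //; apply: addr_ge0 => //; exact: addr_ge0.
have e0 : 0 < e by rewrite /e ltr_wpDl.
have p0 : 0 < p by apply: lt_le_trans p2.
pose sl : R := Num.sqrt lam; have sl0 : 0 < sl by rewrite sqrtr_gt0.
pose Kx : R := (3 ^ d)%N%:R * expR ((((d%:R / 3 + Ca) / sl) ^+ 2) / 2).
have Kx0 : 0 <= Kx by rewrite mulr_ge0 ?expR_ge0.
pose Cm : R := (1 + Kx) * (CF * (12 * C2s * e) `^ p).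
have Cm0 : 0 <= Cm.
  by apply: mulr_ge0; [exact: addr_ge0|apply: mulr_ge0; [exact: ltW|exact: powR_ge0]].
have kap0 : 0 <= 12 * La ^+ 2 * C2q.
  by apply: mulr_ge0 => //; apply: mulr_ge0 => //; exact: sqr_ge0.
(* The threshold on [h] is the one required by [y_component_bound]. *)
exists (12 * La ^+ 2 * C2q + 1)^-1, (Cm + Kx + 1).
split; first by rewrite invr_gt0 ltr_wpDl.
split; first by rewrite ltr_wpDl // addr_ge0.
move=> b f sigma H u AA sol d0 Omega P B BM N M ygrid delta Rr rho N0 M0 dl0 R0 h tk dB g Pi.
move=> Hq hc dh Mh rho1 x0 x0C ub vb X tau v Egrad k kN Z1 Z2 Y1 Y2 HY1 HY2.
have {}HG := HG b f sigma H u AA sol.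
have [_ [_ [_ [_ [gr [ell [_ [_ [bH _]]]]]]]]] := AA.
have {}gr x (y : R) z : enorm (b x y z) + `|f x y z| + enorm (sigma x y) <= La * (1 + `|y| + enorm z).
  by apply: le_trans (gr x y z) _; rewrite ler_wpM2r ?ler_norm // !addr_ge0.
have sgr x (y : R) : enorm (sigma x y) <= La * (1 + `|y|).
  have := gr x y 0; rewrite enorm0 addr0; apply: le_trans.
  by rewrite lerDr addr_ge0.
have {}bH x : `|H x| <= Ka /\ enorm (grad H x) <= Ka.
  by have [h1 [h2 _]] := bH x; split; apply: le_trans (ler_norm K).
have h0 : 0 < h by rewrite divr_gt0 // ltr0n.
have NhT : N%:R * h = T by rewrite mulrC divfK // pnatr_eq0 -lt0n.
have hk : h <= (12 * La ^+ 2 * C2q + 1)^-1 by exact: ltW.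
have h1 : h <= 1.
  by apply: le_trans hk _; rewrite invf_le1 ?lerDr // ltr_wpDl.
have sh0 : 0 < Num.sqrt h by rewrite sqrtr_gt0.
have sh2 : Num.sqrt h ^+ 2 = h by rewrite sqr_sqrtr // ltW.
have sh1 : Num.sqrt h <= 1 by rewrite -sqrtr1 ler_wsqrtr.
pose m : R := M%:R; have m0 : 0 < m by rewrite ltr0n.
(* The hypothesis on [M] gives [m1 <= Num.sqrt h], so the first-order quantization error, and with
   it the mean of a quantized increment, is of order [h]. *)
pose m1 : R := m `^ (- d%:R^-1).
have m10 : 0 < m1 by exact: powR_gt0.
have m1h : m1 ^+ 2 <= h.
  apply: ltW; apply: le_lt_trans Mh; rewrite -powR_mulrn ?(ltW m10) // /m1 -powRrM.
  by rewrite le_eqVlt; apply/orP; left; apply/eqP; congr (_ `^ _); ring.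
have m1s : m1 <= Num.sqrt h by rewrite -ler_sqr ?nnegrE ?(ltW m10) ?(ltW sh0) // sh2.
have tkD j : tk j.+1 - tk j = h by rewrite /tk -mulrBl -natrB // subSnn mul1r.
have tk0 j : 0 <= tk j by rewrite mulr_ge0 // ltW.
have tkS j : tk j < tk j.+1 by rewrite -subr_gt0 tkD.
have tk_homo : {homo tk : i j / (i <= j)%N >-> i <= j}.
  by move=> i j ij; rewrite /tk ler_wpM2r ?(ltW h0) // ler_nat.
have GD j : gaussian_vector P (dB j) (Num.sqrt h).
  by rewrite -(tkD j); apply: brownian_gaussian => //; rewrite tk0 tkS.
pose idx j w := nearest_idx ygrid ((Num.sqrt h)^-1 *: dB j w).
pose c o := Num.sqrt h *: grid_point ygrid o.
have gE j w : g j w = c (idx j w) by rewrite /g nearestE.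
have nI j o : natural_gen B (tk j.+1) (idx j @^-1` [set o]).
  by apply: natural_gen_increment => //; exact: ltW.
have mI j o : measurable (idx j @^-1` [set o]) by apply: natural_gen_measurable BM _ _.
have momq (q : R) j : 1 <= q -> (j < N)%N ->
    (\int[P]_w (enorm (c (idx j w) - dB j w) `^ q)%:E <= ((`|CQ q| * (Num.sqrt h * m1)) `^ q)%:E)%E.
  move=> q1 jN; have [hf he] := Hq q q1 j jN.
  apply: moment_le => //; first exact: lt_le_trans q1.
  apply: le_trans he _; rewrite -mulrA ler_wpM2r ?ler_norm // mulr_ge0 //; exact: ltW.
have inc j : (j < N)%N -> finite_increment P (g j) C1q C2q h.
  move=> jN; exists (option 'I_M), (idx j), c; split => //.
  - move=> i; apply: (@le_trans _ _ (`|CQ 1| * (Num.sqrt h * m1))).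
      apply: (quantization_mean (mI j) (GD j)).
      have := momq 1 j (lexx _) jN; rewrite powRr1; last first.
        by rewrite mulr_ge0 // mulr_ge0 // ltW.
      by under eq_integral do rewrite powRr1 //.
    have hm : Num.sqrt h * m1 <= h by rewrite -[leRHS]sh2 expr2 ler_pM2l.
    exact: ler_wpM2l.
  - have q2 : (\int[P]_w (enorm (c (idx j w) - dB j w) ^+ 2)%:E <= ((`|CQ 2| * (Num.sqrt h * m1)) ^+ 2)%:E)%E.
      have := momq 2 j (_ : 1 <= 2) jN; rewrite powR_mulrn; last first.
        by rewrite mulr_ge0 // mulr_ge0 // ltW.
      under eq_integral do rewrite powR_mulrn //.
      by apply; rewrite ler1n.
    apply: le_trans (quantization_sqr (mI j) (GD j) q2) _.
    rewrite sh2 /C2q [leRHS]mulrDl; apply: lerD; last by rewrite le_eqVlt; apply/orP; left; apply/eqP; ring.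
    rewrite !exprMn sh2 real_normK ?num_real //.
    have m2 : m1 ^+ 2 <= 1 by apply: le_trans m1h h1.
    have ch : 0 <= 2 * (CQ 2) ^+ 2 * h.
      by apply: mulr_ge0; [apply: mulr_ge0 => //; exact: sqr_ge0|exact: ltW].
    have -> : 2 * (CQ 2 ^+ 2 * (h * m1 ^+ 2)) = 2 * CQ 2 ^+ 2 * h * m1 ^+ 2 by ring.
    by rewrite ler_piMr.
have SB := scheme_bound Pi La0 Ka0 C1q0 C2q0 gr bH h0 hk NhT inc.
have [J [hist [Xi [HJ HX]]]] :=
  Xproc_index P b f sigma H N h Pi x0 tk_homo gE nI k.
have kN1 : (k.+1 <= N)%N by [].
pose F y := enorm (vb k.+1 y - v (tk k.+1) y).
have tkI : 0 < tk k.+1 <= T.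
  by rewrite (le_lt_trans (tk0 k) (tkS k)) /= -NhT ler_wpM2r ?(ltW h0) // ler_nat.
have FB y : 0 <= F y <= CF / Num.sqrt h.
  rewrite enorm_ge0 /=; apply: le_trans (enormB _ _) _.
  have [_ vB] := SB k.+1 y kN1.
  have [uG gG] := HG _ y tkI.
  have vv : enorm (v (tk k.+1) y) <= Cv.
    apply: le_trans (enorm_mulmx _ _) _; apply: ler_pM => //.
    by apply: le_trans (sgr _ _) _; rewrite ler_wpM2l // lerD2l.
  have cv : Cv + 1 <= (Cv + 1) / Num.sqrt h by rewrite ler_peMr ?invf_ge1 // addr_ge0.
  have -> : CF / Num.sqrt h = Zb / Num.sqrt h + (Cv + 1) / Num.sqrt h by rewrite /CF; ring.
  apply: lerD => //; apply: le_trans vv _; apply: le_trans cv; by rewrite lerDl.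
(* The drift of the full step. [vhatf] averages [vb] and is of order h^(-1/2), so the drift is of
   the order of the deviation of the increment. *)
pose av x := h *: b x (ub k.+1 x) (vhatf P sigma g Pi (ub k.+1) (vb k.+1) k x).
have bound x : \sum_i F (Pi k.+1 (x + mv (sigma x (ub k.+1 x)) (c i))) * pmass P (idx k) i <=
    Cm * Egrad + Kx * Num.sqrt (\sum_i F (Pi k.+1 (x + (av x + mv (sigma x (ub k.+1 x)) (c i)))) ^+ 2
      * pmass P (idx k) i).
  have [uS _] := SB k.+1 x kN1.
  have aS : enorm (av x) <= Ca * Num.sqrt h.
    rewrite enormZ (gtr0_norm h0) -{1}sh2 expr2 -mulrA mulrC ler_pM2r //.
    set z := vhatf _ _ _ _ _ _ _ _.
    have zS : enorm z <= Zb / Num.sqrt h.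
      have -> : z = \row_j \sum_i vb k.+1 (Pi k.+1 (x + mv (sigma x (ub k.+1 x)) (c i))) 0 j * pmass P (idx k) i.
        apply/rowP => j; rewrite !mxE.
        rewrite -(Ereal_fin P (mI k) (fun i => vb k.+1 (Pi k.+1 (x + mv (sigma x (ub k.+1 x)) (c i))) 0 j)).
        by congr Ereal; apply: funext => w; rewrite /T0f gE.
      apply: mean_enorm_le; [exact: pmass_ge0|exact: pmass_sum|].
      by move=> i; have [_ ] := SB k.+1 (Pi k.+1 (x + mv (sigma x (ub k.+1 x)) (c i))) kN1.
    have g1 := gr x (ub k.+1 x) z.
    have g2 : enorm (b x (ub k.+1 x) z) <= La * (1 + Sb + Zb / Num.sqrt h).
      apply: (@le_trans _ _ (La * (1 + `|ub k.+1 x| + enorm z))).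
        by apply: le_trans g1; rewrite -addrA lerDl addr_ge0.
      by rewrite ler_wpM2l //; apply: lerD => //; rewrite lerD2l.
    apply: (@le_trans _ _ (Num.sqrt h * (La * (1 + Sb + Zb / Num.sqrt h)))).
      by rewrite ler_wpM2l // ltW.
    have -> : Num.sqrt h * (La * (1 + Sb + Zb / Num.sqrt h)) = La * (Num.sqrt h * (1 + Sb) + Zb).
      by field; rewrite lt0r_neq0.
    rewrite /Ca ler_wpM2l // lerD2r ler_piMl // addr_ge0 //.
  have SC : enorm (sigma x (ub k.+1 x)) <= C2s.
    apply: le_trans (sgr _ _) _; rewrite /C2s.
    apply: (@le_trans _ _ (La * (1 + Sb))); last by rewrite lerDl.
    by rewrite ler_wpM2l // lerD2l.
  have Sell (xi : 'rV[R]_d) : sl * enorm xi <= enorm (xi *m sigma x (ub k.+1 x)).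
    rewrite -ler_sqr ?nnegrE ?mulr_ge0 ?(ltW sl0) // exprMn sqr_sqrtr ?(ltW lam0) //.
    apply: le_trans (ell x (ub k.+1 x) xi) _.
    by rewrite mulmxA inner_mul trmxK inner_xx.
  have Hm : (\int[P]_w (enorm (c (idx k w) - dB k w) `^ (2 * p))%:E <=
      ((e * (Num.sqrt h * m `^ (- d%:R^-1))) `^ (2 * p))%:E)%E.
    apply: le_trans (momq (2 * p) k _ kN) _; first by move: p2; clra.
    rewrite lee_fin; apply: ge0_ler_powR.
    - by rewrite mulr_ge0 // ltW.
    - by rewrite nnegrE mulr_ge0 // mulr_ge0 // ltW.
    - by rewrite nnegrE; apply: mulr_ge0; [exact: ltW|apply: mulr_ge0; exact: ltW].
    - by rewrite /e -/m1; apply: ler_wpM2r; [apply: mulr_ge0; exact: ltW|rewrite lerDl].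
  (* The clamp acts after the projection on the infinite grid and is absorbed into the function
     being averaged. *)
  have PE y : Pi k.+1 y = Qclamp delta (Defs.rad Rr rho k.+1) (Pi_inf delta y) by [].
  exact: (one_step_bound x (GD k) (mI k) sl0 Sell SC C2s0 h0 dl0 dh Ca0 aS CF0 FB PE p0 e0 m0 Hm).
have aG := augmented_measurable (t := tk k) BM.
have ind S i : augmented_filtration P B (tk k) S ->
    (P (S `&` idx k @^-1` [set i]) = P S * P (idx k @^-1` [set i]))%E.
  move=> aS.
  pose V : set (rvector R d) := (fun z : 'rV[R]_d => nearest_idx ygrid ((Num.sqrt h)^-1 *: z)) @^-1` [set i].
  have mV : measurable V.
    apply: (@measurable_nearest_idx R d _ (rvector R d) (fun z : 'rV[R]_d => (Num.sqrt h)^-1 *: z)) => j.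
    under eq_fun do rewrite mxE.
    by apply: measurable_funM => //; exact: measurable_rvector_coord.
  by have := brownian_independent BM (_ : 0 <= tk k < tk k.+1) aS mV; apply; rewrite tk0 tkS.
have HJa j : augmented_filtration P B (tk k) (hist @^-1` [set j]).
  exact: natural_sub_augmented.
have ae1 : {ae P, forall w, forall j, (hist @^-1` [set j]) w ->
    Y1 w = \sum_i F (Pi k.+1 (Xi j + mv (sigma (Xi j) (ub k.+1 (Xi j))) (c i))) * pmass P (idx k) i}.
  apply: filter_forall => j.
  apply: (cond_exp_on aG (@augmented_setI _ _ _ _ _ _ _) HY1 (HJa j) (mI k) _ ind).
  by move=> w /= <-; rewrite /Z1 /X HX /T0f gE.
have ae2 : {ae P, forall w, forall j, (hist @^-1` [set j]) w ->
    Y2 w = \sum_i F (Pi k.+1 (Xi j + (av (Xi j) + mv (sigma (Xi j) (ub k.+1 (Xi j))) (c i)))) ^+ 2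
      * pmass P (idx k) i}.
  apply: filter_forall => j.
  apply: (cond_exp_on aG (@augmented_setI _ _ _ _ _ _ _) HY2 (HJa j) (mI k) _ ind
    (F := fun i => F (Pi k.+1 (Xi j + (av (Xi j) + mv (sigma (Xi j) (ub k.+1 (Xi j))) (c i)))) ^+ 2)).
  by move=> w /= <-; rewrite /Z2 /X /= HX /Tf gE.
(* On the atom of [hist w] the chain sits at a fixed point, and both conditional expectations are
   the finite sums compared in [bound]. *)
apply: filterS2 ae1 ae2 => w y1 y2 _.
rewrite (y1 (hist w) erefl) (y2 (hist w) erefl); apply: le_trans (bound _) _.
have EG0 : 0 <= Egrad by rewrite /Egrad !mulr_ge0 ?powR_ge0.
apply: lerD; first by rewrite ler_wpM2r // -addrA lerDl addr_ge0.
by rewrite ler_wpM2r ?sqrtr_ge0 // addrAC lerDr addr_ge0.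
Qed.
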